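(* Let $N\ge2$, $R>0$, $\Omega=B_R(0)\subset\mathbb{R}^N$, $q>1$, $\beta>\frac{N-1}{N}q+1$, $a>1$, and let $u_\beta$ be a minimizer of $G_a$ (such minimizers exist under these assumptions). Then the following hold. (i) For fixed $q>N$, there exists $\beta_*$ such that $u_\beta$ is non-radial for every $\beta>\beta_*$ (for any choice of minimizer $u_\beta$). (ii) If $q\le N$, then $u_\beta$ is radial for any $\beta$.
   Context: $B_R(0)$ is the open ball in $\mathbb{R}^N$ of radius $R$ centered at $0$. $W_0^{1,N}(\Omega)$ is the completion of $C_c^\infty(\Omega)$ with respect to $\|\nabla(\cdot)\|_{L^N(\Omega)}$. For $\Omega=B_R(0)$, $$G_a:=\inf_{u\in W_0^{1,N}(\Omega)\setminus\{0\}}\frac{\int_\Omega|\nabla u|^N\,dx}{\left(\int_\Omega \frac{|u|^q}{|x|^N(\log\frac{aR}{|x|})^\beta}\,dx\right)^{N/q}}.$$ ($G_a$ depends also on $N,q,\beta,R$.) A minimizer of $G_a$ is a function $u\in W_0^{1,N}(\Omega)\setminus\{0\}$ realizing the infimum. In (i), $N,R,a,q$ are fixed and $\beta_*$ may depend on them. *)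

(* Defs.v *)
From HB Require Import structures.
From mathcomp Require Import all_boot all_order all_algebra.
From mathcomp Require Import all_classical all_reals all_analysis.

Set Implicit Arguments.
Unset Strict Implicit.
Unset Printing Implicit Defensive.

Import Order.TTheory GRing.Theory Num.Theory.
Import numFieldNormedType.Exports.

Local Open Scope classical_set_scope.
Local Open Scope ring_scope.

(* R^n is 'rV[R]_n.  Its library topology is the one of the sup norm, i.e. the
   usual one.  Measurable sets are those of the product of the Borel
   sigma-algebras, i.e. the Borel sets. *)
Section measurable_rV.
Context {R : realType} (n : nat).

Let coord (i : 'I_n) (x : 'rV[R]_n) : R := x ord0 i.

Let rV_set0 : g_sigma_preimage coord set0.
Proof. exact: sigma_algebra0. Qed.

Let rV_setC A : g_sigma_preimage coord A -> g_sigma_preimage coord (~` A).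
Proof. exact: sigma_algebraC. Qed.

Let rV_bigcup (F : (set 'rV[R]_n)^nat) :
  (forall i, g_sigma_preimage coord (F i)) ->
  g_sigma_preimage coord (\bigcup_i (F i)).
Proof. exact: sigma_algebra_bigcup. Qed.

HB.instance Definition _ := @isMeasurable.Build default_measure_display
  'rV[R]_n (g_sigma_preimage coord) rV_set0 rV_setC rV_bigcup.

Lemma measurable_coord (i : 'I_n) :
  measurable_fun [set: 'rV[R]_n] (fun x => x ord0 i).
Proof.
move=> _ Y mY; rewrite setTI; apply: sub_sigma_algebra => /=.
rewrite -bigcup_seq/=; exists i => /=; first by rewrite mem_index_enum.
by exists Y => //; rewrite setTI.
Qed.

Lemma measurable_fun_rVP d (T : measurableType d) (f : T -> 'rV[R]_n) :
  (forall i, measurable_fun [set: T] (fun x => f x ord0 i)) ->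
  measurable_fun [set: T] f.
Proof.
move=> mf.
have sub : g_sigma_preimage (fun i => coord i \o f) `<=` measurable.
  apply: smallest_sub; first exact: sigma_algebra_measurable.
  rewrite -bigcup_seq => A [i _ [B mB <-]].
  exact: mf.
rewrite g_sigma_preimage_comp in sub.
by move=> _ A mA; apply: sub; exists A.
Qed.

End measurable_rV.

Section lebesgue_rV.
Context {R : realType}.
Local Open Scope ereal_scope.

Definition cons_rV n (p : measurableTypeR R * 'rV[R]_n) : 'rV[R]_(1 + n) :=
  row_mx (p.1%:M) p.2.

Definition uncons_rV n (x : 'rV[R]_(1 + n)) : measurableTypeR R * 'rV[R]_n :=
  (x ord0 ord0, rsubmx x).

Lemma cons_rVK n : cancel (@cons_rV n) (@uncons_rV n).
Proof.
move=> [t v]; rewrite /uncons_rV /cons_rV row_mxKr; congr pair.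
have -> : ord0 = lshift n (ord0 : 'I_1) by exact/val_inj.
by rewrite row_mxEl !mxE.
Qed.

Lemma measurable_cons_rV n : measurable_fun setT (@cons_rV n).
Proof.
apply: measurable_fun_rVP => i; have [j ->|j ->] := split_ordP i.
- rewrite [X in measurable_fun _ X](_ : _ = fst)//.
  by apply/funext => p; rewrite row_mxEl !ord1 mxE eqxx.
- rewrite [X in measurable_fun _ X](_ : _ =
    (fun x : 'rV[R]_n => x ord0 j) \o snd).
    by apply: measurableT_comp => //; exact: measurable_coord.
  by apply/funext => p; rewrite row_mxEr.
Qed.

Lemma measurable_uncons_rV n : measurable_fun setT (@uncons_rV n).
Proof.
apply/measurable_fun_pair; first exact: measurable_coord.
apply: measurable_fun_rVP => i.
rewrite [X in measurable_fun _ X](_ : _ =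
  (fun x : 'rV[R]_(1 + n) => x ord0 (rshift 1 i))).
  exact: measurable_coord.
by apply/funext => x; rewrite mxE.
Qed.

Section step.
Variables (n : nat) (mu : {sigma_finite_measure set 'rV[R]_n -> \bar R}).

Definition lebesgue_rVS : set 'rV[R]_(1 + n) -> \bar R :=
  pushforward (@lebesgue_measure R \x mu) (@cons_rV n).

Let mcons := @measurable_cons_rV n.

Let lebesgue_rVS0 : lebesgue_rVS set0 = 0.
Proof. exact: measure0. Qed.

Let lebesgue_rVS_ge0 A : 0 <= lebesgue_rVS A.
Proof. exact: measure_ge0. Qed.

Let lebesgue_rVS_sigma_additive : semi_sigma_additive lebesgue_rVS.
Proof. exact: measure_semi_sigma_additive. Qed.

HB.instance Definition _ := isMeasure.Build _ _ _ lebesgue_rVS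
  lebesgue_rVS0 lebesgue_rVS_ge0 lebesgue_rVS_sigma_additive.

Let lebesgue_rVS_sigma_finite : sigma_finite setT lebesgue_rVS.
Proof.
have /sigma_finiteP[F [TF ndF Foo]] := sigma_finiteT (@lebesgue_measure R).
have /sigma_finiteP[G [TG ndG Goo]] := sigma_finiteT mu.
exists (fun k => @uncons_rV n @^-1` (F k `*` G k)).
  rewrite -preimage_bigcup -[LHS](preimage_setT (@uncons_rV n)).
  congr (_ @^-1` _); rewrite -setXTT TF TG predeqE => -[x y]; split.
    move=> [/= [k _ Fkx] [l _ Gly]]; exists (maxn k l) => //; split.
    - by move: x Fkx; exact/subsetPset/ndF/leq_maxl.
    - by move: y Gly; exact/subsetPset/ndG/leq_maxr.
  by move=> [k _ []/= ? ?]; split; exists k.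
move=> k; have [? ?] := Foo k; have [? ?] := Goo k; split.
  rewrite -[X in measurable X]setTI; apply: measurable_uncons_rV => //.
  exact: measurableX.
rewrite /lebesgue_rVS /pushforward -comp_preimage.
rewrite (_ : _ \o _ = id); last by apply/funext => p; exact: cons_rVK.
by rewrite preimage_id product_measure1E// lte_mul_pinfty// ge0_fin_numE.
Qed.

HB.instance Definition _ :=
  Measure_isSigmaFinite.Build _ _ _ lebesgue_rVS lebesgue_rVS_sigma_finite.

End step.

(* Lebesgue measure on R^n: the n-fold product of the one on R. *)
Fixpoint lebesgue_rV (n : nat) :
    {sigma_finite_measure set 'rV[R]_n -> \bar R} :=
  match n with
  | 0 => dirac (0%R : 'rV[R]_0)
  | n'.+1 => lebesgue_rVS (lebesgue_rV n')
  end.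

End lebesgue_rV.
Arguments lebesgue_rV : clear implicits.

Section euclidean.
Context {R : realType} {N : nat}.
Implicit Types (x : 'rV[R]_N) (f : 'rV[R]_N -> R).

(* The Euclidean norm; the library's `|x| on 'rV[R]_N is the sup norm. *)
Definition enorm x : R := Num.sqrt (\sum_i x ord0 i ^+ 2).

Definition eball (r : R) : set 'rV[R]_N := [set x | enorm x < r].

Definition partial (i : 'I_N) f : 'rV[R]_N -> R :=
  fun x => 'D_(delta_mx ord0 i) f x.

Definition gradient f x : 'rV[R]_N := \row_i partial i f x.

(* C^oo: every iterated partial derivative exists and is continuous. *)
Definition smooth f : Prop := forall s : seq 'I_N,
  continuous (foldr partial f s) /\
  forall i x, derivable (foldr partial f s) x (delta_mx ord0 i).

Definition closed_support f : set 'rV[R]_N := closure [set x | f x != 0].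

(* C_c^oo(Omega), its elements being extended by 0 outside Omega. *)
Definition Cc_smooth (Omega : set 'rV[R]_N) : set ('rV[R]_N -> R) :=
  [set f | [/\ smooth f, compact (closed_support f) & closed_support f `<=` Omega]].

End euclidean.

Section sobolev.
Context {R : realType} {N : nat}.
Variable Omega : set 'rV[R]_N.
Local Notation mu := (lebesgue_rV R N).
Implicit Types (u : 'rV[R]_N -> R) (g : 'rV[R]_N -> 'rV[R]_N).

(* W_0^{1,N}(Omega) for a bounded Omega.  By the Poincare inequality, a
   sequence of C_c^oo(Omega) that is Cauchy for the norm of the gradients in
   L^N(Omega) converges in L^N(Omega), and the limit determines its class in the
   completion.  The point of the completion given by (phi_k) is
   represented by the limit u of (phi_k), and its gradient is the
   limit g of (grad phi_k), both in L^N(Omega).  Only the values of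
   u and g on Omega are relevant, and only up to null sets. *)
Definition W01N_gradient u g : Prop :=
  [/\ measurable_fun Omega u, measurable_fun Omega g &
    exists2 phi : nat -> 'rV[R]_N -> R, (forall k, Cc_smooth Omega (phi k)) &
      (fun k => \int[mu]_(x in Omega) (`|phi k x - u x| ^+ N)%:E)%E @ \oo
        --> 0%E /\
      (fun k => \int[mu]_(x in Omega)
        (enorm (gradient (phi k) x - g x) ^+ N)%:E)%E @ \oo --> 0%E].

Definition W01N : set ('rV[R]_N -> R) :=
  [set u | exists g, W01N_gradient u g].

(* The gradient of u : W01N, which is unique up to null sets. *)
Definition wgradient u : 'rV[R]_N -> 'rV[R]_N :=
  xget (fun=> 0) (W01N_gradient u).

(* Elements of W_0^{1,N}(Omega) are classes modulo null sets. *)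
Definition nonzero u : Prop := ~ {ae mu, forall x, Omega x -> u x = 0}.

Definition radial u : Prop := exists f : R -> R,
  {ae mu, forall x, Omega x -> u x = f (enorm x)}.

End sobolev.

Section minimization.
Context {R : realType} {N : nat}.
Variables (r a q beta : R).
Local Notation mu := (lebesgue_rV R N).
Local Notation B := (@eball R N r).
Local Open Scope ereal_scope.

Definition dirichlet (u : 'rV[R]_N -> R) : \bar R :=
  \int[mu]_(x in B) (enorm (wgradient B u x) ^+ N)%:E.

Definition weighted (u : 'rV[R]_N -> R) : \bar R :=
  \int[mu]_(x in B)
    (`|u x| `^ q / (enorm x ^+ N * ln (a * r / enorm x) `^ beta))%:E.

Definition quotient (u : 'rV[R]_N -> R) : \bar R :=
  dirichlet u / weighted u `^ (N%:R / q).

Definition admissible : set ('rV[R]_N -> R) :=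
  [set u | W01N B u /\ nonzero B u].

Definition Ga : \bar R := ereal_inf [set quotient u | u in admissible].

Definition minimizer (u : 'rV[R]_N -> R) : Prop :=
  admissible u /\ quotient u = Ga.

End minimization.
Arguments admissible {R} N r u.
Arguments Ga {R} N r a q beta.
Arguments minimizer {R} N r a q beta u.

(* Main.v *)
(* Lebesgue measure on R^N is used only through its invariance under
   translations, dilations and rotations of coordinate planes (a rotation is a
   product of three shears), so that no polar coordinates are needed.

   Shell estimate.  Comparing phi with its dilates x |-> phi (e^h x), the
   dilation invariance of |x|^(-N) dx and Young's inequality give, for phi
   supported in the ball of radius r,
     int_(rho <= |x| < rho e^tau) |phi|^N |x|^(-N)
       <= C tau (ln (r/rho))^(N-1) int |grad phi|^N.

   (i) Mollifying a rotation-invariant function by a cone kernel gives functions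
   of |x|, so that a radial u obeys the pointwise bound
   |u(x)| <= C (ln (R/|x|))^((N-1)/N) D^(1/N), where D is its Dirichlet integral.
   Summing over shells, its weighted integral is at most
   C beta^(-(p+1)) (ln a)^(-beta) D^(q/N) with p = (N-1) q / N.  A fixed bump
   shrunk to size 1/beta next to the boundary keeps its Dirichlet integral and
   has weighted integral at least c beta^(-N) (ln a)^(-beta).  Since p + 1 > N
   exactly when q > N, a radial u is not a minimizer for large beta.

   (ii) Let q <= N, and let (phi_k) be the m rotates by 2 pi / m, in a coordinate
   plane, of a test function close to a minimizer.  Replace it by
   V = (avg_k (phi_k^2 + d^2)^(N/2))^(1/N) - d.  By Young's inequality only the
   component of the gradient orthogonal to the rotation direction contributes to
   the Dirichlet integral of V, up to O(1/m), while by Jensen's inequality the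
   weighted integral does not decrease in the limit d -> 0.  Hence the gradient
   of a minimizer has no component in the rotation direction; the minimizer is
   then invariant under all these rotations, hence radial. *)

From HB Require Import structures.
Require Import Defs.
From mathcomp Require Import all_boot all_order all_algebra.
From mathcomp Require Import all_classical all_reals all_analysis.
From mathcomp Require Import measurable_realfun ring lra.

Set Implicit Arguments.
Unset Strict Implicit.
Unset Printing Implicit Defensive.

Import Order.TTheory GRing.Theory Num.Theory.
Import numFieldNormedType.Exports.

Local Open Scope classical_set_scope.
Local Open Scope ring_scope.

(** * Lebesgue measure on row vectors: translations, dilations, rotations *)

Section lebesgue_line.
Context {R : realType}.

Lemma ge0_integral_affine (c b : R) (f : measurableTypeR R -> \bar R) : 0 < c ->
  measurable_fun setT f -> (forall x, 0 <= f x)%E ->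
  (\int[@lebesgue_measure R]_x f (c * x + b)%R
    = (c^-1)%:E * \int[@lebesgue_measure R]_x f x)%E.
Proof.
move=> c0 mf f0; pose phi x : measurableTypeR R := c * x + b.
have mphi : measurable_fun [set: measurableTypeR R] phi.
  by apply: measurable_funD => //; apply: measurable_funM.
pose p : {measure set (measurableTypeR R) -> \bar R} :=
  measure_function_pushforward__canonical__measure_function_Measure
    (@lebesgue_measure R) mphi.
pose m := mscale (NngNum (ltW c0)) p.
have mE A : measurable A -> lebesgue_measure A = m A.
  apply: lebesgue_measure_unique => _ [[x y] _ <-] /=.
  rewrite /m /mscale /= /pushforward.
  rewrite (_ : phi @^-1` _ = `](x - b) / c, (y - b) / c]%classic); last first.
    apply/seteqP; split => z /=; rewrite !in_itv /= ltr_pdivrMr// ler_pdivlMr//;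
      by rewrite /phi ltrBlDr lerBrDr mulrC.
  rewrite !lebesgue_measure_itv/= !lte_fin ltr_pM2r ?invr_gt0// ltrD2r.
  case: ifPn => xy; last by rewrite mule0.
  by rewrite -!EFinD -EFinM; congr EFin; field; rewrite gt_eqF.
rewrite [in RHS](eq_measure_integral m); last by move=> A mA _; exact: mE.
rewrite ge0_integral_mscale// ge0_integral_pushforward//.
by rewrite muleA -EFinM mulVf ?gt_eqF// mul1e.
Qed.

End lebesgue_line.

Section measurable_rV.
Context {R : realType}.

Lemma measurable_box n (c : 'rV[R]_n) (e : R) :
  measurable [set x : 'rV[R]_n | forall i, `|x ord0 i - c ord0 i| < e].
Proof.
rewrite (_ : [set _ | _] = \bigcap_(i in [set: 'I_n])
    [set x : 'rV[R]_n | `|x ord0 i - c ord0 i| < e]); last first.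
  by apply/seteqP; split => x /= h i => [_|]; [exact: h|exact: (h i I)].
apply: fin_bigcap_measurable => // i _.
rewrite -[X in measurable X]setTI.
have : measurable_fun setT (fun x : 'rV[R]_n => `|x ord0 i - c ord0 i|).
  apply: measurableT_comp => //; apply: measurable_funB => //.
  exact: measurable_coord.
move=> /(_ measurableT [set y | y < e]); apply.
by rewrite -set_itvNyo; exact: measurable_itv.
Qed.

Lemma open_measurable_rV n (U : set 'rV[R]_n) : open U -> measurable U.
Proof.
move=> oU.
pose box (p : 'rV[rat]_n * nat) :=
  [set x : 'rV[R]_n | forall i, `|x ord0 i - ratr (p.1 ord0 i)| < p.2.+1%:R^-1].
rewrite (_ : U = \bigcup_p (if `[< box p `<=` U >] then box p else set0)).
  apply: countable_bigcupT_measurable; first exact: countableP.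
  move=> p; case: ifPn => // _.
  have := measurable_box (\row_i ratr (p.1 ord0 i)) p.2.+1%:R^-1.
  rewrite (_ : [set _ | _] = box p)//; apply/seteqP; split => x /= h i;
    by have := h i; rewrite mxE.
apply/seteqP; split => [x Ux|x [p _]]; last first.
  by case: ifPn => // /asboolP; apply.
have /nbhs_ballP[e /= e0 exU] : nbhs x U by apply: open_nbhs_nbhs; split.
have [k ke] : exists k : nat, 2 * k.+1%:R^-1 < e.
  have [k _ /(_ _ (leqnn k))] := near_infty_natSinv_lt (PosNum (divr_gt0 e0 (@ltr0n R 2))).
  by move=> /= H; exists k; rewrite mulrC -ltr_pdivlMr.
have H i : exists q : rat, `|x ord0 i - ratr q| < k.+1%:R^-1.
  have k0 : 0 < k.+1%:R^-1 :> R by rewrite invr_gt0.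
  move: (k.+1%:R^-1) k0 => d d0.
  have : x ord0 i - d < x ord0 i + d by lra.
  move=> /rat_in_itvoo[q]; rewrite in_itv /= => /andP[q1 q2].
  by exists q; rewrite ltr_norml; apply/andP; split; lra.
have [q hq] := choice H.
exists (\row_i q i, k) => //; case: asboolP => [_ i|]; first by rewrite mxE.
case=> y /= hy; apply: exU; split => // i j.
rewrite /ball/= (ord1 i); have := hy j; have := hq j; rewrite mxE => h1 h2.
rewrite (le_lt_trans _ ke)// (_ : x 0 j - y 0 j =
  (x 0 j - ratr (q j)) - (y 0 j - ratr (q j))); last by ring.
by rewrite (le_trans (ler_normB _ _))// mulr_natl mulr2n lerD// ltW.
Qed.

Lemma continuous_measurable_rV n (f : 'rV[R]_n -> R) :
  continuous f -> measurable_fun setT f.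
Proof.
move=> cf; apply: (measurability _ (measurable_realfun.RGenOpens.measurableE R)).
move=> /= _ [_ [a [b ->] <-]]; rewrite setTI.
apply: open_measurable_rV; apply: open_comp; last exact: interval_open.
by move=> x _; exact: cf.
Qed.

End measurable_rV.

Section continuous_real.
Context {R : realType} {T : topologicalType}.
Implicit Types f g : T -> R.

Lemma contD f g : continuous f -> continuous g -> continuous (fun x => f x + g x).
Proof. by move=> cf cg x; apply: cvgD; [exact: cf|exact: cg]. Qed.

Lemma contB f g : continuous f -> continuous g -> continuous (fun x => f x - g x).
Proof. by move=> cf cg x; apply: cvgB; [exact: cf|exact: cg]. Qed.

Lemma contM f g : continuous f -> continuous g -> continuous (fun x => f x * g x).
Proof. by move=> cf cg x; apply: cvgM; [exact: cf|exact: cg]. Qed.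

Lemma cont_cst (c : R) : continuous (fun _ : T => c).
Proof. by move=> x; exact: cvg_cst. Qed.

Lemma cont_comp (h : R -> R) f : continuous h -> continuous f -> continuous (h \o f).
Proof. by move=> ch cf x; apply: continuous_comp; [exact: cf|exact: ch]. Qed.

Lemma contX f n : continuous f -> continuous (fun x => f x ^+ n).
Proof. by move=> cf; apply: (cont_comp (@exprn_continuous R n)). Qed.

Lemma cont_norm f : continuous f -> continuous (fun x => `|f x|).
Proof. by move=> cf; apply: (cont_comp (h := fun t : R => `|t|)) => // x; exact: norm_continuous. Qed.

End continuous_real.

Section dot_product.
Context {R : realType} {N : nat}.
Implicit Types (x y : 'rV[R]_N) (c : R).

Definition dot x y : R := \sum_i x ord0 i * y ord0 i.

Lemma dotC x y : dot x y = dot y x.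
Proof. by apply: eq_bigr => i _; rewrite mulrC. Qed.

Lemma dotDl x1 x2 y : dot (x1 + x2) y = dot x1 y + dot x2 y.
Proof. by rewrite -big_split; apply: eq_bigr => i _; rewrite mxE mulrDl. Qed.

Lemma dotZl c x y : dot (c *: x) y = c * dot x y.
Proof. by rewrite mulr_sumr; apply: eq_bigr => i _; rewrite mxE mulrA. Qed.

Lemma dotDr x y1 y2 : dot x (y1 + y2) = dot x y1 + dot x y2.
Proof. by rewrite dotC dotDl !(dotC x). Qed.

Lemma dotZr c x y : dot x (c *: y) = c * dot x y.
Proof. by rewrite dotC dotZl dotC. Qed.

Lemma dotNl x y : dot (- x) y = - dot x y.
Proof. by rewrite -scaleN1r dotZl mulN1r. Qed.

Lemma dotNr x y : dot x (- y) = - dot x y.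
Proof. by rewrite dotC dotNl dotC. Qed.

Lemma dotBl x1 x2 y : dot (x1 - x2) y = dot x1 y - dot x2 y.
Proof. by rewrite dotDl dotNl. Qed.

Lemma dotBr x y1 y2 : dot x (y1 - y2) = dot x y1 - dot x y2.
Proof. by rewrite dotDr dotNr. Qed.

Lemma dot0l y : dot 0 y = 0.
Proof. by rewrite -[0](scale0r 0) dotZl mul0r. Qed.

Lemma dot0r x : dot x 0 = 0.
Proof. by rewrite dotC dot0l. Qed.

Lemma dot_delta x i : dot (delta_mx ord0 i) x = x ord0 i.
Proof.
rewrite /dot (bigD1 i)//= mxE !eqxx mul1r big1 ?addr0// => j ji.
by rewrite mxE (negbTE ji) mul0r.
Qed.

Lemma dot_ge0 x : 0 <= dot x x.
Proof. by apply: sumr_ge0 => i _; rewrite -expr2 sqr_ge0. Qed.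

Lemma enormE x : enorm x = Num.sqrt (dot x x).
Proof. by rewrite /enorm; congr Num.sqrt; apply: eq_bigr => i _; rewrite expr2. Qed.

Lemma enorm_ge0 x : 0 <= enorm x. Proof. exact: sqrtr_ge0. Qed.

Lemma enorm_sqr x : enorm x ^+ 2 = dot x x.
Proof. by rewrite enormE sqr_sqrtr// dot_ge0. Qed.

Lemma enorm_le x y : (enorm x <= enorm y) = (dot x x <= dot y y).
Proof. by rewrite !enormE ler_sqrt// dot_ge0. Qed.

Lemma enormZ c x : enorm (c *: x) = `|c| * enorm x.
Proof.
by rewrite !enormE dotZl dotZr mulrA -expr2 sqrtrM ?sqr_ge0// sqrtr_sqr.
Qed.

Lemma enorm0 : enorm (0 : 'rV[R]_N) = 0.
Proof. by rewrite enormE dot0l sqrtr0. Qed.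

Lemma enormN x : enorm (- x) = enorm x.
Proof. by rewrite -scaleN1r enormZ normrN1 mul1r. Qed.

Lemma enorm_eq0 x : (enorm x == 0) = (x == 0).
Proof.
apply/eqP/eqP => [x0|->]; last exact: enorm0.
have : dot x x = 0 by rewrite -enorm_sqr x0 expr0n.
move=> /eqP; rewrite psumr_eq0; last by move=> i _; rewrite -expr2 sqr_ge0.
move=> /allP H; apply/rowP => i; rewrite mxE; apply/eqP.
by have := H i (mem_index_enum _); rewrite mulf_eq0 orbb.
Qed.

Lemma enorm_gt0 x : (0 < enorm x) = (x != 0).
Proof. by rewrite lt_def enorm_ge0 andbT enorm_eq0. Qed.

Lemma dot_le_enorm x y : dot x y <= enorm x * enorm y.
Proof.
have [->|y0] := eqVneq y 0; first by rewrite dot0r enorm0 mulr0.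
have [xy0|xy0] := ltP (dot x y) 0.
  by rewrite (le_trans (ltW xy0))// mulr_ge0 ?enorm_ge0.
rewrite -(@ler_pXn2r _ 2)// ?nnegrE ?mulr_ge0 ?enorm_ge0//.
rewrite exprMn !enorm_sqr.
have y1 : 0 < dot y y by rewrite -enorm_sqr exprn_gt0// enorm_gt0.
have := dot_ge0 (dot y y *: x - dot x y *: y).
rewrite dotBl !dotBr !dotZl !dotZr (dotC y x) => H.
have : 0 <= dot y y * (dot x x * dot y y - dot x y ^+ 2) by lra.
by rewrite pmulr_rge0// subr_ge0.
Qed.

Lemma ler_enormD x y : enorm (x + y) <= enorm x + enorm y.
Proof.
rewrite -(@ler_pXn2r _ 2)// ?nnegrE ?addr_ge0 ?enorm_ge0//.
rewrite sqrrD !enorm_sqr dotDl !dotDr (dotC y x).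
by have := dot_le_enorm x y; rewrite -mulr_natl; lra.
Qed.

Lemma ler_enormB x y : enorm (x - y) <= enorm x + enorm y.
Proof. by rewrite (le_trans (ler_enormD _ _))// enormN. Qed.

Lemma enormB x y : enorm (x - y) = enorm (y - x).
Proof. by rewrite -enormN opprB. Qed.

Lemma ler_dist_enorm x y : `|enorm x - enorm y| <= enorm (x - y).
Proof.
have := ler_enormD (x - y) y; have := ler_enormD (y - x) x.
by rewrite !subrK (enormB y) => ? ?; rewrite ler_norml; apply/andP; split; lra.
Qed.

Lemma coord_le_enorm x i : `|x ord0 i| <= enorm x.
Proof.
rewrite -(@ler_pXn2r _ 2)// ?nnegrE ?enorm_ge0// enorm_sqr real_normK ?num_real//.
rewrite /dot (bigD1 i)//= -expr2 lerDl; apply: sumr_ge0 => j _.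
by rewrite -expr2 sqr_ge0.
Qed.

Lemma enorm_le_sum x : enorm x <= \sum_i `|x ord0 i|.
Proof.
rewrite [X in enorm X]row_sum_delta.
apply: (big_ind2 (fun a b => enorm a <= b)) => [|a1 b1 a2 b2 h1 h2|i _].
- by rewrite enorm0.
- by rewrite (le_trans (ler_enormD _ _))// lerD.
- rewrite enormZ enormE dot_delta mxE !eqxx sqrtr1 mulr1//.
Qed.

Lemma continuous_sumr (T : topologicalType) (I : Type) (s : seq I)
    (F : I -> T -> R) :
  (forall i, continuous (F i)) -> continuous (fun t => \sum_(i <- s) F i t).
Proof.
move=> cF; elim: s => [|i s IH] t.
  rewrite (_ : (fun _ => _) = cst 0); first exact: cvg_cst.
  by apply/funext => z; rewrite big_nil.
rewrite (_ : (fun _ => _) = (fun t => F i t + \sum_(j <- s) F j t)).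
  by apply: cvgD; [exact: cF|exact: IH].
by apply/funext => z; rewrite big_cons.
Qed.

Lemma continuous_dotl y : continuous (fun x : 'rV[R]_N => dot x y).
Proof.
apply: continuous_sumr => i x.
by apply: continuousM; [exact: coord_continuous|exact: cst_continuous].
Qed.

Lemma continuous_dotr x : continuous (fun y : 'rV[R]_N => dot x y).
Proof.
rewrite (_ : (fun y => dot x y) = (fun y => dot y x)); first exact: continuous_dotl.
by apply/funext => y; rewrite dotC.
Qed.

Lemma continuous_enorm : continuous (@enorm R N).
Proof.
move=> x; apply: (@continuous_comp _ _ _ (fun x : 'rV[R]_N => \sum_i x ord0 i ^+ 2)
  (@Num.sqrt R)); last exact: sqrt_continuous.
apply: continuous_sumr => i {}x.
by apply: (@continuous_comp _ _ _ (fun x : 'rV[R]_N => x ord0 i) (fun t => t ^+ 2));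
  [exact: coord_continuous|exact: exprn_continuous].
Qed.

End dot_product.

Section invariance.
Context {R : realType}.
Local Notation mu := (lebesgue_rV R).
Local Notation leb := (@lebesgue_measure R).
Local Open Scope ereal_scope.

Lemma measurable_cons_rVr n (s : measurableTypeR R) :
  measurable_fun setT (fun v : 'rV[R]_n => cons_rV (s, v)).
Proof. by apply: measurableT_comp => //; exact: measurable_cons_rV. Qed.

Lemma measurable_cons_rVl n (v : 'rV[R]_n) :
  measurable_fun setT (fun s : measurableTypeR R => cons_rV (s, v)).
Proof. by apply: measurableT_comp => //; exact: measurable_cons_rV. Qed.

Lemma cons_rV0 n (s : R) (v : 'rV[R]_n) : (cons_rV (s, v) : 'rV[R]_n.+1) ord0 ord0 = s.
Proof. by have /(congr1 fst) := cons_rVK (s, v). Qed.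

Lemma cons_rV_lift n (s : R) (v : 'rV[R]_n) i :
  (cons_rV (s, v) : 'rV[R]_n.+1) ord0 (lift ord0 i) = v ord0 i.
Proof.
have <- : rshift 1 i = lift ord0 i :> 'I_(1 + n) by exact/val_inj.
by have := row_mxEr (s%:M : 'M[R]_1) v ord0 i.
Qed.

Lemma rV_ord0_ext n (x y : 'rV[R]_n.+1) : x ord0 ord0 = y ord0 ord0 ->
  (forall i, x ord0 (lift ord0 i) = y ord0 (lift ord0 i)) -> x = y.
Proof.
move=> xy0 xyS; apply/rowP => i.
by have [j ->|->] := unliftP ord0 i; [exact: xyS|exact: xy0].
Qed.

Lemma rV_addZE n (x w : 'rV[R]_n) (c : R) i :
  (x + c *: w)%R ord0 i = (x ord0 i + c * w ord0 i)%R.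
Proof. by rewrite !mxE. Qed.

Lemma rsubmx_lift n (x : 'rV[R]_n.+1) i :
  rsubmx (x : 'rV_(1 + n)) ord0 i = x ord0 (lift ord0 i).
Proof. by rewrite mxE; congr (x _ _); exact/val_inj. Qed.

Section fubini.
Context n (f : 'rV[R]_(1 + n) -> \bar R).
Hypotheses (mf : measurable_fun setT f) (f0 : forall x, 0 <= f x).

Let mfc : measurable_fun setT (f \o @cons_rV R n).
Proof. by apply: measurableT_comp => //; exact: measurable_cons_rV. Qed.

Lemma integral_rVS1 :
  \int[mu n.+1]_x f x = \int[leb]_s \int[mu n]_v f (cons_rV (s, v)).
Proof.
transitivity (\int[pushforward (leb \x mu n) (@cons_rV R n)]_x f x); first by [].
rewrite ge0_integral_pushforward//; last exact: measurable_cons_rV.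
by rewrite preimage_setT fubini_tonelli1// => p; exact: f0.
Qed.

Lemma integral_rVS2 :
  \int[mu n.+1]_x f x = \int[mu n]_v \int[leb]_s f (cons_rV (s, v)).
Proof.
transitivity (\int[pushforward (leb \x mu n) (@cons_rV R n)]_x f x); first by [].
rewrite ge0_integral_pushforward//; last exact: measurable_cons_rV.
by rewrite preimage_setT fubini_tonelli2// => p; exact: f0.
Qed.

Lemma measurable_integral_rVr :
  measurable_fun setT (fun s : measurableTypeR R => \int[mu n]_v f (cons_rV (s, v))).
Proof.
have := @measurable_fun_fubini_tonelli_F _ _ (measurableTypeR R) _ R (mu n) (f \o @cons_rV R n) mfc.
by apply => p; exact: f0.
Qed.

End fubini.

Lemma integral_translate n (f : 'rV[R]_n -> \bar R) (z : 'rV[R]_n) :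
  measurable_fun setT f -> (forall x, 0 <= f x) ->
  \int[mu n]_x f (x + z)%R = \int[mu n]_x f x.
Proof.
elim: n f z => [f z _ _|n IH f z mf f0].
  by apply: eq_integral => x _; congr f; apply/rowP => -[].
have consD s (v : 'rV[R]_n) : ((cons_rV (s, v) : 'rV[R]_n.+1) + z)%R =
    cons_rV ((1 * s + z ord0 ord0)%R, (v + rsubmx (z : 'rV_(1 + n)))%R).
  apply: rV_ord0_ext => [|i]; first by rewrite mxE !cons_rV0 mul1r.
  by rewrite mxE !cons_rV_lift mxE rsubmx_lift.
have mfz : measurable_fun setT (fun x : 'rV[R]_n.+1 => f (x + z)%R).
  apply: measurableT_comp => //; apply: measurable_fun_rVP => i.
  under eq_fun do rewrite mxE.
  by apply: measurable_funD => //; exact: measurable_coord.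
rewrite (integral_rVS1 mfz (fun x => f0 _)) (integral_rVS1 mf f0).
under eq_integral => s _.
  under eq_integral => v _ do rewrite consD.
  rewrite (IH (fun v => f (cons_rV ((1 * s + z ord0 ord0)%R, v))))//; last first.
    by apply: measurableT_comp => //; exact: measurable_cons_rVr.
  over.
have := @ge0_integral_affine R 1 (z ord0 ord0)
  (fun s => \int[mu n]_v f (cons_rV (s, v))) ltr01.
rewrite invr1 mul1e; apply; first exact: measurable_integral_rVr.
by move=> s; apply: integral_ge0.
Qed.

Lemma integral_dilate n (f : 'rV[R]_n -> \bar R) (c : R) : (0 < c)%R ->
  measurable_fun setT f -> (forall x, 0 <= f x) ->
  \int[mu n]_x f (c *: x)%R = ((c ^- n)%:E * \int[mu n]_x f x).
Proof.
move=> c0; elim: n f => [f _ _|n IH f mf f0].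
  rewrite expr0 invr1 mul1e.
  by apply: eq_integral => x _; congr f; apply/rowP => -[].
have consZ s (v : 'rV[R]_n) : (c *: (cons_rV (s, v) : 'rV[R]_n.+1))%R =
    cons_rV ((c * s + 0)%R, (c *: v)%R).
  apply: rV_ord0_ext => [|i]; first by rewrite mxE !cons_rV0 addr0.
  by rewrite mxE !cons_rV_lift mxE.
have mfz : measurable_fun setT (fun x : 'rV[R]_n.+1 => f (c *: x)%R).
  apply: measurableT_comp => //; apply: measurable_fun_rVP => i.
  under eq_fun do rewrite mxE.
  by apply: measurable_funM => //; exact: measurable_coord.
rewrite (integral_rVS1 mfz (fun x => f0 _)) (integral_rVS1 mf f0).
under eq_integral => s _.
  under eq_integral => v _ do rewrite consZ.
  rewrite (IH (fun v => f (cons_rV ((c * s + 0)%R, v))))//; last first.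
    by apply: measurableT_comp => //; exact: measurable_cons_rVr.
  over.
rewrite (@ge0_integral_affine R c 0
  (fun s => (c ^- n)%:E * \int[mu n]_v f (cons_rV (s, v))) c0).
- rewrite ge0_integralZl//; last 3 first.
  + exact: measurable_integral_rVr.
  + by move=> s _; exact: integral_ge0.
  + by rewrite lee_fin invr_ge0 exprn_ge0// ltW.
  by rewrite muleA -EFinM exprS invfM.
- by apply: measurable_funeM; exact: measurable_integral_rVr.
- move=> s; rewrite mule_ge0 ?integral_ge0// lee_fin invr_ge0 exprn_ge0//.
  exact: ltW.
Qed.

Section shear.
Context {n : nat}.
Local Notation e := (delta_mx ord0 ord0 : 'rV[R]_n.+1).
Variables (w : 'rV[R]_n.+1) (k : R).
Hypothesis w0 : w ord0 ord0 = 0%R.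
Variables (f : 'rV[R]_n.+1 -> \bar R).
Hypotheses (mf : measurable_fun setT f) (f0 : forall x, 0 <= f x).

Let dotcons s (v : 'rV[R]_n) :
  dot w (cons_rV (s, v)) = dot (rsubmx (w : 'rV_(1 + n))) v.
Proof.
rewrite /dot big_ord_recl w0 mul0r add0r; apply: eq_bigr => i _.
by rewrite cons_rV_lift rsubmx_lift.
Qed.

Lemma integral_shear_head :
  \int[mu n.+1]_x f (x + (k * dot w x) *: e)%R = \int[mu n.+1]_x f x.
Proof.
have mf1 : measurable_fun setT (fun x : 'rV[R]_n.+1 => f (x + (k * dot w x) *: e)%R).
  apply: measurableT_comp => //; apply: measurable_fun_rVP => i.
  under eq_fun do rewrite !mxE.
  apply: measurable_funD; first exact: measurable_coord.
  apply: measurable_funM => //; apply: measurable_funM => //.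
  by apply: continuous_measurable_rV; exact: continuous_dotr.
rewrite (integral_rVS2 mf1 (fun x => f0 _)) (integral_rVS2 mf f0); apply: eq_integral => v _.
have H s : ((cons_rV (s, v) : 'rV[R]_n.+1) + (k * dot w (cons_rV (s, v))) *: e)%R =
    cons_rV ((1 * s + k * dot (rsubmx (w : 'rV_(1 + n))) v)%R, v).
  rewrite dotcons; apply: rV_ord0_ext => [|i].
    by rewrite rV_addZE !cons_rV0 mxE !eqxx mulr1 mul1r.
  by rewrite rV_addZE !cons_rV_lift mxE mulr0 addr0.
under eq_integral do rewrite H.
rewrite (@ge0_integral_affine R 1 _ (fun s => f (cons_rV (s, v))) ltr01)//.
  by rewrite invr1 mul1e.
by apply: measurableT_comp => //; exact: measurable_cons_rVl.
Qed.

Lemma integral_shear_tail :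
  \int[mu n.+1]_x f (x + (k * x ord0 ord0) *: w)%R = \int[mu n.+1]_x f x.
Proof.
have mf1 : measurable_fun setT (fun x : 'rV[R]_n.+1 => f (x + (k * x ord0 ord0) *: w)%R).
  apply: measurableT_comp => //; apply: measurable_fun_rVP => i.
  under eq_fun do rewrite !mxE.
  apply: measurable_funD; first exact: measurable_coord.
  apply: measurable_funM => //; apply: measurable_funM => //.
  exact: measurable_coord.
rewrite (integral_rVS1 mf1 (fun x => f0 _)) (integral_rVS1 mf f0); apply: eq_integral => s _.
have H (v : 'rV[R]_n) : ((cons_rV (s, v) : 'rV[R]_n.+1) + (k * (cons_rV (s, v) : 'rV_n.+1) ord0 ord0) *: w)%R =
    cons_rV (s, v + (k * s) *: rsubmx (w : 'rV_(1 + n)))%R.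
  rewrite cons_rV0; apply: rV_ord0_ext => [|i].
    by rewrite rV_addZE !cons_rV0 w0 mulr0 addr0.
  by rewrite rV_addZE !cons_rV_lift rV_addZE rsubmx_lift.
under eq_integral do rewrite H.
rewrite (integral_translate (f := fun v => f (cons_rV (s, v))))//.
by apply: measurableT_comp => //; exact: measurable_cons_rVr.
Qed.

End shear.
End invariance.

Section rotation.
Context {R : realType} {n : nat}.
Local Notation e := (delta_mx ord0 ord0 : 'rV[R]_n.+1).
Variable w : 'rV[R]_n.+1.
Hypotheses (w0 : w ord0 ord0 = 0) (ww : dot w w = 1).

Definition rot (c s : R) (x : 'rV[R]_n.+1) : 'rV[R]_n.+1 :=
  x + ((c - 1) * x ord0 ord0 - s * dot w x) *: e
    + (s * x ord0 ord0 + (c - 1) * dot w x) *: w.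

Lemma rot_head c s x : rot c s x ord0 ord0 = c * x ord0 ord0 - s * dot w x.
Proof. by rewrite /rot !rV_addZE w0 mxE !eqxx /=; ring. Qed.

Lemma rot_dot c s x : dot w (rot c s x) = s * x ord0 ord0 + c * dot w x.
Proof. by rewrite /rot !dotDr !dotZr (dotC w e) dot_delta w0 ww; ring. Qed.

Lemma rotM c s c' s' x :
  rot c s (rot c' s' x) = rot (c * c' - s * s') (s * c' + c * s') x.
Proof.
apply/rowP => i; rewrite [rot c s _]/rot rot_head rot_dot /rot !rV_addZE; ring.
Qed.

Lemma rot1 x : rot 1 0 x = x.
Proof. by apply/rowP => i; rewrite /rot !rV_addZE; ring. Qed.

Lemma rotDZ c s k x y : rot c s (x + k *: y) = rot c s x + k *: rot c s y.
Proof.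
by apply/rowP => i; rewrite rV_addZE /rot !rV_addZE dotDr dotZr; ring.
Qed.

Lemma rot_isom c s x y : c ^+ 2 + s ^+ 2 = 1 ->
  dot (rot c s x) (rot c s y) = dot x y.
Proof.
move=> cs.
have -> : dot (rot c s x) (rot c s y) = dot x y +
    (c ^+ 2 + s ^+ 2 - 1) * (x ord0 ord0 * y ord0 ord0 + dot w x * dot w y).
  rewrite [rot c s x]/rot !(dotDl, dotZl) dot_delta rot_dot rot_head.
  by rewrite /rot !(dotDr, dotZr) (dotC x e) (dotC x w) dot_delta; ring.
by rewrite cs subrr mul0r addr0.
Qed.

Lemma enorm_rot c s x : c ^+ 2 + s ^+ 2 = 1 -> enorm (rot c s x) = enorm x.
Proof. by move=> cs; rewrite !enormE rot_isom. Qed.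

Lemma continuous_rot_coord c s i : continuous (fun x => rot c s x ord0 i).
Proof.
have -> : (fun x => rot c s x ord0 i) = (fun x => x ord0 i +
    ((c - 1) * x ord0 ord0 - s * dot w x) * e ord0 i +
    (s * x ord0 ord0 + (c - 1) * dot w x) * w ord0 i).
  by apply/funext => x; rewrite /rot !rV_addZE.
apply: contD; first apply: contD.
- exact: coord_continuous.
- apply: contM; last exact: cont_cst.
  apply: contB; apply: contM; try exact: cont_cst.
    exact: coord_continuous.
  exact: continuous_dotr.
- apply: contM; last exact: cont_cst.
  apply: contD; apply: contM; try exact: cont_cst.
    exact: coord_continuous.
  exact: continuous_dotr.
Qed.

Lemma measurable_rot c s : measurable_fun setT (rot c s).
Proof.
apply: measurable_fun_rVP => i; apply: continuous_measurable_rV.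
exact: continuous_rot_coord.
Qed.

Lemma integral_rot c s (f : 'rV[R]_n.+1 -> \bar R) : c ^+ 2 + s ^+ 2 = 1 ->
  measurable_fun setT f -> (forall x, (0 <= f x)%E) ->
  (\int[lebesgue_rV R n.+1]_x f (rot c s x) = \int[lebesgue_rV R n.+1]_x f x)%E.
Proof.
(* for [s != 0] the rotation is a product of three shears *)
have main c' s' g : c' ^+ 2 + s' ^+ 2 = 1 -> s' != 0 ->
    measurable_fun setT g -> (forall x, (0 <= g x)%E) ->
    (\int[lebesgue_rV R n.+1]_x g (rot c' s' x) = \int[lebesgue_rV R n.+1]_x g x)%E.
  move=> cs s0 mg g0; pose k := (c' - 1) / s'.
  pose S1 (x : 'rV[R]_n.+1) := x + (k * dot w x) *: e.
  pose S2 (x : 'rV[R]_n.+1) := x + (s' * x ord0 ord0) *: w.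
  have rotE x : rot c' s' x = S1 (S2 (S1 x)).
    have H1 y : S1 y ord0 ord0 = y ord0 ord0 + k * dot w y.
      by rewrite /S1 rV_addZE mxE !eqxx /= mulr1.
    have H2 y : dot w (S1 y) = dot w y.
      by rewrite /S1 dotDr dotZr (dotC w e) dot_delta w0 mulr0 addr0.
    have H3 y : dot w (S2 y) = dot w y + s' * y ord0 ord0.
      by rewrite /S2 dotDr dotZr ww mulr1.
    apply/rowP => i; rewrite {1}/S1 rV_addZE H3 H2 {1}/S2 rV_addZE H1 /S1 /rot.
    rewrite !rV_addZE.
    have sk : s' * k = c' - 1 by rewrite /k mulrC divfK.
    have kk : k + k + s' * k * k = - s'.
      rewrite sk /k; apply: (mulfI s0).
      have -> : s' * ((c' - 1) / s' + (c' - 1) / s' + (c' - 1) * ((c' - 1) / s'))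
          = (s' / s') * ((c' - 1) * (c' + 1)) by ring.
      by rewrite divff// mul1r mulrN -expr2 -subr_sqr expr1n -cs; ring.
    apply/eqP; rewrite -sk -subr_eq0; apply/eqP.
    transitivity (- (e ord0 i * dot w x) * (k + k + s' * k * k + s')); last first.
      by rewrite kk addNr mulr0.
    by ring.
  have mS1 : measurable_fun setT S1.
    apply: measurable_fun_rVP => i; apply: continuous_measurable_rV.
    rewrite (_ : (fun x => S1 x ord0 i) =
        (fun x => x ord0 i + k * dot w x * e ord0 i)); last first.
      by apply/funext => y; rewrite /S1 rV_addZE.
    apply: contD; first exact: coord_continuous.
    apply: contM; last exact: cont_cst.
    by apply: contM; [exact: cont_cst|exact: continuous_dotr].
  have mS2 : measurable_fun setT S2.
    apply: measurable_fun_rVP => i; apply: continuous_measurable_rV.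
    rewrite (_ : (fun x => S2 x ord0 i) =
        (fun x => x ord0 i + s' * x ord0 ord0 * w ord0 i)); last first.
      by apply/funext => y; rewrite /S2 rV_addZE.
    apply: contD; first exact: coord_continuous.
    apply: contM; last exact: cont_cst.
    by apply: contM; [exact: cont_cst|exact: coord_continuous].
  under eq_integral do rewrite rotE.
  rewrite (@integral_shear_head _ _ w k w0 (fun x => g (S1 (S2 x))))//; last first.
    by apply: measurableT_comp => //; exact: measurableT_comp.
  rewrite (@integral_shear_tail _ _ w s' w0 (fun x => g (S1 x)))//; last first.
    exact: measurableT_comp.
  exact: integral_shear_head.
move=> cs mf f0; have [s0|] := eqVneq s 0; last by move=> s0; exact: main.
move: cs; rewrite s0 expr0n addr0 => /eqP; rewrite sqrf_eq1 => /orP[]/eqP ->.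
  by apply: eq_integral => x _; rewrite rot1.
have E x : rot (-1) 0 x = rot 0 1 (rot 0 1 x) by rewrite rotM; congr rot; ring.
under eq_integral do rewrite E.
rewrite (main 0 1 (fun x => f (rot 0 1 x))) ?oner_neq0//; last 2 first.
- by ring.
- by apply: measurableT_comp => //; exact: measurable_rot.
by rewrite main ?oner_neq0//; ring.
Qed.

End rotation.

Section nonneg_real_integral.
Context d (T : measurableType d) (R : realType) (mu : {measure set T -> \bar R}).
Implicit Types f g : T -> R.
Local Open Scope ereal_scope.

Lemma ge0_int f : (forall x, (0 <= f x)%R) -> 0 <= \int[mu]_x (f x)%:E.
Proof. by move=> f0; apply: integral_ge0 => x _; rewrite lee_fin. Qed.

Lemma le_int f g : measurable_fun setT f -> measurable_fun setT g ->
  (forall x, (0 <= f x)%R) -> (forall x, (f x <= g x)%R) ->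
  \int[mu]_x (f x)%:E <= \int[mu]_x (g x)%:E.
Proof.
move=> mf mg f0 fg; apply: ge0_le_integral => //.
- by move=> x _; rewrite lee_fin.
- exact/measurable_EFinP.
- exact/measurable_EFinP.
- by move=> x _; rewrite lee_fin.
Qed.

Lemma int_add f g : measurable_fun setT f -> measurable_fun setT g ->
  (forall x, (0 <= f x)%R) -> (forall x, (0 <= g x)%R) ->
  \int[mu]_x (f x + g x)%R%:E = \int[mu]_x (f x)%:E + \int[mu]_x (g x)%:E.
Proof.
move=> mf mg f0 g0; rewrite -ge0_integralD//.
- by move=> x _; rewrite lee_fin.
- exact/measurable_EFinP.
- by move=> x _; rewrite lee_fin.
- exact/measurable_EFinP.
Qed.

Lemma int_scale (c : R) f : measurable_fun setT f -> (0 <= c)%R ->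
  (forall x, (0 <= f x)%R) ->
  \int[mu]_x (c * f x)%R%:E = c%:E * \int[mu]_x (f x)%:E.
Proof.
move=> mf c0 f0; rewrite -ge0_integralZl//.
- exact/measurable_EFinP.
- by move=> x _; rewrite lee_fin.
Qed.

Lemma measure_indic (A : set T) : measurable A ->
  mu A = \int[mu]_x (\1_A x : R)%:E.
Proof. by move=> mA; rewrite integral_indic// setIT. Qed.

End nonneg_real_integral.

Section balls.
Context {R : realType}.
Local Notation mu := (lebesgue_rV R).
Local Open Scope ereal_scope.

Lemma measurable_enorm N : measurable_fun setT (@enorm R N).
Proof. by apply: continuous_measurable_rV; exact: continuous_enorm. Qed.

Lemma eballE N (r : R) : eball r = @enorm R N @^-1` [set t | (t < r)%R].
Proof. by []. Qed.

Lemma open_eball N (r : R) : open (eball r : set 'rV[R]_N).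
Proof.
rewrite eballE; apply: open_comp; last exact: open_lt.
by move=> x _; exact: continuous_enorm.
Qed.

Lemma measurable_eball N (r : R) : measurable (eball r : set 'rV[R]_N).
Proof. by apply: open_measurable_rV; exact: open_eball. Qed.

Definition cube N (s : R) : set 'rV[R]_N := [set x | forall i, (`|x ord0 i| <= s)%R].

Arguments cube : clear implicits.

Lemma measurable_cube N s : measurable (cube N s).
Proof.
rewrite (_ : cube N s = \bigcap_(i in [set: 'I_N]) [set x | (`|x ord0 i| <= s)%R]).
  apply: fin_bigcap_measurable => // i _; rewrite -[X in measurable X]setTI.
  have : measurable_fun setT (fun x : 'rV[R]_N => `|x ord0 i|%R).
    by apply: measurableT_comp => //; exact: measurable_coord.
  move=> /(_ measurableT [set y | (y <= s)%R]); apply.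
  by rewrite -set_itvNyc; exact: measurable_itv.
by apply/seteqP; split => x /= h i => [_|]; [exact: h|exact: (h i I)].
Qed.

Lemma lebesgue_cube N (s : R) : (0 <= s)%R -> mu N (cube N s) = (((2 * s) ^+ N)%R)%:E.
Proof.
move=> s0; elim: N => [|N IH].
  by rewrite expr0 /= diracE mem_set// => -[].
rewrite (measure_indic (mu N.+1) (@measurable_cube N.+1 s)).
rewrite integral_rVS1//; last first.
  by apply/measurable_EFinP/measurable_indic; exact: measurable_cube.
have E (t : R) (v : 'rV[R]_N) : \1_(cube N.+1 s) (cons_rV (t, v) : 'rV[R]_N.+1) =
    (\1_(`[- s, s]%classic) t * \1_(cube N s) v)%R :> R.
  rewrite !indicE -natrM mulnb; congr ((nat_of_bool _)%:R).
  apply/idP/andP => [|[]]; rewrite !inE /= in_itv /=.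
    move=> h; split; first by have := h ord0; rewrite cons_rV0 ler_norml.
    by move=> i; have := h (lift ord0 i); rewrite cons_rV_lift.
  move=> ts h i; have [j ->|->] := unliftP ord0 i.
    by rewrite cons_rV_lift; exact: h.
  by rewrite cons_rV0 ler_norml.
under eq_integral => t _.
  under eq_integral => v _ do rewrite E.
  rewrite int_scale//; last by apply: measurable_indic; exact: measurable_cube.
  rewrite (_ : \int[mu N]_x (\1_(cube N s) x)%:E = ((2 * s) ^+ N)%:E); last first.
    by rewrite -IH; apply/esym/measure_indic; exact: measurable_cube.
  rewrite -EFinM mulrC; over.
rewrite int_scale//; last by rewrite exprn_ge0// mulr_ge0.
rewrite (_ : \int[_]_t _ = (2 * s)%:E) -?EFinM ?exprS 1?mulrC//.
transitivity (@lebesgue_measure R `[(- s)%R, s]); first by rewrite integral_indic// setIT.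
rewrite lebesgue_measure_itv /= lte_fin.
case: ltP => [_|s1]; first by rewrite -EFinD; congr EFin; ring.
by congr EFin; lra.
Qed.

Lemma eball_subset_cube N (s : R) : eball s `<=` cube N s.
Proof.
move=> x /= xs i; rewrite (le_trans (coord_le_enorm _ _))//.
by rewrite ltW.
Qed.

Lemma lebesgue_eball_lty N (s : R) : mu N (eball s) < +oo.
Proof.
have [s0|s0] := leP 0%R s; last first.
  rewrite (_ : eball s = set0) ?measure0//; apply/seteqP; split => x //= xs.
  by have := le_lt_trans (enorm_ge0 x) (lt_trans xs s0); rewrite ltxx.
apply: (@le_lt_trans _ _ (mu N (cube N s))).
  apply: le_measure; rewrite ?inE; first exact: measurable_eball.
    exact: measurable_cube.
  exact: eball_subset_cube.
by rewrite lebesgue_cube// ltry.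
Qed.

Lemma lebesgue_eball_gt0 N (s : R) : (0 < s)%R -> 0 < mu N (eball s).
Proof.
move=> s0; pose d := (s / N.+1%:R)%R; have d0 : (0 < d)%R by rewrite divr_gt0.
apply: (@lt_le_trans _ _ (mu N (cube N d))).
  by rewrite lebesgue_cube ?ltW// lte_fin exprn_gt0// mulr_gt0.
apply: le_measure; rewrite ?inE; first exact: measurable_cube.
  exact: measurable_eball.
move=> x /= xd; rewrite /eball /= (le_lt_trans (enorm_le_sum x))//.
apply: (@le_lt_trans _ _ (\sum_(i < N) d)%R); first exact: ler_sum.
rewrite sumr_const card_ord -mulr_natl /d mulrCA gtr_pMr//.
by rewrite ltr_pdivrMr// mul1r ltr_nat.
Qed.

Definition unit_vol N : R := fine (mu N (eball 1)).

Lemma unit_vol_gt0 N : (0 < unit_vol N)%R.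
Proof. by rewrite fine_gt0// lebesgue_eball_gt0//= lebesgue_eball_lty. Qed.

Lemma lebesgue_eball N (s : R) : (0 < s)%R ->
  mu N (eball s) = (s ^+ N * unit_vol N)%:E.
Proof.
move=> s0; rewrite EFinM fineK; last first.
  by rewrite ge0_fin_numE ?lebesgue_eball_lty// measure_ge0.
have mi : measurable_fun setT (fun x : 'rV[R]_N => (\1_(eball s) x : R)%:E).
  by apply/measurable_EFinP; apply: measurable_indic; exact: measurable_eball.
have i0 (x : 'rV[R]_N) : 0 <= (\1_(eball s) x : R)%:E by rewrite lee_fin.
have := integral_dilate s0 mi i0.
under eq_integral => x _.
  rewrite (_ : \1_(eball s) (s *: x) = \1_(eball 1) x)%R; last first.
    rewrite !indicE; congr ((nat_of_bool _)%:R); apply/idP/idP; rewrite !inE /eball /=;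
    by rewrite enormZ gtr0_norm// gtr_pMr.
  over.
rewrite -!measure_indic; try exact: measurable_eball.
by move=> ->; rewrite muleA -EFinM divff ?mul1e// gt_eqF// exprn_gt0.
Qed.

End balls.

(** * Smooth functions, gradients and Sobolev limits *)

Section calculus.
Context {R : realType} {N : nat}.
Implicit Types (f g : 'rV[R]_N -> R) (x y z v : 'rV[R]_N).
Local Notation e_ i := (delta_mx ord0 i : 'rV[R]_N).

Lemma coord_le_mxnorm x i : `|x ord0 i| <= `|x|.
Proof.
have /mapP[j _ ->] : `|x ord0 i| \in [seq `|x k.1 k.2| | k : 'I_1 * 'I_N].
  by apply/mapP; exists (ord0, i) => //=; rewrite mem_enum.
by rewrite [leRHS]/Num.norm /= mx_normrE; apply/bigmax_geP; right => /=; exists j.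
Qed.

Lemma is_derive_line f x v (d : R) :
  is_derive x v f d <-> is_derive (0 : R) 1 (fun t => f (x + t *: v)) d.
Proof.
have E : (fun h : R => h^-1 *: (f (h *: v + x) - f x)) =
    (fun h : R => h^-1 *: (f (x + (h *: 1 + 0) *: v) - f (x + 0 *: v))).
  by apply/funext => h; rewrite scale0r !addr0 [h *: 1]mulr1 (addrC x).
split=> -[]; rewrite /derivable /derive => D1 D2; split;
  rewrite /derivable /derive.
- by rewrite /= -E.
- by rewrite /= -E.
- by rewrite /= E.
- by rewrite /= E.
Qed.

Lemma is_derive_line_at f x v (t d : R) : is_derive (x + t *: v) v f d ->
  is_derive t 1 (fun t => f (x + t *: v)) d.
Proof.
move=> /is_derive_line H.
have -> : (fun t => f (x + t *: v)) =
    (fun s => f (x + t *: v + s *: v)) \o (fun s => s - t).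
  by apply/funext => s /=; rewrite scalerBl addrCA addrK addrC.
rewrite -[d]mulr1; apply: is_derive1_comp; first by rewrite subrr.
rewrite -[X in is_derive _ _ _ X]subr0; apply: is_deriveB.
Qed.

Lemma MVT_line f x v (c : R) : (forall z, derivable f z v) ->
  exists2 t : R, `|t| <= `|c| & f (x + c *: v) - f x = c * 'D_v f (x + t *: v).
Proof.
move=> df; pose g (t : R) := f (x + t *: v).
have dg (t : R) : is_derive t 1 g ('D_v f (x + t *: v)).
  by apply: is_derive_line_at; apply: derivableP.
have cg : continuous g.
  by move=> t; apply: differentiable_continuous; apply/derivable1_diffP; case: (dg t).
have [c0|c0] := leP 0 c.
  have [t] := MVT_segment c0 (fun t _ => dg t) (continuous_subspaceT cg).
  rewrite in_itv /= => /andP[t0 tc]; rewrite /g scale0r addr0 subr0 mulrC => ->.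
  by exists t => //; rewrite !ger0_norm.
have [t] := MVT_segment (ltW c0) (fun t _ => dg t) (continuous_subspaceT cg).
rewrite in_itv /= => /andP[t0 tc]; rewrite /g scale0r addr0 sub0r mulrN mulrC => H.
exists t; first by rewrite !ler0_norm ?lerN2// ltW.
by rewrite -opprB H opprK.
Qed.

Definition C1 f := forall i : 'I_N,
  continuous (partial i f) /\ forall x, derivable f x (e_ i).

Lemma gradientE f x i : gradient f x ord0 i = partial i f x.
Proof. by rewrite mxE. Qed.

Lemma C1_taylor f x (eps : R) : C1 f -> 0 < eps ->
  exists2 del : R, 0 < del & forall h : 'rV[R]_N, \sum_i `|h ord0 i| < del ->
  `|f (x + h) - f x - dot (gradient f x) h| <= eps * \sum_i `|h ord0 i|.
Proof.
move=> cf e0.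
have : \forall y \near x, forall i : 'I_N, `|partial i f y - partial i f x| < eps.
  apply: (@filter_forall _ _ (fun i y => `|partial i f y - partial i f x| < eps)
    (nbhs x) _) => i; have [c _] := cf i.
  by have /cvgrPdist_lt/(_ _ e0) := c x; under eq_near do rewrite distrC.
move=> /nbhs_ballP[del /= d0 H]; exists del => // h hd.
have key (s : seq 'I_N) : \sum_(i <- s) `|h ord0 i| < del ->
    `|f (x + \sum_(i <- s) h ord0 i *: e_ i) - f x -
      \sum_(i <- s) partial i f x * h ord0 i| <= eps * \sum_(i <- s) `|h ord0 i|.
  elim: s => [|i s IH]; first by rewrite !big_nil addr0 !subrr normr0 mulr0.
  rewrite !big_cons => ltd.
  have /IH : \sum_(j <- s) `|h ord0 j| < del by apply: le_lt_trans ltd; rewrite lerDr.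
  move=> {IH}; set z := \sum_(j <- s) _ *: _.
  set S := \sum_(j <- s) partial j f x * _; set A := \sum_(j <- s) `|_| => IH.
  have [t tc E] := MVT_line (x + z) (h ord0 i) (cf i).2.
  have -> : f (x + (h ord0 i *: e_ i + z)) - f x - (partial i f x * h ord0 i + S) =
      (f (x + z) - f x - S) +
      h ord0 i * ('D_(e_ i) f (x + z + t *: e_ i) - partial i f x).
    by rewrite mulrBr -E (addrC _ z) addrA; ring.
  rewrite (le_trans (ler_normD _ _))// [leRHS]mulrDr [leLHS]addrC lerD// normrM mulrC.
  rewrite ler_wpM2r// ltW//; apply: H => /=; rewrite -ball_normE /=.
  rewrite -addrA opprD addrA subrr sub0r normrN.
  apply: le_lt_trans ltd; rewrite addrC (le_trans (ler_normD _ _))// lerD//.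
    rewrite normrZ (le_trans _ tc)// ler_piMr//.
    rewrite [leLHS]/Num.norm /= mx_normrE; apply/bigmax_leP; split => //= k _.
    by rewrite mxE; case: (_ && _); rewrite ?normr1 ?normr0.
  rewrite /z /A; apply: (big_ind2 (fun (a : 'rV[R]_N) b => `|a| <= b)).
  - by rewrite normr0.
  - by move=> a1 b1 a2 b2 h1 h2; rewrite (le_trans (ler_normD _ _))// lerD.
  - move=> j _; rewrite normrZ ler_piMr//.
    rewrite [leLHS]/Num.norm /= mx_normrE; apply/bigmax_leP; split => //= k _.
    by rewrite mxE; case: (_ && _); rewrite ?normr1 ?normr0.
have := key (index_enum _) hd; rewrite -row_sum_delta.
by under [in X in X -> _]eq_bigr do rewrite -gradientE.
Qed.

Lemma C1_diff f x : C1 f ->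
  differentiable f x /\ 'd f x = (fun h => dot (gradient f x) h) :> (_ -> _).
Proof.
move=> cf; pose d h := dot (gradient f x) h.
have lin_d : linear d by move=> k u v; rewrite /d dotDr dotZr.
pose dM := GRing.isLinear.Build _ _ _ _ _ lin_d.
pose dL : {linear 'rV[R]_N -> R} := HB.pack d dM.
have cd : continuous dL by exact: continuous_dotr.
have H (eps : R) : 0 < eps ->
    \forall h \near (0 : 'rV[R]_N), `|f (h + x) - f x - d h| <= eps * `|h|.
  move=> e0; have e1 : 0 < eps / N.+1%:R by rewrite divr_gt0.
  have [del d0 Hd] := C1_taylor x cf e1.
  apply/nbhs_ballP; exists (del / N.+1%:R) => /=; first by rewrite divr_gt0.
  move=> h; rewrite -ball_normE /= sub0r normrN => hd.
  have sh : \sum_i `|h ord0 i| <= N.+1%:R * `|h|.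
    apply: (@le_trans _ _ (\sum_(i < N) `|h|)).
      by apply: ler_sum => i _; exact: coord_le_mxnorm.
    by rewrite sumr_const card_ord -[leLHS]mulr_natl ler_wpM2r// ler_nat.
  rewrite (addrC h) (le_trans (Hd h _))//.
    by rewrite (le_lt_trans sh)// mulrC -ltr_pdivlMr.
  rewrite (le_trans (ler_wpM2l (ltW e1) sh))// mulrA divfK ?pnatr_eq0//.
have E : 'd f x = dL :> (_ -> _).
  apply: diff_unique => //; apply/eqaddoP => eps e0.
  by apply: filterS (H eps e0) => h; rewrite /= opprD addrA.
split => //; apply/diff_locallyP; rewrite E; split => //; apply/eqaddoP => eps e0.
by apply: filterS (H eps e0) => h; rewrite /= opprD addrA.
Qed.

Lemma C1_derive f x v : C1 f ->
  derivable f x v /\ 'D_v f x = dot (gradient f x) v.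
Proof.
move=> /(C1_diff x)[df E]; split; first exact: diff_derivable.
by rewrite deriveE// E.
Qed.

Lemma C1_is_derive f x v : C1 f -> is_derive x v f (dot (gradient f x) v).
Proof. by move=> /(C1_derive x v)[df E]; split. Qed.

Lemma C1_continuous f : C1 f -> continuous f.
Proof. by move=> cf x; apply: differentiable_continuous; have [] := C1_diff x cf. Qed.

Lemma is_derive_comp_line (h : R -> R) f x v (a b : R) :
  is_derive (f x) 1 h b -> is_derive x v f a ->
  is_derive x v (fun z => h (f z)) (b * a).
Proof.
move=> dh /is_derive_line df; apply/is_derive_line.
apply: (is_derive1_comp (f := h) (g := fun t : R => f (x + t *: v))).
by rewrite scale0r addr0.
Qed.

Fixpoint Ck (n : nat) f : Prop :=
  continuous f /\ if n is m.+1 then forall i : 'I_N,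
    (forall x, derivable f x (e_ i)) /\ Ck m (partial i f) else True.

Lemma CkW n f : Ck n.+1 f -> Ck n f.
Proof.
elim: n f => [f []//|n IH f [cf H]]; split => // i.
by have [d c] := H i; split => //; exact: IH.
Qed.

Lemma Ck_continuous n f : Ck n f -> continuous f. Proof. by case: n => [|n] []. Qed.

Lemma Ck_C1 n f : Ck n.+1 f -> C1 f.
Proof. by move=> [_ H] i; have [d c] := H i; split => //; exact: Ck_continuous c. Qed.

Lemma smooth_Ck f : smooth f <-> forall n, Ck n f.
Proof.
have foldrr s i g : foldr partial g (rcons s i) = foldr partial (partial i g) s.
  by elim: s => //= j s ->.
split=> [sf n|].
  elim: n f sf => [f sf|n IH f sf]; first by split => //; exact: (sf [::]).1.
  split; first exact: (sf [::]).1.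
  move=> i; split; first exact: (sf [::]).2.
  by apply: IH => s; rewrite -foldrr; exact: sf.
move=> H s; elim/last_ind: s f H => [|s i IH] f H /=.
  by split; [exact: Ck_continuous (H 0%N)|have [_ Hi] := H 1%N => i; exact: (Hi i).1].
by rewrite foldrr; apply: IH => n; have [_ Hi] := H n.+1; exact: (Hi i).2.
Qed.

Lemma smooth_C1 f : smooth f -> C1 f.
Proof. by move=> /smooth_Ck/(_ 1%N); exact: Ck_C1. Qed.

Lemma smooth_partial f i : smooth f -> smooth (partial i f).
Proof. by move=> /smooth_Ck H; apply/smooth_Ck => n; have [_ Hi] := H n.+1; exact: (Hi i).2. Qed.

Lemma Ck_cst n (c : R) : Ck n (fun=> c).
Proof.
elim: n c => [c|n IH c]; split => //; try exact: cont_cst.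
move=> i; split => [x|]; first exact: derivable_cst.
rewrite (_ : partial i _ = fun=> 0)//.
by apply/funext => x; rewrite /partial derive_cst.
Qed.

Lemma CkD n f g : Ck n f -> Ck n g -> Ck n (fun x => f x + g x).
Proof.
elim: n f g => [f g [cf _] [cg _]|n IH f g [cf Hf] [cg Hg]]; split => //;
  try exact: contD.
move=> i; have [df pf] := Hf i; have [dg pg] := Hg i; split => [x|].
  exact: derivableD.
rewrite (_ : partial i _ = fun x => partial i f x + partial i g x); first exact: IH.
by apply/funext => x; rewrite /partial deriveD.
Qed.

Lemma Ck_sum n (I : Type) (s : seq I) (F : I -> 'rV[R]_N -> R) :
  (forall i, Ck n (F i)) -> Ck n (fun x => \sum_(i <- s) F i x).
Proof.
move=> cF; elim: s => [|i s IH].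
  rewrite (_ : (fun x => _) = fun=> 0); first exact: Ck_cst.
  by apply/funext => x; rewrite big_nil.
rewrite (_ : (fun x => _) = fun x => F i x + \sum_(j <- s) F j x); first exact: CkD.
by apply/funext => x; rewrite big_cons.
Qed.

Lemma CkM n f g : Ck n f -> Ck n g -> Ck n (fun x => f x * g x).
Proof.
elim: n f g => [|n IH] f g Hf Hg; split => //;
  try (by apply: contM; apply: Ck_continuous; eassumption).
move=> i; have [cf /(_ i)[df pf]] := Hf; have [cg /(_ i)[dg pg]] := Hg.
split => [x|]; first exact: derivableM.
rewrite (_ : partial i _ = fun x => f x * partial i g x + g x * partial i f x).
  by apply: CkD; apply: IH => //; exact: CkW.
by apply/funext => x; rewrite /partial deriveM.
Qed.

Lemma Ck_comp n (D : set R) (H : nat -> R -> R) f :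
  (forall k t, D t -> is_derive t 1 (H k) (H k.+1 t)) ->
  (forall x, D (f x)) -> Ck n f -> forall k, Ck n (fun x => H k (f x)).
Proof.
move=> dH Df; elim: n => [|n IH] cf k; (split; last try by []).
- move=> x; apply: continuous_comp; first exact: (Ck_continuous cf).
  apply: differentiable_continuous; apply/derivable1_diffP.
  by case: (dH k _ (Df x)).
- move=> x; apply: continuous_comp; first exact: (Ck_continuous cf).
  apply: differentiable_continuous; apply/derivable1_diffP.
  by case: (dH k _ (Df x)).
- move=> i; have [_ /(_ i)[df pf]] := cf.
  have dE x : is_derive x (e_ i) (fun x => H k (f x)) (H k.+1 (f x) * partial i f x).
    apply: (is_derive_comp_line (h := H k)); first exact: dH.
    exact: derivableP.
  split => [x|]; first by case: (dE x).
  rewrite (_ : partial i _ = fun x => H k.+1 (f x) * partial i f x).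
    by apply: CkM => //; apply: IH; exact: CkW.
  by apply/funext => x; rewrite /partial derive_val.
Qed.

Lemma Ck_powR n f (p : R) : (forall x, 0 < f x) -> Ck n f ->
  Ck n (fun x => f x `^ p).
Proof.
move=> f0 cf; pose H k t : R := (\prod_(j < k) (p - j%:R)) * t `^ (p - k%:R).
have := @Ck_comp n [set t | 0 < t] H f _ f0 cf 0%N.
rewrite (_ : (fun x => H _ _) = fun x => f x `^ p); last first.
  by apply/funext => x; rewrite /H big_ord0 mul1r subr0.
apply => k t /= t0; rewrite /H big_ord_recr /= -mulrA.
rewrite -natr1 opprD addrA.
have := is_deriveZ (f := fun t => t `^ (p - k%:R)) (\prod_(j < k) (p - j%:R))
  (is_derive1_powR (p - k%:R) t0).
by [].
Qed.

Lemma C1_affine f (L K : 'rV[R]_N -> 'rV[R]_N) : C1 f ->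
  (forall x v (t : R), L (x + t *: v) = L x + t *: K v) ->
  forall x v, is_derive x v (fun x => f (L x)) (dot (gradient f (L x)) (K v)).
Proof.
move=> cf HL x v; apply/is_derive_line.
rewrite (_ : (fun t => _) = (fun t : R => f (L x + t *: K v))); last first.
  by apply/funext => t; rewrite HL.
exact/is_derive_line/C1_is_derive.
Qed.

Lemma continuous_rV (L : 'rV[R]_N -> 'rV[R]_N) :
  (forall i, continuous (fun x => L x ord0 i)) -> continuous L.
Proof.
move=> cL x; apply: (@cvgrPdist_lt _ _ _ (nbhs x) _ L (L x)).2 => eps e0.
have : \forall y \near x, forall i, `|L x ord0 i - L y ord0 i| < eps / 2.
  apply: (@filter_forall _ _ (fun i y => `|L x ord0 i - L y ord0 i| < eps / 2)
    (nbhs x) _) => i; have /cvgrPdist_lt := cL i x; apply.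
  by rewrite divr_gt0.
apply: filterS => y H; rewrite [ltLHS]/Num.norm /= mx_normrE.
apply: (@le_lt_trans _ _ (eps / 2)); last by rewrite gtr_pMr// invf_lt1// ltr1n.
apply/bigmax_leP; split => [|k _]; first by rewrite ltW// divr_gt0.
by rewrite /= 2!mxE (ord1 k.1) ltW.
Qed.

Lemma continuous_affine f (L : 'rV[R]_N -> 'rV[R]_N) : continuous f ->
  (forall i, continuous (fun x => L x ord0 i)) -> continuous (fun x => f (L x)).
Proof.
move=> cf /continuous_rV cL x.
by apply: (@continuous_comp _ _ _ L f); [exact: cL|exact: cf].
Qed.

Lemma Ck_affine n f (L K : 'rV[R]_N -> 'rV[R]_N) :
  (forall i, continuous (fun x => L x ord0 i)) ->
  (forall x v (t : R), L (x + t *: v) = L x + t *: K v) ->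
  Ck n f -> Ck n (fun x => f (L x)).
Proof.
move=> cL HL; elim: n f => [|n IH] f cf; (split; last try by []);
  try exact: (continuous_affine (Ck_continuous cf) cL).
move=> i; have dE x := C1_affine (Ck_C1 cf) HL x (e_ i).
split => [x|]; first by case: (dE x).
rewrite (_ : partial i _ =
    fun x => \sum_(j < N) (fun x => partial j f (L x)) x * (K (e_ i)) ord0 j).
  apply: Ck_sum => j; apply: CkM; last exact: Ck_cst.
  by apply: IH; have [_ /(_ j)[]] := cf.
apply/funext => x; rewrite /partial derive_val.
by apply: eq_bigr => j _; rewrite gradientE.
Qed.

End calculus.

Section compact_support.
Context {R : realType} {N : nat}.
Implicit Types (f g : 'rV[R]_N -> R) (x y z v : 'rV[R]_N).
Local Notation e_ i := (delta_mx ord0 i : 'rV[R]_N).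
Local Notation mu := (lebesgue_rV R N).

Definition csupp (s : R) f := forall x, s <= enorm x -> f x = 0.

Lemma csuppW (s t : R) f : s <= t -> csupp s f -> csupp t f.
Proof. by move=> st sf x tx; apply: sf; exact: le_trans tx. Qed.

Lemma mxnorm_le_enorm x : `|x| <= enorm x.
Proof.
rewrite [leLHS]/Num.norm /= mx_normrE; apply/bigmax_leP; split => [|k _].
  exact: enorm_ge0.
by rewrite (ord1 k.1); exact: coord_le_enorm.
Qed.

Lemma closed_enorm_le (s : R) : closed [set x : 'rV[R]_N | enorm x <= s].
Proof.
rewrite (_ : [set _ | _] = ~` (@enorm R N @^-1` [set t | s < t])).
  apply: open_closedC; apply: open_comp; last exact: open_gt.
  by move=> x _; exact: continuous_enorm.
by apply/seteqP; split => x /=; [move=> xs; apply/negP; rewrite -leNgt|move/negP; rewrite -leNgt].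
Qed.

Lemma compact_enorm_le (s : R) : compact [set x : 'rV[R]_N | enorm x <= s].
Proof.
apply: bounded_closed_compact; last exact: closed_enorm_le.
exists s; split; first exact: num_real.
move=> t st x /= xs; rewrite (le_trans (mxnorm_le_enorm x))//.
by rewrite (le_trans xs)// ltW.
Qed.

Lemma Cc_smooth_eball (r : R) f :
  Cc_smooth (eball r) f <-> smooth f /\ exists2 s, s < r & csupp s f.
Proof.
split=> [[sf cf fr]|[sf [s sr fs]]].
  split => //; have [K0|/set0P K0] := eqVneq (closed_support f) set0.
    exists (r - 1); first by rewrite gtrBl.
    move=> x _; apply/eqP/negPn/negP => fx.
    have : closed_support f x by apply: subset_closure.
    by rewrite K0.
  have cn : {within closed_support f, continuous (@enorm R N)}.
    by apply: continuous_subspaceT; exact: continuous_enorm.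
  have [c cK H] := compact_EVT_max K0 cf cn.
  have cr : enorm c < r by apply: fr; exact: set_mem.
  exists ((enorm c + r) / 2); first by lra.
  move=> x sx; apply/eqP/negPn/negP => fx.
  have /H : x \in closed_support f by apply/mem_set; apply: subset_closure.
  by lra.
have sub : closed_support f `<=` [set x | enorm x <= s].
  rewrite [X in _ `<=` X](closure_id _).1; last exact: closed_enorm_le.
  apply: closure_subset => x /= fx; rewrite leNgt; apply/negP => sx.
  by move: fx; rewrite fs ?eqxx// ltW.
split => //; last by move=> x /sub /= xs; exact: le_lt_trans sr.
apply: subclosed_compact sub; last exact: compact_enorm_le.
exact: closed_closure.
Qed.

Lemma csupp_bounded (s : R) f : continuous f -> csupp s f ->
  exists2 M : R, 0 <= M & forall x, `|f x| <= M.
Proof.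
move=> cf fs; have [s0|s0] := ltP s 0.
  exists 0 => // x; rewrite fs ?normr0//.
  exact: le_trans (ltW s0) (enorm_ge0 _).
have cn : {within [set x : 'rV[R]_N | enorm x <= s], continuous (fun x => `|f x|)}.
  by apply: continuous_subspaceT; exact: cont_norm.
have A0 : [set x : 'rV[R]_N | enorm x <= s] !=set0 by exists 0; rewrite /= enorm0.
have [c _ H] := compact_EVT_max A0 (@compact_enorm_le s) cn.
exists `|f c| => // x; have [xs|/ltW xs] := leP (enorm x) s.
  by apply: H; exact/mem_set.
by rewrite fs// normr0.
Qed.

Lemma csupp_partial (s t : R) f i : s < t -> csupp s f -> csupp t (partial i f).
Proof.
move=> st fs x tx; rewrite /partial -[RHS](derive_cst 0 x (e_ i)).
apply: near_eq_derive.
have : open [set y : 'rV[R]_N | s < enorm y].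
  rewrite (_ : [set _ | _] = @enorm R N @^-1` [set u | s < u])//.
  apply: open_comp; last exact: open_gt.
  by move=> y _; exact: continuous_enorm.
move=> oS; have : nbhs x [set y : 'rV[R]_N | s < enorm y].
  by apply: open_nbhs_nbhs; split => //=; exact: lt_le_trans tx.
by apply: filterS => y /= sy; rewrite fs// ltW.
Qed.

Lemma csupp_gradient (s t : R) f x : s < t -> csupp s f -> t <= enorm x ->
  gradient f x = 0.
Proof. by move=> st fs tx; apply/rowP => i; rewrite !mxE (csupp_partial i st fs). Qed.

Lemma gradient_bounded (s : R) f : C1 f -> csupp s f ->
  exists2 M : R, 0 <= M & forall x, enorm (gradient f x) <= M.
Proof.
move=> cf fs.
have H i : exists M, 0 <= M /\ forall x, `|partial i f x| <= M.
  have s1 : s < s + 1 by rewrite ltrDl.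
  have [M M0 HM] := csupp_bounded (cf i).1 (csupp_partial i s1 fs).
  by exists M.
have [M HM] := choice H.
exists (\sum_i M i); first by apply: sumr_ge0 => i _; exact: (HM i).1.
move=> x; rewrite (le_trans (enorm_le_sum _))//; apply: ler_sum => i _.
by rewrite gradientE; exact: (HM i).2.
Qed.

Lemma normr_dot_le x y : `|dot x y| <= enorm x * enorm y.
Proof.
rewrite ler_norml dot_le_enorm andbT lerNl -dotNl (le_trans (dot_le_enorm _ _))//.
by rewrite enormN.
Qed.

Lemma C1_lipschitz (M : R) f : C1 f -> (forall x, enorm (gradient f x) <= M) ->
  forall x y, `|f y - f x| <= M * enorm (y - x).
Proof.
move=> cf HM x y.
have [t _] := @MVT_line _ _ f x (y - x) 1 (fun z => (C1_derive z _ cf).1).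
rewrite scale1r (addrC x) subrK mul1r => ->; rewrite (C1_derive _ _ cf).2.
by rewrite (le_trans (normr_dot_le _ _))// ler_wpM2r// enorm_ge0.
Qed.

Lemma C1_measurable f : C1 f -> measurable_fun setT f.
Proof. by move=> cf; apply: continuous_measurable_rV; exact: C1_continuous. Qed.

Lemma measurable_gradient f : C1 f -> measurable_fun setT (gradient f).
Proof.
move=> cf; apply: measurable_fun_rVP => i; under eq_fun do rewrite gradientE.
exact: continuous_measurable_rV (cf i).1.
Qed.

Lemma int_le_ball f (M s : R) : measurable_fun setT f ->
  (forall x, 0 <= f x) -> (forall x, f x <= M) -> csupp s f ->
  (\int[mu]_x (f x)%:E <= M%:E * mu (eball s))%E.
Proof.
move=> mf f0 fM fs.
have M0 : 0 <= M by exact: le_trans (f0 0) (fM 0).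
have mI : measurable_fun setT (\1_(eball s) : 'rV[R]_N -> R).
  by apply: measurable_indic; exact: measurable_eball.
rewrite (@measure_indic _ _ _ mu _ (@measurable_eball R N s)).
rewrite -int_scale//; apply: le_int => //; first exact: measurable_funM.
move=> x; rewrite indicE; have [xs|/negP xs] := boolP (x \in eball s).
  by rewrite mulr1.
by rewrite mulr0 fs// leNgt; apply/negP => H; apply: xs; exact/mem_set.
Qed.

Lemma int_lty f (M s : R) : measurable_fun setT f ->
  (forall x, 0 <= f x) -> (forall x, f x <= M) -> csupp s f ->
  (\int[mu]_x (f x)%:E < +oo)%E.
Proof.
move=> mf f0 fM fs; rewrite (le_lt_trans (int_le_ball mf f0 fM fs))//.
by rewrite lte_mul_pinfty ?lee_fin ?lebesgue_eball_lty// (le_trans (f0 0)).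
Qed.

Lemma integrable_csupp f (M s : R) : measurable_fun setT f ->
  (forall x, `|f x| <= M) -> csupp s f -> mu.-integrable setT (EFin \o f).
Proof.
move=> mf fM fs; apply/integrableP; split; first exact/measurable_EFinP.
apply: (@int_lty (fun x => `|f x|) M s) => //; first exact: measurableT_comp.
by move=> x sx; rewrite fs// normr0.
Qed.

Lemma integral_translate_signed f z : measurable_fun setT f ->
  (\int[mu]_x (f (x + z))%:E = \int[mu]_x (f x)%:E)%E.
Proof.
move=> mf; have mE : measurable_fun setT (EFin \o f) by exact/measurable_EFinP.
rewrite integralE [RHS]integralE; congr (_ - _)%E.
  rewrite -[RHS](@integral_translate R N ((EFin \o f)^\+)%E z)//; last exact: measurable_funepos.
  by apply: eq_integral => x _; rewrite !funeposE.
rewrite -[RHS](@integral_translate R N ((EFin \o f)^\-)%E z)//; last exact: measurable_funeneg.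
by apply: eq_integral => x _; rewrite !funenegE.
Qed.

Lemma integral_partial0 f (s : R) i : C1 f -> csupp s f ->
  (\int[mu]_x (partial i f x)%:E = 0)%E.
Proof.
move=> cf fs; have mf := C1_measurable cf.
have [M M0 HM] := gradient_bounded cf fs.
have [M' M'0 HM'] := csupp_bounded (C1_continuous cf) fs.
pose h (k : nat) : R := k.+1%:R^-1.
have h0 k : 0 < h k by rewrite invr_gt0.
have h1 k : h k <= 1 by rewrite invf_le1// ler1n.
have e1 : enorm (e_ i) = 1 by rewrite enormE dot_delta mxE !eqxx sqrtr1.
pose D k x := (h k)^-1 * (f (x + h k *: e_ i) - f x).
have mS k : measurable_fun setT (fun x => f (x + h k *: e_ i)).
  apply: measurableT_comp => //; apply: measurable_fun_rVP => j.
  under eq_fun do rewrite mxE.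
  by apply: measurable_funD => //; exact: measurable_coord.
have mD k : measurable_fun setT (D k).
  by apply: measurable_funM => //; exact: measurable_funB.
have sS k : csupp (s + 1) (fun x => f (x + h k *: e_ i)).
  move=> x sx; apply: fs.
  have := ler_enormB (x + h k *: e_ i) (h k *: e_ i).
  by rewrite addrK enormZ e1 mulr1 gtr0_norm//; have := h1 k; lra.
have D0 k : (\int[mu]_x (D k x)%:E = 0)%E.
  have I1 : mu.-integrable setT (EFin \o (fun x => f (x + h k *: e_ i))).
    exact: integrable_csupp (mS k) _ (sS k).
  have I2 : mu.-integrable setT (EFin \o f) by exact: integrable_csupp mf _ fs.
  under eq_integral do rewrite EFinM.
  rewrite integralZl//; last first.
    have := integrableB measurableT I1 I2; apply: eq_integrable => //.
  under eq_integral do rewrite EFinB.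
  rewrite integralB// integral_translate_signed// subee ?mule0//.
  exact: integrable_fin_num.
have Dlim x : D k x @[k --> \oo] --> partial i f x.
  have [d _] := C1_derive x (e_ i) cf.
  have hc : h k @[k --> \oo] --> (0 : R) by exact: cvg_harmonic.
  have /cvg_ex[l Hl] := d.
  have El : partial i f x = l by rewrite /partial /derive; apply/cvg_lim.
  rewrite El; move/cvgr_dnbhsP : Hl.
  move=> /(_ h) H; have {}H := H (conj (fun k => lt0r_neq0 (h0 k)) hc).
  by under eq_fun do rewrite /D (addrC x); exact: H.
have mP : measurable_fun setT (partial i f).
  exact: continuous_measurable_rV (cf i).1.
have H1 k : measurable_fun setT (fun x => (D k x)%:E) by exact/measurable_EFinP.
have H2 : measurable_fun setT (fun x => (partial i f x)%:E) by exact/measurable_EFinP.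
have H3 : {ae mu, forall x, setT x ->
    (fun k => (D k x)%:E) @ \oo --> (partial i f x)%:E}.
  by apply: aeW => x _; apply: cvg_EFin; [exact: nearW|exact: Dlim].
have H4 : mu.-integrable setT (fun x => (M * \1_(eball (s + 1)) x)%:E).
  apply: (@integrable_csupp _ M (s + 1)).
  - by apply: measurable_funM => //; apply: measurable_indic; exact: measurable_eball.
  - move=> x; rewrite indicE normrM (ger0_norm M0) ler_piMr//.
    by case: (_ \in _); rewrite ?normr1 ?normr0.
  - move=> x sx; rewrite indicE memNset ?mulr0//= => H.
    by have := lt_le_trans H sx; rewrite ltxx.
have H5 : {ae mu, forall x k, setT x ->
    (`|(D k x)%:E| <= (M * \1_(eball (s + 1)) x)%:E)%E}.
  apply: aeW => x k _; rewrite /= lee_fin indicE.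
  have [xs|xs] := ltP (enorm x) (s + 1).
    rewrite mem_set// mulr1 /D normrM gtr0_norm ?invr_gt0// ler_pdivrMl//.
    rewrite (le_trans (C1_lipschitz cf HM _ _))// (addrC x) addrK enormZ e1 mulr1.
    by rewrite gtr0_norm// mulrC.
  rewrite memNset ?mulr0; last by move=> /= /lt_le_trans/(_ xs); rewrite ltxx.
  by rewrite /D sS// fs ?subrr ?mulr0 ?normr0//; lra.
have [_ _] := dominated_convergence measurableT H1 H2 H3 H4 H5.
rewrite (_ : [sequence _]_n = cst 0%E); last by apply/funext => k /=; rewrite D0.
by move=> /cvg_unique; apply => //; exact: cvg_cst.
Qed.

End compact_support.

Section elementary.
Context {R : realType}.
Implicit Types (a b : R).

Lemma exprD1_le n (t : R) : 0 <= t <= 1 -> (1 + t) ^+ n <= 1 + (2 ^+ n - 1) * t.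
Proof.
move=> /andP[t0 t1]; elim: n => [|n IH]; first by rewrite !expr0 subrr mul0r addr0.
rewrite exprS (@le_trans _ _ ((1 + t) * (1 + (2 ^+ n - 1) * t)))//.
  by rewrite ler_wpM2l// addr_ge0.
have : 0 <= (2 ^+ n - 1) * (t * (1 - t)).
  rewrite mulr_ge0 ?mulr_ge0 ?subr_ge0//.
  by rewrite exprn_ege1// ler1n.
by rewrite exprS; set k := 2 ^+ n; lra.
Qed.

Lemma exprD_le n (eps : R) : 0 < eps -> exists2 C : R, 0 < C &
  forall a b, 0 <= a -> 0 <= b -> (a + b) ^+ n <= (1 + eps) * a ^+ n + C * b ^+ n.
Proof.
move=> e0; pose d := Num.min 1 (eps / 2 ^+ n).
have d0 : 0 < d by rewrite lt_min ltr01 divr_gt0// exprn_gt0.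
have d1 : d <= 1 by rewrite ge_min lexx.
have dn : (1 + d) ^+ n <= 1 + eps.
  have d01 : 0 <= d <= 1 by rewrite (ltW d0).
  rewrite (le_trans (exprD1_le n d01))// lerD2l.
  have : d <= eps / 2 ^+ n by rewrite ge_min lexx orbT.
  rewrite ler_pdivlMr ?exprn_gt0// mulrBl mul1r mulrC => H.
  by rewrite lerBlDr (le_trans H)// lerDl ltW.
exists ((d^-1 + 1) ^+ n); first by rewrite exprn_gt0// addr_gt0// invr_gt0.
move=> a b a0 b0; have [bd|bd] := leP b (d * a).
  have ab : a + b <= (1 + d) * a by lra.
  apply: (@le_trans _ _ ((1 + d) ^+ n * a ^+ n)).
    rewrite -exprMn; apply: lerXn2r => //; rewrite nnegrE ?addr_ge0//.
    by rewrite (le_trans _ ab) ?addr_ge0.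
  apply: (@le_trans _ _ ((1 + eps) * a ^+ n)).
    by rewrite ler_wpM2r// exprn_ge0.
  by rewrite lerDl mulr_ge0 ?exprn_ge0// addr_ge0// invr_ge0 ltW.
have ab : a + b <= (d^-1 + 1) * b.
  by rewrite mulrDl mul1r lerD2r ler_pdivlMl// ltW.
apply: (@le_trans _ _ ((d^-1 + 1) ^+ n * b ^+ n)).
  rewrite -exprMn; apply: lerXn2r => //; rewrite nnegrE ?addr_ge0//.
  by rewrite (le_trans _ ab) ?addr_ge0.
by rewrite lerDr mulr_ge0 ?exprn_ge0// addr_ge0// ltW.
Qed.

Lemma exprB_tangent n a b : 0 <= a -> 0 <= b ->
  a ^+ n.+1 - b ^+ n.+1 <= n.+1%:R * a ^+ n * (a - b).
Proof.
move=> a0 b0; elim: n => [|n IH]; first by rewrite !expr1 expr0 !mul1r.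
have H : 0 <= (a ^+ n.+1 - b ^+ n.+1) * (a - b).
  have [ab|/ltW ab] := leP a b.
    by rewrite mulr_le0// subr_le0// lerXn2r.
  by rewrite mulr_ge0// subr_ge0// lerXn2r.
have := ler_wpM2l a0 IH; rewrite -(natr1 n.+1) !(exprS _ n.+1) => {}IH.
rewrite [in leLHS](_ : a * a ^+ n.+1 - b * b ^+ n.+1 =
   a * (a ^+ n.+1 - b ^+ n.+1) + b ^+ n.+1 * (a - b)); last by ring.
rewrite (le_trans (lerD IH (lexx _)))// -subr_ge0.
rewrite (_ : _ - _ = (a ^+ n.+1 - b ^+ n.+1) * (a - b))//.
by rewrite !exprS; ring.
Qed.

Lemma young_expr n a b : 0 <= a -> 0 <= b ->
  n.+1%:R * a ^+ n * b <= n%:R * a ^+ n.+1 + b ^+ n.+1.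
Proof.
move=> a0 b0; have := exprB_tangent n a0 b0.
rewrite (_ : _ * (a - b) = n.+1%:R * a ^+ n.+1 - n.+1%:R * a ^+ n * b); last first.
  by rewrite exprSr; ring.
by rewrite -(natr1 n) !mulrDl !mul1r; lra.
Qed.

Lemma norm_le_expr n (eps a : R) : 0 < eps -> 0 <= a ->
  a <= eps + eps ^- n * a ^+ n.+1.
Proof.
move=> e0 a0; have [ae|ae] := leP a eps.
  by rewrite (le_trans ae)// lerDl mulr_ge0 ?exprn_ge0// invr_ge0 exprn_ge0// ltW.
rewrite (@le_trans _ _ (eps ^- n * a ^+ n.+1))//; last by rewrite lerDr ltW.
rewrite mulrC ler_pdivlMr ?exprn_gt0// exprS ler_wpM2l//.
by rewrite lerXn2r ?nnegrE// ltW.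
Qed.

End elementary.

Section small_sequences.
Context {R : realType}.
Implicit Types F G : nat -> \bar R.
Local Open Scope ereal_scope.

Definition small F := forall eps : R, (0 < eps)%R ->
  exists K, forall k, (K <= k)%N -> F k <= eps%:E.

Lemma cvg0_small F : F @ \oo --> 0 -> small F.
Proof.
move=> /fine_cvgP[fF cF] eps e0.
have /cvgrPdist_lt/(_ _ e0) cF' := cF.
have [K _ H] := filterI fF cF'; exists K => k Kk.
have [fk /=] := H k Kk; rewrite sub0r normrN => /ltW He.
by rewrite -(fineK fk) lee_fin (le_trans (ler_norm _)).
Qed.

Lemma small_le F G : (forall k, F k <= G k) -> small G -> small F.
Proof.
by move=> FG sG e /sG[K HK]; exists K => k /HK; apply: le_trans.
Qed.

Lemma smallD F G : small F -> small G -> small (fun k => F k + G k).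
Proof.
move=> sF sG e e0; have e2 : (0 < e / 2)%R by rewrite divr_gt0.
have [K HK] := sF _ e2; have [L HL] := sG _ e2.
exists (maxn K L) => k; rewrite geq_max => /andP[Kk Lk].
by rewrite (splitr e) EFinD leeD ?HK ?HL.
Qed.

Lemma smallZ (c : R) F : (0 <= c)%R -> (forall k, 0 <= F k) ->
  small F -> small (fun k => c%:E * F k).
Proof.
move=> c0 F0 sF e e0; have e2 : (0 < e / (c + 1))%R by rewrite divr_gt0// ltr_wpDl.
have [K HK] := sF _ e2; exists K => k /HK H.
apply: (@le_trans _ _ (c%:E * (e / (c + 1))%:E)); first exact: lee_wpmul2l.
rewrite -EFinM lee_fin mulrCA ger_pMr// ler_pdivrMr ?ltr_wpDl// mul1r.
by rewrite lerDl.
Qed.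

Lemma small_const (x : \bar R) : small (fun=> x) -> x <= 0.
Proof.
move=> sx; apply/lee_addgt0Pr => e e0; rewrite add0e.
by have [K HK] := sx e e0; exact: HK (leqnn K).
Qed.

End small_sequences.

Section sobolev.
Context {R : realType} {N : nat}.
Implicit Types (f u : 'rV[R]_N -> R) (x y z v : 'rV[R]_N).
Local Notation mu := (lebesgue_rV R N).
Variable r : R.

Definition tame f := smooth f /\ exists2 s, s < r & csupp s f.

Lemma tame_C1 f : tame f -> C1 f. Proof. by move=> [/smooth_C1]. Qed.

Lemma tame_csupp f : tame f -> csupp r f.
Proof. by move=> [_ [s sr fs]]; apply: csuppW fs; exact: ltW. Qed.

Lemma tame_gradient0 f x : tame f -> r <= enorm x -> gradient f x = 0.
Proof. by move=> [_ [s sr fs]]; exact: csupp_gradient fs. Qed.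

Lemma tame_bounded f : tame f -> exists2 M : R, 0 <= M & forall x, `|f x| <= M.
Proof.
by move=> tf; apply: csupp_bounded (tame_csupp tf); exact/C1_continuous/tame_C1.
Qed.

Lemma tame_gradient_bounded f : tame f ->
  exists2 M : R, 0 <= M & forall x, enorm (gradient f x) <= M.
Proof. by move=> tf; apply: gradient_bounded (tame_csupp tf); exact: tame_C1. Qed.

Lemma smoothB f (g : 'rV[R]_N -> R) : smooth f -> smooth g -> smooth (fun x => f x - g x).
Proof.
move=> /smooth_Ck sf /smooth_Ck sg; apply/smooth_Ck => n.
rewrite (_ : (fun x => _) = fun x => f x + (-1) * g x); last first.
  by apply/funext => x; rewrite mulN1r.
by apply: CkD => //; apply: CkM => //; exact: Ck_cst.
Qed.

Lemma tameB f (g : 'rV[R]_N -> R) : tame f -> tame g -> tame (fun x => f x - g x).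
Proof.
move=> [sf [s sr fs]] [sg [t tr gt]]; split; first exact: smoothB.
exists (Num.max s t); first by rewrite gt_max sr.
by move=> x; rewrite ge_max => /andP[sx tx]; rewrite fs// gt// subrr.
Qed.

Lemma gradientB f (g : 'rV[R]_N -> R) x : C1 f -> C1 g ->
  gradient (fun x => f x - g x) x = gradient f x - gradient g x.
Proof.
move=> cf cg; apply/rowP => i; rewrite !mxE /partial.
by apply: deriveB; [exact: (cf i).2|exact: (cg i).2].
Qed.

Record approxW u (g : 'rV[R]_N -> 'rV[R]_N) (phi : nat -> 'rV[R]_N -> R) : Prop := {
  approxW_mu : measurable_fun setT u;
  approxW_mg : measurable_fun setT g;
  approxW_u0 : csupp r u;
  approxW_g0 : forall x, r <= enorm x -> g x = 0;
  approxW_tame : forall k, tame (phi k);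
  approxW_u : small (fun k => \int[mu]_x (`|phi k x - u x| ^+ N)%:E)%E;
  approxW_g : small (fun k =>
    \int[mu]_x (enorm (gradient (phi k) x - g x) ^+ N)%:E)%E }.

Lemma W01N_approx u g : (0 < N)%N -> W01N_gradient (eball r) u g ->
  exists phi, approxW (u \_ (eball r)) (g \_ (eball r)) phi.
Proof.
move=> N0 [mu_ mg [phi cphi [c1 c2]]]; exists phi.
have tphi k : tame (phi k) by apply/Cc_smooth_eball; exact: cphi.
have mB := @measurable_eball R N r.
have out x : r <= enorm x -> x \notin eball r.
  by move=> rx; apply/negP => /set_mem /= H; have := lt_le_trans H rx; rewrite ltxx.
have pat (T : pointedType) (h : 'rV[R]_N -> T) x : eball r x -> (h \_ (eball r)) x = h x.
  by move=> xB; rewrite patchE mem_set.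
have inn x : x \notin eball r -> r <= enorm x.
  by move=> xB; rewrite leNgt; apply/negP => H; move/negP: xB; apply; exact/mem_set.
have pt : (point : 'rV[R]_N) = 0 by apply/rowP => i; rewrite !mxE.
split => //.
- by apply/(measurable_restrictT _ mB).
- by apply/(measurable_restrictT _ mB).
- by move=> x /out xr; rewrite patchE (negbTE xr).
- by move=> x /out xr; rewrite patchE (negbTE xr) pt.
- apply: small_le (cvg0_small c1) => k.
  rewrite [leRHS]integral_mkcond le_eqVlt; apply/orP; left; apply/eqP.
  apply: eq_integral => x _.
  rewrite !patchE; case: ifPn => // xB.
  by rewrite (tame_csupp (tphi k) (inn _ xB)) subr0 normr0 expr0n gtn_eqF.
- apply: small_le (cvg0_small c2) => k.
  rewrite [leRHS]integral_mkcond le_eqVlt; apply/orP; left; apply/eqP.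
  apply: eq_integral => x _.
  rewrite !patchE; case: ifPn => // xB.
  by rewrite (tame_gradient0 (tphi k) (inn _ xB)) pt subr0 enorm0 expr0n gtn_eqF.
Qed.

Lemma measurable_enorm_comp d (T : measurableType d) (g : T -> 'rV[R]_N) :
  measurable_fun setT g -> measurable_fun setT (fun t => enorm (g t)).
Proof. by move=> mg; apply: measurableT_comp => //; exact: measurable_enorm. Qed.

Lemma measurable_rVB (g1 g2 : 'rV[R]_N -> 'rV[R]_N) :
  measurable_fun setT g1 -> measurable_fun setT g2 ->
  measurable_fun setT (fun x => g1 x - g2 x).
Proof.
move=> m1 m2; apply: measurable_fun_rVP => i.
rewrite (_ : (fun x => _) = fun x => g1 x ord0 i - g2 x ord0 i); last first.
  by apply/funext => x; rewrite !mxE.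
by apply: measurable_funB; apply: (measurableT_comp (measurable_coord i)).
Qed.

Lemma small_L1 (F : nat -> 'rV[R]_N -> R) : (0 < N)%N ->
  (forall k, measurable_fun setT (F k)) -> (forall k x, 0 <= F k x) ->
  (forall k, csupp r (F k)) ->
  small (fun k => \int[mu]_x (F k x ^+ N)%:E)%E ->
  small (fun k => \int[mu]_x (F k x)%:E)%E.
Proof.
move=> N0 mF F0 Fr sF e e0.
pose m := fine (mu (eball r)) + 1.
have m0 : 0 < m by rewrite ltr_wpDl ?fine_ge0// measure_ge0.
have d0 : 0 < e / 2 / m by rewrite !divr_gt0.
pose d := e / 2 / m.
have c0 : 0 <= d ^- N.-1 by rewrite invr_ge0 exprn_ge0// ltW.
have F0' k : (0 <= \int[mu]_x (F k x ^+ N)%:E)%E.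
  by apply: ge0_int => x; rewrite exprn_ge0.
have e2 : 0 < e / 2 by rewrite divr_gt0.
have [K HK] := smallZ c0 F0' sF e2.
exists K => k /HK; rewrite -int_scale//; last first.
- by move=> x; rewrite exprn_ge0.
- exact: measurable_funX.
move=> H.
have mI : measurable_fun setT (\1_(eball r) : 'rV[R]_N -> R).
  by apply: measurable_indic; exact: measurable_eball.
apply: (@le_trans _ _ (\int[mu]_x (d * \1_(eball r) x + d ^- N.-1 * F k x ^+ N)%:E)%E).
  apply: le_int => //.
    apply: measurable_funD; apply: measurable_funM => //.
    exact: measurable_funX.
  move=> x; have [xr|rx] := ltP (enorm x) r.
    rewrite indicE mem_set// mulr1.
    by rewrite -[in leRHS](prednK N0); exact: norm_le_expr.
  have i0 : 0 <= (\1_(eball r) x : R) by rewrite indicE.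
  rewrite (Fr _ _ rx); apply: addr_ge0; apply: mulr_ge0 => //; first exact: ltW.
rewrite int_add//; last 4 first.
- exact: measurable_funM.
- by apply: measurable_funM => //; exact: measurable_funX.
- by move=> x; rewrite mulr_ge0// ltW.
- by move=> x; rewrite mulr_ge0 ?exprn_ge0// invr_ge0 exprn_ge0// ltW.
rewrite (splitr e) EFinD leeD//.
rewrite int_scale//; last exact: ltW.
rewrite -(@measure_indic _ _ _ mu _ (@measurable_eball R N r)).
rewrite -[X in (_ * X)%E]fineK; last first.
  by rewrite ge0_fin_numE ?lebesgue_eball_lty// measure_ge0.
rewrite -EFinM lee_fin; apply: (@le_trans _ _ (e / 2 / m * fine (mu (eball r)))).
  by [].
by rewrite mulrAC ler_pdivrMr// ler_wpM2l ?ltW// ltrDl.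
Qed.


Lemma smooth_powR f (p : R) : (forall x, 0 < f x) -> smooth f ->
  smooth (fun x => f x `^ p).
Proof. by move=> f0 /smooth_Ck sf; apply/smooth_Ck => n; exact: Ck_powR. Qed.

Lemma smoothM f (g : 'rV[R]_N -> R) : smooth f -> smooth g ->
  smooth (fun x => f x * g x).
Proof.
by move=> /smooth_Ck sf /smooth_Ck sg; apply/smooth_Ck => n; exact: CkM.
Qed.

Lemma smoothD f (g : 'rV[R]_N -> R) : smooth f -> smooth g ->
  smooth (fun x => f x + g x).
Proof.
by move=> /smooth_Ck sf /smooth_Ck sg; apply/smooth_Ck => n; exact: CkD.
Qed.

Lemma smooth_cst (c : R) : smooth (fun _ : 'rV[R]_N => c).
Proof. by apply/smooth_Ck => n; exact: Ck_cst. Qed.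


End sobolev.

Section saturation.
Context {R : realType}.
Implicit Types s t : R.

Definition sat t := t * (1 + t ^+ 2) `^ (-1).
Definition tsat t := t * sat t.

Let q0 t : 0 < 1 + t ^+ 2. Proof. by rewrite ltr_wpDr ?sqr_ge0. Qed.

Lemma satE t : sat t = t / (1 + t ^+ 2).
Proof. by rewrite /sat powR_inv1// ltW. Qed.

Lemma norm_sat_le1 t : `|sat t| <= 1.
Proof.
rewrite satE normrM normfV (ger0_norm (ltW (q0 t))) ler_pdivrMr// mul1r.
have := sqr_ge0 (`|t| - 1); rewrite sqrrB1 real_normK ?num_real//.
have := normr_ge0 t; have := sqr_ge0 t; lra.
Qed.

Lemma tsatE t : tsat t = t ^+ 2 / (1 + t ^+ 2).
Proof. by rewrite /tsat satE mulrA expr2. Qed.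

Lemma tsat_ge0 t : 0 <= tsat t.
Proof. by rewrite tsatE divr_ge0 ?sqr_ge0// ltW. Qed.

Lemma tsat_le1 t : tsat t <= 1.
Proof. by rewrite tsatE ler_pdivrMr// mul1r lerDr. Qed.

Lemma tsat_eq0 t : tsat t = 0 -> t = 0.
Proof.
move=> /eqP; rewrite tsatE mulf_eq0 invr_eq0 (gt_eqF (q0 _)) orbF expf_eq0 /=.
by move/eqP.
Qed.

Lemma tsat_lipschitz s t : tsat s <= tsat t + `|s - t|.
Proof.
have E u : tsat u = 1 - (1 + u ^+ 2)^-1.
  by rewrite tsatE; field; rewrite gt_eqF.
rewrite !E -subr_ge0.
have -> : 1 - (1 + t ^+ 2)^-1 + `|s - t| - (1 - (1 + s ^+ 2)^-1) =
  (`|s - t| * ((1 + s ^+ 2) * (1 + t ^+ 2)) - (s ^+ 2 - t ^+ 2))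
    / ((1 + s ^+ 2) * (1 + t ^+ 2)).
  by field; rewrite !gt_eqF.
apply: divr_ge0; last by rewrite mulr_ge0 ?ltW.
rewrite subr_ge0 subr_sqr.
rewrite (le_trans (ler_norm _))// normrM ler_wpM2l//.
rewrite (le_trans (ler_normD _ _))//.
have := sqr_ge0 (`|s| - 1); have := sqr_ge0 (`|t| - 1).
rewrite !sqrrB1 !real_normK ?num_real//.
have := sqr_ge0 (s * t); rewrite exprMn.
have := sqr_ge0 s; have := sqr_ge0 t; lra.
Qed.

Lemma measurable_sat : measurable_fun setT sat.
Proof.
apply: measurable_funM => //; apply: (@measurableT_comp _ _ _ _ _ _ (fun u => u `^ (-1))).
  exact: measurable_powR.
by apply: measurable_funD => //; exact: measurable_funX.
Qed.

Lemma measurable_tsat : measurable_fun setT tsat.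
Proof. by apply: measurable_funM => //; exact: measurable_sat. Qed.

End saturation.

Section gradient_uniqueness.
Context {R : realType} {N : nat}.
Implicit Types (f u : 'rV[R]_N -> R) (x y z v : 'rV[R]_N).
Local Notation mu := (lebesgue_rV R N).
Variable r : R.
Local Notation tame := (@tame R N r).

Lemma partial_le_enorm f i (M : R) : (forall x, enorm (gradient f x) <= M) ->
  forall x, `|partial i f x| <= M.
Proof.
by move=> H x; rewrite -gradientE; apply: le_trans (H x); exact: coord_le_enorm.
Qed.

Lemma tame_partial0 f i x : tame f -> r <= enorm x -> partial i f x = 0.
Proof. by move=> tf rx; rewrite -gradientE (tame_gradient0 tf rx) mxE. Qed.

Lemma measurable_partial f i : C1 f -> measurable_fun setT (partial i f).
Proof. by move=> cf; exact: continuous_measurable_rV (cf i).1. Qed.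

Lemma measurable_normB d (T : measurableType d) (f1 f2 : T -> R) :
  measurable_fun setT f1 -> measurable_fun setT f2 ->
  measurable_fun setT (fun t => `|f1 t - f2 t|).
Proof. by move=> m1 m2; apply: measurableT_comp => //; exact: measurable_funB. Qed.

(* integration by parts of f' against the bounded field sat (partial i f) *)
Lemma int_tsat_partial f i : tame f -> exists2 C : R, 0 <= C & forall f', tame f' ->
  (\int[mu]_x (tsat (partial i f x))%:E <=
   \int[mu]_x (`|partial i f x - partial i f' x|)%:E + C%:E * \int[mu]_x (`|f' x|)%:E)%E.
Proof.
move=> tf; have cf := tame_C1 tf.
pose eta x := sat (partial i f x).
have seta : smooth eta.
  have sc : smooth (partial i f) by apply: smooth_partial; case: tf.
  apply: smoothM => //; apply: smooth_powR => [x|].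
    by rewrite ltr_wpDr ?sqr_ge0.
  by apply: smoothD; [exact: smooth_cst|exact: smoothM].
have ceta := smooth_C1 seta.
have eta0 : csupp r eta.
  by move=> x rx; rewrite /eta (tame_partial0 i tf rx) /sat mul0r.
have [C C0 HC] := gradient_bounded ceta eta0.
exists C => // f' tf'; have cf' := tame_C1 tf'.
pose A x : R := `|partial i f x - partial i f' x| + C * `|f' x|.
have mc := measurable_partial i cf; have mc' := measurable_partial i cf'.
have mf' : measurable_fun setT (fun x => `|f' x|).
  by apply: measurableT_comp => //; exact: C1_measurable.
have mA : measurable_fun setT A.
  by apply: measurable_funD; [exact: measurable_normB|exact: measurable_funM].
have mCf' : measurable_fun setT (fun x => C * `|f' x|) by exact: measurable_funM.
rewrite -int_scale//.
rewrite -(int_add mu (measurable_normB mc mc') mCf' (fun x => normr_ge0 _)); last first.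
  by move=> x; rewrite mulr_ge0.
have sF' : smooth (fun x => f' x * eta x) by apply: smoothM => //; case: tf'.
have cF := smooth_C1 sF'.
have sF : csupp r (fun x => f' x * eta x) by move=> x rx; rewrite eta0// mulr0.
have I0 := integral_partial0 i cF sF.
have dF x : partial i (fun x => f' x * eta x) x =
    f' x * partial i eta x + eta x * partial i f' x.
  by rewrite /partial deriveM//; [exact: (cf' i).2|exact: (ceta i).2].
have [Mk Mk0 HMk] := tame_bounded tf'.
have [Dk Dk0 HDk] := tame_gradient_bounded tf'.
have [DK DK0 HDK] := tame_gradient_bounded tf.
have IA : mu.-integrable setT (EFin \o A).
  apply: (@integrable_csupp _ _ A (DK + Dk + C * Mk) r) => //.
    move=> x; rewrite ger0_norm ?addr_ge0 ?mulr_ge0//.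
    rewrite lerD ?ler_wpM2l// (le_trans (ler_normB _ _))// lerD//;
      exact: partial_le_enorm.
  move=> x rx; rewrite /A !tame_partial0// (tame_csupp tf' rx).
  by rewrite normr0 mulr0 subrr normr0 addr0.
have IP : mu.-integrable setT (EFin \o partial i (fun x => f' x * eta x)).
  have [M M0 HM] := gradient_bounded cF sF.
  apply: (@integrable_csupp _ _ _ M r).
  - exact: measurable_partial.
  - exact: partial_le_enorm.
  - by move=> x rx; rewrite dF eta0// (tame_csupp tf' rx) !mul0r addr0.
have IAP := integrableD measurableT IA IP.
have IH : mu.-integrable setT (EFin \o (fun x => tsat (partial i f x))).
  apply: (@integrable_csupp _ _ _ 1 r).
  - by apply: measurableT_comp => //; exact: measurable_tsat.
  - by move=> x; rewrite ger0_norm ?tsat_ge0// tsat_le1.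
  - by move=> x rx; rewrite tame_partial0// /tsat mul0r.
have := le_integral measurableT IH IAP.
rewrite integralD// I0 adde0; apply => x _.
  rewrite /= -EFinD lee_fin dF /tsat -/(eta x) /A.
  have : (partial i f x - partial i f' x) * eta x <= `|partial i f x - partial i f' x|.
    rewrite (le_trans (ler_norm _))// normrM ler_piMr//; exact: norm_sat_le1.
  have : - (f' x * partial i eta x) <= C * `|f' x|.
    rewrite (le_trans (ler_norm _))// normrN normrM mulrC ler_wpM2r//.
    exact: partial_le_enorm.
  lra.
Qed.

Section sequence.
Variables (psi : nat -> 'rV[R]_N -> R) (G : 'rV[R]_N -> 'rV[R]_N).
Hypotheses (N0 : (0 < N)%N) (mG : measurable_fun setT G).
Hypotheses (G0 : forall x, r <= enorm x -> G x = 0) (tpsi : forall k, tame (psi k)).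
Hypothesis spsi : small (fun k => \int[mu]_x (`|psi k x| ^+ N)%:E)%E.
Hypothesis sG :
  small (fun k => \int[mu]_x (enorm (gradient (psi k) x - G x) ^+ N)%:E)%E.

Let cpsi k : C1 (psi k) := tame_C1 (tpsi k).

Let mGi i : measurable_fun setT (fun x => G x ord0 i).
Proof. exact: (measurableT_comp (measurable_coord i)). Qed.

Let s1 i : small (fun k => \int[mu]_x (`|partial i (psi k) x - G x ord0 i|)%:E)%E.
Proof.
apply: (@small_L1 _ _ r) => //.
- by move=> k; apply: measurable_normB => //; exact: measurable_partial.
- by move=> k x rx; rewrite tame_partial0// G0// mxE subrr normr0.
apply: small_le sG => k; apply: le_int.
- by apply: measurable_funX; apply: measurable_normB => //; exact: measurable_partial.
- apply: measurable_funX; apply: measurable_enorm_comp; apply: measurable_rVB => //.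
  exact: measurable_gradient.
- by move=> x; rewrite exprn_ge0.
- move=> x; apply: lerXn2r; rewrite ?nnegrE ?enorm_ge0//.
  have := coord_le_enorm (gradient (psi k) x - G x) i.
  by rewrite !mxE -gradientE mxE.
Qed.

Let s0 : small (fun k => \int[mu]_x (`|psi k x|)%:E)%E.
Proof.
apply: (@small_L1 _ _ r) => //.
- by move=> k; apply: measurableT_comp => //; exact: C1_measurable.
- by move=> k x rx; rewrite (tame_csupp (tpsi k) rx) normr0.
Qed.

Let main i K : (\int[mu]_x (tsat (partial i (psi K) x))%:E <=
  \int[mu]_x (`|partial i (psi K) x - G x ord0 i|)%:E)%E.
Proof.
have [C C0 step] := int_tsat_partial i (tpsi K).
apply/lee_addgt0Pr => e e0.
have p0 k : (0 <= \int[mu]_x (`|psi k x|)%:E)%E by apply: ge0_int.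
have [L HL] := smallD (s1 i) (smallZ C0 p0 s0) e0.
apply: le_trans (step _ (tpsi L)) _.
have mB k : measurable_fun setT (fun x => `|partial i (psi k) x - G x ord0 i|).
  by apply: measurable_normB => //; exact: measurable_partial.
apply: (@le_trans _ _ ((\int[mu]_x (`|partial i (psi K) x - G x ord0 i|)%:E +
  \int[mu]_x (`|partial i (psi L) x - G x ord0 i|)%:E) + C%:E * \int[mu]_x (`|psi L x|)%:E)%E).
  apply: leeD => //; rewrite -int_add//; apply: le_int => //.
  - by apply: measurable_normB; exact: measurable_partial.
  - exact: measurable_funD.
  - move=> x; rewrite (distrC (partial i (psi L) x)).
    by rewrite (le_trans (ler_distD (G x ord0 i) _ _)).
by rewrite -addeA leeD2l// HL.
Qed.

Let key i : {ae mu, forall x, G x ord0 i = 0}.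
Proof.
have Z : (\int[mu]_x (tsat (G x ord0 i))%:E = 0)%E.
  have g0 : (0 <= \int[mu]_x (tsat (G x ord0 i))%:E)%E.
    by apply: ge0_int => x; exact: tsat_ge0.
  apply/eqP; rewrite eq_le g0 andbT; apply: small_const.
  apply: small_le (smallD (s1 i) (s1 i)) => k.
  have mp := measurable_partial i (cpsi k).
  apply: (@le_trans _ _ (\int[mu]_x (tsat (partial i (psi k) x))%:E +
      \int[mu]_x (`|partial i (psi k) x - G x ord0 i|)%:E)%E).
    have mt : measurable_fun setT (fun x => tsat (partial i (psi k) x)).
      by apply: measurableT_comp => //; exact: measurable_tsat.
    have mB := measurable_normB mp (mGi i).
    rewrite -int_add//; last by move=> x; exact: tsat_ge0.
    apply: le_int => //.
    - by apply: (measurableT_comp measurable_tsat).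
    - exact: measurable_funD.
    - by move=> x; exact: tsat_ge0.
    - by move=> x; rewrite distrC; exact: tsat_lipschitz.
  by rewrite leeD2r// main.
have mhG : measurable_fun setT (fun x => (tsat (G x ord0 i))%:E).
  by apply/measurable_EFinP; apply: (measurableT_comp measurable_tsat).
have := (ae_eq_integral_abs mu measurableT mhG).1.
rewrite (eq_integral (fun x => (tsat (G x ord0 i))%:E)); last first.
  by move=> x _; rewrite gee0_abs// lee_fin tsat_ge0.
by move=> /(_ Z); apply: filterS => x /(_ I) [] /tsat_eq0.
Qed.

Lemma approx0_gradient : {ae mu, forall x, G x = 0}.
Proof.
have : {ae mu, forall x, forall i, G x ord0 i = 0}.
  exact: (@filter_forall _ _ (fun i x => G x ord0 i = 0) (almost_everywhere mu) _ key).
by apply: filterS => x H; apply/rowP => i; rewrite H mxE.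
Qed.

End sequence.
End gradient_uniqueness.

Section measure_limits.
Context d (T : measurableType d) (R : realType) (mu : {measure set T -> \bar R}).
Local Open Scope ereal_scope.

Lemma measurable_funV (f : T -> R) : (forall x, (0 <= f x)%R) ->
  measurable_fun setT f -> measurable_fun setT (fun x => (f x)^-1)%R.
Proof.
move=> f0 mf; rewrite (_ : (fun x => _) = (fun x => f x `^ (-1))%R).
  by apply: (@measurableT_comp _ _ _ _ _ _ (fun u => u `^ (-1))%R) => //;
    exact: measurable_powR.
by apply/funext => x; rewrite powR_inv1.
Qed.

Lemma measurable_fun_powR (f : T -> R) (p : R) :
  measurable_fun setT f -> measurable_fun setT (fun x => f x `^ p)%R.
Proof.
by move=> mf; apply: (@measurableT_comp _ _ _ _ _ _ (fun u => u `^ p)%R) => //;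
  exact: measurable_powR.
Qed.

(* Passing to a fast subsequence makes the sum of the integrals finite. *)
Lemma ae_subseq (F : nat -> T -> R) : (forall k, measurable_fun setT (F k)) ->
  (forall k x, (0 <= F k x)%R) -> small (fun k => \int[mu]_x (F k x)%:E) ->
  exists2 n : nat -> nat, (forall j, (j <= n j)%N) &
    {ae mu, forall x, small (fun j => (F (n j) x)%:E)}.
Proof.
move=> mF F0 sF.
have H j : exists n, (j <= n)%N /\ \int[mu]_x (F n x)%:E <= ((2^-1 ^+ j.+1)%R)%:E.
  have e0 : (0 < 2^-1 ^+ j.+1 :> R)%R by rewrite exprn_gt0// invr_gt0.
  have [K HK] := sF _ e0; exists (maxn K j); rewrite leq_maxr; split => //.
  by apply: HK; exact: leq_maxl.
have [n Hn] := choice H; exists n => [j|]; first by have [] := Hn j.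
pose f j x := (F (n j) x)%:E.
have mf j : measurable_fun setT (f j) by exact/measurable_EFinP.
have f0 j x : 0 <= f j x by rewrite lee_fin.
have S1 : \sum_(j <oo) \int[mu]_x f j x <= 1.
  apply: lime_le; first by apply: is_cvg_nneseries => j _ _; apply: integral_ge0.
  apply: nearW => k; apply: (@le_trans _ _ (\sum_(0 <= j < k) ((2^-1 ^+ j.+1)%R)%:E)).
    by apply: lee_sum => j _; have [] := Hn j.
  rewrite sumEFin lee_fin.
  suff -> : (\sum_(0 <= j < k) 2^-1 ^+ j.+1 = 1 - 2^-1 ^+ k :> R)%R.
    by rewrite gerBl exprn_ge0// invr_ge0.
  elim: k => [|k IH]; first by rewrite big_geq// expr0 subrr.
  by rewrite big_nat_recr//= IH exprS; field.
have I : mu.-integrable setT (fun x => \sum_(j <oo) f j x).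
  apply/integrableP; split; first by apply: ge0_emeasurable_sum => // j x _ _.
  rewrite (eq_integral (fun x => \sum_(j <oo) f j x)); last first.
    by move=> x _; rewrite gee0_abs//; apply: nneseries_ge0 => j _ _.
  by rewrite integral_nneseries// (le_lt_trans S1)// ltry.
apply: filterS (integrable_ae measurableT I) => x /(_ Logic.I) fx.
have foo : \sum_(j <oo) f j x < +oo.
  by rewrite -ge0_fin_numE//; apply: nneseries_ge0 => j _ _.
have := cvg0_small (nneseries_tail_cvg foo (fun j _ => f0 j x)).
move=> s e /s[K HK]; exists K => k /HK; apply: le_trans.
have /(_ k.+1) := @nneseries_lim_ge R (f^~ x) predT k _ (fun j _ _ => f0 j x).
by rewrite big_nat1.
Qed.

Lemma small_cvg (a : nat -> R) (l : R) : small (fun j => (`|a j - l|)%:E) ->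
  a @ \oo --> l.
Proof.
move=> s; apply/cvgrPdist_le => e /s[K HK].
by exists K => // j /= /HK; rewrite lee_fin distrC.
Qed.

Lemma expr_norm_le n (F G E : R) : (0 <= G)%R -> (0 <= E)%R -> (F <= G + E)%R ->
  (0 <= F)%R -> forall eps C : R,
  (forall a b, 0 <= a -> 0 <= b -> (a + b) ^+ n <= (1 + eps) * a ^+ n + C * b ^+ n)%R ->
  (F ^+ n <= (1 + eps) * G ^+ n + C * E ^+ n)%R.
Proof.
move=> G0 E0 FG F0 eps C H; apply: le_trans (H _ _ G0 E0).
by apply: lerXn2r => //; rewrite nnegrE// addr_ge0.
Qed.

Section LN.
Variables (n : nat) (F : T -> R) (Fk Ek : nat -> T -> R).
Hypotheses (mF : measurable_fun setT F) (mFk : forall k, measurable_fun setT (Fk k)).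
Hypotheses (mEk : forall k, measurable_fun setT (Ek k)).
Hypotheses (F0 : forall x, (0 <= F x)%R) (Fk0 : forall k x, (0 <= Fk k x)%R).
Hypotheses (Ek0 : forall k x, (0 <= Ek k x)%R).
Hypothesis FE : forall k x, (`|Fk k x - F x| <= Ek k x)%R.
Hypothesis sE : small (fun k => \int[mu]_x (Ek k x ^+ n)%:E).

Let bound (G H E : T -> R) : measurable_fun setT G -> measurable_fun setT H ->
  measurable_fun setT E -> (forall x, (0 <= G x)%R) -> (forall x, (0 <= H x)%R) ->
  (forall x, (0 <= E x)%R) -> (forall x, (H x <= G x + E x)%R) -> forall eps C : R,
  (0 < eps)%R -> (0 < C)%R ->
  (forall a b, 0 <= a -> 0 <= b -> (a + b) ^+ n <= (1 + eps) * a ^+ n + C * b ^+ n)%R ->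
  \int[mu]_x (H x ^+ n)%:E <=
  (1 + eps)%:E * \int[mu]_x (G x ^+ n)%:E + C%:E * \int[mu]_x (E x ^+ n)%:E.
Proof.
move=> mG mH mE G0 H0 E0 HGE eps C e0 C0 HC.
have e1 : (0 <= 1 + eps)%R by rewrite addr_ge0// ltW.
have X0 (f : T -> R) x : (forall x, (0 <= f x)%R) -> (0 <= f x ^+ n)%R.
  by move=> f0; rewrite exprn_ge0.
rewrite -!int_scale//; try exact: measurable_funX; try (by move=> x; exact: X0);
  try exact: ltW.
rewrite -int_add//; try (by apply: measurable_funM => //; exact: measurable_funX);
  try (by move=> x; rewrite mulr_ge0 ?X0// ltW).
apply: le_int => //.
- exact: measurable_funX.
- by apply: measurable_funD; apply: measurable_funM => //; exact: measurable_funX.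
- by move=> x; exact: X0.
- by move=> x; exact: expr_norm_le.
Qed.

Let FkF k x : (Fk k x <= F x + Ek k x)%R.
Proof. by have := FE k x; rewrite ler_norml => /andP[_]; rewrite lerBlDl. Qed.

Let FFk k x : (F x <= Fk k x + Ek k x)%R.
Proof. by have := FE k x; rewrite ler_norml => /andP[]; lra. Qed.

Let I0 (f : T -> R) : (forall x, (0 <= f x)%R) -> 0 <= \int[mu]_x (f x ^+ n)%:E.
Proof. by move=> f0; apply: ge0_int => x; rewrite exprn_ge0. Qed.

Lemma LN_lty : (forall k, \int[mu]_x (Fk k x ^+ n)%:E < +oo) ->
  \int[mu]_x (F x ^+ n)%:E < +oo.
Proof.
move=> foo; have [C C0 HC] := exprD_le n (@ltr01 R).
have [K HK] := sE ltr01.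
apply: le_lt_trans (bound (mFk K) mF (mEk K) (Fk0 K) F0 (Ek0 K) (FFk K) ltr01 C0 HC) _.
rewrite lte_add_pinfty// lte_mul_pinfty ?lee_fin ?addr_ge0//.
  exact: ltW.
by rewrite (le_lt_trans (HK _ (leqnn K)))// ltry.
Qed.

Hypothesis Foo : \int[mu]_x (F x ^+ n)%:E < +oo.

Let Ffin : \int[mu]_x (F x ^+ n)%:E = (fine (\int[mu]_x (F x ^+ n)%:E))%:E.
Proof. by rewrite fineK// ge0_fin_numE// I0. Qed.

Let m := fine (\int[mu]_x (F x ^+ n)%:E).

Let m0 : (0 <= m)%R. Proof. exact/fine_ge0/I0. Qed.

Lemma LN_upper (e : R) : (0 < e)%R -> exists K, forall k, (K <= k)%N ->
  \int[mu]_x (Fk k x ^+ n)%:E <= \int[mu]_x (F x ^+ n)%:E + e%:E.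
Proof.
move=> e0; have e1 : (0 < e / (2 * (m + 1)))%R.
  by rewrite divr_gt0// mulr_gt0// ltr_wpDl.
have [C C0 HC] := exprD_le n e1.
have e2 : (0 < e / 2)%R by rewrite divr_gt0.
have [K HK] := smallZ (ltW C0) (fun k => I0 (Ek0 k)) sE e2.
exists K => k Kk.
apply: le_trans (bound mF (mFk k) (mEk k) F0 (Fk0 k) (Ek0 k) (FkF k) e1 C0 HC) _.
apply: le_trans (leeD (lexx _) (HK k Kk)) _.
rewrite Ffin -/m -EFinM -!EFinD lee_fin mulrDl mul1r -addrA lerD2l.
rewrite [leRHS]splitr lerD2r (@le_trans _ _ (e / (2 * (m + 1)) * (m + 1)))%R//.
  by rewrite ler_wpM2l ?lerDl// ltW.
by rewrite invfM mulrA divfK// gt_eqF// ltr_wpDl.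
Qed.

Lemma LN_lower (e : R) : (0 < e)%R -> exists K, forall k, (K <= k)%N ->
  \int[mu]_x (F x ^+ n)%:E <= \int[mu]_x (Fk k x ^+ n)%:E + e%:E.
Proof.
move=> e0; have [K1 HK1] := LN_upper ltr01.
have e1 : (0 < e / (2 * (m + 1)))%R.
  by rewrite divr_gt0// mulr_gt0// ltr_wpDl.
have [C C0 HC] := exprD_le n e1.
have e2 : (0 < e / 2)%R by rewrite divr_gt0.
have [K HK] := smallZ (ltW C0) (fun k => I0 (Ek0 k)) sE e2.
exists (maxn K1 K) => k; rewrite geq_max => /andP[K1k Kk].
apply: le_trans (bound (mFk k) mF (mEk k) (Fk0 k) F0 (Ek0 k) (FFk k) e1 C0 HC) _.
apply: le_trans (leeD (lexx _) (HK k Kk)) _.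
have := HK1 k K1k; rewrite Ffin -/m -EFinD => ub.
have fk : \int[mu]_x (Fk k x ^+ n)%:E \is a fin_num.
  by rewrite ge0_fin_numE ?I0// (le_lt_trans ub)// ltry.
move: ub; rewrite -(fineK fk) lee_fin -EFinM -!EFinD lee_fin.
set a := fine _ => am.
rewrite mulrDl mul1r -addrA lerD2l [leRHS]splitr lerD2r.
rewrite (@le_trans _ _ (e / (2 * (m + 1)) * (m + 1)))%R//.
  by rewrite ler_wpM2l// ltW.
by rewrite invfM mulrA divfK// gt_eqF// ltr_wpDl.
Qed.

End LN.

End measure_limits.

Section sobolev_facts.
Context {R : realType} {N : nat}.
Implicit Types (f u : 'rV[R]_N -> R) (x y z v : 'rV[R]_N).
Local Notation mu := (lebesgue_rV R N).
Variable r : R.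
Local Notation tame := (@tame R N r).

Lemma DCT_small (f_ : nat -> 'rV[R]_N -> R) f (M s : R) :
  (forall k, measurable_fun setT (f_ k)) -> measurable_fun setT f ->
  (forall k x, `|f_ k x| <= M) -> (forall k, csupp s (f_ k)) ->
  (forall x, f_ k x @[k --> \oo] --> f x) ->
  small (fun k => \int[mu]_x (`|f_ k x - f x|)%:E)%E.
Proof.
move=> mf_ mf fM fs cf.
have H1 k : measurable_fun setT (EFin \o f_ k) by exact/measurable_EFinP.
have H2 : measurable_fun setT (EFin \o f) by exact/measurable_EFinP.
have H3 : {ae mu, forall x, setT x -> (fun k => (EFin \o f_ k) x) @ \oo --> (EFin \o f) x}.
  by apply: aeW => x _; apply: cvg_EFin; [exact: nearW|exact: cf].
have M0 : 0 <= M by apply: le_trans (fM 0%N 0).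
have H4 : mu.-integrable setT (EFin \o (fun x => M * \1_(eball s) x)).
  apply: (@integrable_csupp _ _ _ M s).
  - by apply: measurable_funM => //; apply: measurable_indic; exact: measurable_eball.
  - move=> x; rewrite indicE normrM (ger0_norm M0) ler_piMr//.
    by case: (_ \in _); rewrite ?normr1 ?normr0.
  - move=> x sx; rewrite indicE memNset ?mulr0//= => H.
    by have := lt_le_trans H sx; rewrite ltxx.
have H5 : {ae mu, forall x k, setT x ->
    (`|(EFin \o f_ k) x| <= (EFin \o (fun x => M * \1_(eball s) x)%R) x)%E}.
  apply: aeW => x k _; rewrite /= lee_fin indicE.
  have [xs|xs] := ltP (enorm x) s; first by rewrite mem_set// mulr1.
  rewrite memNset ?mulr0; last by move=> /= /lt_le_trans/(_ xs); rewrite ltxx.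
  by rewrite fs// normr0.
have [_ H _] := dominated_convergence measurableT H1 H2 H3 H4 H5.
by apply: small_le (cvg0_small H).
Qed.

Lemma tame_int_gradient_lty f n : (0 < n)%N -> tame f ->
  (\int[mu]_x (enorm (gradient f x) ^+ n)%:E < +oo)%E.
Proof.
move=> n0 tf; have [M M0 HM] := tame_gradient_bounded tf.
apply: (@int_lty _ _ _ (M ^+ n) r).
- apply: measurable_funX; apply: measurable_enorm_comp; apply: measurable_gradient.
  exact: tame_C1 tf.
- by move=> x; rewrite exprn_ge0// enorm_ge0.
- by move=> x; apply: lerXn2r; rewrite ?nnegrE ?enorm_ge0.
- by move=> x rx; rewrite (tame_gradient0 tf rx) enorm0 expr0n gtn_eqF.
Qed.

Lemma tame_W01N f : (0 < N)%N -> tame f -> W01N_gradient (eball r) f (gradient f).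
Proof.
move=> N0 tf; split.
- exact: measurable_funS (C1_measurable (tame_C1 tf)).
- exact: measurable_funS (measurable_gradient (tame_C1 tf)).
exists (fun=> f) => [k|]; first by apply/Cc_smooth_eball.
split; rewrite (_ : (fun=> _) = cst 0%E); try exact: cvg_cst.
- apply/funext => k; apply: integral0_eq => x _.
  by rewrite subrr normr0 expr0n gtn_eqF.
- apply/funext => k; apply: integral0_eq => x _.
  by rewrite subrr enorm0 expr0n gtn_eqF.
Qed.

Lemma W01N_wgradient u : W01N (eball r) u ->
  W01N_gradient (eball r) u (wgradient (eball r) u).
Proof. by move=> [g Hg]; apply: (xgetPex _ (ex_intro _ g Hg)). Qed.

Lemma dirichlet_ext u (g : 'rV[R]_N -> 'rV[R]_N) : (0 < N)%N ->
  (\int[mu]_(x in eball r) (enorm (g x) ^+ N)%:E =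
   \int[mu]_x (enorm ((g \_ (eball r)) x) ^+ N)%:E)%E.
Proof.
move=> N0; rewrite [LHS]integral_mkcond; apply: eq_integral => x _.
have pt : (point : 'rV[R]_N) = 0 by apply/rowP => i; rewrite !mxE.
by rewrite !patchE; case: ifPn => // _; rewrite pt enorm0 expr0n gtn_eqF.
Qed.

Lemma approxW_grad_lty u g phi : (0 < N)%N -> approxW r u g phi ->
  (\int[mu]_x (enorm (g x) ^+ N)%:E < +oo)%E.
Proof.
move=> N0 [_ mg _ _ tphi _ sg].
apply: (@LN_lty _ _ _ mu N (fun x => enorm (g x))
  (fun k x => enorm (gradient (phi k) x)) (fun k x => enorm (gradient (phi k) x - g x))).
- exact: measurable_enorm_comp.
- move=> k; apply: measurable_enorm_comp; apply: measurable_gradient.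
  exact: tame_C1 (tphi k).
- move=> k; apply: measurable_enorm_comp; apply: measurable_rVB => //.
  by apply: measurable_gradient; exact: tame_C1 (tphi k).
- by move=> x; exact: enorm_ge0.
- by move=> k x; exact: enorm_ge0.
- by move=> k x; exact: enorm_ge0.
- by move=> k x; exact: ler_dist_enorm.
- exact: sg.
- by move=> k; exact: tame_int_gradient_lty.
Qed.

Lemma dirichlet_tame (v : 'rV[R]_N -> R) : (0 < N)%N -> tame v ->
  dirichlet r v = (\int[mu]_x (enorm (gradient v x) ^+ N)%:E)%E.
Proof.
move=> N0 tv; have Wv : W01N (eball r) v by exists (gradient v); exact: tame_W01N.
have [phi aphi] := W01N_approx N0 (W01N_wgradient Wv).
rewrite /dirichlet dirichlet_ext//; set wg := wgradient _ _ \_ _ in aphi *.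
have vE : v \_ (eball r) = v.
  apply/funext => x; rewrite patchE; case: ifPn => // xr.
  rewrite (tame_csupp tv)// leNgt; apply/negP => H.
  by move/negP: xr; apply; exact/mem_set.
rewrite vE in aphi; case: aphi => _ mwg _ wg0 tphi su sg.
have mgv : measurable_fun setT (gradient v) by apply: measurable_gradient; exact: tame_C1 tv.
have : {ae mu, forall x, wg x - gradient v x = 0}.
  apply: (@approx0_gradient _ _ r (fun k x => phi k x - v x)) => //.
  - exact: measurable_rVB.
  - by move=> x rx; rewrite wg0// (tame_gradient0 tv rx) subr0.
  - by move=> k; exact: tameB.
  - apply: small_le sg => k; rewrite le_eqVlt; apply/orP; left; apply/eqP.
    apply: eq_integral => x _; congr ((enorm _ ^+ _)%:E).
    rewrite gradientB; [|exact: tame_C1 (tphi k)|exact: tame_C1 tv].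
    by rewrite opprB addrA subrK.
move=> ae0; apply: ge0_ae_eq_integral => //.
- by apply/measurable_EFinP; apply: measurable_funX; exact: measurable_enorm_comp.
- by apply/measurable_EFinP; apply: measurable_funX; exact: measurable_enorm_comp.
- by move=> x _; rewrite lee_fin exprn_ge0// enorm_ge0.
- by move=> x _; rewrite lee_fin exprn_ge0// enorm_ge0.
by apply: filterS ae0 => x /subr0_eq ->.
Qed.

End sobolev_facts.

Section young_parameter.
Context {R : realType}.

Lemma young_param n (lam a b : R) : 0 < lam -> 0 <= a -> 0 <= b ->
  n.+1%:R * a ^+ n * b <= n%:R * lam * a ^+ n.+1 + lam ^- n * b ^+ n.+1.
Proof.
move=> l0 a0 b0; pose s := lam `^ (n.+1%:R^-1).
have s0 : 0 < s by exact: powR_gt0.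
have sn : s ^+ n.+1 = lam.
  by rewrite -powR_mulrn ?ltW// -powRrM mulVf// powRr1// ltW.
have s1 : 0 <= s ^- n by rewrite invr_ge0 exprn_ge0// ltW.
have := young_expr n (mulr_ge0 (ltW s0) a0) (mulr_ge0 s1 b0).
rewrite (_ : n.+1%:R * (s * a) ^+ n * (s ^- n * b) = n.+1%:R * a ^+ n * b); last first.
  have sn0 : s ^+ n != 0 by rewrite expf_neq0// gt_eqF.
  by rewrite exprMn; field.
rewrite exprMn sn exprMn (_ : (s ^- n) ^+ n.+1 = lam ^- n) ?mulrA//.
by rewrite exprVn -exprM mulnC exprM sn.
Qed.

Lemma expR_sub1_le (h : R) : expR h - 1 <= h * expR h.
Proof.
have := expR_ge1Dx (- h); rewrite expRN => H.
have e0 := expR_gt0 h.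
have : (1 - h) * expR h <= 1.
  by rewrite -[leRHS](mulVf (lt0r_neq0 e0)) ler_wpM2r// ltW.
lra.
Qed.

End young_parameter.

(** * Hardy-type estimates on shells *)

Section shell_estimate.
Context {R : realType} {n : nat}.
Implicit Types (f u : 'rV[R]_n.+1 -> R) (x y z v : 'rV[R]_n.+1).
Local Notation mu := (lebesgue_rV R n.+1).

Definition shell (rho tau : R) : set 'rV[R]_n.+1 :=
  eball (rho * expR tau) `\` eball rho.

Lemma shellP rho tau x :
  shell rho tau x <-> rho <= enorm x /\ enorm x < rho * expR tau.
Proof.
rewrite /shell /eball /=; split=> [[xt /negP]|[xr xt]]; first by rewrite -leNgt.
by split => //; apply/negP; rewrite -leNgt.
Qed.

Lemma measurable_shell rho tau : measurable (shell rho tau).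
Proof. by apply: measurableD; exact: measurable_eball. Qed.

(* The junk value [invN 0 = 0] (from [0^-1 = 0]) only matters on a null set. *)
Definition invN x : R := (enorm x ^+ n.+1)^-1.

Lemma invN_ge0 x : 0 <= invN x.
Proof. by rewrite invr_ge0 exprn_ge0// enorm_ge0. Qed.

Lemma measurable_invN : measurable_fun setT invN.
Proof.
apply: measurable_funV; first by move=> x; rewrite exprn_ge0// enorm_ge0.
by apply: measurable_funX; exact: measurable_enorm.
Qed.

Lemma invN_le (rho : R) x : 0 < rho -> rho <= enorm x -> invN x <= rho ^- n.+1.
Proof.
move=> r0 rx; rewrite lef_pV2 ?posrE ?exprn_gt0//; last exact: lt_le_trans rx.
by apply: lerXn2r; rewrite ?nnegrE ?enorm_ge0// ltW.
Qed.

Section estimate.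
Variables (r rho tau : R) (phi : 'rV[R]_n.+1 -> R).
Hypotheses (cphi : C1 phi) (phi0 : csupp r phi).
Hypotheses (r0 : 0 < rho) (t0 : 0 < tau).

Let H (s : R) : R := Num.min (Num.max (s - ln rho) 0) tau.

Let H_ge0 s : 0 <= H s.
Proof. by rewrite /H le_min le_max lexx orbT ltW. Qed.

Let H_le s : H s <= tau. Proof. by rewrite /H ge_min lexx orbT. Qed.

Let H0 s : s <= ln rho -> H s = 0.
Proof.
move=> sr; rewrite /H (max_idPr _) ?subr_le0// (min_idPl _)//; exact: ltW.
Qed.

Let H1 s : ln rho <= s -> s <= ln rho + tau -> H s = s - ln rho.
Proof.
move=> rs st; rewrite /H (max_idPl _) ?subr_ge0// (min_idPl _)//.
by rewrite lerBlDl.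
Qed.

Let H2 (s : R) : ln rho + tau <= s -> H s = tau.
Proof.
move=> st; rewrite /H (max_idPl _); last by rewrite subr_ge0; have := t0; lra.
by rewrite (min_idPr _)// lerBrDl.
Qed.

Let dH_bound (s h : R) : 0 <= h -> 0 <= H (s + h) - H s <= h.
Proof.
move=> h0; have [sr|rs] := leP s (ln rho).
  rewrite (H0 sr) subr0 H_ge0 /=.
  have [shr|rsh] := leP (s + h) (ln rho); first by rewrite H0.
  by rewrite /H ge_min ge_max h0 andbT; apply/orP; left; lra.
have [st|ts] := leP (ln rho + tau) s.
  by rewrite !H2 ?subrr//; lra.
rewrite (H1 (ltW rs) (ltW ts)).
have [sht|tsh] := leP (s + h) (ln rho + tau).
  by rewrite H1//; lra.
by rewrite H2 ?(ltW tsh)//; lra.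
Qed.

Let mH : measurable_fun setT H.
Proof.
apply: measurable_minr => //; apply: measurable_maxr => //.
by apply: measurable_funB.
Qed.

Let h (k : nat) : R := k.+1%:R^-1.
Let h_gt0 k : 0 < h k. Proof. by rewrite invr_gt0. Qed.
Let h_le1 k : h k <= 1. Proof. by rewrite invf_le1// ler1n. Qed.
Let h_cvg : h k @[k --> \oo] --> (0 : R). Proof. exact: cvg_harmonic. Qed.

Let phik k x : R := phi (expR (h k) *: x).
Let dH k x : R := (H (ln (enorm x) + h k) - H (ln (enorm x))) / h k.
Let dk k x : R := `|phi x - phik k x| / h k.
Let P k x : R := `|phik k x| ^+ n.+1 * invN x * dH k x.
Let B k x : R := `|phik k x| ^+ n.+1 * invN x * H (ln (enorm x)).
Let S x : R := `|phi x| ^+ n.+1 * invN x * H (ln (enorm x)).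
Let out x : R := \1_(~` eball rho) x.
Let Q k x : R := dk k x ^+ n.+1 * invN x * out x.

Let mphi : measurable_fun setT phi. Proof. exact: C1_measurable. Qed.

Let mphik k : measurable_fun setT (phik k).
Proof.
apply: (measurableT_comp mphi); apply: measurable_fun_rVP => i.
under eq_fun do rewrite mxE.
by apply: measurable_funM => //; exact: measurable_coord.
Qed.

Let mln : measurable_fun setT (fun x => ln (enorm x)).
Proof. by apply: measurableT_comp => //; exact: measurable_enorm. Qed.

Let mHln : measurable_fun setT (fun x => H (ln (enorm x))).
Proof. exact: (measurableT_comp mH). Qed.

Let mdH k : measurable_fun setT (dH k).
Proof.
apply: measurable_funM => //; apply: measurable_funB => //.
by apply: (measurableT_comp mH); exact: measurable_funD.
Qed.

Let mdk k : measurable_fun setT (dk k).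
Proof. by apply: measurable_funM => //; exact: measurable_normB. Qed.

Let mX f : measurable_fun setT f -> measurable_fun setT (fun x => `|f x| ^+ n.+1).
Proof. by move=> mf; apply: measurable_funX; exact: measurableT_comp. Qed.

Let mP k : measurable_fun setT (P k).
Proof.
apply: measurable_funM => //; apply: measurable_funM; first exact: mX.
exact: measurable_invN.
Qed.

Let mB k : measurable_fun setT (B k).
Proof.
apply: measurable_funM => //; apply: measurable_funM; first exact: mX.
exact: measurable_invN.
Qed.

Let mS : measurable_fun setT S.
Proof.
apply: measurable_funM => //; apply: measurable_funM; first exact: mX.
exact: measurable_invN.
Qed.

Let mout : measurable_fun setT out.
Proof.
by apply: measurable_indic; apply: measurableC; exact: measurable_eball.
Qed.

Let mQ k : measurable_fun setT (Q k).
Proof.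
apply: measurable_funM => //; apply: measurable_funM; last exact: measurable_invN.
exact: measurable_funX.
Qed.

Let dH_ge0 k x : 0 <= dH k x.
Proof.
rewrite divr_ge0 ?(ltW (h_gt0 k))//.
by have /andP[] := dH_bound (ln (enorm x)) (ltW (h_gt0 k)).
Qed.

Let dH_le1 k x : dH k x <= 1.
Proof.
rewrite ler_pdivrMr// mul1r.
by have /andP[] := dH_bound (ln (enorm x)) (ltW (h_gt0 k)).
Qed.

Let P_ge0 k x : 0 <= P k x.
Proof.
apply: mulr_ge0; last exact: dH_ge0.
by apply: mulr_ge0; [exact: exprn_ge0|exact: invN_ge0].
Qed.
Let B_ge0 k x : 0 <= B k x.
Proof. by rewrite !mulr_ge0 ?exprn_ge0 ?invN_ge0. Qed.
Let S_ge0 x : 0 <= S x.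
Proof. by rewrite !mulr_ge0 ?exprn_ge0 ?invN_ge0. Qed.
Let dk_ge0 k x : 0 <= dk k x.
Proof. by rewrite divr_ge0// ltW. Qed.
Let out_ge0 x : 0 <= out x. Proof. by rewrite /out indicE. Qed.
Let Q_ge0 k x : 0 <= Q k x.
Proof. by rewrite !mulr_ge0 ?exprn_ge0 ?invN_ge0. Qed.

Let dilation k : (\int[mu]_x (h k * P k x + B k x)%:E = \int[mu]_x (S x)%:E)%E.
Proof.
have c0 := expR_gt0 (h k).
have E x : h k * P k x + B k x = expR (h k) ^+ n.+1 * S (expR (h k) *: x).
  rewrite /P /B /S /invN enormZ (gtr0_norm c0) exprMn invfM -/(phik k x).
  have [->|x0] := eqVneq x 0.
    by rewrite enorm0 expr0n /= invr0 !(mulr0, mul0r) addr0.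
  have ex : 0 < enorm x by rewrite enorm_gt0.
  rewrite lnM ?posrE// expRK (addrC (h k)) /dH.
  have hn : h k != 0 by rewrite gt_eqF.
  have cn : expR (h k) ^+ n.+1 != 0 by rewrite expf_neq0// gt_eqF.
  rewrite [X in _ = X](_ : _ =
    `|phik k x| ^+ n.+1 * (enorm x ^+ n.+1)^-1 * H (ln (enorm x) + h k)); last first.
    rewrite !mulrA (mulrC (expR _ ^+ _)) -!mulrA; congr (_ * _).
    by rewrite mulrA divff// mul1r.
  have gen (X a b : R) : h k * (X * ((a - b) / h k)) + X * b = X * a by field.
  exact: gen.
under eq_integral do rewrite E.
have mSc : measurable_fun setT (fun x => S (expR (h k) *: x)).
  apply: (measurableT_comp mS); apply: measurable_fun_rVP => i.
  under eq_fun do rewrite mxE.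
  by apply: measurable_funM => //; exact: measurable_coord.
have cn0 : 0 <= expR (h k) ^+ n.+1 by rewrite exprn_ge0// ltW.
rewrite (int_scale mu mSc cn0 (fun x => S_ge0 _)).
have mSE : measurable_fun setT (EFin \o S) by exact/measurable_EFinP.
rewrite (integral_dilate c0 mSE) => [|x]; last by rewrite lee_fin.
by rewrite muleA -EFinM divff ?mul1e// expf_neq0// gt_eqF.
Qed.

Let c1 k : 1 <= expR (h k).
Proof. by rewrite -expR0 ler_expR ltW. Qed.

Let phik0 k x : r <= enorm x -> phik k x = 0.
Proof.
move=> rx; apply: phi0; rewrite enormZ gtr0_norm ?expR_gt0//.
by rewrite (le_trans rx)// ler_peMl ?enorm_ge0.
Qed.

Let pointwise lam k x : 0 < lam ->
  S x <= B k x + h k * (tau * (n%:R * lam * (`|phi x| ^+ n.+1 * invN x * out x) +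
     lam ^- n * Q k x)).
Proof.
move=> l0; have [xr|rx] := ltP (enorm x) rho.
  have out0 : out x = 0 by rewrite /out indicE memNset// => /= -[].
  have [->|x0] := eqVneq x 0.
    by rewrite /S /B /Q /invN enorm0 expr0n /= invr0 !(mulr0, mul0r) addr0 mulr0 mulr0 addr0.
  rewrite /S /B /Q out0 H0 ?ler_ln ?posrE ?enorm_gt0// ?(ltW xr)//.
  by rewrite !mulr0 !addr0 mulr0 mulr0.
have out1 : out x = 1.
  by rewrite /out indicE mem_set//= => H3; have := lt_le_trans H3 rx; rewrite ltxx.
rewrite /S /B /Q out1 !mulr1.
set a := `|phi x|; set b := `|phik k x|; set d := dk k x; set i := invN x.
set Hx := H _.
have tang := exprB_tangent n (normr_ge0 (phi x)) (normr_ge0 (phik k x)).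
have ab : a - b <= h k * d.
  rewrite /d /dk mulrCA divff ?gt_eqF// mulr1.
  by rewrite (le_trans (ler_norm _))// ler_dist_dist.
have yng := young_param n l0 (normr_ge0 (phi x)) (dk_ge0 k x).
have key : a ^+ n.+1 - b ^+ n.+1 <=
    h k * (n%:R * lam * a ^+ n.+1 + lam ^- n * d ^+ n.+1).
  apply: le_trans tang _.
  apply: (@le_trans _ _ (n.+1%:R * a ^+ n * (h k * d))).
    by rewrite ler_wpM2l// mulr_ge0// exprn_ge0.
  by rewrite mulrCA ler_wpM2l// ltW.
rewrite -lerBlDl -mulrBl -mulrBl.
pose W : R := n%:R * lam * a ^+ n.+1 + lam ^- n * d ^+ n.+1; rewrite -/W in key.
have l0' := ltW l0; have d0 : 0 <= d by exact: dk_ge0.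
have a0 : 0 <= a by exact: normr_ge0.
have W0 : 0 <= W by rewrite addr_ge0// mulr_ge0 ?invr_ge0 ?exprn_ge0// mulr_ge0.
rewrite [leRHS](_ : _ = h k * W * i * tau); last by rewrite /W; ring.
apply: (@le_trans _ _ (h k * W * i * Hx)).
  by rewrite ler_wpM2r ?H_ge0// ler_wpM2r ?invN_ge0.
by rewrite ler_wpM2l ?H_le// !mulr_ge0 ?invN_ge0// ltW.
Qed.

Let Y := (\int[mu]_x (`|phi x| ^+ n.+1 * invN x * out x)%:E)%E.

Let mY : measurable_fun setT (fun x => `|phi x| ^+ n.+1 * invN x * out x).
Proof.
apply: measurable_funM => //; apply: measurable_funM; first exact: mX.
exact: measurable_invN.
Qed.

Let Y_ge0 x : 0 <= `|phi x| ^+ n.+1 * invN x * out x.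
Proof. by rewrite !mulr_ge0 ?exprn_ge0 ?invN_ge0. Qed.

Let B_lty k : (\int[mu]_x (B k x)%:E < +oo)%E.
Proof.
have [M M0 HM] := csupp_bounded (C1_continuous cphi) phi0.
apply: (@int_lty _ _ _ (M ^+ n.+1 * rho ^- n.+1 * tau) r) => //.
- move=> x; have [xr|rx] := ltP (enorm x) rho.
    have -> : B k x = 0.
      have [->|x0] := eqVneq x 0.
        by rewrite /B /invN enorm0 expr0n /= invr0 mulr0 mul0r.
      by rewrite /B H0 ?mulr0// ler_ln ?posrE ?enorm_gt0// ltW.
    by rewrite !mulr_ge0 ?invr_ge0 ?exprn_ge0// ltW.
  rewrite /B; apply: ler_pM => //; rewrite ?mulr_ge0 ?exprn_ge0 ?invN_ge0//.
  apply: ler_pM => //; rewrite ?exprn_ge0 ?invN_ge0//; last exact: invN_le.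
  by apply: lerXn2r; rewrite ?nnegrE//; exact: HM.
- by move=> x rx; rewrite /B phik0// normr0 expr0n /= !mul0r.
Qed.

Let bound_k lam k : 0 < lam -> (\int[mu]_x (P k x)%:E <=
  tau%:E * ((n%:R * lam)%:E * Y + (lam ^- n)%:E * \int[mu]_x (Q k x)%:E))%E.
Proof.
move=> l0.
have ln0 : 0 <= lam ^- n by rewrite invr_ge0 exprn_ge0// ltW.
have nl0 : 0 <= n%:R * lam by rewrite mulr_ge0// ltW.
have mE1 : measurable_fun setT (fun x => n%:R * lam * (`|phi x| ^+ n.+1 * invN x * out x)).
  exact: measurable_funM.
have mE2 : measurable_fun setT (fun x => lam ^- n * Q k x) by exact: measurable_funM.
have E1 x : 0 <= n%:R * lam * (`|phi x| ^+ n.+1 * invN x * out x) by exact: mulr_ge0.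
have E2 x : 0 <= lam ^- n * Q k x by exact: mulr_ge0.
rewrite -int_scale// -(int_scale mu (mQ k) ln0 (Q_ge0 k)) -int_add//.
rewrite -int_scale ?(ltW t0)//; last 2 first.
- exact: measurable_funD.
- by move=> x; exact: addr_ge0.
pose E x := tau * (n%:R * lam * (`|phi x| ^+ n.+1 * invN x * out x) + lam ^- n * Q k x).
rewrite -/(E _).
have mE : measurable_fun setT E by apply: measurable_funM => //; exact: measurable_funD.
have E0 x : 0 <= E x by rewrite mulr_ge0 ?(ltW t0)// addr_ge0.
have := dilation k; have mhP : measurable_fun setT (fun x => h k * P k x).
  exact: measurable_funM.
rewrite int_add// => [|x]; last by rewrite mulr_ge0// ltW.
rewrite (int_scale mu (mP k) (ltW (h_gt0 k)) (P_ge0 k)) => dil.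
have : (\int[mu]_x (S x)%:E <= \int[mu]_x (B k x)%:E + (h k)%:E * \int[mu]_x (E x)%:E)%E.
  have mhE : measurable_fun setT (fun x => h k * E x) by exact: measurable_funM.
  rewrite -int_scale ?(ltW (h_gt0 k))// -int_add//; last first.
    by move=> x; rewrite mulr_ge0// ltW.
  apply: le_int => //; first exact: measurable_funD.
  by move=> x; exact: pointwise.
rewrite -dil addeC leeD2lE; last first.
  by rewrite ge0_fin_numE ?B_lty// ge0_int.
by rewrite lee_pmul2l// lte_fin.
Qed.

Let Pl x : R := `|phi x| ^+ n.+1 * invN x * \1_(shell rho tau) x.
Let Ql x : R := `|dot (gradient phi x) x| ^+ n.+1 * invN x * out x.

Let mPl : measurable_fun setT Pl.
Proof.
apply: measurable_funM; last by apply: measurable_indic; exact: measurable_shell.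
by apply: measurable_funM; [exact: mX|exact: measurable_invN].
Qed.

Let mdot : measurable_fun setT (fun x => dot (gradient phi x) x).
Proof.
apply: measurable_sum => i; apply: measurable_funM; last exact: measurable_coord.
by under eq_fun do rewrite gradientE; exact: measurable_partial.
Qed.

Let mQl : measurable_fun setT Ql.
Proof.
apply: measurable_funM => //; apply: measurable_funM; last exact: measurable_invN.
exact: mX.
Qed.

Let expRh_cvg : expR (h k) @[k --> \oo] --> (1 : R).
Proof.
rewrite -[X in _ --> X]expR0; apply: continuous_cvg => //; exact: continuous_expR.
Qed.

Let phik_cvg x : phik k x @[k --> \oo] --> phi x.
Proof.
have : (fun k => phi (x + (expR (h k) - 1) *: x)) k @[k --> \oo] --> phi (x + (0 : R) *: x).
  have D := @is_derive_line_at R n.+1 phi x x 0 _ (C1_is_derive (x + 0 *: x) x cphi).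
  have C : {for (0 : R), continuous (fun t : R => phi (x + t *: x))}.
    apply: differentiable_continuous; apply/derivable1_diffP; by case: D.
  apply: (@continuous_cvg _ _ _ _ _ _ (fun t : R => phi (x + t *: x))) => //.
  by rewrite -(subrr (1 : R)); apply: cvgB => //; exact: cvg_cst.
rewrite scale0r addr0; under eq_fun do rewrite scalerBl scale1r addrCA subrr addr0.
exact.
Qed.

Let near_h (e : R) : 0 < e -> \forall k \near \oo, h k < e.
Proof.
move=> e0; have /cvgrPdist_lt/(_ _ e0) := h_cvg; apply: filterS => k.
by rewrite sub0r normrN gtr0_norm.
Qed.

Let dH_cvg x : x != 0 -> dH k x @[k --> \oo] --> (\1_(shell rho tau) x : R).
Proof.
rewrite -enorm_gt0 => x0.
have shE : shell rho tau x <-> ln rho <= ln (enorm x) /\ ln (enorm x) < ln rho + tau.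
  rewrite shellP -{2}(expRK tau) -lnM ?posrE ?expR_gt0//.
  by rewrite ler_ln ?posrE// ltr_ln ?posrE// mulr_gt0// expR_gt0.
apply: cvg_near_cst; have [xr|rx] := ltP (ln (enorm x)) (ln rho).
  have e0 : 0 < ln rho - ln (enorm x) by rewrite subr_gt0.
  apply: filterS (near_h e0) => k hk.
  rewrite /dH !H0 ?(ltW xr)//; last by lra.
  rewrite subrr mul0r indicE memNset// => /shE[]; lra.
have [xt|tx] := ltP (ln (enorm x)) (ln rho + tau).
  have e0 : 0 < ln rho + tau - ln (enorm x) by rewrite subr_gt0.
  apply: filterS (near_h e0) => k hk; have := h_gt0 k => hk0.
  rewrite /dH !H1//; try lra.
  rewrite indicE mem_set; last by apply/shE.
  rewrite (_ : _ - _ - _ = h k); last by ring.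
  by rewrite divff// gt_eqF.
apply: nearW => k; have := h_gt0 k => hk0; rewrite /dH !H2//; last by lra.
by rewrite subrr mul0r indicE memNset// => /shE[]; lra.
Qed.

Let invN0 : invN 0 = 0. Proof. by rewrite /invN enorm0 expr0n /= invr0. Qed.

Let normX_cvg (a : nat -> R) (l : R) : a k @[k --> \oo] --> l ->
  `|a k| ^+ n.+1 @[k --> \oo] --> `|l| ^+ n.+1.
Proof.
move=> al; have c : continuous (fun t : R => `|t| ^+ n.+1).
  by apply: contX; apply: cont_norm => t; exact: cvg_id.
by apply: (@continuous_cvg _ _ _ _ _ _ (fun t : R => `|t| ^+ n.+1)) => //; exact: c.
Qed.

Let P_cvg x : P k x @[k --> \oo] --> Pl x.
Proof.
have [->|x0] := eqVneq x 0.
  rewrite /P /Pl invN0 mulr0 mul0r; under eq_fun do rewrite mulr0 mul0r.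
  exact: cvg_cst.
apply: cvgM; last exact: dH_cvg.
by apply: cvgM; [apply: normX_cvg; exact: phik_cvg|exact: cvg_cst].
Qed.

Let dk_cvg x : dk k x @[k --> \oo] --> `|dot (gradient phi x) x|.
Proof.
pose g (s : R) := phi (0 + expR s *: x).
have D : is_derive (0 : R) 1 g (dot (gradient phi x) x).
  have D1 : is_derive (expR (0 : R)) 1 (fun t : R => phi (0 + t *: x))
      (dot (gradient phi x) x).
    have := @is_derive_line_at R n.+1 phi 0 x 1 _ (C1_is_derive (0 + 1 *: x) x cphi).
    by rewrite expR0 scale1r add0r.
  have := is_derive1_comp D1 (is_derive_expR (0 : R)).
  by rewrite expR0 mulr1.
have /cvg_ex[l Hl] : derivable g 0 1 by case: D.
have El : dot (gradient phi x) x = l.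
  by rewrite -(@derive_val _ _ _ _ _ _ _ D) /derive; apply/cvg_lim.
rewrite El; move/cvgr_dnbhsP : Hl => /(_ h (conj (fun k => lt0r_neq0 (h_gt0 k)) h_cvg)) Hl.
have gE k : `|(h k)^-1 * (g (h k * 1 + 0) - g 0)| = dk k x.
  rewrite normrM gtr0_norm ?invr_gt0// mulrC /dk distrC mulr1 addr0; congr (`|_ - _| / _).
    by rewrite /g expR0 scale1r add0r.
  by rewrite /g /phik add0r.
by under eq_fun do rewrite -gE; exact: cvg_norm Hl.
Qed.

Let Q_cvg x : Q k x @[k --> \oo] --> Ql x.
Proof.
apply: cvgM; last exact: cvg_cst.
apply: cvgM; last exact: cvg_cst.
under eq_fun do rewrite -[dk _ _]ger0_norm//.
by rewrite -[`|dot _ _|]normr_id; apply: normX_cvg; exact: dk_cvg.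
Qed.

Let P_csupp k : csupp r (P k).
Proof. by move=> x rx; rewrite /P (phik0 k rx) normr0 expr0n /= !mul0r. Qed.

Let P_small : small (fun k => \int[mu]_x (`|P k x - Pl x|)%:E)%E.
Proof.
have [M M0 HM] := csupp_bounded (C1_continuous cphi) phi0.
apply: (@DCT_small _ _ _ _ (M ^+ n.+1 * (rho / expR 1) ^- n.+1) r) => //.
have re : 0 < rho / expR 1 by rewrite divr_gt0// expR_gt0.
move=> k x; rewrite ger0_norm//.
have C0 : 0 <= M ^+ n.+1 * (rho / expR 1) ^- n.+1.
  by rewrite mulr_ge0 ?invr_ge0 ?exprn_ge0// ltW.
have [->|x0] := eqVneq x 0; first by rewrite /P invN0 mulr0 mul0r.
have [xr|rx] := ltP (enorm x) (rho / expR 1).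
  rewrite /P /dH !H0 ?subrr ?mul0r ?mulr0//.
    by rewrite ler_ln ?posrE ?enorm_gt0// (le_trans (ltW xr))// ler_pdivrMr ?expR_gt0// ler_peMr ?(ltW r0)// -expR0 ler_expR.
  rewrite -(expRK (h k)) -lnM ?posrE ?enorm_gt0 ?expR_gt0//.
  rewrite ler_ln ?posrE ?mulr_gt0 ?enorm_gt0 ?expR_gt0//.
  rewrite (@le_trans _ _ (rho / expR 1 * expR (h k)))//.
    by rewrite ler_wpM2r ?(ltW xr)// ltW ?expR_gt0.
  by rewrite mulrAC ler_pdivrMr ?expR_gt0// ler_wpM2l ?ler_expR// ltW.
rewrite /P -[leRHS]mulr1; apply: ler_pM => //; rewrite ?mulr_ge0 ?exprn_ge0 ?invN_ge0//.
apply: ler_pM; rewrite ?exprn_ge0 ?invN_ge0//; last exact: invN_le.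
by apply: lerXn2r; rewrite ?nnegrE//; exact: HM.
Qed.

Let Q_small : small (fun k => \int[mu]_x (`|Q k x - Ql x|)%:E)%E.
Proof.
have [M M0 HM] := gradient_bounded cphi phi0.
have C1' : 0 <= M * (expR 1 * `|r|) by rewrite !mulr_ge0// ltW ?expR_gt0.
apply: (@DCT_small _ _ _ _ ((M * (expR 1 * `|r|)) ^+ n.+1 * rho ^- n.+1) r) => //; last first.
  by move=> k x rx; rewrite /Q /dk phik0// phi0// subrr normr0 mul0r expr0n /= !mul0r.
move=> k x; rewrite ger0_norm//.
have C0 : 0 <= (M * (expR 1 * `|r|)) ^+ n.+1 * rho ^- n.+1.
  by rewrite mulr_ge0 ?invr_ge0 ?exprn_ge0// ltW.
have [xr|rx] := ltP (enorm x) rho.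
  by rewrite /Q /out indicE memNset ?mulr0// => /= -[].
have [xr|xr] := leP r (enorm x).
  by rewrite /Q /dk phik0// phi0// subrr normr0 mul0r expr0n /= !mul0r.
rewrite /Q /out indicE mem_set ?mulr1; last first.
  by move=> /= H3; have := lt_le_trans H3 rx; rewrite ltxx.
apply: ler_pM; rewrite ?exprn_ge0 ?invN_ge0//; last exact: invN_le.
apply: lerXn2r; rewrite ?nnegrE//.
rewrite /dk ler_pdivrMr//; rewrite (le_trans (C1_lipschitz cphi HM _ _))//.
rewrite -{1}(scale1r x) -scalerBl enormZ -mulrA ler_wpM2l//.
rewrite distrC ger0_norm ?subr_ge0//.
apply: (@le_trans _ _ (h k * expR (h k) * enorm x)).
  by rewrite ler_wpM2r ?enorm_ge0// expR_sub1_le.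
rewrite mulrC (mulrC (h k)) mulrA ler_wpM2r ?(ltW (h_gt0 k))// mulrC.
apply: ler_pM; rewrite ?enorm_ge0// ?ler_expR// ?(ltW (expR_gt0 _))//.
by rewrite (le_trans (ltW xr))// ler_norm.
Qed.

Let Ql_ge0 x : 0 <= Ql x.
Proof. by rewrite !mulr_ge0 ?exprn_ge0 ?invN_ge0. Qed.

Let Pl_ge0 x : 0 <= Pl x.
Proof. by rewrite !mulr_ge0 ?exprn_ge0 ?invN_ge0// indicE. Qed.

Let D := (\int[mu]_x (enorm (gradient phi x) ^+ n.+1)%:E)%E.

Let Ql_le : (\int[mu]_x (Ql x)%:E <= D)%E.
Proof.
apply: le_int => //.
  apply: measurable_funX; apply: measurable_enorm_comp; exact: measurable_gradient.
move=> x; rewrite /Ql; have [->|x0] := eqVneq x 0.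
  by rewrite invN0 mulr0 mul0r exprn_ge0// enorm_ge0.
apply: (@le_trans _ _ (`|dot (gradient phi x) x| ^+ n.+1 * invN x)).
  by rewrite ler_piMr ?mulr_ge0 ?exprn_ge0 ?invN_ge0// /out indicE; case: (_ \in _).
rewrite /invN ler_pdivrMr ?exprn_gt0 ?enorm_gt0// -exprMn.
by apply: lerXn2r; rewrite ?nnegrE ?mulr_ge0 ?enorm_ge0// normr_dot_le.
Qed.

Lemma shell_estimate_param (lam : R) : 0 < lam ->
  (\int[mu]_x (`|phi x| ^+ n.+1 * invN x * \1_(shell rho tau) x)%:E <=
   tau%:E * ((n%:R * lam)%:E * \int[mu]_x (`|phi x| ^+ n.+1 * invN x * \1_(~` eball rho) x)%:E
     + (lam ^- n)%:E * \int[mu]_x (enorm (gradient phi x) ^+ n.+1)%:E))%E.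
Proof.
move=> l0; rewrite -/Pl -/D -/Y.
have ln0 : 0 <= lam ^- n by rewrite invr_ge0 exprn_ge0// ltW.
apply/lee_addgt0Pr => e e0.
have tl0 : 0 <= tau * lam ^- n by rewrite mulr_ge0// ltW.
have i0 (f : nat -> 'rV[R]_n.+1 -> R) g k : (0 <= \int[mu]_x (`|f k x - g x|)%:E)%E.
  exact: ge0_int.
have [k Hk] := smallD P_small (smallZ tl0 (i0 Q Ql) Q_small) e0.
apply: le_trans (leeD (lexx _) (Hk k (leqnn k))).
apply: (@le_trans _ _ (\int[mu]_x (P k x)%:E + \int[mu]_x (`|P k x - Pl x|)%:E)%E).
  have mPP : measurable_fun setT (fun x => `|P k x - Pl x|) by exact: measurable_normB.
  rewrite -(int_add mu (mP k) mPP)//; apply: le_int => //; first exact: measurable_funD.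
  by move=> x; rewrite distrC -lerBlDl ler_norm.
have swp (x1 x2 x3 : \bar R) : (x1 + (x2 + x3) = (x1 + x3) + x2)%E.
  by rewrite (addeC x2) addeA.
rewrite [leRHS]swp; apply: leeD => //.
apply: le_trans (bound_k k l0) _.
rewrite (EFinM tau (lam ^- n)) -(muleA tau%:E) -ge0_muleDr; last 2 first.
- rewrite adde_ge0// mule_ge0 ?ge0_int ?lee_fin ?mulr_ge0 ?(ltW l0)//.
  by move=> x; rewrite exprn_ge0// enorm_ge0.
- by rewrite mule_ge0 ?lee_fin.
rewrite lee_pmul2l ?lte_fin// -addeA leeD2l// -ge0_muleDr; last 2 first.
- by apply: ge0_int => x; rewrite exprn_ge0// enorm_ge0.
- exact: i0.
rewrite lee_pmul2l ?lte_fin ?invr_gt0 ?exprn_gt0//.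
apply: (@le_trans _ _ (\int[mu]_x (Ql x)%:E + \int[mu]_x (`|Q k x - Ql x|)%:E)%E).
  have mQQ : measurable_fun setT (fun x => `|Q k x - Ql x|) by exact: measurable_normB.
  rewrite -(int_add mu mQl mQQ)//; apply: le_int => //; first exact: measurable_funD.
  by move=> x; rewrite -lerBlDl ler_norm.
by rewrite leeD2r.
Qed.

End estimate.

Definition shell_const : R := n%:R * n.+1%:R ^+ n.+1 + 1.

Lemma shell_const_gt0 : 0 < shell_const.
Proof. by rewrite ltr_wpDl// mulr_ge0// exprn_ge0. Qed.

Lemma shell_estimate (r rho tau : R) phi : C1 phi -> csupp r phi ->
  0 < rho -> rho < r -> 0 < tau ->
  (\int[mu]_x (`|phi x| ^+ n.+1 * invN x * \1_(shell rho tau) x)%:E <=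
   (shell_const * tau * ln (r / rho) ^+ n)%:E *
     \int[mu]_x (enorm (gradient phi x) ^+ n.+1)%:E)%E.
Proof.
move=> cphi phi0 r0 rr t0; pose t : R := ln (r / rho).
have tg0 : 0 < t by rewrite ln_gt0// ltr_pdivlMr// mul1r.
have mphi : measurable_fun setT phi by exact: C1_measurable.
have mout : measurable_fun setT (\1_(~` eball rho) : 'rV[R]_n.+1 -> R).
  by apply: measurable_indic; apply: measurableC; exact: measurable_eball.
have mF : measurable_fun setT (fun x => `|phi x| ^+ n.+1 * invN x * \1_(~` eball rho) x).
  apply: measurable_funM => //; apply: measurable_funM; last exact: measurable_invN.
  by apply: measurable_funX; exact: measurableT_comp.
have [M M0 HM] := csupp_bounded (C1_continuous cphi) phi0.
have [K K0 HK] := gradient_bounded cphi phi0.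
set D := (\int[mu]_x (enorm (gradient phi x) ^+ n.+1)%:E)%E.
have mG : measurable_fun setT (fun x => enorm (gradient phi x) ^+ n.+1).
  by apply: measurable_funX; apply: measurable_enorm_comp; exact: measurable_gradient.
have D0 : (0 <= D)%E by apply: ge0_int => x; rewrite exprn_ge0// enorm_ge0.
have Dfin : D \is a fin_num.
  rewrite ge0_fin_numE//; apply: (@int_lty _ _ _ (K ^+ n.+1) (r + 1)) => //.
  - by move=> x; rewrite exprn_ge0// enorm_ge0.
  - by move=> x; apply: lerXn2r; rewrite ?nnegrE ?enorm_ge0.
  - by move=> x rx; rewrite (csupp_gradient _ phi0 rx) ?ltrDl// enorm0 expr0n.
set Y := (\int[mu]_x (`|phi x| ^+ n.+1 * invN x * \1_(~` eball rho) x)%:E)%E.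
have F0 x : 0 <= `|phi x| ^+ n.+1 * invN x * \1_(~` eball rho) x.
  by rewrite !mulr_ge0 ?exprn_ge0 ?invN_ge0// indicE.
have Y0 : (0 <= Y)%E by exact: ge0_int.
have Yfin : Y \is a fin_num.
  rewrite ge0_fin_numE//; apply: (@int_lty _ _ _ (M ^+ n.+1 * rho ^- n.+1) r) => //.
  - move=> x; have [xr|rx] := ltP (enorm x) rho.
      by rewrite indicE memNset ?mulr0 ?mulr_ge0 ?invr_ge0 ?exprn_ge0 ?(ltW r0)// => /= -[].
    apply: (@le_trans _ _ (`|phi x| ^+ n.+1 * invN x)).
      by rewrite ler_piMr ?mulr_ge0 ?exprn_ge0 ?invN_ge0// indicE; case: (_ \in _).
    apply: ler_pM; rewrite ?exprn_ge0 ?invN_ge0//; last exact: invN_le.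
    by apply: lerXn2r; rewrite ?nnegrE//; exact: HM.
  - by move=> x rx; rewrite phi0// normr0 expr0n /= !mul0r.
have est s lam : 0 < s -> 0 < lam ->
    (\int[mu]_x (`|phi x| ^+ n.+1 * invN x * \1_(shell rho s) x)%:E <=
      (s * (n%:R * lam * fine Y + lam ^- n * fine D))%:E)%E.
  move=> s0 l0; have := shell_estimate_param cphi phi0 r0 s0 l0.
  rewrite -/D -/Y -{1}(fineK Dfin) -{1}(fineK Yfin).
  by rewrite -(EFinM (n%:R * lam)) -(EFinM (lam ^- n)) -EFinD -(EFinM s).
have YE : (Y <= \int[mu]_x (`|phi x| ^+ n.+1 * invN x * \1_(shell rho t) x)%:E)%E.
  apply: le_int => //.
    apply: measurable_funM; last by apply: measurable_indic; exact: measurable_shell.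
    apply: measurable_funM; last exact: measurable_invN.
    by apply: measurable_funX; exact: measurableT_comp.
  move=> x; have [rx|xr] := leP r (enorm x).
    by rewrite phi0// normr0 expr0n /= !mul0r.
  rewrite ler_wpM2l ?mulr_ge0 ?exprn_ge0 ?invN_ge0//.
  have [xs|xs] := ltP (enorm x) rho.
    by rewrite indicE memNset// => /= -[].
  rewrite !indicE [in leRHS]mem_set; first by case: (_ \in _).
  by apply/shellP; rewrite xs lnK ?posrE ?divr_gt0// ?(lt_trans r0)// mulrC divfK ?gt_eqF.
have := D0; rewrite -(fineK Dfin) lee_fin => d0.
have := YE; rewrite -(fineK Yfin) => /le_trans/(_ (est t (n.+1%:R * t)^-1 tg0 _)).
rewrite invr_gt0 mulr_gt0// lee_fin => /(_ isT) Yle.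
have Yle' : fine Y <= n.+1%:R ^+ n.+1 * t ^+ n.+1 * fine D.
  have N0 : (0 : R) < n.+1%:R by [].
  have E1 : t * (n%:R * (n.+1%:R * t)^-1 * fine Y + (n.+1%:R * t)^-1 ^- n * fine D) =
      n%:R / n.+1%:R * fine Y + t * (n.+1%:R * t) ^+ n * fine D.
    rewrite mulrDr exprVn invrK; congr (_ + _); last by rewrite mulrA.
    by field; rewrite !gt_eqF.
  move: Yle; rewrite E1 -lerBlDl.
  rewrite (_ : fine Y - n%:R / n.+1%:R * fine Y = fine Y / n.+1%:R); last first.
    by have nE : (n.+1%:R : R) = n%:R + 1 by [rewrite -natr1]; rewrite nE; field; rewrite -nE gt_eqF.
  rewrite ler_pdivrMr// => /le_trans; apply; rewrite le_eqVlt; apply/orP; left; apply/eqP.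
  by rewrite !exprS exprMn; ring.
apply: le_trans (est tau t^-1 t0 _) _; first by rewrite invr_gt0.
rewrite -EFinM lee_fin exprVn invrK -/t.
apply: (@le_trans _ _ (tau * (n%:R * t^-1 * (n.+1%:R ^+ n.+1 * t ^+ n.+1 * fine D) +
    t ^+ n * fine D))).
  by rewrite ler_wpM2l ?(ltW t0)// lerD2r ler_wpM2l// mulr_ge0// invr_ge0 ltW.
rewrite /shell_const le_eqVlt; apply/orP; left; apply/eqP.
rewrite (exprS t); set X := _ ^+ n.+1; set Z := t ^+ n; field.
by rewrite gt_eqF.
Qed.

End shell_estimate.

Section shells.
Context {R : realType} {n : nat}.
Implicit Types (f u : 'rV[R]_n.+1 -> R) (x y z v : 'rV[R]_n.+1).
Local Notation mu := (lebesgue_rV R n.+1).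

Lemma shell_estimate_lim (r rho tau : R) u g phi : approxW r u g phi ->
  0 < rho -> rho < r -> 0 < tau ->
  (\int[mu]_x (`|u x| ^+ n.+1 * invN x * \1_(shell rho tau) x)%:E <=
   (@shell_const R n * tau * ln (r / rho) ^+ n)%:E *
     \int[mu]_x (enorm (g x) ^+ n.+1)%:E)%E.
Proof.
move=> A r0 rr t0; have Dlt := approxW_grad_lty (ltn0Sn n) A.
case: A => mu_ mg u0 g0 tphi su sg.
have r0' := ltW r0.
pose h x : R := (enorm x)^-1 * \1_(shell rho tau) x.
have h0 x : 0 <= h x by rewrite mulr_ge0 ?invr_ge0 ?enorm_ge0// indicE.
have mh : measurable_fun setT h.
  apply: measurable_funM; last by apply: measurable_indic; exact: measurable_shell.
  by apply: measurable_funV; [exact: enorm_ge0|exact: measurable_enorm].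
have h_le x : h x <= rho^-1.
  rewrite /h indicE; have [/set_mem/shellP[xr _]|xs] := boolP (x \in _).
    by rewrite mulr1 lef_pV2 ?posrE// (lt_le_trans r0).
  by rewrite mulr0 invr_ge0.
have hX f x : (`|f x| * h x) ^+ n.+1 = `|f x| ^+ n.+1 * invN x * \1_(shell rho tau) x.
  rewrite /h /invN !exprMn exprVn mulrA; congr (_ * _); rewrite indicE.
  by case: (_ \in _); rewrite ?expr1n// expr0n.
have mphi k : measurable_fun setT (phi k) by apply: C1_measurable; exact: tame_C1 (tphi k).
have mn f : measurable_fun setT f -> measurable_fun setT (fun x => `|f x|).
  by move=> mf; exact: measurableT_comp.
have mF f : measurable_fun setT f -> measurable_fun setT (fun x => `|f x| * h x).
  by move=> mf; apply: measurable_funM => //; exact: mn.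
have F0 f x : 0 <= `|f x| * h x by rewrite mulr_ge0.
have mD f : measurable_fun setT f -> measurable_fun setT (fun x => `|f x - u x| * h x).
  by move=> mf; apply: measurable_funM => //; apply: mn; exact: measurable_funB.
have C0 : 0 <= @shell_const R n * tau * ln (r / rho) ^+ n :> R.
  rewrite mulr_ge0 ?mulr_ge0 ?(ltW t0) ?(ltW shell_const_gt0)//.
  by rewrite exprn_ge0// ln_ge0// ler_pdivlMr// mul1r ltW.
set C := @shell_const R n * tau * _ in C0 *.
have est k := shell_estimate (tame_C1 (tphi k)) (tame_csupp (tphi k)) r0 rr t0.
have FE k x : `| `|phi k x| * h x - `|u x| * h x | <= `|phi k x - u x| * h x.
  by rewrite -mulrBl normrM (ger0_norm (h0 x)) ler_wpM2r// ler_dist_dist.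
have sE : small (fun k => \int[mu]_x ((`|phi k x - u x| * h x) ^+ n.+1)%:E)%E.
  have c0 : 0 <= rho^-1 ^+ n.+1 by rewrite exprn_ge0// invr_ge0.
  have I0 k : (0 <= \int[mu]_x (`|phi k x - u x| ^+ n.+1)%:E)%E.
    by apply: ge0_int => x; rewrite exprn_ge0.
  apply: small_le (smallZ c0 I0 su) => k.
  have mX : measurable_fun setT (fun x => `|phi k x - u x| ^+ n.+1).
    by apply: measurable_funX; apply: mn; exact: measurable_funB.
  rewrite -(int_scale mu mX c0); last by move=> x; rewrite exprn_ge0.
  apply: le_int.
  - by apply: measurable_funX; exact: mD.
  - exact: measurable_funM.
  - by move=> x; rewrite exprn_ge0// mulr_ge0.
  - move=> x; rewrite exprMn mulrC ler_wpM2r ?exprn_ge0//.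
    by apply: lerXn2r; rewrite ?nnegrE ?invr_ge0.
have Foo : (\int[mu]_x ((`|u x| * h x) ^+ n.+1)%:E < +oo)%E.
  have foo k : (\int[mu]_x ((`|phi k x| * h x) ^+ n.+1)%:E < +oo)%E.
    under eq_integral do rewrite hX.
    apply: le_lt_trans (est k) _; rewrite lte_mul_pinfty ?lee_fin//.
    exact: tame_int_gradient_lty (tphi k).
  exact: (LN_lty (mF _ mu_) (fun k => mF _ (mphi k)) (fun k => mD _ (mphi k))
    (F0 u) (fun k => F0 (phi k)) (fun k x => mulr_ge0 (normr_ge0 (phi k x - u x)) (h0 x)) FE sE foo).
under eq_integral do rewrite -hX.
apply/lee_addgt0Pr => e e0.
have e2 : 0 < e / 2 by rewrite divr_gt0.
have [K1 HK1] := LN_lower (mF _ mu_) (fun k => mF _ (mphi k)) (fun k => mD _ (mphi k))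
  (F0 u) (fun k => F0 (phi k)) (fun k x => mulr_ge0 (normr_ge0 (phi k x - u x)) (h0 x)) FE sE Foo e2.
have e3 : 0 < e / 2 / (C + 1) by rewrite divr_gt0// ltr_wpDl.
have mgk k : measurable_fun setT (gradient (phi k)).
  by apply: measurable_gradient; exact: tame_C1 (tphi k).
have [K2 HK2] := LN_upper (measurable_enorm_comp mg)
  (fun k => measurable_enorm_comp (mgk k))
  (fun k => measurable_enorm_comp (measurable_rVB (mgk k) mg))
  (fun x => enorm_ge0 _) (fun k x => enorm_ge0 _) (fun k x => enorm_ge0 _)
  (fun k x => ler_dist_enorm _ _) sg Dlt e3.
pose k := maxn K1 K2.
apply: le_trans (HK1 k (leq_maxl _ _)) _.
rewrite [in leRHS](splitr e) EFinD addeA leeD2r//.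
under eq_integral do rewrite hX.
apply: le_trans (est k) _; rewrite -/C.
apply: (@le_trans _ _ (C%:E * (\int[mu]_x (enorm (g x) ^+ n.+1)%:E + (e / 2 / (C + 1))%:E))%E).
  by rewrite lee_wpmul2l ?lee_fin// HK2// leq_maxr.
have g0' : (0 <= \int[mu]_x (enorm (g x) ^+ n.+1)%:E)%E.
  by apply: ge0_int => x; rewrite exprn_ge0// enorm_ge0.
rewrite ge0_muleDr ?lee_fin ?(ltW e3)// leeD2l// -EFinM lee_fin.
rewrite mulrCA ger_pMr// ler_pdivrMr ?ltr_wpDl// mul1r lerDl.
exact: ler01.
Qed.

End shells.

Section series.
Context {R : realType}.

Lemma nneseries_le (f : nat -> R) (S : R) : (forall j, 0 <= f j) ->
  (forall k, \sum_(0 <= j < k) f j <= S) -> (\sum_(j <oo) (f j)%:E <= S%:E)%E.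
Proof.
move=> f0 fS; apply: lime_le.
  by apply: is_cvg_nneseries => j _ _; rewrite lee_fin.
by apply: nearW => k; rewrite sumEFin lee_fin.
Qed.

Lemma powR_step (d x : R) : 0 < d -> 1 <= x ->
  d / (2 + d) * x `^ (- (1 + d)) <= x `^ (- d) - (x + 1) `^ (- d).
Proof.
move=> d0 x1; have x0 : 0 < x by exact: lt_le_trans x1.
have x10 : 0 < x + 1 by rewrite addr_gt0.
have -> : x `^ (- (1 + d)) = x `^ (- d) / x.
  by rewrite opprD addrC powRD ?(gt_eqF x0) ?implybT// powR_inv1// ltW.
have l : (x + 1)^-1 <= ln ((x + 1) / x).
  have : ln (1 + - (x + 1)^-1) <= - (x + 1)^-1.
    apply: le_ln1Dx; rewrite ltrN2 invf_lt1// ltrDr//.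
  rewrite (_ : 1 + - (x + 1)^-1 = x / (x + 1)); last by field; rewrite gt_eqF.
  by rewrite -[x / (x + 1)]invf_div lnV ?posrE ?divr_gt0// lerN2.
have e : ((x + 1) / x) `^ (- d) <= (x + 1) / (x + 1 + d).
  rewrite powRN /powR gt_eqF ?divr_gt0//.
  rewrite -[leRHS]invrK lef_pV2 ?posrE ?invr_gt0 ?divr_gt0 ?expR_gt0 ?addr_gt0//.
  rewrite invf_div; apply: le_trans (expR_ge1Dx _).
  apply: (@le_trans _ _ (1 + d * (x + 1)^-1)); last by rewrite lerD2l ler_wpM2l// ltW.
  by rewrite le_eqVlt; apply/orP; left; apply/eqP; field; rewrite gt_eqF.
rewrite [in leRHS](_ : x + 1 = x * ((x + 1) / x)); last by rewrite mulrCA divff ?mulr1// gt_eqF.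
rewrite powRM ?(ltW x0) ?divr_ge0 ?(ltW x10) ?(ltW x0)//.
rewrite -[X in _ <= X - _]mulr1 -mulrBr mulrCA ler_wpM2l ?powR_ge0//.
have : 1 - (x + 1) / (x + 1 + d) <= 1 - ((x + 1) / x) `^ (- d) by rewrite lerD2l lerN2.
apply: le_trans.
rewrite (_ : 1 - _ = d / (x + 1 + d)); last by field; rewrite gt_eqF// addr_gt0.
rewrite -mulrA ler_wpM2l ?(ltW d0)// -invfM lef_pV2 ?posrE ?mulr_gt0 ?addr_gt0//.
have := mulr_ge0 (ltW d0) (ltW x0); nra.
Qed.

Lemma zeta_le (s : R) : 1 < s -> forall k,
  \sum_(0 <= j < k) j.+1%:R `^ (- s) <= (s + 1) / (s - 1).
Proof.
move=> s1 k; pose d : R := s - 1; have d0 : 0 < d by rewrite subr_gt0.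
have c0 : 0 < d / (2 + d) by rewrite divr_gt0// addr_gt0.
have cV : (s + 1) / (s - 1) = (d / (2 + d))^-1.
  by rewrite invf_div /d; congr (_ / _); ring.
have H : d / (2 + d) * \sum_(0 <= j < k) j.+1%:R `^ (- s) <= 1 - k.+1%:R `^ (- d).
  elim: k => [|k IH]; first by rewrite big_geq// mulr0 powR1 subrr.
  rewrite big_nat_recr//= mulrDr.
  have -> : - s = - (1 + d) by rewrite /d; ring.
  have := @powR_step d k.+1%:R d0; rewrite ler1n => /(_ isT).
  rewrite natr1; have -> : - (1 + d) = - s by rewrite /d; ring.
  by move: IH; lra.
rewrite cV -[leRHS]mul1r ler_pdivlMr// mulrC (le_trans H)//.
Qed.

Lemma weight_series (p g M : R) : 0 <= p -> p + 1 < g -> 0 < M ->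
  exists2 S : R, 0 < S &
    (\sum_(j <oo) (j.+1%:R `^ p * (M + j%:R) `^ (- g))%:E <= S%:E)%E.
Proof.
move=> p0 pg M0; pose m := Num.min 1 M.
have m0 : 0 < m by rewrite lt_min ltr01.
have s1 : 1 < g - p by lra.
exists (m `^ (- g) * ((g - p + 1) / (g - p - 1))).
  by rewrite mulr_gt0 ?powR_gt0// divr_gt0//; lra.
apply: nneseries_le => [j|k]; first by rewrite mulr_ge0 ?powR_ge0.
apply: le_trans (ler_wpM2l (powR_ge0 m (- g)) (zeta_le s1 k)).
rewrite mulr_sumr; apply: ler_sum => j _.
have j0 : (0 : R) < j.+1%:R by [].
rewrite (_ : - (g - p) = p + - g); last by ring.
rewrite powRD ?(gt_eqF j0) ?implybT// mulrCA ler_wpM2l ?powR_ge0//.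
rewrite -powRM ?(ltW m0)// !powRN lef_pV2 ?posrE ?powR_gt0 ?mulr_gt0 ?ltr_wpDr//.
apply: ge0_ler_powR; rewrite ?nnegrE ?mulr_ge0 ?addr_ge0 ?(ltW m0) ?(ltW M0)//; first lra.
rewrite -natr1 mulrDr mulr1 addrC lerD ?ge_min ?lexx ?orbT//.
by rewrite ler_piMl// ge_min lexx.
Qed.

End series.

Section shell_volume.
Context {R : realType} {n : nat}.
Implicit Types (x y z v : 'rV[R]_n.+1).
Local Notation mu := (lebesgue_rV R n.+1).
Local Notation V := (unit_vol n.+1 : R).

Lemma lebesgue_shell (rho tau : R) : 0 < rho -> 0 < tau ->
  mu (shell rho tau) = (rho ^+ n.+1 * V * (expR tau ^+ n.+1 - 1))%:E.
Proof.
move=> r0 t0; have e0 := expR_gt0 tau.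
have sub : eball rho `<=` (eball (rho * expR tau) : set 'rV[R]_n.+1).
  by move=> x; rewrite /eball /= => /lt_le_trans; apply; rewrite ler_peMr ?ltW// -expR0 ltr_expR.
rewrite [LHS](_ : _ = ((rho * expR tau) ^+ n.+1 * V)%:E - (rho ^+ n.+1 * V)%:E)%E.
  by rewrite -EFinB exprMn; congr (_%:E); ring.
rewrite -(lebesgue_eball n.+1 (mulr_gt0 r0 e0)) -(lebesgue_eball n.+1 r0).
rewrite -[in RHS](setIidr sub); apply: measureD; try exact: measurable_eball.
exact: lebesgue_eball_lty.
Qed.

Lemma expRX_sub1_ge (tau : R) : 0 < tau -> tau <= expR tau ^+ n.+1 - 1.
Proof.
move=> t0; have := expR_ge1Dx tau => H.
rewrite lerBrDl; apply: le_trans H _; rewrite ler_eXnr//.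
by rewrite -expR0 ler_expR ltW.
Qed.

Lemma expRX_sub1_le (tau : R) : 0 < tau -> tau <= 1 ->
  expR tau ^+ n.+1 - 1 <= tau * (n.+1%:R * expR n.+1%:R).
Proof.
move=> t0 t1; rewrite -expRM_natl; apply: le_trans (expR_sub1_le _) _.
have h0 : 0 <= n.+1%:R * tau by rewrite mulr_ge0// ltW.
rewrite [leRHS](_ : _ = n.+1%:R * tau * expR n.+1%:R); last by ring.
by apply: ler_wpM2l => //; rewrite ler_expR ler_piMr.
Qed.

Definition shell_vol : R := V * (n.+1%:R * expR n.+1%:R).

Lemma shell_vol_gt0 : 0 < shell_vol.
Proof. by rewrite !mulr_gt0 ?unit_vol_gt0 ?expR_gt0. Qed.

Lemma measurable_invN_shell rho tau :
  measurable_fun setT (fun x => invN x * \1_(shell rho tau) x : R).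
Proof.
apply: measurable_funM; first exact: measurable_invN.
by apply: measurable_indic; exact: measurable_shell.
Qed.

Lemma invN_shell_le rho tau : 0 < rho -> 0 < tau -> tau <= 1 ->
  (\int[mu]_x (invN x * \1_(shell rho tau) x)%:E <= (shell_vol * tau)%:E)%E.
Proof.
move=> r0 t0 t1; have c0 : 0 <= rho ^- n.+1 by rewrite invr_ge0 exprn_ge0// ltW.
have mS : measurable (shell rho tau : set 'rV[R]_n.+1) by exact: measurable_shell.
have i0 (x : 'rV[R]_n.+1) : 0 <= \1_(shell rho tau) x :> R by rewrite indicE.
apply: (@le_trans _ _ (\int[mu]_x (rho ^- n.+1 * \1_(shell rho tau) x)%:E)%E).
  apply: le_int.
  - exact: measurable_invN_shell.
  - by apply: measurable_funM; [exact: measurable_cst|apply: measurable_indic].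
  - by move=> x; rewrite mulr_ge0 ?invN_ge0.
  - move=> x; rewrite indicE; have [/set_mem/shellP[xr _]|xs] := boolP (x \in _).
      by rewrite !mulr1 invN_le.
    by rewrite !mulr0.
have mI : measurable_fun setT (\1_(shell rho tau) : 'rV[R]_n.+1 -> R) by exact: measurable_indic.
rewrite (int_scale mu mI c0 i0).
rewrite (etrans (esym (measure_indic mu mS)) (lebesgue_shell r0 t0)) -EFinM lee_fin /shell_vol.
rewrite !mulrA mulVf ?mul1r ?expf_neq0 ?gt_eqF// -!mulrA ler_wpM2l ?(ltW (unit_vol_gt0 _))//.
by rewrite mulrA mulrC expRX_sub1_le.
Qed.

Lemma invN_shell_ge rho tau : 0 < rho -> 0 < tau -> tau <= 1 ->
  ((V * expR (- n.+1%:R) * tau)%:E <= \int[mu]_x (invN x * \1_(shell rho tau) x)%:E)%E.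
Proof.
move=> r0 t0 t1; pose c : R := (rho * expR tau) ^- n.+1.
have re0 : 0 < rho * expR tau by rewrite mulr_gt0 ?expR_gt0.
have c0 : 0 <= c by rewrite invr_ge0 exprn_ge0// ltW.
have mS : measurable (shell rho tau : set 'rV[R]_n.+1) by exact: measurable_shell.
have i0 (x : 'rV[R]_n.+1) : 0 <= \1_(shell rho tau) x :> R by rewrite indicE.
apply: (@le_trans _ _ (\int[mu]_x (c * \1_(shell rho tau) x)%:E)%E); last first.
  apply: le_int.
  - by apply: measurable_funM; [exact: measurable_cst|apply: measurable_indic].
  - exact: measurable_invN_shell.
  - by move=> x; rewrite mulr_ge0.
  - move=> x; rewrite indicE; have [/set_mem/shellP[xr xt]|xs] := boolP (x \in _).
      rewrite !mulr1 /c lef_pV2 ?posrE ?exprn_gt0// ?(lt_le_trans r0)//.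
      by apply: lerXn2r; rewrite ?nnegrE ?enorm_ge0 ?ltW.
    by rewrite !mulr0.
have mI : measurable_fun setT (\1_(shell rho tau) : 'rV[R]_n.+1 -> R) by exact: measurable_indic.
rewrite (int_scale mu mI c0 i0).
rewrite (etrans (esym (measure_indic mu mS)) (lebesgue_shell r0 t0)) -EFinM lee_fin /c.
have rX : rho ^+ n.+1 != 0 by rewrite expf_neq0 ?gt_eqF.
have eX : expR tau ^+ n.+1 != 0 by rewrite expf_neq0 ?gt_eqF ?expR_gt0.
rewrite [leRHS](_ : _ = V * (expR tau ^- n.+1 * (expR tau ^+ n.+1 - 1))); last first.
  by rewrite exprMn; move: rX eX; set X := rho ^+ _; set Y := expR tau ^+ _ => X0 Y0; field; apply/andP.
rewrite -mulrA ler_wpM2l ?(ltW (unit_vol_gt0 _))//.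
apply: ler_pM; rewrite ?expR_ge0 ?(ltW t0)//; last exact: expRX_sub1_ge.
by rewrite -expRM_natl -expRN ler_expR lerN2 ler_piMr.
Qed.

End shell_volume.

Section weighted_bounds.
Context {R : realType} {n : nat}.
Implicit Types (f u : 'rV[R]_n.+1 -> R) (x y z v : 'rV[R]_n.+1).
Local Notation mu := (lebesgue_rV R n.+1).

Definition ashell (r tau : R) (j : nat) : set 'rV[R]_n.+1 :=
  shell (r * expR (- (j.+1%:R * tau))) tau.

Lemma ashellP r tau j x : ashell r tau j x <->
  r * expR (- (j.+1%:R * tau)) <= enorm x /\ enorm x < r * expR (- (j%:R * tau)).
Proof.
rewrite /ashell shellP -mulrA -expRD (_ : - (j.+1%:R * tau) + tau = - (j%:R * tau))//.
by rewrite -natr1; ring.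
Qed.

Lemma ashell_cover (r tau : R) x : 0 < tau -> x != 0 -> enorm x < r ->
  exists j, ashell r tau j x.
Proof.
rewrite -enorm_gt0 => t0 x0 xr; have r0 := lt_trans x0 xr.
pose y := ln (r / enorm x) / tau.
have [m Hm] : exists m : nat, y <= m%:R.
  exists (Num.Def.trunc y).+1; have [y0|y0] := leP 0 y.
    by rewrite ltW//; have /andP[] := Num.Theory.trunc_itv y0.
  by rewrite (le_trans (ltW y0)).
case: (ex_minnP (ex_intro (fun m : nat => y <= m%:R) m Hm)) => -[|j] Hj minj.
  exfalso; have : 0 < y by rewrite divr_gt0// ln_gt0// ltr_pdivlMr// mul1r.
  by rewrite ltNge Hj.
have jy : j%:R < y.
  by rewrite ltNge; apply/negP => /minj; rewrite ltnn.
have E : enorm x = r * expR (- (y * tau)).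
  rewrite /y divfK ?gt_eqF// expRN lnK ?posrE ?divr_gt0// invf_div mulrC divfK//.
  by rewrite gt_eqF.
exists j; apply/ashellP; rewrite E ler_wpM2l ?(ltW r0) ?ler_expR ?lerN2 ?ler_wpM2r ?(ltW t0)//.
by rewrite ltr_pM2l// ltr_expR ltrN2 ltr_pM2r.
Qed.

Definition shell_int (r q tau : R) u j : \bar R :=
  (\int[mu]_x (`|u x| `^ q * invN x * \1_(ashell r tau j) x)%:E)%E.

Lemma measurable_shell_int (r q tau : R) u j : measurable_fun setT u ->
  measurable_fun setT (fun x => `|u x| `^ q * invN x * \1_(ashell r tau j) x).
Proof.
move=> mu_; apply: measurable_funM; last by apply: measurable_indic; exact: measurable_shell.
apply: measurable_funM; last exact: measurable_invN.
by apply: measurable_fun_powR; exact: measurableT_comp.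
Qed.

Definition hweight (r a beta : R) x : R := (enorm x ^+ n.+1 * ln (a * r / enorm x) `^ beta)^-1.

Lemma measurable_hweight r a beta : measurable_fun setT (hweight r a beta).
Proof.
apply: measurable_funV.
  by move=> x; rewrite mulr_ge0 ?exprn_ge0 ?enorm_ge0 ?powR_ge0.
apply: measurable_funM; first by apply: measurable_funX; exact: measurable_enorm.
apply: measurable_fun_powR; apply: measurableT_comp; first exact: measurable_ln.
apply: measurable_funM => //; apply: measurable_funV; last exact: measurable_enorm.
by move=> x; exact: enorm_ge0.
Qed.

Lemma hweight_ge0 r a beta x : 0 <= hweight r a beta x.
Proof. by rewrite invr_ge0 mulr_ge0 ?exprn_ge0 ?enorm_ge0 ?powR_ge0. Qed.

Lemma hweight0 r a beta : hweight r a beta 0 = 0.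
Proof. by rewrite /hweight enorm0 expr0n mul0r invr0. Qed.

Lemma hweight_le (r a beta s : R) x : 0 < r -> 1 < a -> 0 <= beta -> x != 0 ->
  0 <= s -> enorm x <= r * expR (- s) ->
  hweight r a beta x <= (ln a + s) `^ (- beta) * invN x.
Proof.
rewrite -enorm_gt0 => r0 a1 b0 x0 s0 xs; have a0 : 0 < a by exact: lt_trans a1.
have La : 0 < ln a by exact: ln_gt0.
rewrite /hweight invfM mulrC -/(invN x) ler_wpM2r ?invN_ge0//.
have H : ln a + s <= ln (a * r / enorm x).
  rewrite -{1}(expRK s) -lnM ?posrE ?expR_gt0//.
  rewrite ler_ln ?posrE ?divr_gt0 ?mulr_gt0 ?expR_gt0// ler_pdivlMr//.
  rewrite -mulrA ler_wpM2l ?(ltW a0)// mulrC -ler_pdivlMr ?expR_gt0//.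
  by rewrite -expRN.
have A0 : 0 < ln a + s by rewrite ltr_wpDr.
have B0 := lt_le_trans A0 H.
rewrite powRN lef_pV2 ?posrE ?powR_gt0//.
by apply: ge0_ler_powR; rewrite ?nnegrE// ltW.
Qed.

Lemma weightedE (r a q beta : R) u : weighted r a q beta u =
  (\int[mu]_(x in eball r) (`|u x| `^ q * hweight r a beta x)%:E)%E.
Proof. by []. Qed.

Lemma weighted_le_series (r a q beta tau : R) u : 0 < r -> 1 < a -> 0 <= beta ->
  0 < tau -> measurable_fun setT u ->
  (weighted r a q beta u <=
   \sum_(j <oo) ((ln a + j%:R * tau) `^ (- beta))%:E * shell_int r q tau u j)%E.
Proof.
move=> r0 a1 b0 t0 mu_.
pose f j x : \bar R := ((ln a + j%:R * tau) `^ (- beta) *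
  (`|u x| `^ q * invN x * \1_(ashell r tau j) x))%:E.
have F0 j x : 0 <= `|u x| `^ q * invN x * \1_(ashell r tau j) x.
  by rewrite !mulr_ge0 ?powR_ge0 ?invN_ge0// indicE.
have f0 j x : (0 <= f j x)%E by rewrite lee_fin mulr_ge0 ?powR_ge0.
have mf j : measurable_fun setT (f j).
  by apply/measurable_EFinP; apply: measurable_funM => //; exact: measurable_shell_int.
have -> : (\sum_(j <oo) ((ln a + j%:R * tau) `^ (- beta))%:E * shell_int r q tau u j =
    \int[mu]_x (\sum_(j <oo) f j x))%E.
  rewrite integral_nneseries//; apply: eq_eseriesr => j _.
  rewrite /f (int_scale mu (measurable_shell_int r q tau j mu_))//; exact: powR_ge0.
rewrite weightedE integral_mkcond; apply: ge0_le_integral => //.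
- by move=> x _; rewrite patchE; case: ifP => // _; rewrite lee_fin mulr_ge0 ?powR_ge0 ?hweight_ge0.
- apply/(measurable_restrictT _ (measurable_eball _)); apply/measurable_EFinP.
  apply: measurable_funS (measurable_funM _ (measurable_hweight r a beta)) => //.
  by apply: measurable_fun_powR; exact: measurableT_comp.
- by apply: ge0_emeasurable_sum => j *; [exact: f0|exact: mf].
move=> x _; rewrite patchE; case: ifPn => [/set_mem /= xr|_]; last exact: nneseries_ge0.
have [->|x0] := eqVneq x 0.
  by rewrite hweight0 mulr0; apply: nneseries_ge0.
have [j xj] := ashell_cover t0 x0 xr.
have /ashellP[_ xj2] := xj.
apply: le_trans (@nneseries_lim_ge R (fun i => f i x) xpredT 0%N j.+1 (fun i _ _ => f0 i x)).
rewrite big_nat_recr//=; apply: le_trans (leeDr _ _); last by apply: sume_ge0 => i _.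
rewrite lee_fin indicE mem_set// mulr1 mulrCA ler_wpM2l ?powR_ge0//.
by apply: hweight_le => //; [rewrite mulr_ge0// ltW|exact: ltW].
Qed.

Lemma weighted_le (r a q beta tau c : R) (K : R) u : 0 < r -> 1 < a -> 0 <= beta ->
  0 < tau -> measurable_fun setT u -> 0 <= c -> 0 <= K ->
  (forall j, shell_int r q tau u j <= (c * j.+1%:R `^ K)%:E)%E ->
  (weighted r a q beta u <=
   c%:E * \sum_(j <oo) (j.+1%:R `^ K * (ln a + j%:R * tau) `^ (- beta))%:E)%E.
Proof.
move=> r0 a1 b0 t0 mu_ c0 K0 H.
apply: le_trans (weighted_le_series q r0 a1 b0 t0 mu_) _.
rewrite -nneseriesZl; last by move=> j _; rewrite lee_fin mulr_ge0 ?powR_ge0.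
apply: lee_nneseries => [j _ _|j _].
  rewrite mule_ge0 ?lee_fin ?powR_ge0//; apply: ge0_int => x.
  by rewrite !mulr_ge0 ?powR_ge0 ?invN_ge0// indicE.
rewrite (mulrC (j.+1%:R `^ K)) EFinM muleCA lee_wpmul2l ?lee_fin ?powR_ge0//.
Qed.

End weighted_bounds.

Section weighted_finite.
Context {R : realType} {n : nat}.
Implicit Types (f u : 'rV[R]_n.+1 -> R) (x y z v : 'rV[R]_n.+1).
Local Notation mu := (lebesgue_rV R n.+1).

Lemma powR_le_expr (q c y : R) : 0 < q -> q <= n.+1%:R -> 0 < c -> 0 <= y ->
  y `^ q <= c `^ (q / n.+1%:R) * (y ^+ n.+1 / c + 1).
Proof.
move=> q0 qN c0 y0; set th := q / n.+1%:R.
have th0 : 0 < th by rewrite divr_gt0.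
have th1 : th <= 1 by rewrite ler_pdivrMr// mul1r.
have s0 : 0 <= y ^+ n.+1 / c by rewrite divr_ge0 ?exprn_ge0// ltW.
have -> : y `^ q = c `^ th * (y ^+ n.+1 / c) `^ th.
  rewrite -powRM ?(ltW c0)// mulrC divfK ?gt_eqF// -powR_mulrn// -powRrM.
  by congr (_ `^ _); rewrite /th mulrC divfK.
rewrite ler_wpM2l ?powR_ge0//; have [s1|s1] := leP 1 (y ^+ n.+1 / c).
  by rewrite (le_trans (ler1_powR s1 th1))// lerDl.
rewrite (@le_trans _ _ 1) ?lerDr// -[leRHS](congr1 (fun h : R -> R => h th) (powR1 R)).
by apply: ge0_ler_powR; rewrite ?nnegrE//; exact: ltW.
Qed.

Lemma ln_shell (r tau : R) j : 0 < r -> ln (r / (r * expR (- (j.+1%:R * tau)))) = j.+1%:R * tau.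
Proof. by move=> r0; rewrite invfM mulrA divff ?gt_eqF// mul1r -expRN opprK expRK. Qed.

Lemma weighted_lty (r a q beta : R) u g phi : 0 < r -> 1 < a -> 0 < q ->
  q <= n.+1%:R -> n%:R / n.+1%:R * q + 1 < beta -> approxW r u g phi ->
  (weighted r a q beta u < +oo)%E.
Proof.
move=> r0 a1 q0 qN hb A; have mu_ := approxW_mu A.
have Dlt := approxW_grad_lty (ltn0Sn n) A.
have D0 : (0 <= \int[mu]_x (enorm (g x) ^+ n.+1)%:E)%E.
  by apply: ge0_int => x; rewrite exprn_ge0// enorm_ge0.
pose D : R := fine (\int[mu]_x (enorm (g x) ^+ n.+1)%:E).
have DE : (\int[mu]_x (enorm (g x) ^+ n.+1)%:E = D%:E)%E.
  by rewrite fineK// ge0_fin_numE.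
have D0' : 0 <= D by exact: fine_ge0.
have p0 : 0 <= n%:R / n.+1%:R * q :> R by rewrite mulr_ge0 ?divr_ge0// ltW.
have C0 := @shell_const_gt0 R n; have V0 := @shell_vol_gt0 R n.
have c0 : 0 <= @shell_const R n * D + @shell_vol R n by exact: addr_ge0 (mulr_ge0 (ltW C0) D0') (ltW V0).
have b0 : 0 <= beta by rewrite ltW// (le_lt_trans _ hb)// addr_ge0.
have [S S0 HS] := weight_series p0 hb (ln_gt0 a1).
have H j : (shell_int r q 1 u j <=
    ((@shell_const R n * D + @shell_vol R n) * j.+1%:R `^ (n%:R / n.+1%:R * q))%:E)%E.
  have j0 : (0 : R) < j.+1%:R by [].
  pose rho : R := r * expR (- (j.+1%:R * 1)).
  have rho0 : 0 < rho by rewrite mulr_gt0 ?expR_gt0.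
  have rhor : rho < r by rewrite gtr_pMr// -expR0 ltr_expR oppr_lt0 mulr1.
  have E1 := shell_estimate_lim A rho0 rhor ltr01.
  have E2 := @invN_shell_le R n rho 1 rho0 ltr01 (lexx _).
  rewrite ln_shell// mulr1 in E1; rewrite mulr1 in E2.
  pose c : R := j.+1%:R ^+ n.
  have cg0 : 0 < c by exact: exprn_gt0.
  have cE : j.+1%:R `^ (n%:R / n.+1%:R * q) = c `^ (q / n.+1%:R).
    by rewrite /c -powR_mulrn ?ltW// -powRrM mulrAC mulrA.
  have m1 : measurable_fun setT (fun x => `|u x| ^+ n.+1 * invN x * \1_(shell rho 1) x).
    apply: measurable_funM; last by apply: measurable_indic; exact: measurable_shell.
    apply: measurable_funM; last exact: measurable_invN.
    by apply: measurable_funX; exact: measurableT_comp.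
  have m2 := @measurable_invN_shell R n rho 1.
  have p1 x : 0 <= `|u x| ^+ n.+1 * invN x * \1_(shell rho 1) x.
    by rewrite !mulr_ge0 ?exprn_ge0 ?invN_ge0// indicE.
  have p2 x : 0 <= invN x * \1_(shell rho 1) x by rewrite mulr_ge0 ?invN_ge0// indicE.
  have cV0 : 0 <= c^-1 by rewrite invr_ge0 ltW.
  pose F x := c^-1 * (`|u x| ^+ n.+1 * invN x * \1_(shell rho 1) x) + invN x * \1_(shell rho 1) x.
  have m1' : measurable_fun setT (fun x => c^-1 * (`|u x| ^+ n.+1 * invN x * \1_(shell rho 1) x)).
    exact: measurable_funM.
  have mF : measurable_fun setT F by exact: measurable_funD.
  apply: (@le_trans _ _ (\int[mu]_x (c `^ (q / n.+1%:R) * F x)%:E)%E).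
    apply: le_int.
    - exact: measurable_shell_int.
    - exact: measurable_funM.
    - by move=> x; rewrite !mulr_ge0 ?powR_ge0 ?invN_ge0// indicE.
    - move=> x; rewrite /F.
      rewrite [leRHS](_ : _ = (c `^ (q / n.+1%:R) * (`|u x| ^+ n.+1 / c + 1)) * invN x * \1_(shell rho 1) x).
        rewrite ler_wpM2r ?indicE// ler_wpM2r ?invN_ge0//.
        exact: powR_le_expr.
      by field; rewrite gt_eqF.
  have F0 x : 0 <= F x by rewrite addr_ge0// mulr_ge0.
  rewrite (int_scale mu mF (powR_ge0 _ _) F0) (int_add mu m1' m2)//; last first.
    by move=> x; rewrite mulr_ge0.
  rewrite (int_scale mu m1 cV0 p1) cE (mulrC _ (c `^ _)) EFinM lee_wpmul2l ?lee_fin ?powR_ge0//.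
  rewrite EFinD leeD//.
  apply: (le_trans (lee_wpmul2l _ E1)); first by rewrite lee_fin.
  rewrite DE.
  rewrite -EFinM lee_fin mulr1 -/c le_eqVlt; apply/orP; left; apply/eqP.
  by field; rewrite gt_eqF.
apply: le_lt_trans (weighted_le r0 a1 b0 ltr01 mu_ c0 p0 H) _.
under eq_eseriesr do rewrite mulr1.
by rewrite lte_mul_pinfty ?lee_fin// (le_lt_trans HS)// ltry.
Qed.

Lemma weighted_bound_le (r a q beta tau B p : R) u : 0 < r -> 1 < a -> 0 < q ->
  0 <= beta -> 0 < tau -> tau <= 1 -> 0 <= p -> 0 <= B -> measurable_fun setT u ->
  {ae mu, forall x, 0 < enorm x -> enorm x < r -> `|u x| <= B * ln (r / enorm x) `^ p} ->
  (weighted r a q beta u <=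
   (B `^ q * @shell_vol R n * tau * tau `^ (p * q))%:E *
    \sum_(j <oo) (j.+1%:R `^ (p * q) * (ln a + j%:R * tau) `^ (- beta))%:E)%E.
Proof.
move=> r0 a1 q0 b0 t0 t1 p0 B0 mu_ H; have V0 := @shell_vol_gt0 R n.
have c0 : 0 <= B `^ q * @shell_vol R n * tau * tau `^ (p * q).
  by exact: mulr_ge0 (mulr_ge0 (mulr_ge0 (powR_ge0 _ _) (ltW V0)) (ltW t0)) (powR_ge0 _ _).
apply: weighted_le => //; first by rewrite mulr_ge0// ltW.
move=> j; pose rho : R := r * expR (- (j.+1%:R * tau)).
have rho0 : 0 < rho by rewrite mulr_gt0 ?expR_gt0.
have E2 := @invN_shell_le R n rho tau rho0 t0 t1.
have m2 := @measurable_invN_shell R n rho tau.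
have p2 x : 0 <= invN x * \1_(shell rho tau) x by rewrite mulr_ge0 ?invN_ge0// indicE.
pose M : R := B `^ q * (j.+1%:R * tau) `^ (p * q).
have M0 : 0 <= M by rewrite mulr_ge0 ?powR_ge0.
apply: (@le_trans _ _ (\int[mu]_x (M * (invN x * \1_(shell rho tau) x))%:E)%E).
  apply: ae_ge0_le_integral => //.
  - by move=> x _; rewrite lee_fin !mulr_ge0 ?powR_ge0 ?invN_ge0// indicE.
  - by apply/measurable_EFinP; exact: measurable_shell_int.
  - by move=> x _; rewrite lee_fin mulr_ge0.
  - by apply/measurable_EFinP; exact: measurable_funM.
  apply: filterS H => x Hx _; rewrite lee_fin mulrA.
  rewrite !indicE; have [/set_mem xs|xs] := boolP (x \in _); last by rewrite !mulr0.
  rewrite !mulr1 ler_wpM2r ?invN_ge0//.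
  have [xr xt] := iffLR (ashellP _ _ _ _) xs.
  have x0 : 0 < enorm x by exact: lt_le_trans xr.
  have xr' : enorm x < r.
    apply: lt_le_trans xt _; rewrite ger_pMr// -[leRHS]expR0 ler_expR oppr_le0.
    by rewrite mulr_ge0// ltW.
  have l0 : 0 <= ln (r / enorm x) by rewrite ln_ge0// ler_pdivlMr// mul1r ltW.
  have jt0 : 0 <= j.+1%:R * tau by rewrite mulr_ge0// ltW.
  have lj : ln (r / enorm x) <= j.+1%:R * tau.
    rewrite -(ln_shell tau j r0) ler_ln ?posrE ?divr_gt0//.
    by rewrite ler_wpM2l ?(ltW r0)// lef_pV2 ?posrE.
  rewrite /M powRrM -powRM ?powR_ge0//.
  apply: ge0_ler_powR; rewrite ?nnegrE ?mulr_ge0 ?powR_ge0//; first exact: ltW.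
  apply: le_trans (Hx x0 xr') _; rewrite ler_wpM2l//.
  by apply: ge0_ler_powR; rewrite ?nnegrE.
rewrite (int_scale mu m2 M0 p2).
apply: (le_trans (lee_wpmul2l _ E2)); first by rewrite lee_fin.
rewrite -EFinM lee_fin /M powRM ?(ltW t0)// le_eqVlt; apply/orP; left; apply/eqP.
ring.
Qed.

End weighted_finite.

(** * Rotation-invariant functions are radial *)

Section cone.
Context {R : realType} {N : nat}.
Implicit Types (f g h : 'rV[R]_N -> R) (x y z v : 'rV[R]_N).
Local Notation mu := (lebesgue_rV R N).

Definition cone (e : R) z : R := Num.max 0 (e - enorm z).

Lemma cone_ge0 e z : 0 <= cone e z. Proof. by rewrite /cone le_max lexx. Qed.

Lemma cone_le e z : 0 <= e -> cone e z <= e.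
Proof. by move=> e0; rewrite /cone ge_max e0 gerBl enorm_ge0. Qed.

Lemma cone0 e z : e <= enorm z -> cone e z = 0.
Proof. by move=> ez; rewrite /cone (max_idPl _)// subr_le0. Qed.

Lemma measurable_cone e : measurable_fun setT (cone e).
Proof.
apply: measurable_maxr; first exact: measurable_cst.
by apply: measurable_funB; [exact: measurable_cst|exact: measurable_enorm].
Qed.

Lemma cone_lip e y z : `|cone e y - cone e z| <= enorm (y - z).
Proof.
have := ler_dist_enorm z y; rewrite -(enormN (z - y)) opprB /cone.
move: (enorm y) (enorm z) (enorm (y - z)) => a b c.
rewrite !ler_norml => /andP[h1 h2].
by case: (leP 0 (e - a)) => h3; case: (leP 0 (e - b)) => h4; apply/andP; split; lra.
Qed.

Definition cone_int e : R := fine (\int[mu]_z (cone e z)%:E)%E.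

Lemma cone_intE e : 0 <= e -> (\int[mu]_z (cone e z)%:E = (cone_int e)%:E)%E.
Proof.
move=> e0; rewrite fineK// ge0_fin_numE; last by apply: ge0_int => z; exact: cone_ge0.
apply: (@int_lty _ _ _ e e).
- exact: measurable_cone.
- by move=> z; exact: cone_ge0.
- by move=> z; exact: cone_le.
- exact: cone0.
Qed.

Lemma cone_int_gt0 e : 0 < e -> 0 < cone_int e.
Proof.
move=> e0; have e2 : 0 < e / 2 by rewrite divr_gt0.
rewrite -lte_fin -cone_intE ?(ltW e0)//.
have mB : measurable (eball (e / 2) : set 'rV[R]_N) by exact: measurable_eball.
have mI : measurable_fun setT (\1_(eball (e / 2)) : 'rV[R]_N -> R) by exact: measurable_indic.
have i0 x : 0 <= \1_(eball (e / 2)) x :> R by rewrite indicE.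
apply: (@lt_le_trans _ _ (\int[mu]_z (e / 2 * \1_(eball (e / 2)) z)%:E)%E).
  rewrite (int_scale mu mI (ltW e2) i0) mule_gt0 ?lte_fin//.
  by rewrite -(measure_indic mu mB) lebesgue_eball_gt0.
apply: le_int => //.
- exact: measurable_funM.
- exact: measurable_cone.
- by move=> x; rewrite mulr_ge0// ltW.
move=> x; rewrite indicE; have [/set_mem /= xe|_] := boolP (x \in _).
  by rewrite mulr1 /cone le_max; apply/orP; right; move: xe; rewrite /eball /=; lra.
by rewrite mulr0 cone_ge0.
Qed.

Lemma measurable_cone_shift e x : measurable_fun setT (fun y => cone e (y - x)).
Proof.
apply: (measurableT_comp (measurable_cone e)); apply: measurable_fun_rVP => i.
rewrite (_ : (fun y => _) = fun y => y ord0 i - x ord0 i); last first.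
  by apply/funext => y; rewrite !mxE.
by apply: measurable_funB; [exact: measurable_coord|exact: measurable_cst].
Qed.

Definition moll e f x : \bar R := (\int[mu]_y (f y * cone e (y - x))%:E)%E.

Section moll.
Variable (e : R).
Hypothesis (e0 : 0 < e).

Let measurable_mollF f x : measurable_fun setT f ->
  measurable_fun setT (fun y => f y * cone e (y - x)).
Proof. by move=> mf; apply: measurable_funM => //; exact: measurable_cone_shift. Qed.

Let mollF_ge0 f x : (forall x, 0 <= f x) -> forall y, 0 <= f y * cone e (y - x).
Proof. by move=> f0 y; rewrite mulr_ge0 ?cone_ge0. Qed.

Lemma moll_ge0 f x : (forall x, 0 <= f x) -> (0 <= moll e f x)%E.
Proof. by move=> f0; apply: ge0_int; exact: mollF_ge0. Qed.

Lemma mollE f x : measurable_fun setT f -> (forall x, 0 <= f x) ->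
  moll e f x = (\int[mu]_z (f (z + x) * cone e z)%:E)%E.
Proof.
move=> mf f0.
have := @integral_translate R N (fun y => (f y * cone e (y - x))%:E) x.
rewrite -/(moll e f x) => <-.
- by apply: eq_integral => z _; rewrite addrK.
- by apply/measurable_EFinP; exact: measurable_mollF.
- by move=> y; rewrite lee_fin mollF_ge0.
Qed.

Lemma int_cone_shift x : (\int[mu]_y (cone e (y - x))%:E = (cone_int e)%:E)%E.
Proof.
rewrite -cone_intE ?(ltW e0)//.
have := @integral_translate R N (fun y => (cone e (y - x))%:E) x.
move=> <-.
- by apply: eq_integral => z _; rewrite addrK.
- by apply/measurable_EFinP; exact: measurable_cone_shift.
- by move=> y; rewrite lee_fin cone_ge0.
Qed.

Lemma le_moll f g x : measurable_fun setT f -> measurable_fun setT g ->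
  (forall x, 0 <= f x) -> (forall y, enorm (y - x) < e -> f y <= g y) ->
  (moll e f x <= moll e g x)%E.
Proof.
move=> mf mg f0 fg; apply: le_int.
- exact: measurable_mollF.
- exact: measurable_mollF.
- exact: mollF_ge0.
- move=> y; have [ey|ye] := leP e (enorm (y - x)); first by rewrite cone0// !mulr0.
  by rewrite ler_wpM2r ?cone_ge0// fg.
Qed.

Lemma mollD f g x : measurable_fun setT f -> measurable_fun setT g ->
  (forall x, 0 <= f x) -> (forall x, 0 <= g x) ->
  moll e (fun y => f y + g y) x = (moll e f x + moll e g x)%E.
Proof.
move=> mf mg f0 g0; rewrite /moll -int_add//.
- by apply: eq_integral => y _; rewrite mulrDl.
- exact: measurable_mollF.
- exact: measurable_mollF.
- exact: mollF_ge0.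
- exact: mollF_ge0.
Qed.

Lemma moll_cst (c : R) x : 0 <= c -> moll e (fun=> c) x = (c * cone_int e)%:E.
Proof.
move=> c0; rewrite /moll int_scale//.
- by rewrite int_cone_shift -EFinM.
- exact: measurable_cone_shift.
- by move=> y; exact: cone_ge0.
Qed.

Lemma moll_lty f x : measurable_fun setT f -> (forall x, 0 <= f x) ->
  (\int[mu]_y (f y)%:E < +oo)%E -> moll e f x \is a fin_num.
Proof.
move=> mf f0 foo; rewrite ge0_fin_numE ?moll_ge0//.
apply: (@le_lt_trans _ _ (\int[mu]_y (e * f y)%:E)%E).
  apply: le_int.
  - exact: measurable_mollF.
  - exact: measurable_funM.
  - exact: mollF_ge0.
  - by move=> y; rewrite mulrC ler_wpM2r// cone_le// ltW.
by rewrite int_scale ?(ltW e0)// lte_mul_pinfty ?lee_fin// ltW.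
Qed.

Lemma measurable_mollP f : measurable_fun setT f -> (forall x, 0 <= f x) ->
  measurable_fun setT (fun p : 'rV[R]_N * 'rV[R]_N => f (p.2 + p.1)).
Proof.
move=> mf f0; apply: (measurableT_comp mf); apply: measurable_fun_rVP => i.
rewrite (_ : (fun y : 'rV[R]_N * 'rV[R]_N => (y.2 + y.1) ord0 i) =
  fun y : 'rV[R]_N * 'rV[R]_N => y.2 ord0 i + y.1 ord0 i); last first.
  by apply/funext => y; rewrite !mxE.
by apply: measurable_funD; apply: (measurableT_comp (measurable_coord i)).
Qed.

Lemma measurable_moll f : measurable_fun setT f -> (forall x, 0 <= f x) ->
  measurable_fun setT (moll e f).
Proof.
move=> mf f0; rewrite (_ : moll e f =
   fubini_F mu (fun p : 'rV[R]_N * 'rV[R]_N => (f (p.2 + p.1) * cone e p.2)%:E)); last first.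
  by apply/funext => x; rewrite mollE.
apply: measurable_fun_fubini_tonelli_F => [|p]; last by rewrite lee_fin mulr_ge0 ?cone_ge0.
apply/measurable_EFinP; apply: measurable_funM; first exact: measurable_mollP.
by apply: (measurableT_comp (measurable_cone e)).
Qed.

Lemma int_moll f h : measurable_fun setT f -> (forall x, 0 <= f x) ->
  measurable_fun setT h -> (forall x, 0 <= h x) ->
  (\int[mu]_x ((h x)%:E * moll e f x) =
   \int[mu]_z ((cone e z)%:E * \int[mu]_x (h x * f (z + x))%:E))%E.
Proof.
move=> mf f0 mh h0.
pose F (p : 'rV[R]_N * 'rV[R]_N) := (h p.1 * (f (p.2 + p.1) * cone e p.2))%:E.
have mF : measurable_fun setT F.
  apply/measurable_EFinP; apply: measurable_funM; first exact: (measurableT_comp mh).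
  apply: measurable_funM; first exact: measurable_mollP.
  by apply: (measurableT_comp (measurable_cone e)).
have F0 p : (0 <= F p)%E by rewrite lee_fin !mulr_ge0 ?cone_ge0.
have mshift x : measurable_fun setT (fun z => f (z + x)).
  have := measurable_mollP mf f0.
  by move=> H; apply: (measurableT_comp H (measurable_pair1 x)).
have mshift2 z : measurable_fun setT (fun x => f (z + x)).
  have := measurable_mollP mf f0.
  by move=> H; apply: (measurableT_comp H (measurable_pair2 z)).
transitivity (\int[mu]_x \int[mu]_z F (x, z))%E.
  apply: eq_integral => x _; rewrite mollE// -int_scale//.
    by apply: measurable_funM => //; exact: measurable_cone.
  by move=> z; rewrite mulr_ge0 ?cone_ge0.
rewrite fubini_tonelli//; apply: eq_integral => z _; rewrite -int_scale ?cone_ge0//.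
- by apply: eq_integral => x _; rewrite /F /=; congr (_%:E); ring.
- exact: measurable_funM.
- by move=> x; rewrite mulr_ge0.
Qed.

Lemma int_moll1 f : measurable_fun setT f -> (forall x, 0 <= f x) ->
  (\int[mu]_x moll e f x = (cone_int e)%:E * \int[mu]_x (f x)%:E)%E.
Proof.
move=> mf f0; transitivity (\int[mu]_x ((1 : R)%:E * moll e f x))%E.
  by apply: eq_integral => x _; rewrite mul1e.
rewrite (@int_moll f (fun=> 1))//.
transitivity (\int[mu]_z ((cone e z)%:E * \int[mu]_x (f x)%:E))%E.
  apply: eq_integral => z _; congr (_ * _)%E.
  rewrite -[RHS](@integral_translate R N (EFin \o f) z).
  - by apply: eq_integral => x _ /=; rewrite mul1r addrC.
  - exact/measurable_EFinP.
  - by move=> x; rewrite lee_fin.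
rewrite ge0_integralZr//.
- by rewrite cone_intE// ltW.
- by apply/measurable_EFinP; exact: measurable_cone.
- by move=> x _; rewrite lee_fin cone_ge0.
- exact: ge0_int.
Qed.

End moll.

End cone.

Section rotation_invariance.
Context {R : realType} {n : nat}.
Implicit Types (f g h u : 'rV[R]_n.+2 -> R) (x y z v w : 'rV[R]_n.+2).
Local Notation mu := (lebesgue_rV R n.+2).
Local Notation e0 := (delta_mx ord0 ord0 : 'rV[R]_n.+2).

Definition rot_invariant f := forall w, w ord0 ord0 = 0 -> dot w w = 1 ->
  forall c s, c ^+ 2 + s ^+ 2 = 1 -> {ae mu, forall x, f (rot w c s x) = f x}.

Lemma rot_to_axis x : exists w c s, [/\ w ord0 ord0 = 0, dot w w = 1,
  c ^+ 2 + s ^+ 2 = 1 & rot w c s x = enorm x *: e0].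
Proof.
have ee : dot e0 e0 = 1 by rewrite dot_delta mxE !eqxx.
pose x0 := x ord0 ord0.
have [v [xv v0]] : exists v, x = v + x0 *: e0 /\ v ord0 ord0 = 0.
  exists (x + (- x0) *: e0); split; last by rewrite rV_addZE mxE !eqxx /= -/x0; ring.
  by apply/rowP => i; rewrite !rV_addZE; ring.
have xx : dot x x = dot v v + x0 ^+ 2.
  rewrite {1 2}xv dotDl dotZl !dotDr !dotZr (dotC v e0) (dot_delta v) v0 ee; ring.
have [vm|vm] := eqVneq (enorm v) 0.
  have {}vm : v = 0 by apply/eqP; rewrite -enorm_eq0 vm.
  have xE : enorm x = `|x0| by rewrite enormE xx vm dot0l add0r sqrtr_sqr.
  pose w : 'rV[R]_n.+2 := delta_mx ord0 (lift ord0 ord0).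
  have w0 : w ord0 ord0 = 0 by rewrite mxE.
  have wx : dot w x = 0.
    by rewrite xv vm add0r dotZr (dotC w e0) dot_delta w0 mulr0.
  exists w, (if 0 <= x0 then 1 else -1), 0; split => //.
  - by rewrite dot_delta mxE !eqxx.
  - by case: ifP => _; ring.
  - apply/rowP => i; rewrite /rot !rV_addZE wx [RHS]mxE xE -/x0.
    rewrite (_ : x ord0 i = x0 * e0 ord0 i); last by rewrite xv vm add0r mxE.
    set b := e0 ord0 i.
        by case: ifPn => [/ger0_norm ->|]; last rewrite -ltNge => /ltr0_norm ->; ring.
pose m := enorm v; have m0 : 0 < m by rewrite lt_neqAle eq_sym vm enorm_ge0.
have vv : dot v v = m ^+ 2 by rewrite enorm_sqr.
pose r := enorm x; have rr : r ^+ 2 = m ^+ 2 + x0 ^+ 2 by rewrite enorm_sqr xx vv.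
have r0 : 0 < r.
  rewrite lt_neqAle enorm_ge0 andbT eq_sym; apply/eqP => r0.
  by move: rr; rewrite r0 expr0n /=; have := exprn_gt0 2 m0; have := sqr_ge0 x0; lra.
have rn : r != 0 by rewrite gt_eqF.
have mn : m != 0 by rewrite gt_eqF.
exists (m^-1 *: v), (x0 / r), (- m / r); split.
- by rewrite mxE v0 mulr0.
- by rewrite dotZl dotZr vv; field.
- rewrite !expr_div_n sqrrN -mulrDl addrC -rr divff// expf_neq0//.
- have wx : dot (m^-1 *: v) x = m.
    rewrite dotZl {1}xv dotDr dotZr (dotC v e0) dot_delta v0 vv; field.
    exact: mn.
  apply/rowP => i; rewrite /rot !rV_addZE wx -/x0 -/r [RHS]mxE.
  rewrite [X in X + _ + _](_ : _ = m * (m^-1 *: v) ord0 i + x0 * e0 ord0 i); last first.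
    rewrite [in LHS]xv rV_addZE; congr (_ + _).
    have -> : (m^-1 *: v) ord0 i = m^-1 * v ord0 i by rewrite mxE.
    by rewrite mulrA divff// mul1r.
  set a := (m^-1 *: v) ord0 i; set b := e0 ord0 i.
  transitivity ((x0 ^+ 2 + m ^+ 2) / r * b); first by field.
  by rewrite addrC -rr expr2 mulfK.
Qed.

Lemma moll_rot (e : R) f w c s x : 0 < e -> measurable_fun setT f ->
  (forall x, 0 <= f x) -> w ord0 ord0 = 0 -> dot w w = 1 -> c ^+ 2 + s ^+ 2 = 1 ->
  {ae mu, forall x, f (rot w c s x) = f x} ->
  moll e f (rot w c s x) = moll e f x.
Proof.
move=> eg mf f0 w0 ww cs inv.
have mc z := measurable_cone_shift e z.
have mr : measurable_fun setT (rot w c s) by exact: measurable_rot.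
rewrite /moll -(@integral_rot _ _ w w0 ww c s
  (fun y => (f y * cone e (y - rot w c s x))%:E) cs); last 2 first.
- by apply/measurable_EFinP; apply: measurable_funM.
- by move=> y; rewrite lee_fin mulr_ge0 ?cone_ge0.
have coneE y : cone e (rot w c s y - rot w c s x) = cone e (y - x).
  have -> : rot w c s y - rot w c s x = rot w c s (y - x).
    by rewrite -scaleN1r -rotDZ scaleN1r.
  by rewrite /cone enorm_rot.
under eq_integral do rewrite coneE.
apply: ge0_ae_eq_integral => //.
- apply/measurable_EFinP; apply: measurable_funM => //.
  exact: (measurableT_comp mf mr).
- by apply/measurable_EFinP; apply: measurable_funM.
- by move=> y _; rewrite lee_fin mulr_ge0 ?cone_ge0.
- by move=> y _; rewrite lee_fin mulr_ge0 ?cone_ge0.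
by apply: filterS inv => y ->.
Qed.

Lemma moll_axis (e : R) f x : 0 < e -> measurable_fun setT f ->
  (forall x, 0 <= f x) -> rot_invariant f ->
  moll e f (enorm x *: e0) = moll e f x.
Proof.
move=> eg mf f0 inv; have [w [c [s [w0 ww cs <-]]]] := rot_to_axis x.
by apply: moll_rot => //; exact: inv.
Qed.

End rotation_invariance.

Section mollify.
Context {R : realType} {N : nat}.
Implicit Types (f g h : 'rV[R]_N -> R) (x y z v : 'rV[R]_N).
Local Notation mu := (lebesgue_rV R N).
Variables (r : R) (u : 'rV[R]_N -> R) (phi : nat -> 'rV[R]_N -> R).
Hypotheses (mu_ : measurable_fun setT u) (u0 : forall x, 0 <= u x).
Hypotheses (mphi : forall k, measurable_fun setT (phi k)).
Hypotheses (phi0 : forall k x, 0 <= phi k x) (phir : forall k, csupp r (phi k)).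
Hypothesis (philip : forall k, exists2 M : R, 0 <= M &
  forall x y, `|phi k x - phi k y| <= M * enorm (x - y)).
Hypothesis (uoo : (\int[mu]_x (u x)%:E < +oo)%E).
Hypothesis (phioo : forall k, (\int[mu]_x (phi k x)%:E < +oo)%E).
Hypothesis (su : small (fun k => \int[mu]_x (`|phi k x - u x|)%:E)%E).

Definition mollR (e : R) f x : R := fine (moll e f x) / cone_int (N := N) e.

Lemma measurable_mollR e f : 0 < e -> measurable_fun setT f -> (forall x, 0 <= f x) ->
  measurable_fun setT (mollR e f).
Proof.
move=> e0 mf f0; apply: measurable_funM; last exact: measurable_cst.
by apply: (measurableT_comp (@fine_measurable R setT measurableT)); exact: measurable_moll.
Qed.

Lemma mollR_phi e k (M : R) x : 0 < e -> 0 <= M ->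
  (forall x y, `|phi k x - phi k y| <= M * enorm (x - y)) ->
  `|mollR e (phi k) x - phi k x| <= M * e * \1_(eball (r + e)) x.
Proof.
move=> e0 M0 HM; have K0 := @cone_int_gt0 R N e e0.
have Me0 : 0 <= M * e by rewrite mulr_ge0// ltW.
have fin := moll_lty e0 x (mphi k) (phi0 k) (phioo k).
have [xr|rx] := ltP (enorm x) (r + e); last first.
  have -> : mollR e (phi k) x = 0.
    rewrite /mollR /moll integral0_eq ?mul0r// => y _.
    have [ye|ey] := ltP (enorm (y - x)) e; last by rewrite cone0// mulr0.
    rewrite phir ?mul0r//.
    by have := ler_enormD (x - y) y; rewrite subrK enormB; move: rx ye; lra.
  rewrite phir ?subrr ?normr0 ?mulr_ge0 ?indicE//; move: rx e0; lra.
rewrite indicE mem_set// mulr1.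
have near y : enorm (y - x) < e -> `|phi k y - phi k x| <= M * e.
  by move=> ye; rewrite (le_trans (HM _ _))// ler_wpM2l// ltW.
have up : fine (moll e (phi k) x) <= (phi k x + M * e) * cone_int (N := N) e.
  rewrite -lee_fin fineK// -(moll_cst e0 x (addr_ge0 (phi0 k x) Me0)); apply: le_moll => // y /near.
  by rewrite ler_norml => /andP[_]; lra.
have low : phi k x * cone_int (N := N) e <= fine (moll e (phi k) x) + M * e * cone_int (N := N) e.
  rewrite -lee_fin EFinD fineK// -(moll_cst e0 x (phi0 k x)) -(moll_cst e0 x Me0) -mollD//.
  apply: le_moll => //; first exact: measurable_funD.
  by move=> y /near; rewrite ler_norml => /andP[]; lra.
rewrite /mollR ler_norml; apply/andP; split.
  rewrite lerBrDr ler_pdivlMr// mulrDl mulNr; lra.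
by rewrite lerBlDr ler_pdivrMr// addrC.
Qed.

Lemma mollR_dist e k x : 0 < e ->
  `|mollR e u x - mollR e (phi k) x| <=
    fine (moll e (fun y => `|phi k y - u y|) x) / cone_int (N := N) e.
Proof.
move=> e0; have K0 := @cone_int_gt0 R N e e0.
have md : measurable_fun setT (fun y => `|phi k y - u y|) by exact: measurable_normB.
have doo : (\int[mu]_y (`|phi k y - u y|)%:E < +oo)%E.
  apply: (@le_lt_trans _ _ (\int[mu]_y (phi k y + u y)%:E)%E).
    apply: le_int => //; first exact: measurable_funD.
    move=> y; rewrite (le_trans (ler_normB _ _))//.
    by rewrite !ger0_norm// ?phi0// ?u0.
  rewrite (int_add mu (mphi k) mu_ (phi0 k) u0); exact: lte_add_pinfty.
have f1 := moll_lty e0 x mu_ u0 uoo.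
have f2 := moll_lty e0 x (mphi k) (phi0 k) (phioo k).
have f3 := moll_lty e0 x md (fun y => normr_ge0 _) doo.
rewrite /mollR -mulrBl normrM (gtr0_norm (_ : 0 < _^-1)) ?invr_gt0// ler_wpM2r ?invr_ge0 ?(ltW K0)//.
rewrite ler_norml; apply/andP; split.
- rewrite -subr_ge0 opprK addrAC subr_ge0 -lee_fin EFinD !fineK// -mollD//.
  apply: le_moll => //; first exact: measurable_funD.
  by move=> y _; have := ler_norm (phi k y - u y); lra.
- rewrite lerBlDl -lee_fin EFinD !fineK// -mollD//.
  apply: le_moll => //; first exact: measurable_funD.
  by move=> y _; have := ler_norm (u y - phi k y); rewrite distrC; lra.
Qed.

Lemma mollR_small : small (fun m : nat => \int[mu]_x (`|mollR m.+1%:R^-1 u x - u x|)%:E)%E.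
Proof.
move=> eps eps0; have e4 : 0 < eps / 4 by rewrite divr_gt0.
have [k0 Hk0] := su e4; pose k := k0; have {Hk0}Hk := Hk0 k (leqnn k).
have [M M0 HM] := philip k.
pose V : R := fine (mu (eball (r + 1))).
have VE : mu (eball (r + 1)) = V%:E.
  by rewrite fineK// ge0_fin_numE ?measure_ge0// lebesgue_eball_lty.
have V0 : 0 <= V by rewrite fine_ge0// measure_ge0.
have [m0 Hm0] : exists m0 : nat, 2 * (M * V) / eps <= m0.+1%:R.
  exists (Num.Def.trunc (2 * (M * V) / eps)).
  have c0 : 0 <= 2 * (M * V) / eps by rewrite divr_ge0 ?mulr_ge0// ltW.
  by have /andP[_ /ltW] := Num.Theory.trunc_itv c0.
exists m0 => m mm; pose e : R := m.+1%:R^-1.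
have e0 : 0 < e by rewrite invr_gt0.
have e1 : e <= 1 by rewrite invf_le1// ler1n.
have K0 := @cone_int_gt0 R N e e0.
have md : measurable_fun setT (fun y => `|phi k y - u y|) by exact: measurable_normB.
have doo : (\int[mu]_y (`|phi k y - u y|)%:E < +oo)%E.
  by rewrite (le_lt_trans Hk)// ltry.
pose F1 x := fine (moll e (fun y => `|phi k y - u y|) x) / cone_int (N := N) e.
pose F2 x := M * e * \1_(eball (r + 1)) x.
pose F3 x := `|phi k x - u x|.
have mF1 : measurable_fun setT F1 by exact: measurable_mollR.
have mB : measurable (eball (r + 1) : set 'rV[R]_N) by exact: measurable_eball.
have mI : measurable_fun setT (\1_(eball (r + 1)) : 'rV[R]_N -> R) by exact: measurable_indic.
have i0 x : 0 <= \1_(eball (r + 1)) x :> R by rewrite indicE.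
have Me0 : 0 <= M * e by rewrite mulr_ge0// ltW.
have mF2 : measurable_fun setT F2 by exact: measurable_funM.
have F10 x : 0 <= F1 x by rewrite divr_ge0 ?(ltW K0)// fine_ge0// moll_ge0.
have F20 x : 0 <= F2 x by rewrite mulr_ge0.
have F30 x : 0 <= F3 x by exact: normr_ge0.
have mF12 : measurable_fun setT (fun x => F1 x + F2 x) by exact: measurable_funD.
apply: (@le_trans _ _ (\int[mu]_x (F1 x + F2 x + F3 x)%:E)%E).
  apply: le_int => //.
  - by apply: measurable_normB => //; exact: measurable_mollR.
  - exact: measurable_funD.
  move=> x; have H1 := mollR_dist k x e0; have H2 := mollR_phi x e0 M0 HM.
  have H3 : M * e * \1_(eball (r + e)) x <= F2 x.
    rewrite ler_wpM2l// !indicE; have [/set_mem xr|_] := boolP (x \in _) => //.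
    rewrite mem_set//; move: xr; rewrite /eball /= => /lt_le_trans; apply.
    by rewrite lerD2l.
  have := ler_normD (mollR e u x - mollR e (phi k) x) (mollR e (phi k) x - u x).
  have := ler_normD (mollR e (phi k) x - phi k x) (phi k x - u x).
  rewrite !addrA !subrK => h1 h2; rewrite (le_trans h2)// -addrA lerD//.
  by rewrite (le_trans h1)// lerD// (le_trans H2).
rewrite (int_add mu mF12 md)//; last by move=> x; rewrite addr_ge0.
rewrite (int_add mu mF1 mF2)// (int_scale mu mI Me0 i0).
have -> : (\int[mu]_x (\1_(eball (r + 1)) x)%:E = V%:E)%E by rewrite -VE; exact: esym (measure_indic mu mB).
rewrite -EFinM.
have -> : (\int[mu]_x (F1 x)%:E = \int[mu]_x (F3 x)%:E)%E.
  pose G x := fine (moll e F3 x).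
  have mG : measurable_fun setT G.
    apply: (measurableT_comp (@fine_measurable R setT measurableT)); exact: measurable_moll.
  have G0 x : 0 <= G x by rewrite fine_ge0// moll_ge0.
  have Kv0 : 0 <= (cone_int (N := N) e)^-1 by rewrite invr_ge0 ltW.
  transitivity (\int[mu]_x ((cone_int (N := N) e)^-1 * G x)%:E)%E.
    by apply: eq_integral => x _; rewrite /F1 mulrC.
  rewrite (int_scale mu mG Kv0 G0).
  transitivity (((cone_int (N := N) e)^-1)%:E * \int[mu]_x moll e F3 x)%E.
    by congr (_ * _)%E; apply: eq_integral => x _; rewrite fineK// moll_lty.
  rewrite int_moll1// muleA -EFinM mulVf ?mul1e// gt_eqF//.
apply: (@le_trans _ _ ((eps / 4)%:E + (M * e * V)%:E + (eps / 4)%:E)%E).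
  by rewrite leeD// leeD2r.
rewrite -!EFinD lee_fin.
suff : M * e * V <= eps / 2 by lra.
rewrite /e mulrAC ler_pdivrMr//.
have : m0.+1%:R <= m.+1%:R :> R by rewrite ler_nat ltnS.
move: Hm0; rewrite ler_pdivrMr//; nra.
Qed.

End mollify.

Section radial_functions.
Context {R : realType} {n : nat}.
Implicit Types (f g h : 'rV[R]_n.+2 -> R) (x y z v : 'rV[R]_n.+2).
Local Notation mu := (lebesgue_rV R n.+2).
Local Notation e0 := (delta_mx ord0 ord0 : 'rV[R]_n.+2).
Variables (r : R) (u : 'rV[R]_n.+2 -> R) (phi : nat -> 'rV[R]_n.+2 -> R).
Hypotheses (mu_ : measurable_fun setT u) (u0 : forall x, 0 <= u x).
Hypotheses (mphi : forall k, measurable_fun setT (phi k)).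
Hypotheses (phi0 : forall k x, 0 <= phi k x) (phir : forall k, csupp r (phi k)).
Hypothesis (philip : forall k, exists2 M : R, 0 <= M &
  forall x y, `|phi k x - phi k y| <= M * enorm (x - y)).
Hypothesis (uoo : (\int[mu]_x (u x)%:E < +oo)%E).
Hypothesis (phioo : forall k, (\int[mu]_x (phi k x)%:E < +oo)%E).
Hypothesis (su : small (fun k => \int[mu]_x (`|phi k x - u x|)%:E)%E).
Hypothesis inv : rot_invariant u.

Lemma mollR_cvg : exists2 m : nat -> nat, (forall j, (j <= m j)%N) &
  {ae mu, forall x, mollR (m j).+1%:R^-1 u x @[j --> \oo] --> u x}.
Proof.
have sm := mollR_small mu_ u0 mphi phi0 phir philip uoo phioo su.
have [|k x|m mj H] := ae_subseq _ _ sm.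
- move=> k; apply: measurable_normB; last exact: mu_.
  by apply: measurable_mollR; rewrite ?invr_gt0.
- exact: normr_ge0.
by exists m => //; apply: filterS H => x; exact: small_cvg.
Qed.

Lemma mollR_axis e x : 0 < e -> mollR e u (enorm x *: e0) = mollR e u x.
Proof. by move=> eg; rewrite /mollR moll_axis. Qed.

Lemma rot_invariant_radial : exists f : R -> R, {ae mu, forall x, u x = f (enorm x)}.
Proof.
have [m mj H] := mollR_cvg.
exists (fun t => lim (mollR (m j).+1%:R^-1 u (t *: e0) @[j --> \oo])).
apply: filterS H => x Hx; under eq_fun do rewrite mollR_axis ?invr_gt0//.
by apply/esym; exact: (cvg_lim (@Rhausdorff R)).
Qed.

Lemma mollR_lip e x y : 0 < e -> `|mollR e u x - mollR e u y| <=
  fine (\int[mu]_z (u z)%:E)%E / cone_int (N := n.+2) e * enorm (x - y).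
Proof.
move=> eg; have K0 := @cone_int_gt0 R n.+2 e eg.
have f1 z := moll_lty eg z mu_ u0 uoo.
have I0 : (0 <= \int[mu]_z (u z)%:E)%E by exact: ge0_int.
have If : (\int[mu]_z (u z)%:E)%E \is a fin_num by rewrite ge0_fin_numE.
have main a b : fine (moll e u a) <= fine (moll e u b) +
    fine (\int[mu]_z (u z)%:E)%E * enorm (a - b).
  rewrite -lee_fin EFinD EFinM (fineK (f1 a)) (fineK (f1 b)) (fineK If) muleC.
  rewrite -(int_scale mu mu_ (enorm_ge0 (a - b)) u0).
  have mK c : measurable_fun setT (fun z => u z * cone e (z - c)).
    by apply: measurable_funM => //; exact: measurable_cone_shift.
  have mE : measurable_fun setT (fun z => enorm (a - b) * u z) by exact: measurable_funM.
  rewrite -int_add//; last 2 first.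
  - by move=> z; rewrite mulr_ge0 ?cone_ge0.
  - by move=> z; rewrite mulr_ge0 ?enorm_ge0.
  apply: le_int => //; first exact: measurable_funD.
    by move=> z; rewrite mulr_ge0 ?cone_ge0.
  move=> z; rewrite (mulrC (enorm _)) -mulrDr ler_wpM2l//.
  have := cone_lip e (z - a) (z - b).
  have -> : z - a - (z - b) = b - a by rewrite opprB addrC addrA subrK.
  rewrite (enormB b a); have := ler_norm (cone e (z - a) - cone e (z - b)).
  lra.
rewrite /mollR -mulrBl normrM (gtr0_norm (_ : 0 < _^-1)) ?invr_gt0//.
rewrite mulrAC ler_wpM2r ?invr_ge0 ?(ltW K0)// ler_norml; apply/andP; split.
- by rewrite lerNl opprB lerBlDl enormB; exact: main.
- by rewrite lerBlDl; exact: main.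
Qed.

Variables (C D : R).
Hypotheses (C0 : 0 < C) (D0 : 0 < D) (rg : 0 < r).
Hypothesis shb : forall e z rho tau, 0 < e -> enorm z < e -> 0 < rho -> rho < r -> 0 < tau ->
  (\int[mu]_x (u (z + x) ^+ n.+2 * invN x * \1_(shell rho tau) x)%:E <=
    (C * tau * ln ((r + e) / rho) ^+ n.+1 * D)%:E)%E.

Let c0 : R := unit_vol n.+2 * expR (- n.+2%:R).
Let c0_gt0 : 0 < c0. Proof. by rewrite mulr_gt0 ?unit_vol_gt0 ?expR_gt0. Qed.

Definition radial_const : R := C / (unit_vol n.+2 * expR (- n.+2%:R)) + 1.

Let shell_mean e x tau c : 0 < e -> 0 < enorm x -> enorm x < r -> 0 < tau -> tau <= 1 ->
  0 < c -> c ^+ n.+2 = ln ((r + e) / enorm x) ^+ n.+1 * D ->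
  mollR e u x <= c * radial_const +
    fine (\int[mu]_z (u z)%:E)%E / cone_int (N := n.+2) e * (enorm x * (expR tau - 1)).
Proof.
move=> eg x0 xr t0 t1 cg cE; have K0 := @cone_int_gt0 R n.+2 e eg.
set rho := enorm x in x0 xr cE *; set L := fine _ / _.
have I0 : (0 <= \int[mu]_z (u z)%:E)%E by exact: ge0_int.
have L0 : 0 <= L by exact: divr_ge0 (fine_ge0 I0) (ltW K0).
pose h y : R := invN y * \1_(shell rho tau) y.
have mh : measurable_fun setT h by exact: measurable_invN_shell.
have h0 y : 0 <= h y by rewrite mulr_ge0 ?invN_ge0// indicE.
have Sle := @invN_shell_le R n.+1 rho tau x0 t0 t1.
have Sge := @invN_shell_ge R n.+1 rho tau x0 t0 t1.
pose S : R := fine (\int[mu]_y (h y)%:E)%E.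
have SE : (\int[mu]_y (h y)%:E = S%:E)%E.
  by rewrite fineK// ge0_fin_numE ?ge0_int// (le_lt_trans Sle)// ltry.
rewrite -/(h _) SE lee_fin -/c0 in Sge.
have S0 : 0 < S by rewrite (lt_le_trans _ Sge)// mulr_gt0.
pose del : R := L * (rho * (expR tau - 1)).
have del0 : 0 <= del by rewrite mulr_ge0// mulr_ge0 ?(ltW x0)// subr_ge0 -expR0 ler_expR ltW.
have mm : measurable_fun setT (mollR e u) by exact: measurable_mollR.
have m0 y : 0 <= mollR e u y by rewrite divr_ge0 ?(ltW K0)// fine_ge0// moll_ge0.
have mmh : measurable_fun setT (fun y => h y * mollR e u y) by exact: (measurable_funM mh mm).
have mdh : measurable_fun setT (fun y => del * h y) by exact: (measurable_funM (measurable_cst _) mh).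
have step1 : ((mollR e u x * S)%:E <=
    \int[mu]_y (h y * mollR e u y)%:E + (del * S)%:E)%E.
  rewrite (EFinM (mollR e u x)) (EFinM del) -SE -(int_scale mu mh (m0 x) h0).
  rewrite -(int_scale mu mh del0 h0) -(int_add mu mmh mdh); last 2 first.
  - by move=> y; rewrite mulr_ge0.
  - by move=> y; rewrite mulr_ge0.
  apply: le_int => //.
  - exact: (measurable_funM (measurable_cst _) mh).
  - exact: (measurable_funD mmh mdh).
  - by move=> y; rewrite mulr_ge0.
  move=> y; rewrite [h y * _]mulrC -mulrDl.
  rewrite /h indicE; have [/set_mem/shellP[yr yt]|_] := boolP (y \in _); last by rewrite !mulr0.
  rewrite mulr1 ler_wpM2r ?invN_ge0// -lerBlDl.
  rewrite -(mollR_axis x eg) -(mollR_axis y eg) (le_trans (ler_norm _))//.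
  rewrite (le_trans (mollR_lip _ _ eg))// ler_wpM2l//.
  rewrite -scalerBl enormZ [enorm e0]enormE dot_delta mxE !eqxx sqrtr1 mulr1.
  by rewrite distrC -/rho ger0_norm ?subr_ge0// mulrBr mulr1 lerD2r ltW.
have inner z : enorm z < e -> (\int[mu]_y (h y * u (z + y))%:E <= (c * (C * tau + S))%:E)%E.
  move=> ze; have mus : measurable_fun setT (fun y => u (z + y)).
    by have H := measurable_mollP mu_ u0; apply: (measurableT_comp H (measurable_pair2 z)).
  have mX : measurable_fun setT (fun y => u (z + y) ^+ n.+2 * invN y * \1_(shell rho tau) y).
    apply: measurable_funM; last by apply: measurable_indic; exact: measurable_shell.
    by apply: measurable_funM; [exact: measurable_funX|exact: measurable_invN].
  have X0 y : 0 <= u (z + y) ^+ n.+2 * invN y * \1_(shell rho tau) y.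
    apply: mulr_ge0; last by rewrite indicE.
    by apply: mulr_ge0; [exact: exprn_ge0|exact: invN_ge0].
  have cn0 : 0 <= c ^- n.+1 by rewrite invr_ge0 exprn_ge0// ltW.
  apply: (@le_trans _ _ (\int[mu]_y (c ^- n.+1 *
      (u (z + y) ^+ n.+2 * invN y * \1_(shell rho tau) y) + c * h y)%:E)%E).
    apply: le_int.
    - exact: (measurable_funM mh mus).
    - exact: (measurable_funD (measurable_funM (measurable_cst _) mX) (measurable_funM (measurable_cst _) mh)).
    - by move=> y; rewrite mulr_ge0.
    - move=> y; rewrite [leRHS](_ : _ = h y * (c + c ^- n.+1 * u (z + y) ^+ n.+2)).
        by rewrite ler_wpM2l//; exact: norm_le_expr.
      by rewrite /h; ring.
  rewrite int_add//; last 4 first.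
  - exact: (measurable_funM (measurable_cst _) mX).
  - exact: (measurable_funM (measurable_cst _) mh).
  - by move=> y; rewrite mulr_ge0.
  - by move=> y; rewrite mulr_ge0// ltW.
  rewrite (int_scale mu mX cn0 X0) (int_scale mu mh (ltW cg) h0) SE.
  apply: (@le_trans _ _ ((c ^- n.+1)%:E * (C * tau * ln ((r + e) / rho) ^+ n.+1 * D)%:E + (c * S)%:E)%E).
    by rewrite EFinM leeD2r// lee_wpmul2l ?lee_fin//; exact: shb.
  rewrite -EFinM -EFinD lee_fin (_ : C * tau * _ * D = C * tau * (c * c ^+ n.+1)); last first.
    by rewrite -exprS cE; ring.
  rewrite le_eqVlt; apply/orP; left; apply/eqP.
  have : c ^+ n.+1 != 0 by rewrite expf_neq0// gt_eqF.
  by move: (c ^+ n.+1) => Y Y0; field.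
have step2 : (\int[mu]_y (h y * mollR e u y)%:E <= (c * (C * tau + S))%:E)%E.
  pose G y : R := fine (moll e u y).
  have GE y : (G y)%:E = moll e u y by rewrite fineK// moll_lty.
  have mG : measurable_fun setT G.
    apply: (measurableT_comp (@fine_measurable R setT measurableT)); exact: measurable_moll.
  have G0 y : 0 <= G y by rewrite fine_ge0// moll_ge0.
  have Kv0 : 0 <= (cone_int (N := n.+2) e)^-1 by rewrite invr_ge0 ltW.
  have mhG : measurable_fun setT (fun y => h y * G y) by exact: (measurable_funM mh mG).
  have -> : (\int[mu]_y (h y * mollR e u y)%:E =
     ((cone_int (N := n.+2) e)^-1)%:E * \int[mu]_y (h y * G y)%:E)%E.
    rewrite -int_scale//; last by move=> y; rewrite mulr_ge0.
    by apply: eq_integral => y _; congr (_%:E); rewrite /mollR -/(G y); ring.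
  have -> : (\int[mu]_y (h y * G y)%:E = \int[mu]_y ((h y)%:E * moll e u y))%E.
    by apply: eq_integral => y _; rewrite -GE.
  rewrite int_moll//.
  apply: (@le_trans _ _ ((cone_int (N := n.+2) e)^-1%:E *
      \int[mu]_z ((c * (C * tau + S)) * cone e z)%:E)%E).
    rewrite lee_wpmul2l ?lee_fin//; apply: ge0_le_integral => //.
    - move=> z _; rewrite mule_ge0 ?lee_fin ?cone_ge0//; apply: ge0_int => y.
      by rewrite mulr_ge0.
    - apply: emeasurable_funM; first by apply/measurable_EFinP; exact: measurable_cone.
      have := @measurable_fun_fubini_tonelli_F _ _ _ _ R mu
        (fun p : 'rV[R]_n.+2 * 'rV[R]_n.+2 => (h p.2 * u (p.1 + p.2))%:E); apply.
        apply/measurable_EFinP; apply: measurable_funM; first exact: (measurableT_comp mh).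
        apply: (measurableT_comp mu_); apply: measurable_fun_rVP => i.
        rewrite (_ : (fun y : 'rV[R]_n.+2 * 'rV[R]_n.+2 => (y.1 + y.2) ord0 i) =
          fun y : 'rV[R]_n.+2 * 'rV[R]_n.+2 => y.1 ord0 i + y.2 ord0 i); last first.
          by apply/funext => y; rewrite !mxE.
        by apply: measurable_funD; apply: (measurableT_comp (measurable_coord i)).
      by move=> p; rewrite lee_fin mulr_ge0.
    - by apply/measurable_EFinP; apply: measurable_funM => //; exact: measurable_cone.
    move=> z _; have [ez|ze] := leP e (enorm z).
      by rewrite cone0// mul0e mulr0.
    rewrite mulrC EFinM lee_wpmul2l ?lee_fin ?cone_ge0//; exact: inner.
  rewrite int_scale//.
  - by rewrite cone_intE ?(ltW eg)// -!EFinM lee_fin mulrCA mulVf ?mulr1// gt_eqF.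
  - exact: measurable_cone.
  - by rewrite !mulr_ge0 ?addr_ge0 ?mulr_ge0// ltW.
  - by move=> z; exact: cone_ge0.
have : mollR e u x * S <= c * (C * tau + S) + del * S.
  by rewrite -lee_fin (le_trans step1)// [leRHS]EFinD leeD2r.
have := Sge; rewrite /radial_const -/c0 -/del => H1 H2.
rewrite -(ler_pM2r S0) (le_trans H2)// mulrDl lerD2r -mulrA ler_wpM2l ?(ltW cg)//.
rewrite mulrDl mul1r lerD2r -mulrA ler_wpM2l ?(ltW C0)//.
by rewrite mulrC ler_pdivlMr// mulrC.
Qed.

Let radial_const_gt0 : 0 < radial_const.
Proof. by rewrite ltr_wpDl// divr_ge0// ltW. Qed.

Lemma mollR_bound e x : 0 < e -> 0 < enorm x -> enorm x < r ->
  mollR e u x ^+ n.+2 <= radial_const ^+ n.+2 * (ln ((r + e) / enorm x) ^+ n.+1 * D).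
Proof.
move=> eg x0 xr; pose X : R := ln ((r + e) / enorm x) ^+ n.+1 * D.
have X0 : 0 < X.
  rewrite mulr_gt0// exprn_gt0// ln_gt0// ltr_pdivlMr// mul1r.
  by rewrite (lt_trans xr)// ltrDl.
pose c : R := X `^ (n.+2%:R^-1).
have c_gt0 : 0 < c by exact: powR_gt0.
have cX : c ^+ n.+2 = X.
  by rewrite -powR_mulrn ?ltW// -powRrM mulVf// powRr1// ltW.
have K0 := @cone_int_gt0 R n.+2 e eg.
have m0 y : 0 <= mollR e u y by rewrite divr_ge0 ?(ltW K0)// fine_ge0// moll_ge0.
have R0 := mulr_ge0 (ltW radial_const_gt0) (ltW c_gt0).
rewrite -/X -cX -exprMn; apply: lerXn2r; rewrite ?nnegrE//.
apply/ler_addgt0Pr => eps eps0.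
set L := fine (\int[mu]_z (u z)%:E)%E / cone_int (N := n.+2) e.
have L0 : 0 <= L.
  by apply: divr_ge0; [apply: fine_ge0; exact: ge0_int|exact: ltW].
pose M : R := L * (enorm x * expR 1) + 1.
have M0 : 0 < M by rewrite ltr_wpDl// mulr_ge0// mulr_ge0// ?(ltW x0)// ltW ?expR_gt0.
pose tau := Num.min 1 (eps / M).
have t0 : 0 < tau by rewrite lt_min ltr01 divr_gt0.
have t1 : tau <= 1 by rewrite ge_min lexx.
rewrite (le_trans (shell_mean eg x0 xr t0 t1 c_gt0 cX))// mulrC lerD2l -/L.
have tM : tau * M <= eps by rewrite -ler_pdivlMr// ge_min lexx orbT.
apply: le_trans tM; apply: (@le_trans _ _ (tau * (L * (enorm x * expR 1)))).
  rewrite [leRHS]mulrCA ler_wpM2l// [leRHS]mulrCA ler_wpM2l ?(ltW x0)//.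
  by rewrite (le_trans (expR_sub1_le _))// ler_wpM2l ?(ltW t0)// ler_expR.
by rewrite ler_wpM2l ?(ltW t0)// lerDl.
Qed.

Lemma rot_invariant_bound : {ae mu, forall x, 0 < enorm x -> enorm x < r ->
  u x ^+ n.+2 <= radial_const ^+ n.+2 * (ln (r / enorm x) ^+ n.+1 * D)}.
Proof.
have [m mj H] := mollR_cvg; apply: filterS H => x Hx x0 xr.
pose a j : R := ln (r / enorm x) + j.+1%:R^-1 / r.
have ca : a @ \oo --> ln (r / enorm x).
  rewrite -[X in _ --> X]addr0 -[X in _ --> _ + X](mul0r r^-1).
  by apply: cvgD; [exact: cvg_cst|apply: cvgM; [exact: cvg_harmonic|exact: cvg_cst]].
have l0 : 0 <= ln (r / enorm x) by rewrite ln_ge0// ler_pdivlMr// mul1r ltW.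
have bnd j : mollR (m j).+1%:R^-1 u x ^+ n.+2 <=
    radial_const ^+ n.+2 * (a j ^+ n.+1 * D).
  pose e : R := (m j).+1%:R^-1; have eg : 0 < e by rewrite invr_gt0.
  apply: le_trans (mollR_bound eg x0 xr) _.
  have e1 : 1 <= (r + e) / enorm x.
    by rewrite ler_pdivlMr// mul1r (le_trans (ltW xr))// lerDl ltW.
  rewrite ler_wpM2l ?exprn_ge0 ?(ltW radial_const_gt0)// ler_wpM2r ?(ltW D0)//.
  apply: lerXn2r; rewrite ?nnegrE ?ln_ge0// ?addr_ge0 ?divr_ge0 ?invr_ge0 ?(ltW rg)//.
  have -> : (r + e) / enorm x = (r / enorm x) * (1 + e / r).
    by field; rewrite !gt_eqF.
  have er : 0 <= e / r by rewrite divr_ge0 ?(ltW rg) ?(ltW eg).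
  rewrite lnM ?posrE ?divr_gt0 ?ltr_wpDr// lerD2l.
  rewrite (le_trans (le_ln1Dx _))//; first by rewrite (lt_le_trans _ er).
  by rewrite ler_wpM2r ?invr_ge0 ?(ltW rg)// /e lef_pV2 ?posrE// ler_nat ltnS.
apply: (ler_cvg_to (_ : (fun j => mollR (m j).+1%:R^-1 u x ^+ n.+2) @ \oo --> _)
  (_ : (fun j => radial_const ^+ n.+2 * (a j ^+ n.+1 * D)) @ \oo --> _)); last exact: nearW.
- have cX : continuous (fun t : R => t ^+ n.+2) by apply: contX => t; exact: cvg_id.
  by apply: (@continuous_cvg _ _ _ _ _ _ (fun t : R => t ^+ n.+2)) => //; exact: cX.
- have cX : continuous (fun t : R => t ^+ n.+1) by apply: contX => t; exact: cvg_id.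
  apply: cvgM; first exact: cvg_cst.
  apply: cvgM; last exact: cvg_cst.
  by apply: (@continuous_cvg _ _ _ _ _ _ (fun t : R => t ^+ n.+1)) => //; exact: cX.
Qed.

End radial_functions.

Section bernoulli.
Context {R : realType}.

Lemma bernoulli_ge (x : R) i : 0 <= x -> 1 + i%:R * x <= (1 + x) ^+ i.
Proof.
move=> x0; elim: i => [|i IH]; first by rewrite mul0r addr0 expr0.
rewrite exprS; apply: (@le_trans _ _ ((1 + x) * (1 + i%:R * x))); last first.
  by rewrite ler_wpM2l// addr_ge0.
have : 0 <= i%:R * x * x by rewrite !mulr_ge0.
by rewrite -natr1; nra.
Qed.

End bernoulli.

Section translation.
Context {R : realType} {N : nat}.
Implicit Types (f u : 'rV[R]_N -> R) (x y z v : 'rV[R]_N).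
Local Notation mu := (lebesgue_rV R N).

Lemma measurable_comp_add d (T : measurableType d) (f : 'rV[R]_N -> T) z :
  measurable_fun setT f -> measurable_fun setT (fun x => f (z + x)).
Proof.
move=> mf; apply: (measurableT_comp mf); apply: measurable_fun_rVP => i.
rewrite (_ : (fun x : 'rV[R]_N => (z + x) ord0 i) = fun x => z ord0 i + x ord0 i).
  by apply: measurable_funD; [exact: measurable_cst|exact: measurable_coord].
by apply/funext => y; rewrite mxE.
Qed.

Lemma int_comp_add f z : measurable_fun setT f -> (forall x, 0 <= f x) ->
  (\int[mu]_x (f (z + x))%:E = \int[mu]_x (f x)%:E)%E.
Proof.
move=> mf f0; rewrite -[RHS](@integral_translate R N (EFin \o f) z).
- by apply: eq_integral => x _ /=; rewrite addrC.
- exact/measurable_EFinP.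
- by move=> x; rewrite lee_fin.
Qed.

Lemma tame_affine (r s c : R) f z : tame r f -> 0 < c -> enorm z + r / c <= s ->
  tame s (fun x => f (c *: (x - z))).
Proof.
move=> [sf [t tr ft]] c0 zs; split.
  apply/smooth_Ck => n; move/smooth_Ck : sf => /(_ n) sf.
  apply: (@Ck_affine _ _ n f (fun x => c *: (x - z)) (fun v => c *: v)) => //.
    move=> i; rewrite (_ : (fun x : 'rV[R]_N => (c *: (x - z)) ord0 i) =
      fun x => c * (x ord0 i - z ord0 i)); last by apply/funext => x; rewrite !mxE.
    apply: contM; first exact: cont_cst.
    by apply: contB; [exact: coord_continuous|exact: cont_cst].
  by move=> x v a; rewrite -addrA (addrC (a *: v)) addrA scalerDr !scalerA (mulrC c).
exists (enorm z + t / c).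
  by rewrite (lt_le_trans _ zs)// ltrD2l ltr_pM2r ?invr_gt0.
move=> x xs; apply: ft; rewrite enormZ gtr0_norm// mulrC -ler_pdivrMr//.
have := ler_enormD (x - z) z; rewrite subrK; move: xs; lra.
Qed.

Lemma gradient_affine (c : R) f z x : C1 f ->
  gradient (fun x => f (c *: (x - z))) x = c *: gradient f (c *: (x - z)).
Proof.
move=> cf; apply/rowP => i; rewrite !mxE /partial.
have HL y v (t : R) : c *: (y + t *: v - z) = c *: (y - z) + t *: (c *: v).
  by rewrite -addrA (addrC (t *: v)) addrA scalerDr !scalerA (mulrC c).
have D := C1_affine cf HL x (delta_mx ord0 i).
rewrite (@derive_val _ _ _ _ _ _ _ D) dotZr; congr (_ * _).
by rewrite dotC dot_delta mxE.
Qed.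

End translation.

Section sobolev_radial.
Context {R : realType} {n : nat}.
Implicit Types (f g h u : 'rV[R]_n.+2 -> R) (x y z v : 'rV[R]_n.+2).
Local Notation mu := (lebesgue_rV R n.+2).
Local Notation e0 := (delta_mx ord0 ord0 : 'rV[R]_n.+2).
Variables (r : R) (u : 'rV[R]_n.+2 -> R) (g : 'rV[R]_n.+2 -> 'rV[R]_n.+2).
Variable (phi : nat -> 'rV[R]_n.+2 -> R).
Hypothesis (A : approxW r u g phi).

Let mphi k : measurable_fun setT (phi k).
Proof. exact: C1_measurable (tame_C1 (approxW_tame A k)). Qed.

Lemma approxW_L1 : small (fun k => \int[mu]_x (`|phi k x - u x|)%:E)%E.
Proof.
apply: (@small_L1 _ _ r (fun k x => `|phi k x - u x|)) => //.
- by move=> k; apply: measurable_normB => //; exact: approxW_mu A.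
- move=> k x rx; rewrite (tame_csupp (approxW_tame A k) rx) (approxW_u0 A rx).
  by rewrite subrr normr0.
- exact: approxW_u A.
Qed.

Lemma approxW_phi_int k : (\int[mu]_x (`|phi k x|)%:E < +oo)%E.
Proof.
have [M M0 HM] := tame_bounded (approxW_tame A k).
apply: (@int_lty _ _ _ M r) => //; first exact: measurableT_comp.
by move=> x /(tame_csupp (approxW_tame A k)) ->; rewrite normr0.
Qed.

Lemma approxW_int : (\int[mu]_x (`|u x|)%:E < +oo)%E.
Proof.
have mu_ := approxW_mu A; have [k0 Hk0] := approxW_L1 ltr01.
have mn f : measurable_fun setT f -> measurable_fun setT (fun x => `|f x|).
  by move=> mf; exact: measurableT_comp.
have md : measurable_fun setT (fun x => `|phi k0 x - u x|) by exact: measurable_normB.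
apply: (@le_lt_trans _ _ (\int[mu]_x (`|phi k0 x| + `|phi k0 x - u x|)%:E)%E).
  apply: le_int => //.
  - exact: mn.
  - by apply: measurable_funD => //; exact: mn.
  - by move=> x; have := ler_normB (phi k0 x) (phi k0 x - u x); rewrite opprB addrC subrK.
rewrite (int_add mu (mn _ (mphi k0)) md)//; apply: lte_add_pinfty.
  exact: approxW_phi_int.
by rewrite (le_lt_trans (Hk0 _ (leqnn _)))// ltry.
Qed.

Section lipschitz_comp.
Variable G : R -> R.
Hypotheses (mG : measurable_fun setT G) (G0 : forall t, 0 <= G t) (G00 : G 0 = 0).
Hypothesis (Glip : forall s t, `|G s - G t| <= `|s - t|).

Let Gle t : G t <= `|t|.
Proof. by have := Glip t 0; rewrite G00 !subr0 ger0_norm. Qed.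

Let mGu f : measurable_fun setT f -> measurable_fun setT (fun x => G (f x)).
Proof. by move=> mf; exact: measurableT_comp. Qed.

Let Goo f : measurable_fun setT f -> (\int[mu]_x (`|f x|)%:E < +oo)%E ->
  (\int[mu]_x (G (f x))%:E < +oo)%E.
Proof.
move=> mf; apply: le_lt_trans; apply: le_int => //; first exact: mGu.
exact: measurableT_comp.
Qed.

Let Gsmall : small (fun k => \int[mu]_x (`|G (phi k x) - G (u x)|)%:E)%E.
Proof.
apply: small_le approxW_L1 => k; apply: le_int => //.
- by apply: measurable_normB; apply: mGu => //; exact: approxW_mu A.
- by apply: measurable_normB => //; exact: approxW_mu A.
Qed.

Let Gphir k : csupp r (fun x => G (phi k x)).
Proof. by move=> x rx; rewrite (tame_csupp (approxW_tame A k)). Qed.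

Let Gphilip k : exists2 M : R, 0 <= M &
  forall x y, `|G (phi k x) - G (phi k y)| <= M * enorm (x - y).
Proof.
have [M M0 HM] := tame_gradient_bounded (approxW_tame A k).
exists M => // x y; apply: le_trans (Glip _ _) _.
exact: C1_lipschitz (tame_C1 (approxW_tame A k)) HM _ _.
Qed.

Hypothesis inv : rot_invariant u.

Let Ginv : rot_invariant (fun x => G (u x)).
Proof.
by move=> w w0 ww c s cs; apply: filterS (inv w0 ww cs) => x ->.
Qed.

Lemma lip_comp_radial : exists f : R -> R, {ae mu, forall x, G (u x) = f (enorm x)}.
Proof.
apply: (rot_invariant_radial (mGu (approxW_mu A)) (fun x => G0 (u x))
  (fun k => mGu (mphi k)) (fun k x => G0 (phi k x)) Gphir Gphilip
  (Goo (approxW_mu A) approxW_int) (fun k => Goo (mphi k) (approxW_phi_int k)) Gsmall Ginv).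
Qed.

Lemma lip_comp_bound C D : 0 < C -> 0 < D -> 0 < r ->
  (forall e z rho tau, 0 < e -> enorm z < e -> 0 < rho -> rho < r -> 0 < tau ->
   (\int[mu]_x (G (u (z + x)) ^+ n.+2 * invN x * \1_(shell rho tau) x)%:E <=
    (C * tau * ln ((r + e) / rho) ^+ n.+1 * D)%:E)%E) ->
  {ae mu, forall x, 0 < enorm x -> enorm x < r ->
  G (u x) ^+ n.+2 <= @radial_const R n C ^+ n.+2 * (ln (r / enorm x) ^+ n.+1 * D)}.
Proof.
move=> C0 D0 r0 H.
apply: (rot_invariant_bound (mGu (approxW_mu A)) (fun x => G0 (u x))
  (fun k => mGu (mphi k)) (fun k x => G0 (phi k x)) Gphir Gphilip
  (Goo (approxW_mu A) approxW_int) (fun k => Goo (mphi k) (approxW_phi_int k)) Gsmall Ginv C0 D0 r0 H).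
Qed.

End lipschitz_comp.

Lemma approxW_translate (e : R) z : enorm z < e ->
  approxW (r + e) (fun x => u (z + x)) (fun x => g (z + x)) (fun k x => phi k (z + x)).
Proof.
move=> ze; have mu_ := approxW_mu A; have mg := approxW_mg A.
have phiE k : (fun x => phi k (z + x)) = (fun x => phi k (1 *: (x - - z))).
  by apply/funext => x; rewrite scale1r opprK addrC.
have far x : r + e <= enorm x -> r <= enorm (z + x).
  by move=> rx; have := ler_enormB (z + x) z; rewrite addrAC subrr add0r; lra.
split.
- exact: measurable_comp_add.
- exact: measurable_comp_add.
- by move=> x /far /(approxW_u0 A).
- by move=> x /far /(approxW_g0 A).
- move=> k; rewrite phiE; apply: tame_affine (approxW_tame A k) ltr01 _.
  by rewrite enormN divr1 addrC lerD2l ltW.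
- apply: small_le (approxW_u A) => k.
  have mF : measurable_fun setT (fun y => `|phi k y - u y| ^+ n.+2).
    by apply: measurable_funX; exact: measurable_normB.
  have F0 y : 0 <= `|phi k y - u y| ^+ n.+2 by exact: exprn_ge0.
  by rewrite -(int_comp_add z mF F0).
- apply: small_le (approxW_g A) => k.
  have mgk : measurable_fun setT (gradient (phi k)).
    by apply: measurable_gradient; exact: tame_C1 (approxW_tame A k).
  have mF : measurable_fun setT (fun y => enorm (gradient (phi k) y - g y) ^+ n.+2).
    by apply: measurable_funX; apply: measurable_enorm_comp; exact: measurable_rVB.
  have F0 y : 0 <= enorm (gradient (phi k) y - g y) ^+ n.+2 by rewrite exprn_ge0// enorm_ge0.
  have E := int_comp_add z mF F0; rewrite -E.
  rewrite le_eqVlt; apply/orP; left; apply/eqP; apply: eq_integral => x _.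
  rewrite phiE gradient_affine; last exact: tame_C1 (approxW_tame A k).
  by rewrite !scale1r opprK (addrC x).
Qed.

Hypothesis (inv : rot_invariant u).

Lemma approxW_radial : radial (eball r) u.
Proof.
have Mlip (s t : R) : `|Num.max 0 s - Num.max 0 t| <= `|s - t|.
  rewrite ler_norml; have := ler_norm (s - t); have := ler_norm (t - s); rewrite distrC.
  by case: (leP 0 s) => ?; case: (leP 0 t) => ?; move=> ? ?; apply/andP; split; lra.
have Mlip' (s t : R) : `|Num.max 0 (- s) - Num.max 0 (- t)| <= `|s - t|.
  by rewrite (le_trans (Mlip _ _))// -opprD normrN.
have m1 : measurable_fun setT (fun t : R => Num.max 0 t).
  by apply: measurable_maxr; [exact: measurable_cst|exact: measurable_id].
have m2 : measurable_fun setT (fun t : R => Num.max 0 (- t)).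
  apply: measurable_maxr; first exact: measurable_cst.
  by apply: measurable_funN; exact: measurable_id.
have p1 (t : R) : 0 <= Num.max 0 t by rewrite le_max lexx.
have p2 (t : R) : 0 <= Num.max 0 (- t) by rewrite le_max lexx.
have z1 : Num.max 0 0 = 0 :> R by rewrite maxxx.
have z2 : Num.max 0 (- 0) = 0 :> R by rewrite oppr0 maxxx.
have [f1 H1] := lip_comp_radial m1 p1 z1 Mlip inv.
have [f2 H2] := lip_comp_radial m2 p2 z2 Mlip' inv.
exists (fun t => f1 t - f2 t); apply: filterS2 H1 H2 => x <- <- _.
by case: (leP 0 (u x)) => ?; case: (leP 0 (- u x)) => ?; lra.
Qed.

Lemma approxW_radial_bound (D : R) : 0 < D -> 0 < r ->
  (\int[mu]_x (enorm (g x) ^+ n.+2)%:E <= D%:E)%E ->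
  {ae mu, forall x, 0 < enorm x -> enorm x < r -> `|u x| ^+ n.+2 <=
   @radial_const R n (@shell_const R n.+1) ^+ n.+2 * (ln (r / enorm x) ^+ n.+1 * D)}.
Proof.
move=> D0 r0 HD; have mg := approxW_mg A.
have mA : measurable_fun setT (fun t : R => `|t|) by exact: normr_measurable.
apply: (lip_comp_bound mA (@normr_ge0 _ _) (@normr0 _ _) (@ler_dist_dist _ _) inv
  shell_const_gt0 D0 r0).
move=> e z rho tau eg ze rho0 rr t0.
have rre : rho < r + e by rewrite (lt_trans rr)// ltrDl.
apply: le_trans (shell_estimate_lim (approxW_translate ze) rho0 rre t0) _.
have mF : measurable_fun setT (fun y => enorm (g y) ^+ n.+2).
  by apply: measurable_funX; exact: measurable_enorm_comp.
have F0 y : 0 <= enorm (g y) ^+ n.+2 by rewrite exprn_ge0// enorm_ge0.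
have E := int_comp_add z mF F0; rewrite E.
rewrite [leRHS]EFinM lee_wpmul2l ?lee_fin//.
rewrite mulr_ge0 ?exprn_ge0 ?ln_ge0//; last first.
  by rewrite ler_pdivlMr// mul1r ltW.
exact: mulr_ge0 (ltW shell_const_gt0) (ltW t0).
Qed.

End sobolev_radial.

(** * Non-radial minimizers for large beta *)

Section radial_upper_bound.
Context {R : realType} {n : nat}.
Implicit Types (f u : 'rV[R]_n.+2 -> R) (x y z v w : 'rV[R]_n.+2).
Local Notation mu := (lebesgue_rV R n.+2).
Local Notation p := (n.+1%:R / n.+2%:R : R).

Lemma ae_rot w c s (P : 'rV[R]_n.+2 -> Prop) : w ord0 ord0 = 0 -> dot w w = 1 ->
  c ^+ 2 + s ^+ 2 = 1 -> {ae mu, forall x, P x} -> {ae mu, forall x, P (rot w c s x)}.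
Proof.
move=> w0 ww cs [B [mB B0 PB]].
have mr : measurable_fun setT (rot w c s) by exact: measurable_rot.
have mrB : measurable (rot w c s @^-1` B) by rewrite -[X in measurable X]setTI; exact: mr.
have mI : measurable_fun setT (EFin \o \1_B : 'rV[R]_n.+2 -> \bar R).
  by apply/measurable_EFinP; exact: measurable_indic.
have I0 x : (0 <= (EFin \o \1_B : 'rV[R]_n.+2 -> \bar R) x)%E by rewrite lee_fin indicE.
have E : mu (rot w c s @^-1` B) = 0%E.
  apply: etrans (measure_indic mu mrB) _.
  apply: etrans (integral_rot w0 ww cs mI I0) _.
  exact: etrans (esym (measure_indic mu mB)) B0.
by exists (rot w c s @^-1` B); split; [exact: mrB|exact: E|move=> x /= Hx; exact: PB].
Qed.

Lemma radial_rot_invariant (r : R) u : radial (eball r) u ->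
  rot_invariant (u \_ (eball r)).
Proof.
move=> [f Hf] w w0 ww c s cs; apply: filterS2 Hf (ae_rot w0 ww cs Hf) => x H1 H2.
have E := @enorm_rot _ _ w w0 ww c s x cs.
rewrite !patchE; have -> : (rot w c s x \in eball r) = (x \in eball r).
  by apply/idP/idP => /set_mem; rewrite /eball /= ?E => H; apply/mem_set; rewrite /= ?E.
case: ifPn => // /set_mem xr; rewrite H1// H2; first by rewrite E.
by rewrite /eball /= E.
Qed.

Lemma weighted_restrict (r a q beta : R) u :
  weighted r a q beta (u \_ (eball r)) = weighted r a q beta u.
Proof.
by apply: eq_integral => x xr; rewrite patchE xr.
Qed.

Lemma radial_weighted_bound (r a q : R) : 0 < r -> 1 < a -> 0 < q ->
  exists2 B : R, 0 < B & exists2 b0 : R, 0 < b0 &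
  forall beta, b0 <= beta -> forall u g phi (D : R), approxW r u g phi -> rot_invariant u ->
    0 < D -> (\int[mu]_x (enorm (g x) ^+ n.+2)%:E <= D%:E)%E ->
    (weighted r a q beta u <=
     (B * beta `^ (- (p * q + 1)) * (ln a) `^ (- beta) * D `^ (q / n.+2%:R))%:E)%E.
Proof.
move=> r0 a1 q0; pose L := ln a; have L0 : 0 < L by exact: ln_gt0.
have p0 : 0 <= p by exact: divr_ge0.
have pq0 : 0 <= p * q by rewrite mulr_ge0// ltW.
have [m0 Hm0] : exists m0 : nat, p * q + 1 < m0%:R.
  exists (Num.Def.trunc (p * q + 1)).+1.
  by have /andP[] := Num.Theory.trunc_itv (addr_ge0 pq0 (@ler01 R)).
have m0_gt0 : (0 : R) < m0%:R by rewrite (le_lt_trans _ Hm0)// addr_ge0.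
have [S S0 HS] := weight_series pq0 Hm0 m0_gt0.
have C0 : 0 < @shell_const R n.+1 by exact: shell_const_gt0.
have V0 : 0 < @shell_vol R n.+1 by exact: shell_vol_gt0.
pose K : R := @radial_const R n (@shell_const R n.+1).
have K0 : 0 < K by rewrite ltr_wpDl// divr_ge0 ?(ltW C0)// mulr_ge0 ?(ltW (unit_vol_gt0 _))// expR_ge0.
have two : (0 : R) < 2 by [].
pose B : R := K `^ q * @shell_vol R n.+1 * (2 * L) `^ (p * q + 1) * (m0%:R `^ m0%:R * S).
have M0 : (0 : R) < m0%:R `^ m0%:R * S by rewrite mulr_gt0 ?powR_gt0.
exists B.
  by apply: mulr_gt0 M0; apply: mulr_gt0 (powR_gt0 _ (mulr_gt0 two L0)); apply: mulr_gt0 V0; exact: powR_gt0.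
exists (2 * m0%:R + 2 * L); first by rewrite addr_gt0 ?mulr_gt0.
move=> beta hb u g phi D A inv D0 HD.
have b1 : 2 * m0%:R <= beta by rewrite (le_trans _ hb)// lerDl mulr_ge0// ltW.
have b2 : 2 * L <= beta by rewrite (le_trans _ hb)// lerDr mulr_ge0// ltW.
have b_gt0 : 0 < beta by rewrite (lt_le_trans _ b1)// mulr_gt0.
pose i := Num.Def.trunc (beta / m0%:R).
have bm0 : 0 <= beta / m0%:R by rewrite divr_ge0// ltW.
have /andP[i1 i2] := Num.Theory.trunc_itv bm0; rewrite -/i in i1 i2.
have mi1 : m0%:R * i%:R <= beta by rewrite mulrC -ler_pdivlMr.
have mi2 : beta / 2 <= m0%:R * i%:R.
  move: i2; rewrite ltr_pdivrMr// -natr1 mulrDl mul1r mulrC; lra.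
have mi0 : 0 < m0%:R * i%:R :> R by rewrite (lt_le_trans _ mi2)// divr_gt0.
have i0 : 0 < i%:R :> R by move: mi0; rewrite pmulr_rgt0.
pose tau : R := L / (m0%:R * i%:R).
have t0 : 0 < tau by rewrite divr_gt0.
have t2 : tau <= 2 * L / beta.
  rewrite ler_pdivrMr// mulrAC ler_pdivlMr//.
  by rewrite mulrAC [leLHS]mulrC ler_wpM2r ?(ltW L0)//; move: mi2; lra.
have t1 : tau <= 1 by rewrite (le_trans t2)// ler_pdivrMr// mul1r.
pose B1 : R := K * D `^ (n.+2%:R^-1).
have B10 : 0 <= B1 by exact: mulr_ge0 (ltW K0) (powR_ge0 _ _).
have Hu : {ae mu, forall x, 0 < enorm x -> enorm x < r ->
    `|u x| <= B1 * ln (r / enorm x) `^ p}.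
  apply: filterS (approxW_radial_bound A inv D0 r0 HD) => x Hx x0 xr.
  have l0 : 0 <= ln (r / enorm x) by rewrite ln_ge0// ler_pdivlMr// mul1r ltW.
  have := Hx x0 xr; rewrite -/K.
  have -> : K ^+ n.+2 * (ln (r / enorm x) ^+ n.+1 * D) =
      (B1 * ln (r / enorm x) `^ p) ^+ n.+2.
    rewrite /B1 !exprMn -mulrA; congr (_ * _).
    rewrite -!powR_mulrn ?powR_ge0// -!powRrM mulVf// divfK// powRr1 ?(ltW D0)//.
    by rewrite mulrC.
  by rewrite ler_pXn2r// nnegrE// mulr_ge0 ?powR_ge0.
apply: le_trans (weighted_bound_le r0 a1 q0 (ltW b_gt0) t0 t1 p0 B10 (approxW_mu A) Hu) _.
have ser : (\sum_(j <oo) (j.+1%:R `^ (p * q) * (ln a + j%:R * tau) `^ (- beta))%:E <=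
    (L `^ (- beta) * (m0%:R `^ m0%:R * S))%:E)%E.
  rewrite mulrA EFinM.
  apply: (@le_trans _ _ ((L `^ (- beta) * m0%:R `^ m0%:R)%:E *
     \sum_(j <oo) (j.+1%:R `^ (p * q) * (m0%:R + j%:R) `^ (- m0%:R))%:E)%E); last first.
    by rewrite lee_wpmul2l// lee_fin mulr_ge0 ?powR_ge0.
  rewrite -nneseriesZl; last by move=> j _; rewrite lee_fin mulr_ge0 ?powR_ge0.
  apply: lee_nneseries => [j _ _|j _]; first by rewrite lee_fin mulr_ge0 ?powR_ge0.
  rewrite lee_fin [leRHS]mulrCA ler_wpM2l ?powR_ge0// -/L.
  pose y : R := j%:R / (m0%:R * i%:R); have y0 : 0 <= y by rewrite divr_ge0// ltW.
  have -> : L + j%:R * tau = L * (1 + y) by rewrite /tau /y; field; rewrite !gt_eqF.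
  have y1 : 0 <= 1 + y by rewrite addr_ge0.
  rewrite powRM ?(ltW L0)// -mulrA ler_wpM2l ?powR_ge0//.
  have E : (m0%:R + j%:R) / m0%:R = 1 + i%:R * y :> R by rewrite /y; field; rewrite !gt_eqF.
  have -> : m0%:R `^ m0%:R * (m0%:R + j%:R) `^ (- m0%:R) = (1 + i%:R * y) `^ (- m0%:R).
    rewrite -E !powRN powRM ?addr_ge0 ?invr_ge0 ?(ltW m0_gt0)//.
    have -> : m0%:R^-1 `^ m0%:R = (m0%:R `^ m0%:R)^-1 :> R.
      by rewrite -[m0%:R^-1]powR_inv1 ?(ltW m0_gt0)// -powRrM mulN1r powRN.
    by rewrite invfM invrK mulrC.
  have iy1 : 0 < 1 + i%:R * y by rewrite ltr_wpDr// mulr_ge0// ltW.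
  rewrite !powRN lef_pV2 ?posrE; [|by rewrite powR_gt0// ltr_wpDr|by rewrite powR_gt0].
  apply: (@le_trans _ _ ((1 + y) `^ (i%:R * m0%:R))); last first.
    by apply: ler_powR; [rewrite lerDl|rewrite mulrC].
  rewrite powRrM (powR_mulrn i y1); apply: ge0_ler_powR; rewrite ?nnegrE ?exprn_ge0 ?(ltW m0_gt0) ?(ltW iy1)//.
  exact: bernoulli_ge.
have c0 : 0 <= B1 `^ q * @shell_vol R n.+1 * tau * tau `^ (p * q).
  exact: mulr_ge0 (mulr_ge0 (mulr_ge0 (powR_ge0 _ _) (ltW V0)) (ltW t0)) (powR_ge0 _ _).
apply: le_trans (lee_wpmul2l _ ser) _; first by rewrite lee_fin.
rewrite -EFinM lee_fin.
have tt : tau * tau `^ (p * q) <= (2 * L) `^ (p * q + 1) * beta `^ (- (p * q + 1)).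
  have -> : tau * tau `^ (p * q) = tau `^ (p * q + 1).
    by rewrite powRD ?(gt_eqF t0) ?implybT// powRr1 ?(ltW t0)// mulrC.
  have -> : beta `^ (- (p * q + 1)) = beta^-1 `^ (p * q + 1).
    by rewrite -[beta^-1]powR_inv1 ?(ltW b_gt0)// -powRrM mulN1r.
  rewrite -powRM ?mulr_ge0 ?invr_ge0 ?(ltW L0) ?(ltW b_gt0)//.
  have c1 : 0 <= 2 * L / beta by exact: le_trans (ltW t0) t2.
  have c2 : 0 <= p * q + 1 by exact: addr_ge0 pq0 ler01.
  by apply: (ge0_ler_powR c2); rewrite ?nnegrE // ltW.
have BE : B1 `^ q = K `^ q * D `^ (q / n.+2%:R).
  by rewrite /B1 powRM ?(ltW K0) ?powR_ge0// -powRrM [_^-1 * q]mulrC.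
pose X : R := K `^ q * D `^ (q / n.+2%:R) * @shell_vol R n.+1 * (L `^ (- beta) * (m0%:R `^ m0%:R * S)).
have X0 : 0 <= X.
  apply: mulr_ge0; first exact: mulr_ge0 (mulr_ge0 (powR_ge0 _ _) (powR_ge0 _ _)) (ltW V0).
  exact: mulr_ge0 (powR_ge0 _ _) (ltW M0).
rewrite BE [leLHS](_ : _ = X * (tau * tau `^ (p * q))); last by rewrite /X; ring.
apply: le_trans (ler_wpM2l X0 tt) _; rewrite le_eqVlt; apply/orP; left; apply/eqP.
rewrite /X /B /L; ring.
Qed.

End radial_upper_bound.

Section functional.
Context {R : realType} {n : nat}.
Implicit Types (f u : 'rV[R]_n.+1 -> R) (x y z v w : 'rV[R]_n.+1).
Local Notation mu := (lebesgue_rV R n.+1).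

Lemma int_eq0_ae f : measurable_fun setT f -> (forall x, 0 <= f x) ->
  (\int[mu]_x (f x)%:E = 0)%E -> {ae mu, forall x, f x = 0}.
Proof.
move=> mf f0 I0; have mE : measurable_fun setT (EFin \o f) by exact/measurable_EFinP.
have := (ae_eq_integral_abs mu measurableT mE).1; case.
  by rewrite -I0; apply: eq_integral => x _; rewrite /= ger0_norm.
by move=> B [mB B0 sB]; exists B; split => // x Hx; apply: sB => H; apply: Hx; have [] := H Logic.I.
Qed.

Lemma ae_neq0 : {ae mu, forall x, x != 0}.
Proof.
have m0 : measurable [set (0 : 'rV[R]_n.+1)].
  rewrite (_ : [set 0] = [set x | enorm x <= 0]).
    rewrite (_ : [set x | _] = @enorm R n.+1 @^-1` `]-oo, 0]); last first.
      by apply/seteqP; split => x /=; rewrite in_itv.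
    by rewrite -[X in measurable X]setTI; exact: measurable_enorm.
  apply/seteqP; split => x /= => [->|]; first by rewrite enorm0.
  by move=> x0; apply/eqP; rewrite -enorm_eq0 eq_le x0 enorm_ge0.
exists [set 0]; split => //; last first.
  by move=> x /= H; apply/eqP; apply/negPn/negP => x0; apply: H.
have V0 := @unit_vol_gt0 R n.+1.
apply/eqP; rewrite eq_le measure_ge0 andbT; apply/lee_addgt0Pr => e e0; rewrite add0e.
pose s := Num.min 1 (e / unit_vol n.+1).
have s0 : 0 < s by rewrite lt_min ltr01 divr_gt0.
apply: (@le_trans _ _ (mu (eball s))).
  apply: le_measure; rewrite ?inE//; first exact: measurable_eball.
  by move=> x /= ->; rewrite /eball /= enorm0.
rewrite (lebesgue_eball n.+1 s0) lee_fin -ler_pdivlMr//.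
apply: (@le_trans _ _ s); last by rewrite ge_min lexx orbT.
by rewrite exprS ler_piMr ?(ltW s0)// exprn_ile1 ?(ltW s0)// ge_min lexx.
Qed.

Lemma hweight_gt0 (r a beta : R) x : 0 < r -> 1 < a -> 0 < enorm x -> enorm x < r ->
  0 < hweight r a beta x.
Proof.
move=> r0 a1 x0 xr; rewrite invr_gt0 mulr_gt0 ?exprn_gt0// powR_gt0// ln_gt0//.
rewrite ltr_pdivlMr// mul1r (lt_le_trans xr)// ler_peMl ?(ltW r0)//; exact: ltW.
Qed.

Lemma weighted_csupp (r a q beta : R) u : q != 0 -> csupp r u ->
  weighted r a q beta u = (\int[mu]_x (`|u x| `^ q * hweight r a beta x)%:E)%E.
Proof.
move=> q0 ur; rewrite weightedE integral_mkcond; apply: eq_integral => x _.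
rewrite patchE; case: ifPn => // xr; rewrite ur ?normr0 ?powR0 ?mul0r//.
by rewrite leNgt; apply/negP => H; move/negP: xr; apply; exact/mem_set.
Qed.

Lemma measurable_weighted (r a q beta : R) u : measurable_fun setT u ->
  measurable_fun setT (fun x => `|u x| `^ q * hweight r a beta x).
Proof.
move=> mu_; apply: measurable_funM; last exact: measurable_hweight.
by apply: measurable_fun_powR; exact: measurableT_comp.
Qed.

Lemma weighted_gt0 (r a q beta : R) u : 0 < r -> 1 < a -> 0 < q ->
  measurable_fun setT u -> csupp r u -> nonzero (eball r) u ->
  (0 < weighted r a q beta u)%E.
Proof.
move=> r0 a1 q0 mu_ ur un; have q0' : q != 0 by rewrite gt_eqF.
have F0 x : 0 <= `|u x| `^ q * hweight r a beta x.
  by apply: mulr_ge0; [exact: powR_ge0|exact: hweight_ge0].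
rewrite weighted_csupp// lt_neqAle ge0_int// andbT eq_sym; apply/eqP => I0.
apply: un; have := int_eq0_ae (measurable_weighted r a q beta mu_) F0 I0.
move=> H; apply: filterS2 H ae_neq0 => x Hx x0 xr.
move: Hx => /eqP; rewrite mulf_eq0 (gt_eqF (hweight_gt0 beta r0 a1 _ xr)) ?orbF; last by rewrite enorm_gt0.
by rewrite powR_eq0 q0' andbT normr_eq0 => /eqP.
Qed.

Lemma quotient_le (r a q beta d k : R) u : 0 < q -> 0 <= d -> 0 < k ->
  dirichlet r u = d%:E -> (k%:E <= weighted r a q beta u)%E ->
  (quotient r a q beta u <= (d / k `^ (n.+1%:R / q))%:E)%E.
Proof.
move=> q0 d0 k0 D H; rewrite /quotient D.
have e0 : 0 < n.+1%:R / q by rewrite divr_gt0.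
case: (weighted r a q beta u) H => [s||] //; last first.
  by move=> _; rewrite poweRyr ?gt_eqF// invey mule0 lee_fin divr_ge0 ?powR_ge0.
rewrite lee_fin => ks; have s0 : 0 < s by exact: lt_le_trans ks.
rewrite poweR_EFin inver gt_eqF ?powR_gt0// -EFinM lee_fin ler_wpM2l//.
by rewrite lef_pV2 ?posrE ?powR_gt0//; apply: (ge0_ler_powR (ltW e0)); rewrite ?nnegrE ?(ltW k0) ?(ltW s0).
Qed.

Lemma quotient_ge (r a q beta d k : R) u : 0 < q -> 0 <= d ->
  dirichlet r u = d%:E -> (0 < weighted r a q beta u)%E ->
  (weighted r a q beta u <= k%:E)%E ->
  ((d / k `^ (n.+1%:R / q))%:E <= quotient r a q beta u)%E.
Proof.
move=> q0 d0 D; rewrite /quotient D.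
have e0 : 0 < n.+1%:R / q by rewrite divr_gt0.
case: (weighted r a q beta u) => [s||] //; rewrite lte_fin lee_fin => s0 sk.
rewrite poweR_EFin inver gt_eqF ?powR_gt0// -EFinM lee_fin ler_wpM2l//.
have k0 : 0 < k by exact: lt_le_trans sk.
by rewrite lef_pV2 ?posrE ?powR_gt0//; apply: (ge0_ler_powR (ltW e0)); rewrite ?nnegrE ?(ltW k0) ?(ltW s0).
Qed.

Lemma tame_nonzero_exists (r : R) u : admissible n.+1 r u ->
  exists2 phi0, tame r phi0 & ~ {ae mu, forall x, phi0 x = 0}.
Proof.
move=> [[g Wg] un]; have [phi A] := W01N_approx (ltn0Sn n) Wg.
apply: contrapT => H; apply: un.
have phi0 k : {ae mu, forall x, phi k x = 0}.
  by apply: contrapT => Hk; apply: H; exists (phi k) => //; exact: approxW_tame A k.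
set U := u \_ _ in A; have mU := approxW_mu A.
have I0 : (\int[mu]_x (`|U x| ^+ n.+1)%:E = 0)%E.
  apply/eqP; rewrite eq_le; apply/andP; split; last first.
    by apply: ge0_int => x; exact: exprn_ge0.
  apply: small_const; apply: small_le (approxW_u A) => k.
  have mk : measurable_fun setT (phi k) by apply: C1_measurable; exact: tame_C1 (approxW_tame A k).
  apply: ae_ge0_le_integral => //.
  - by apply/measurable_EFinP; apply: measurable_funX; exact: measurableT_comp.
  - by apply/measurable_EFinP; apply: measurable_funX; exact: measurable_normB.
  - by apply: filterS (phi0 k) => x -> _; rewrite sub0r normrN.
have mX : measurable_fun setT (fun x => `|U x| ^+ n.+1).
  by apply: measurable_funX; exact: measurableT_comp.
apply: filterS (int_eq0_ae mX (fun x => exprn_ge0 _ (normr_ge0 _)) I0) => x Hx xr.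
move/eqP : Hx; rewrite expf_eq0 /= normr_eq0 => /eqP.
by rewrite /U patchE mem_set.
Qed.

End functional.

Section test_function.
Context {R : realType} {n : nat}.
Implicit Types (f u : 'rV[R]_n.+1 -> R) (x y z v w : 'rV[R]_n.+1).
Local Notation mu := (lebesgue_rV R n.+1).

Lemma int_affine f (c : R) z : 0 < c -> measurable_fun setT f -> (forall x, 0 <= f x) ->
  (\int[mu]_x (f (c *: (x - z)))%:E = (c ^- n.+1)%:E * \int[mu]_x (f x)%:E)%E.
Proof.
move=> c0 mf f0; have mE : measurable_fun setT (EFin \o f) by exact/measurable_EFinP.
rewrite -(@integral_dilate R n.+1 (EFin \o f) c c0 mE); last by move=> x; rewrite lee_fin.
have mc : measurable_fun setT (fun x => f (c *: x)).
  apply: (measurableT_comp mf); apply: measurable_fun_rVP => i.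
  rewrite (_ : (fun x : 'rV[R]_n.+1 => (c *: x) ord0 i) = fun x => c * x ord0 i).
    by apply: measurable_funM; [exact: measurable_cst|exact: measurable_coord].
  by apply/funext => y; rewrite mxE.
have mc0 x : 0 <= f (c *: x) by [].
rewrite -(int_comp_add (- z) mc mc0).
by apply: eq_integral => x _; rewrite (addrC x).
Qed.

Lemma test_function_bounds (r a q beta : R) phi0 : 0 < r -> 1 < a -> 0 < q ->
  6 <= beta -> tame r phi0 ->
  exists2 v : 'rV[R]_n.+1 -> R, tame r v &
    dirichlet r v = (\int[mu]_x (enorm (gradient phi0 x) ^+ n.+1)%:E)%E /\
    ((r ^- n.+1 * (ln a `^ (- beta) * expR (- (6 / ln a))) * beta ^- n.+1)%:E *
      \int[mu]_x (`|phi0 x| `^ q)%:E <= weighted r a q beta v)%E.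
Proof.
move=> r0 a1 q0 b6 tphi; have b0 : 0 < beta by exact: lt_le_trans b6.
have q0' : q != 0 by rewrite gt_eqF.
have L0 : 0 < ln a by exact: ln_gt0.
have a0 : 0 < a by exact: lt_trans a1.
pose e : R := beta^-1; have e0 : 0 < e by rewrite invr_gt0.
have e6 : e <= 6^-1 by rewrite lef_pV2 ?posrE.
have e3 : 0 < 1 - 3 * e by move: e6; lra.
have e2 : 0 <= 1 - 2 * e by move: e6 e0; lra.
pose z : 'rV[R]_n.+1 := (r * (1 - 2 * e)) *: delta_mx ord0 ord0.
have ze : enorm z = r * (1 - 2 * e).
  rewrite enormZ [enorm (delta_mx _ _)]enormE dot_delta mxE !eqxx sqrtr1 mulr1 ger0_norm//.
  by rewrite mulr_ge0// ltW.
pose v x := phi0 (beta *: (x - z)).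
have mphi : measurable_fun setT phi0 by apply: C1_measurable; exact: tame_C1 tphi.
have tv : tame r v.
  apply: tame_affine tphi b0 _; rewrite ze -/e -mulrDr ger_pMr//; move: e0; lra.
exists v; first exact: tv.
split.
  apply: etrans (dirichlet_tame (ltn0Sn n) tv) _.
  have mG : measurable_fun setT (fun x => enorm (gradient phi0 x) ^+ n.+1).
    apply: measurable_funX; apply: measurable_enorm_comp; apply: measurable_gradient.
    exact: tame_C1 tphi.
  have G0 x : 0 <= enorm (gradient phi0 x) ^+ n.+1 by rewrite exprn_ge0// enorm_ge0.
  have bn : 0 <= beta ^+ n.+1 by rewrite exprn_ge0// ltW.
  transitivity (\int[mu]_x (beta ^+ n.+1 *
      enorm (gradient phi0 (beta *: (x - z))) ^+ n.+1)%:E)%E.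
    apply: eq_integral => x _; rewrite gradient_affine; last exact: tame_C1 tphi.
    by rewrite enormZ gtr0_norm// exprMn.
  have mbG : measurable_fun setT (fun y => beta ^+ n.+1 * enorm (gradient phi0 y) ^+ n.+1).
    exact: (measurable_funM (measurable_cst _) mG).
  have bG0 y : 0 <= beta ^+ n.+1 * enorm (gradient phi0 y) ^+ n.+1 by exact: mulr_ge0.
  apply: etrans (int_affine z b0 mbG bG0) _.
  rewrite (int_scale mu mG bn G0) muleA -EFinM mulVf ?mul1e// expf_neq0// gt_eqF//.
have mP : measurable_fun setT (fun x => `|phi0 x| `^ q).
  by apply: measurable_fun_powR; exact: measurableT_comp.
have P0 x : 0 <= `|phi0 x| `^ q by exact: powR_ge0.
pose kap : R := r ^- n.+1 * (ln a `^ (- beta) * expR (- (6 / ln a))).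
have kap0 : 0 <= kap.
  by rewrite mulr_ge0 ?invr_ge0 ?exprn_ge0 ?(ltW r0)// mulr_ge0 ?powR_ge0 ?expR_ge0.
rewrite -/kap weighted_csupp//; last exact: tame_csupp tv.
have -> : ((kap * beta ^- n.+1)%:E * \int[mu]_x (`|phi0 x| `^ q)%:E =
    \int[mu]_x (kap * `|v x| `^ q)%:E)%E.
  have mkP : measurable_fun setT (fun y => kap * `|phi0 y| `^ q).
    exact: (measurable_funM (measurable_cst _) mP).
  have kP0 y : 0 <= kap * `|phi0 y| `^ q by exact: mulr_ge0.
  apply/esym; apply: etrans (int_affine z b0 mkP kP0) _.
  by rewrite (int_scale mu mP kap0 P0) muleA -EFinM mulrC.
have mv : measurable_fun setT v by apply: C1_measurable; exact: tame_C1 tv.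
have mPv : measurable_fun setT (fun x => `|v x| `^ q).
  by apply: measurable_fun_powR; exact: measurableT_comp.
apply: le_int.
- exact: (measurable_funM (measurable_cst _) mPv).
- exact: measurable_weighted.
- by move=> x; exact: mulr_ge0 kap0 (powR_ge0 _ _).
move=> x; have [vx|vx] := eqVneq (v x) 0; first by rewrite vx normr0 powR0// mulr0 mul0r.
have xr : enorm x < r.
  by rewrite ltNge; apply/negP => rx; move: vx; rewrite (tame_csupp tv rx) eqxx.
have xz : r * (1 - 3 * e) <= enorm x.
  rewrite leNgt; apply/negP => H; move/eqP: vx; apply; apply: (tame_csupp tphi).
  rewrite enormZ gtr0_norm// -ler_pdivrMl// -/e.
  have := ler_enormD (z - x) x; rewrite subrK enormB ze; lra.
have x0 : 0 < enorm x by rewrite (lt_le_trans _ xz)// mulr_gt0.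
rewrite mulrC ler_wpM2l ?powR_ge0// /hweight invfM.
apply: ler_pM; rewrite ?invr_ge0 ?exprn_ge0 ?(ltW r0)// ?mulr_ge0 ?powR_ge0 ?expR_ge0//.
  rewrite lef_pV2 ?posrE ?exprn_gt0//.
  by apply: lerXn2r; rewrite ?nnegrE ?(ltW x0) ?(ltW r0) ?(ltW xr).
have l1 : 1 < a * r / enorm x.
  rewrite ltr_pdivlMr// mul1r (lt_le_trans xr)// ler_peMl ?(ltW r0)//; exact: ltW.
have lnb : ln (a * r / enorm x) <= ln a * (1 + 6 / (ln a * beta)).
  have -> : ln a * (1 + 6 / (ln a * beta)) = ln a + 6 * e.
    by rewrite /e; field; rewrite !gt_eqF.
  apply: (@le_trans _ _ (ln (a * (1 + 6 * e)))).
    have p6 : 0 < 1 + 6 * e by rewrite addr_gt0// mulr_gt0.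
    rewrite ler_ln ?posrE ?divr_gt0 ?mulr_gt0// -mulrA ler_wpM2l ?(ltW a0)//.
    rewrite ler_pdivrMr//; apply: (@le_trans _ _ ((1 + 6 * e) * (r * (1 - 3 * e)))).
      rewrite mulrCA ler_peMr ?(ltW r0)//; move: e0 e6; nra.
    by rewrite ler_wpM2l// ltW.
  rewrite lnM ?posrE ?addr_gt0 ?mulr_gt0// lerD2l le_ln1Dx//.
  by rewrite (lt_trans _ (_ : 0 < 6 * e)) ?mulr_gt0// oppr_lt0.
have lb0 : 0 < ln (a * r / enorm x) by exact: ln_gt0.
rewrite powRN expRN -invfM lef_pV2 ?posrE ?mulr_gt0 ?powR_gt0 ?expR_gt0//.
have y0 : 0 < 1 + 6 / (ln a * beta) by rewrite addr_gt0// divr_gt0// mulr_gt0.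
apply: (@le_trans _ _ ((ln a * (1 + 6 / (ln a * beta))) `^ beta)).
  by apply: (ge0_ler_powR (ltW b0)); rewrite ?nnegrE ?(ltW lb0) ?(ltW (mulr_gt0 L0 y0)).
rewrite powRM ?(ltW L0) ?(ltW y0)// ler_wpM2l ?powR_ge0//.
rewrite /powR gt_eqF// ler_expR.
apply: (@le_trans _ _ (beta * (6 / (ln a * beta)))).
  rewrite ler_wpM2l ?(ltW b0)// le_ln1Dx//.
  by rewrite (lt_trans _ (_ : 0 < 6 / (ln a * beta))) ?divr_gt0 ?mulr_gt0// oppr_lt0.
by rewrite le_eqVlt; apply/orP; left; apply/eqP; field; rewrite !gt_eqF.
Qed.

End test_function.

Section nonradial_minimizers.
Context {R : realType} {n : nat}.
Local Notation mu := (lebesgue_rV R n.+2).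
Local Notation p := (n.+1%:R / n.+2%:R : R).

Lemma restrict_nonzero (r : R) (u : 'rV[R]_n.+2 -> R) :
  nonzero (eball r) u -> nonzero (eball r) (u \_ (eball r)).
Proof.
move=> un H; apply: un; apply: filterS H => x Hx xr.
by have := Hx xr; rewrite patchE mem_set.
Qed.

Lemma tame_admissible (r a q beta : R) (v : 'rV[R]_n.+2 -> R) : 0 < r -> 1 < a -> 0 < q ->
  tame r v -> (0 < weighted r a q beta v)%E -> admissible n.+2 r v.
Proof.
move=> r0 a1 q0 tv v0; split.
  by exists (gradient v); exact: tame_W01N.
move=> H; move: v0; have -> : weighted r a q beta v = 0%E; last by rewrite ltxx.
have mv : measurable_fun setT v by apply: C1_measurable; exact: tame_C1 tv.
rewrite weighted_csupp ?gt_eqF//; last exact: tame_csupp tv.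
have -> : 0%E = (\int[mu]_x (0 : R)%:E)%E by rewrite integral0.
apply: ge0_ae_eq_integral => //.
- by apply/measurable_EFinP; exact: measurable_weighted.
- move=> x _; rewrite lee_fin; apply: mulr_ge0; [exact: powR_ge0|exact: hweight_ge0].
apply: filterS H => x Hx _; have [xr|rx] := ltP (enorm x) r.
  by rewrite Hx// normr0 powR0 ?gt_eqF// mul0r.
by rewrite (tame_csupp tv rx) normr0 powR0 ?gt_eqF// mul0r.
Qed.

Lemma minimizer_le (r a q beta : R) u (v : 'rV[R]_n.+2 -> R) :
  minimizer n.+2 r a q beta u -> admissible n.+2 r v ->
  (quotient r a q beta u <= quotient r a q beta v)%E.
Proof. by move=> [_ ->] av; apply: ereal_inf_lbound; exists v. Qed.

Lemma powR_threshold (c del th D beta : R) : 0 < c -> 0 < del -> 0 < th -> 0 <= D ->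
  0 < beta -> ((D + 1) `^ th^-1 / c) `^ del^-1 < beta -> D < (c * beta `^ del) `^ th.
Proof.
move=> c0 del0 th0 D0 b0 H.
have D1 : 0 <= D + 1 by exact: addr_ge0.
have H1 : (D + 1) `^ th^-1 / c < beta `^ del.
  have := gt0_ltr_powR del0; move/(_ _ beta) => H1.
  have := H1 _ _ _ H; rewrite !nnegrE => /(_ (powR_ge0 _ _) (ltW b0)).
  by rewrite -powRrM mulVf ?(gt_eqF del0)// powRr1// divr_ge0 ?powR_ge0// ltW.
rewrite ltr_pdivrMr// mulrC in H1.
have H3 : (D + 1) `^ th^-1 `^ th < (c * beta `^ del) `^ th.
  by apply: (gt0_ltr_powR th0); rewrite ?nnegrE ?powR_ge0// mulr_ge0 ?powR_ge0// ltW.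
apply: lt_trans H3; rewrite -powRrM mulVf ?(gt_eqF th0)// powRr1//.
by rewrite ltrDl ltr01.
Qed.

Theorem symmetry_breaking (r a q : R) : 0 < r -> 1 < a -> n.+2%:R < q ->
  exists beta_star : R, forall beta : R, beta_star < beta ->
    forall u : 'rV[R]_n.+2 -> R, minimizer n.+2 r a q beta u -> ~ radial (eball r) u.
Proof.
move=> r0 a1 Nq; have q0 : 0 < q by exact: lt_trans Nq.
have q0' : q != 0 by rewrite gt_eqF.
have [[phi0 tphi phin]|H] := pselect (exists2 phi0 : 'rV[R]_n.+2 -> R,
    tame r phi0 & ~ {ae mu, forall x, phi0 x = 0}); last first.
  by exists 0 => beta _ u [/tame_nonzero_exists Hu _]; exfalso; exact: H Hu.
have L0 : 0 < ln a by exact: ln_gt0.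
have [B B0 [b0 b00 HB]] := @radial_weighted_bound R n r a q r0 a1 q0.
have mphi : measurable_fun setT phi0 by apply: C1_measurable; exact: tame_C1 tphi.
have [M M0 HM] := tame_bounded tphi.
pose I : R := fine (\int[mu]_x (`|phi0 x| `^ q)%:E)%E.
have mP : measurable_fun setT (fun x => `|phi0 x| `^ q).
  by apply: measurable_fun_powR; exact: measurableT_comp.
have I_ge0 : (0 <= \int[mu]_x (`|phi0 x| `^ q)%:E)%E.
  by apply: ge0_int => x; exact: powR_ge0.
have IE : (\int[mu]_x (`|phi0 x| `^ q)%:E = I%:E)%E.
  rewrite fineK// ge0_fin_numE//; apply: (@int_lty _ _ _ (M `^ q) r) => //.
  - by move=> x; apply: (ge0_ler_powR (ltW q0)); rewrite ?nnegrE.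
  - by move=> x /(tame_csupp tphi) ->; rewrite normr0 powR0.
have I0 : 0 < I.
  rewrite lt_neqAle -lee_fin -IE I_ge0 andbT eq_sym; apply/eqP => I0; apply: phin.
  rewrite I0 in IE; have := int_eq0_ae mP (fun x => powR_ge0 _ _) IE.
  apply: filterS => x /eqP; rewrite powR_eq0 q0' andbT normr_eq0 => /eqP //.
pose D0 : R := fine (\int[mu]_x (enorm (gradient phi0 x) ^+ n.+2)%:E)%E.
have DE : (\int[mu]_x (enorm (gradient phi0 x) ^+ n.+2)%:E = D0%:E)%E.
  rewrite fineK// ge0_fin_numE; first exact: tame_int_gradient_lty tphi.
  by apply: ge0_int => x; rewrite exprn_ge0// enorm_ge0.
have D00 : 0 <= D0.
  by apply: fine_ge0; apply: ge0_int => x; rewrite exprn_ge0// enorm_ge0.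
pose c : R := r ^- n.+2 * expR (- (6 / ln a)) * I / B.
have c0 : 0 < c by rewrite divr_gt0// mulr_gt0// mulr_gt0 ?expR_gt0// invr_gt0 exprn_gt0.
pose del : R := p * q + 1 - n.+2%:R.
have del0 : 0 < del.
  have -> : del = (q / n.+2%:R - 1) * n.+1%:R.
    have nE : n.+2%:R = n.+1%:R + 1 :> R by rewrite -natr1.
    have N0 : n.+2%:R != 0 :> R by [].
    rewrite /del; move: nE N0; move: (n.+2%:R) (n.+1%:R) => N m -> N0.
    by field.
  by rewrite mulr_gt0// subr_gt0 ltr_pdivlMr// mul1r.
pose th : R := n.+2%:R / q; have th0 : 0 < th by rewrite divr_gt0.
pose bs : R := ((D0 + 1) `^ th^-1 / c) `^ del^-1.
exists (b0 + 6 + bs) => beta hb u umin urad.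
have bs0 : 0 <= bs by exact: powR_ge0.
have hb0 : b0 <= beta by move: hb b00 bs0; lra.
have hb6 : 6 <= beta by move: hb b00 bs0; lra.
have hbs : bs < beta by move: hb b00; lra.
have bg0 : 0 < beta by exact: lt_le_trans hb6.
have [[Wu un] _] := umin.
have [phi A] := W01N_approx (ltn0Sn _) (W01N_wgradient Wu).
have Dlt := approxW_grad_lty (ltn0Sn _) A.
set U := u \_ _ in A; set g := wgradient _ u \_ _ in A Dlt.
have inv : rot_invariant U by exact: radial_rot_invariant.
have dE : dirichlet r u = (\int[mu]_x (enorm (g x) ^+ n.+2)%:E)%E by rewrite /dirichlet dirichlet_ext.
pose d : R := fine (\int[mu]_x (enorm (g x) ^+ n.+2)%:E)%E.
have I0g : (0 <= \int[mu]_x (enorm (g x) ^+ n.+2)%:E)%E.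
  by apply: ge0_int => x; rewrite exprn_ge0// enorm_ge0.
have gE : (\int[mu]_x (enorm (g x) ^+ n.+2)%:E = d%:E)%E by rewrite fineK// ge0_fin_numE.
have d0 : 0 <= d by exact: fine_ge0.
have W0 : (0 < weighted r a q beta u)%E.
  rewrite -weighted_restrict; apply: weighted_gt0 => //.
  - exact: approxW_mu A.
  - exact: approxW_u0 A.
  - exact: restrict_nonzero.
pose Bb : R := B * beta `^ (- (p * q + 1)) * (ln a) `^ (- beta).
have Bb0 : 0 < Bb by rewrite mulr_gt0 ?powR_gt0// mulr_gt0 ?powR_gt0.
have Wle (D : R) : 0 < D -> d <= D ->
    (weighted r a q beta u <= (Bb * D `^ (q / n.+2%:R))%:E)%E.
  move=> D1 dD; rewrite -weighted_restrict; apply: (HB beta hb0 U g phi D A inv D1).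
  by rewrite gE lee_fin.
have [v tv [dv Wv]] := test_function_bounds r0 a1 q0 hb6 tphi.
pose k : R := r ^- n.+2 * (ln a `^ (- beta) * expR (- (6 / ln a))) * beta ^- n.+2 * I.
have k0 : 0 < k.
  rewrite mulr_gt0// mulr_gt0 ?invr_gt0 ?exprn_gt0// mulr_gt0 ?invr_gt0 ?exprn_gt0//.
  by rewrite mulr_gt0 ?powR_gt0 ?expR_gt0.
rewrite IE -EFinM -/k in Wv; rewrite DE in dv.
have Wv0 : (0 < weighted r a q beta v)%E by apply: lt_le_trans Wv; rewrite lte_fin.
have quv := minimizer_le umin (tame_admissible r0 a1 q0 tv Wv0).
have qv := quotient_le q0 D00 k0 dv Wv.
have [dd|dd] := ltP 0 d; last first.
  have {}dd : d = 0 by apply/eqP; rewrite eq_le dd.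
  move: W0; apply/negP; rewrite -leNgt; apply/lee_addgt0Pr => e e0; rewrite add0e.
  pose D := (e / Bb) `^ (n.+2%:R / q).
  have Dg : 0 < D by rewrite powR_gt0// divr_gt0.
  apply: le_trans (Wle D Dg _) _; first by rewrite dd ltW.
  rewrite lee_fin /D -powRrM (_ : n.+2%:R / q * (q / n.+2%:R) = 1); last by rewrite mulrA divfK// divff.
  by rewrite powRr1 ?divr_ge0 ?(ltW e0) ?(ltW Bb0)// mulrC divfK// gt_eqF.
have qu := quotient_ge q0 d0 (etrans dE gE) W0 (Wle d dd (lexx _)).
have := le_trans (le_trans qu quv) qv; rewrite lee_fin -/th.
have -> : (Bb * d `^ (q / n.+2%:R)) `^ th = Bb `^ th * d.
  rewrite powRM ?(ltW Bb0) ?powR_ge0// -powRrM (_ : q / n.+2%:R * th = 1) ?powRr1 ?(ltW dd)//.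
  by rewrite /th mulrA divfK// divff.
have Bt : 0 < Bb `^ th by exact: powR_gt0.
have kt : 0 < k `^ th by exact: powR_gt0.
rewrite invfM mulrCA divff ?gt_eqF// mulr1 => H.
have kB : k / Bb = c * beta `^ del.
  rewrite /k /Bb /c.
  have -> : beta `^ del = beta `^ (p * q + 1) / beta ^+ n.+2.
    by rewrite /del powRB ?(gt_eqF bg0) ?implybT// powR_mulrn ?ltW.
  rewrite (powRN beta); have X0 := powR_gt0 (p * q + 1) bg0; have Y0 := powR_gt0 (- beta) L0.
  have Z0 := exprn_gt0 n.+2 bg0; have T0 := exprn_gt0 n.+2 r0.
  move: X0 Y0 Z0 T0; move: (beta `^ _) (ln a `^ _) (beta ^+ _) (r ^+ _) => X Y Z T X0 Y0 Z0 T0.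
  by field; rewrite !gt_eqF.
have : (k / Bb) `^ th <= D0.
  rewrite powRM ?invr_ge0 ?(ltW k0) ?(ltW Bb0)//.
  have -> : Bb^-1 `^ th = (Bb `^ th)^-1.
    by rewrite -[Bb^-1]powR_inv1 ?(ltW Bb0)// -powRrM mulN1r powRN.
  by rewrite mulrC -ler_pdivlMr.
apply/negP; rewrite -ltNge kB.
exact: powR_threshold hbs.
Qed.

End nonradial_minimizers.

(** * Radial minimizers for q at most N *)

Section projection.
Context {R : realType} {N : nat}.
Implicit Types (j u v : 'rV[R]_N).

Definition proj j v : 'rV[R]_N := v - (dot v j / dot j j) *: j.

Lemma proj_orth j v : dot (proj j v) j = 0.
Proof.
rewrite /proj dotBl dotZl; have [j0|j0] := eqVneq (dot j j) 0.
  have : enorm j == 0 by rewrite enormE j0 sqrtr0.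
  by rewrite enorm_eq0 => /eqP ->; rewrite !dot0r mulr0 subr0.
by rewrite divfK// subrr.
Qed.

Lemma proj_dot j u v : dot (proj j u) v = dot (proj j u) (proj j v).
Proof. by rewrite [in RHS]/proj dotBr dotZr proj_orth mulr0 subr0. Qed.

Lemma projB j u v : proj j (u - v) = proj j u - proj j v.
Proof.
by apply/rowP => i; rewrite /proj dotBl mulrBl !mxE; ring.
Qed.

Lemma proj_pythagoras j v : dot v v = dot (proj j v) (proj j v) + dot v j ^+ 2 / dot j j.
Proof.
rewrite -proj_dot /proj dotBl dotZl (dotC j v) expr2; ring.
Qed.

Lemma proj_le j v : enorm (proj j v) <= enorm v.
Proof.
by rewrite enorm_le (proj_pythagoras j v) lerDl divr_ge0 ?sqr_ge0 ?dot_ge0.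
Qed.

Lemma le_projD j v : enorm v <= enorm (proj j v) + `|dot v j| / enorm j.
Proof.
have -> : `|dot v j| / enorm j = enorm ((dot v j / dot j j) *: j).
  rewrite enormZ normrM normfV (ger0_norm (dot_ge0 j)) -enorm_sqr -mulrA; congr (_ * _).
  have [->|j0] := eqVneq (enorm j) 0; first by rewrite expr0n /= invr0 mul0r.
  by field.
by rewrite (le_trans _ (ler_enormD _ _))// /proj subrK.
Qed.

Lemma proj_eq j v : enorm (proj j v) = enorm v -> dot v j = 0.
Proof.
move=> H; have := proj_pythagoras j v; rewrite -!enorm_sqr H -{1}(addr0 (enorm v ^+ 2)).
move=> /addrI/esym/eqP; rewrite mulf_eq0 sqrf_eq0 invr_eq0 expf_eq0 /= enorm_eq0.
by move=> /orP[/eqP //|/eqP ->]; rewrite dot0r.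
Qed.

Lemma ler_dist_proj j u v : `|enorm (proj j u) - enorm (proj j v)| <= enorm (u - v).
Proof. by rewrite (le_trans (ler_dist_enorm _ _))// -projB proj_le. Qed.

End projection.

Section trigonometry.
Context {R : realType}.
Implicit Types a b d : R.

Let lip (f df : R -> R) a b : (forall x : R, is_derive x 1 f (df x)) ->
  (forall x : R, `|df x| <= 1) -> `|f a - f b| <= `|a - b|.
Proof.
wlog ab : a b / b <= a => [H|] dfE df1.
  by have [/H|/ltW /H] := leP b a; [apply|rewrite distrC (distrC a); apply].
have cf x : {for x, continuous f}.
  by apply: differentiable_continuous; apply/derivable1_diffP; case: (dfE x).
have [c _ ->] := MVT_segment ab (fun x _ => dfE x) (continuous_subspaceT cf).
by rewrite normrM ler_piMl.
Qed.

Lemma cos_lip a b : `|cos a - cos b| <= `|a - b|.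
Proof.
by apply: (@lip cos (fun x => - sin x)) => x; rewrite normrN sin_max.
Qed.

Lemma sin_lip a b : `|sin a - sin b| <= `|a - b|.
Proof. by apply: (@lip sin cos) => x; exact: cos_max. Qed.

Lemma cos_sub1 d : `|cos d - 1| <= d ^+ 2.
Proof.
wlog d0 : d / 0 <= d => [H|].
  by have [/H//|/ltW d0] := leP 0 d; rewrite -cosN -sqrrN; apply: H; rewrite oppr_ge0.
have cf : continuous (@cos R) by exact: continuous_cos.
have [c] := MVT_segment d0 (fun x _ => is_derive_cos x) (continuous_subspaceT cf).
rewrite in_itv /= cos0 subr0 => /andP[c0 cd] ->; rewrite normrM normrN (ger0_norm d0) expr2.
rewrite ler_wpM2r//; have := sin_lip c 0; rewrite sin0 !subr0 => /le_trans; apply.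
by rewrite ger0_norm.
Qed.

Lemma sin_subid d : `|sin d - d| <= d ^+ 2.
Proof.
wlog d0 : d / 0 <= d => [H|].
  have [/H//|/ltW d0] := leP 0 d; rewrite -sqrrN -normrN opprB -(opprK (d - _)) opprB.
  have := H (- d); rewrite sinN opprK oppr_ge0 => /(_ d0); by rewrite addrC distrC addrC -normrN opprD opprK.
pose f (x : R) := sin x - x.
have df (x : R) : is_derive x 1 f (cos x - 1).
  exact: is_deriveB.
have cf x : {for x, continuous f}.
  by apply: differentiable_continuous; apply/derivable1_diffP; case: (df x).
have [c] := MVT_segment d0 (fun x _ => df x) (continuous_subspaceT cf).
rewrite in_itv /= /f sin0 !subr0 => /andP[c0 cd] ->.
rewrite normrM (ger0_norm d0) expr2 ler_wpM2r//.
have := cos_lip c 0; rewrite cos0 subr0 => /le_trans; apply.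
by rewrite ger0_norm.
Qed.

Lemma cos_sin_angle (c s : R) : c ^+ 2 + s ^+ 2 = 1 -> exists th, c = cos th /\ s = sin th.
Proof.
move=> cs; have c1 : -1 <= c <= 1.
  have : `|c| ^+ 2 <= 1 ^+ 2 by rewrite real_normK ?num_real// expr1n -cs lerDl sqr_ge0.
  by rewrite -ler_norml ler_pXn2r ?nnegrE.
have ca : cos (acos c) = c by apply: acosK; rewrite in_itv.
have sa : sin (acos c) = `|s|.
  by rewrite sin_acos// -cs addrAC subrr add0r sqrtr_sqr.
have [s0|s0] := leP 0 s.
  by exists (acos c); rewrite ca sa ger0_norm.
by exists (- acos c); rewrite cosN sinN ca sa ltr0_norm// opprK.
Qed.

End trigonometry.

Section plane_rotation.
Context {R : realType} {n : nat}.
Implicit Types (f u : 'rV[R]_n.+1 -> R) (x y z v : 'rV[R]_n.+1).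
Local Notation mu := (lebesgue_rV R n.+1).
Local Notation e0 := (delta_mx ord0 ord0 : 'rV[R]_n.+1).
Variable w : 'rV[R]_n.+1.
Hypotheses (w0 : w ord0 ord0 = 0) (ww : dot w w = 1).

Definition angular x : 'rV[R]_n.+1 := x ord0 ord0 *: w - dot w x *: e0.

Definition rotT (th : R) x := rot w (cos th) (sin th) x.

Let we : dot w e0 = 0. Proof. by rewrite dotC dot_delta. Qed.
Let ee : dot e0 e0 = 1. Proof. by rewrite dot_delta mxE !eqxx. Qed.

Lemma dot_angular x : dot (angular x) (angular x) = x ord0 ord0 ^+ 2 + dot w x ^+ 2.
Proof.
by rewrite /angular !(dotBl, dotZl) !(dotBr, dotZr) (dotC e0 w) we ww ee; ring.
Qed.

Lemma angular_le x : enorm (angular x) <= enorm x.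
Proof.
rewrite enorm_le dot_angular.
have [a aE] : exists a, a = x ord0 ord0 *: e0 + dot w x *: w by eexists.
have xa : dot a x = x ord0 ord0 ^+ 2 + dot w x ^+ 2.
  by rewrite aE dotDl !dotZl dot_delta; ring.
have aa : dot a a = x ord0 ord0 ^+ 2 + dot w x ^+ 2.
  by rewrite {1}aE dotDl !dotZl dot_delta aE dotDr !dotZr we ww !mxE !eqxx w0 /=; ring.
have := dot_ge0 (x - a); rewrite dotBl !dotBr (dotC x a) xa aa; lra.
Qed.

Lemma angular_rot c s x : angular (rot w c s x) = rot w c s (angular x).
Proof.
apply/rowP => i; rewrite {1}/angular rot_head// rot_dot// /rot !rV_addZE.
have h : angular x ord0 ord0 = - dot w x.
  by rewrite /angular !mxE w0 !eqxx /= mulr0 mulr1 add0r.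
have d : dot w (angular x) = x ord0 ord0.
  by rewrite /angular dotBr !dotZr we ww; ring.
by rewrite h d /angular !mxE; ring.
Qed.

Lemma rotT0 x : rotT 0 x = x.
Proof. by rewrite /rotT cos0 sin0 rot1. Qed.

Lemma rotTD a b x : rotT a (rotT b x) = rotT (a + b) x.
Proof. by rewrite /rotT rotM// cosD sinD; congr (rot w _ _ _); ring. Qed.

Lemma rotT_2pi x : rotT (pi *+ 2) x = x.
Proof. by rewrite /rotT sin2pi cos2pi rot1. Qed.

Lemma enorm_rotT a x : enorm (rotT a x) = enorm x.
Proof. by rewrite /rotT enorm_rot// cos2Dsin2. Qed.

Lemma rotTE a x : rotT a x - x - a *: angular x =
  (cos a - 1) *: (x ord0 ord0 *: e0 + dot w x *: w) + (sin a - a) *: angular x.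
Proof.
by apply/rowP => i; rewrite /rotT /rot /angular !mxE; ring.
Qed.

Let enorm_radial x : enorm (x ord0 ord0 *: e0 + dot w x *: w) = enorm (angular x).
Proof.
rewrite !enormE dot_angular !(dotDl, dotZl) !(dotDr, dotZr) (dotC e0 w) we ww ee.
by congr (Num.sqrt _); ring.
Qed.

Lemma rotT_sub_le a x : enorm (rotT a x - x) <= 2 * `|a| * enorm (angular x).
Proof.
have -> : rotT a x - x = (cos a - cos 0) *: (x ord0 ord0 *: e0 + dot w x *: w) +
    (sin a - sin 0) *: angular x.
  by rewrite cos0 sin0; apply/rowP => i; rewrite /rotT /rot /angular !mxE; ring.
rewrite (le_trans (ler_enormD _ _))// !enormZ enorm_radial -mulrDl ler_wpM2r ?enorm_ge0//.
have := cos_lip a 0; have := sin_lip a 0; rewrite subr0; lra.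
Qed.

Lemma rotT_taylor1 a x :
  enorm (rotT a x - x - a *: angular x) <= 2 * a ^+ 2 * enorm (angular x).
Proof.
rewrite rotTE (le_trans (ler_enormD _ _))// !enormZ enorm_radial -mulrDl ler_wpM2r ?enorm_ge0//.
have := cos_sub1 a; have := sin_subid a; lra.
Qed.

Lemma rot_taylor f (M L : R) a y : C1 f ->
  (forall x, enorm (gradient f x) <= M) -> 0 <= L ->
  (forall x z, enorm (gradient f x - gradient f z) <= L * enorm (x - z)) ->
  `|f (rotT a y) - f y - a * dot (gradient f y) (angular y)| <=
    (4 * L * enorm (angular y) + 2 * M) * a ^+ 2 * enorm (angular y).
Proof.
move=> cf HM L0 HL; have [h hE] : exists h, h = rotT a y - y by exists (rotT a y - y).
have [t t1] := @MVT_line _ _ f y h 1 (fun z => (C1_derive z h cf).1).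
rewrite scale1r mul1r (C1_derive _ _ cf).2 => E.
have -> : rotT a y = y + h by rewrite hE addrC subrK.
rewrite E -dotZr.
have -> : dot (gradient f (y + t *: h)) h - dot (gradient f y) (a *: angular y) =
   dot (gradient f (y + t *: h) - gradient f y) h + dot (gradient f y) (h - a *: angular y).
  by rewrite dotBl dotBr; ring.
have M0 : 0 <= M by exact: le_trans (enorm_ge0 _) (HM 0).
have H1 := rotT_sub_le a y; have H2 := rotT_taylor1 a y; rewrite -hE in H1 H2.
set b := enorm (angular y) in H1 H2 *; have b0 : 0 <= b by exact: enorm_ge0.
rewrite (le_trans (ler_normD _ _))// mulrDl mulrDl lerD//.
  rewrite (le_trans (normr_dot_le _ _))//.
  apply: (@le_trans _ _ (L * (2 * `|a| * b) * (2 * `|a| * b))).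
    apply: ler_pM => //; rewrite ?enorm_ge0//.
    rewrite (le_trans (HL _ _))// ler_wpM2l// addrC addKr enormZ.
    rewrite normr1 in t1; rewrite (le_trans _ H1)// ler_piMl ?enorm_ge0//.
  rewrite [leLHS](_ : _ = 4 * L * b * (`|a| ^+ 2) * b); last by ring.
  by rewrite real_normK ?num_real.
rewrite (le_trans (normr_dot_le _ _))//.
apply: (@le_trans _ _ (M * (2 * a ^+ 2 * b))); last by rewrite le_eqVlt; apply/orP; left; apply/eqP; ring.
by apply: ler_pM; rewrite ?enorm_ge0.
Qed.

Lemma proj_rot c s j v : c ^+ 2 + s ^+ 2 = 1 ->
  proj (rot w c s j) (rot w c s v) = rot w c s (proj j v).
Proof.
move=> cs; rewrite /proj (rot_isom w0 ww v j cs) (rot_isom w0 ww j j cs).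
by rewrite -[in LHS]scaleNr -[in RHS]scaleNr rotDZ.
Qed.

End plane_rotation.

Section angular_derivative.
Context {R : realType} {n : nat}.
Implicit Types (f u : 'rV[R]_n.+1 -> R) (x y z v : 'rV[R]_n.+1).
Local Notation mu := (lebesgue_rV R n.+1).
Variable r : R.
Hypothesis r0 : 0 < r.

Lemma tame_gradient_lip f : tame r f -> exists2 L : R, 0 <= L &
  forall x y, enorm (gradient f x - gradient f y) <= L * enorm (x - y).
Proof.
move=> [sf [s sr fs]]; pose t := (s + r) / 2.
have st : s < t by rewrite /t; lra.
have H i : exists L : R, 0 <= L /\ forall x y, `|partial i f x - partial i f y| <= L * enorm (x - y).
  have c : C1 (partial i f) by apply: smooth_C1; exact: smooth_partial.
  have [L L0 HL] := gradient_bounded c (csupp_partial i st fs).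
  by exists L; split => // x y; exact: C1_lipschitz.
have [L HL] := choice H; exists (\sum_i L i) => [|x y].
  by apply: sumr_ge0 => i _; have [] := HL i.
rewrite (le_trans (enorm_le_sum _))// mulr_suml; apply: ler_sum => i _.
by rewrite !mxE; exact: (HL i).2.
Qed.

Variable w : 'rV[R]_n.+1.
Hypotheses (w0 : w ord0 ord0 = 0) (ww : dot w w = 1).
Local Notation rotT := (rotT w).
Local Notation J := (angular w).

Lemma measurable_rotT th : measurable_fun setT (rotT th).
Proof. exact: measurable_rot. Qed.

Lemma int_rotT f th : measurable_fun setT f -> (forall x, 0 <= f x) ->
  (\int[mu]_x (f (rotT th x))%:E = \int[mu]_x (f x)%:E)%E.
Proof.
move=> mf f0; have mE : measurable_fun setT (EFin \o f) by exact/measurable_EFinP.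
have F0 x : (0 <= (EFin \o f) x)%E by rewrite lee_fin.
exact: (integral_rot w0 ww (cos2Dsin2 th) mE F0).
Qed.

Lemma measurable_angular : measurable_fun setT J.
Proof.
apply: measurable_fun_rVP => i.
rewrite (_ : (fun x : 'rV[R]_n.+1 => J x ord0 i) = fun x => x ord0 ord0 * w ord0 i -
    dot w x * (delta_mx ord0 ord0 : 'rV[R]_n.+1) ord0 i); last first.
  by apply/funext => x; rewrite /angular !mxE.
apply: measurable_funB; apply: measurable_funM => //; first exact: measurable_coord.
by apply: continuous_measurable_rV; exact: continuous_dotr.
Qed.

Lemma measurable_dot (g h : 'rV[R]_n.+1 -> 'rV[R]_n.+1) : measurable_fun setT g ->
  measurable_fun setT h -> measurable_fun setT (fun x => dot (g x) (h x)).
Proof.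
move=> mg mh; apply: measurable_sum => i; apply: measurable_funM.
  exact: (measurableT_comp (measurable_coord i) mg).
exact: (measurableT_comp (measurable_coord i) mh).
Qed.

Lemma tame_rot_step f : tame r f -> exists2 C : R, 0 <= C & forall a x,
  `|f (rotT a x) - f x - a * dot (gradient f x) (J x)| <= C * a ^+ 2 * \1_(eball r) x.
Proof.
move=> tf; have [M M0 HM] := tame_gradient_bounded tf.
have [L L0 HL] := tame_gradient_lip tf.
have C0 : 0 <= (4 * L * r + 2 * M) * r.
  by rewrite mulr_ge0 ?(ltW r0)// addr_ge0// mulr_ge0 ?(ltW r0)// mulr_ge0.
exists ((4 * L * r + 2 * M) * r) => // a x.
rewrite indicE; have [xr|rx] := ltP (enorm x) r; last first.
  rewrite (tame_csupp tf rx) (tame_gradient0 tf rx) dot0l.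
  rewrite (tame_csupp tf); last by rewrite enorm_rotT.
  rewrite mulr0 !subr0 normr0; apply: mulr_ge0 => //.
  exact: mulr_ge0 C0 (sqr_ge0 _).
rewrite mem_set// mulr1.
rewrite (le_trans (rot_taylor w0 ww a x (tame_C1 tf) HM L0 HL))//.
have Jr : enorm (J x) <= r by rewrite (le_trans (angular_le w0 ww x))// ltW.
rewrite mulrAC ler_wpM2r ?sqr_ge0//; apply: ler_pM; rewrite ?enorm_ge0//.
  by rewrite addr_ge0// ?mulr_ge0 ?enorm_ge0.
by rewrite lerD2r ler_wpM2l// mulr_ge0.
Qed.

Lemma int_rot_diff f th : tame r f ->
  (\int[mu]_x (`|f (rotT th x) - f x|)%:E <=
   (`|th|)%:E * \int[mu]_x (`|dot (gradient f x) (J x)|)%:E)%E.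
Proof.
move=> tf; have [C C0 HC] := tame_rot_step tf.
have mf : measurable_fun setT f by apply: C1_measurable; exact: tame_C1 tf.
have mg : measurable_fun setT (gradient f) by apply: measurable_gradient; exact: tame_C1 tf.
have mT : measurable_fun setT (fun x => `|dot (gradient f x) (J x)|).
  by apply: measurableT_comp => //; apply: measurable_dot => //; exact: measurable_angular.
pose V : R := fine (mu (eball r)).
have VE : mu (eball r) = V%:E by rewrite fineK// ge0_fin_numE ?measure_ge0// lebesgue_eball_lty.
have V0 : 0 <= V by rewrite fine_ge0// measure_ge0.
have mB : measurable (eball r : set 'rV[R]_n.+1) by exact: measurable_eball.
have mI : measurable_fun setT (\1_(eball r) : 'rV[R]_n.+1 -> R) by exact: measurable_indic.
have i0 (x : 'rV[R]_n.+1) : 0 <= \1_(eball r) x :> R by rewrite indicE.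
have IV : (\int[mu]_x (\1_(eball r) x)%:E = V%:E)%E by rewrite -VE; exact: esym (measure_indic mu mB).
have th1 := normr_ge0 th.
apply/lee_addgt0Pr => e e0.
have [m0 Hm0] : exists m0 : nat, C * th ^+ 2 * V / e <= m0.+1%:R.
  exists (Num.Def.trunc (C * th ^+ 2 * V / e)).
  have c0 : 0 <= C * th ^+ 2 * V / e by exact: divr_ge0 (mulr_ge0 (mulr_ge0 C0 (sqr_ge0 _)) V0) (ltW e0).
  by have /andP[_ /ltW] := Num.Theory.trunc_itv c0.
pose m := m0.+1; pose d := th / m%:R.
have m_gt0 : 0 < m%:R :> R by [].
pose A y := `|f (rotT d y) - f y|.
have mrot a : measurable_fun setT (fun x => f (rotT a x)).
  exact: (measurableT_comp mf (measurable_rotT a)).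
have mA : measurable_fun setT A by exact: (measurable_normB (mrot d) mf).
have A0 y : 0 <= A y by exact: normr_ge0.
have tele (k : nat) : (\int[mu]_x (`|f (rotT (k%:R * d) x) - f x|)%:E <=
    k%:R%:E * \int[mu]_x (A x)%:E)%E.
  elim: k => [|k IH].
    rewrite mul0e integral0_eq// => x _.
    by rewrite mul0r rotT0 subrr normr0.
  have mAk : measurable_fun setT (fun x => A (rotT (k%:R * d) x)).
    exact: (measurableT_comp mA (measurable_rotT _)).
  have mdk := measurable_normB (mrot (k%:R * d)) mf.
  apply: (@le_trans _ _ (\int[mu]_x (A (rotT (k%:R * d) x) + `|f (rotT (k%:R * d) x) - f x|)%:E)%E).
    apply: le_int.
    - exact: (measurable_normB (mrot _) mf).
    - exact: (measurable_funD mAk mdk).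
    - by move=> x; exact: normr_ge0.
    move=> x; have -> : f (rotT (k.+1%:R * d) x) - f x =
        (f (rotT d (rotT (k%:R * d) x)) - f (rotT (k%:R * d) x)) +
        (f (rotT (k%:R * d) x) - f x).
      by rewrite rotTD// addrA subrK -natr1 mulrDl mul1r (addrC d).
    exact: ler_normD.
  rewrite (int_add mu mAk mdk); [|by []|by move=> x; exact: normr_ge0].
  rewrite (int_rotT (k%:R * d) mA A0) -natr1 EFinD (addeC k%:R%:E) ge0_muleDl ?lee_fin// mul1e.
  by rewrite leeD2l.
have step1 : (\int[mu]_x (`|f (rotT th x) - f x|)%:E <= m%:R%:E * \int[mu]_x (A x)%:E)%E.
  have -> : rotT th = rotT (m%:R * d) by rewrite /d mulrC divfK// gt_eqF.
  exact: tele.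
apply: le_trans step1 _.
have d0 := normr_ge0 d.
have Cd0 : 0 <= C * d ^+ 2 by rewrite mulr_ge0 ?sqr_ge0.
have mdT : measurable_fun setT (fun x => `|d| * `|dot (gradient f x) (J x)|).
  exact: (measurable_funM (measurable_cst _) mT).
have mCI : measurable_fun setT (fun x : 'rV[R]_n.+1 => C * d ^+ 2 * \1_(eball r) x).
  exact: (measurable_funM (measurable_cst _) mI).
have AI : (\int[mu]_x (A x)%:E <= `|d|%:E * \int[mu]_x (`|dot (gradient f x) (J x)|)%:E +
    (C * d ^+ 2 * V)%:E)%E.
  rewrite [(C * _ * V)%:E]EFinM -IV -(int_scale mu mI Cd0 i0).
  rewrite -(int_scale mu mT d0 (fun x => normr_ge0 _)).
  rewrite -(int_add mu mdT mCI); last 2 first.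
  - by move=> x; exact: mulr_ge0.
  - by move=> x; exact: mulr_ge0.
  apply: le_int => //; first exact: (measurable_funD mdT mCI).
  move=> x; have := HC d x; rewrite -normrM.
  have := ler_normD (f (rotT d x) - f x - d * dot (gradient f x) (J x))
    (d * dot (gradient f x) (J x)).
  rewrite subrK /A; lra.
apply: (le_trans (lee_wpmul2l _ AI)); first by rewrite lee_fin.
have T0 : (0 <= \int[mu]_x (`|dot (gradient f x) (J x)|)%:E)%E by apply: ge0_int => x.
rewrite ge0_muleDr; last 2 first.
- by rewrite mule_ge0// lee_fin.
- by rewrite lee_fin mulr_ge0.
rewrite muleA -EFinM; apply: leeD.
  by rewrite /d normrM normfV (gtr0_norm m_gt0) mulrC divfK// gt_eqF.
rewrite -EFinM lee_fin.
have -> : m%:R * (C * d ^+ 2 * V) = C * th ^+ 2 * V / m%:R.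
  by rewrite /d; field; rewrite gt_eqF.
by rewrite ler_pdivrMr// -ler_pdivrMl// mulrC.
Qed.

End angular_derivative.

Section angular_invariance.
Context {R : realType} {n : nat}.
Implicit Types (f : 'rV[R]_n.+2 -> R) (x y z v : 'rV[R]_n.+2).
Local Notation mu := (lebesgue_rV R n.+2).
Variables (r : R) (u : 'rV[R]_n.+2 -> R) (g : 'rV[R]_n.+2 -> 'rV[R]_n.+2).
Variable (phi : nat -> 'rV[R]_n.+2 -> R).
Hypotheses (r0 : 0 < r) (A : approxW r u g phi).
Variable w : 'rV[R]_n.+2.
Hypotheses (w0 : w ord0 ord0 = 0) (ww : dot w w = 1).
Hypothesis Tg : {ae mu, forall x, dot (g x) (angular w x) = 0}.

Let mgk k : measurable_fun setT (gradient (phi k)).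
Proof. by apply: measurable_gradient; exact: tame_C1 (approxW_tame A k). Qed.

Lemma approxW_grad_L1 :
  small (fun k => \int[mu]_x (enorm (gradient (phi k) x - g x))%:E)%E.
Proof.
apply: (@small_L1 _ _ r (fun k x => enorm (gradient (phi k) x - g x))) => //.
- by move=> k; apply: measurable_enorm_comp; apply: measurable_rVB => //; exact: approxW_mg A.
- by move=> k x; exact: enorm_ge0.
- move=> k x rx; rewrite (tame_gradient0 (approxW_tame A k) rx) (approxW_g0 A rx).
  by rewrite subr0 enorm0.
- exact: approxW_g A.
Qed.

Let T_small : small (fun k => \int[mu]_x (`|dot (gradient (phi k) x) (angular w x)|)%:E)%E.
Proof.
have mJ := @measurable_angular R n.+1 w.
have I0 k : (0 <= \int[mu]_x (enorm (gradient (phi k) x - g x))%:E)%E.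
  by apply: ge0_int => x; exact: enorm_ge0.
apply: small_le (smallZ (ltW r0) I0 approxW_grad_L1) => k.
have mG : measurable_fun setT (fun x => enorm (gradient (phi k) x - g x)).
  by apply: measurable_enorm_comp; apply: measurable_rVB => //; exact: approxW_mg A.
rewrite -(int_scale mu mG (ltW r0) (fun x => enorm_ge0 _)).
apply: ae_ge0_le_integral => //.
- by apply/measurable_EFinP; apply: measurableT_comp => //; exact: measurable_dot.
- by move=> x _; rewrite lee_fin mulr_ge0 ?enorm_ge0 ?(ltW r0).
- by apply/measurable_EFinP; exact: (measurable_funM (measurable_cst _) mG).
apply: filterS Tg => x Tx _; rewrite lee_fin.
have -> : dot (gradient (phi k) x) (angular w x) =
    dot (gradient (phi k) x - g x) (angular w x) by rewrite dotBl Tx subr0.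
have [xr|rx] := ltP (enorm x) r; last first.
  rewrite (tame_gradient0 (approxW_tame A k) rx) (approxW_g0 A rx) subr0 dot0l normr0.
  by rewrite mulr_ge0 ?enorm_ge0 ?(ltW r0).
rewrite (le_trans (normr_dot_le _ _))// mulrC ler_wpM2r ?enorm_ge0//.
by rewrite (le_trans (angular_le w0 ww x))// ltW.
Qed.

Lemma angular_invariant th : {ae mu, forall x, u (rotT w th x) = u x}.
Proof.
have mu_ := approxW_mu A.
have mphi k : measurable_fun setT (phi k) by apply: C1_measurable; exact: tame_C1 (approxW_tame A k).
have mR f : measurable_fun setT f -> measurable_fun setT (fun x => f (rotT w th x)).
  by move=> mf; exact: (measurableT_comp mf (measurable_rotT w th)).
have I0 : (\int[mu]_x (`|u (rotT w th x) - u x|)%:E = 0)%E.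
  apply/eqP; rewrite eq_le; apply/andP; split; last by apply: ge0_int => x; exact: normr_ge0.
  have T0 k : (0 <= \int[mu]_x (`|dot (gradient (phi k) x) (angular w x)|)%:E)%E.
    by apply: ge0_int => x; exact: normr_ge0.
  have sL := approxW_L1 A.
  apply: small_const; apply: small_le (smallD (smallD sL (smallZ (normr_ge0 th) T0 T_small)) sL).
  move=> k; have md : measurable_fun setT (fun x => `|phi k x - u x|) by exact: measurable_normB.
  have mdR := mR _ md.
  have mr : measurable_fun setT (fun x => `|phi k (rotT w th x) - phi k x|).
    by apply: measurable_normB => //; exact: mR.
  have n0 (h : 'rV[R]_n.+2 -> R) x : 0 <= `|h x| by exact: normr_ge0.
  have mdr := measurable_funD mdR mr.
  apply: (@le_trans _ _ (\int[mu]_x (`|phi k (rotT w th x) - u (rotT w th x)| +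
      `|phi k (rotT w th x) - phi k x| + `|phi k x - u x|)%:E)%E).
    apply: le_int.
    - by apply: measurable_normB => //; exact: mR.
    - exact: (measurable_funD mdr md).
    - by move=> x; exact: normr_ge0.
    move=> x; set a := u (rotT _ _ _); set b := phi k (rotT _ _ _); set c := phi k x; set d := u x.
    have := ler_normD (a - b) (b - c); have := ler_normD (a - c) (c - d).
    by rewrite !addrA !subrK distrC (distrC a b); lra.
  have p1 x : 0 <= `|phi k (rotT w th x) - u (rotT w th x)| by exact: normr_ge0.
  have p2 x : 0 <= `|phi k (rotT w th x) - phi k x| by exact: normr_ge0.
  have p3 x : 0 <= `|phi k x - u x| by exact: normr_ge0.
  rewrite (int_add mu mdr md (fun x => addr_ge0 (p1 x) (p2 x)) p3) (int_add mu mdR mr p1 p2).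
  apply: leeD => //; apply: leeD.
    by have := int_rotT w0 ww th md p3 => ->.
  exact: int_rot_diff (approxW_tame A k).
have mur : measurable_fun setT (fun x => `|u (rotT w th x) - u x|).
  by apply: measurable_normB => //; exact: mR.
apply: filterS (int_eq0_ae mur (fun x => normr_ge0 _) I0) => x /eqP.
by rewrite normr_eq0 subr_eq0 => /eqP.
Qed.

End angular_invariance.

Section power_inequalities.
Context {R : realType}.

Lemma powR_concave (th z : R) : 0 < th -> th <= 1 -> 0 <= z -> z `^ th <= 1 + th * (z - 1).
Proof.
move=> th0; rewrite le_eqVlt => /orP[/eqP -> z0|th1 z0].
  by rewrite powRr1// mul1r addrC subrK.
have p0 : 0 < th^-1 by rewrite invr_gt0.
have q0 : 0 < (1 - th)^-1 by rewrite invr_gt0 subr_gt0.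
have pq : th^-1^-1 + (1 - th)^-1^-1 = 1 by rewrite !invrK addrC subrK.
have := conjugate_powR (powR_ge0 z th) (@ler01 R) p0 q0 pq.
rewrite mulr1 !invrK -powRrM mulfV ?gt_eqF// powRr1//.
have -> : 1 `^ (1 - th)^-1 = 1 :> R by rewrite powR1.
lra.
Qed.

Lemma powR_convex (q x : R) : 1 <= q -> 0 <= x -> 1 + q * (x - 1) <= x `^ q.
Proof.
move=> q1 x0; have q0 : 0 < q by exact: lt_le_trans q1.
have := @powR_concave q^-1 (x `^ q); rewrite invr_gt0 => /(_ q0).
rewrite invf_le1// => /(_ q1 (powR_ge0 _ _)).
rewrite -powRrM mulfV ?gt_eqF// powRr1// => H.
have : q * x <= q * (1 + q^-1 * (x `^ q - 1)) by rewrite ler_wpM2l// ltW.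
by rewrite mulrDr mulrA divff ?gt_eqF// mul1r mulr1; lra.
Qed.

Lemma powR_shift (q M s t d : R) : 1 < q -> 0 <= s -> 0 <= t -> t <= M -> 0 <= d ->
  t - d <= s -> t `^ q <= s `^ q + q * M `^ (q - 1) * d.
Proof.
move=> q1 s0 t0 tM d0 ts; have q0 : 0 < q by exact: lt_trans q1.
have [->|tn] := eqVneq t 0.
  rewrite powR0 ?gt_eqF// addr_ge0 ?powR_ge0// mulr_ge0//.
  exact: mulr_ge0 (ltW q0) (powR_ge0 _ _).
have tp : 0 < t by rewrite lt_neqAle eq_sym tn.
have := powR_convex (ltW q1) (divr_ge0 s0 t0).
rewrite powRM ?invr_ge0//; have -> : t^-1 `^ q = (t `^ q)^-1.
  by rewrite -[t^-1]powR_inv1// -powRrM mulN1r powRN.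
rewrite ler_pdivlMr ?powR_gt0// => H.
have E : t `^ q = t `^ (q - 1) * t.
  by rewrite powRB ?tn ?implybT// powRr1// divfK.
have H2 : t `^ q - q * (t `^ (q - 1)) * d <= s `^ q.
  apply: le_trans H; rewrite E mulrA.
  have -> : (1 + q * (s / t - 1)) * t `^ (q - 1) * t = t `^ (q - 1) * (t + q * (s - t)).
    by field.
  have -> : t `^ (q - 1) * t - q * t `^ (q - 1) * d = t `^ (q - 1) * (t - q * d) by ring.
  rewrite ler_wpM2l ?powR_ge0// lerD2l -mulrN ler_wpM2l ?(ltW q0)//; move: ts; lra.
have H3 : q * t `^ (q - 1) * d <= q * M `^ (q - 1) * d.
  rewrite ler_wpM2r// ler_wpM2l ?(ltW q0)//; apply: ge0_ler_powR => //.
  - by rewrite subr_ge0 ltW.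
  - by rewrite nnegrE (le_trans t0).
lra.
Qed.

Section averages.
Variable m : nat.
Hypothesis m0 : (0 < m)%N.

Definition avg (G : nat -> R) : R := (\sum_(k < m) G k) / m%:R.

Let mR : 0 < m%:R :> R. Proof. by rewrite ltr0n. Qed.

Lemma avg_le G H : (forall k, G k <= H k) -> avg G <= avg H.
Proof. by move=> GH; rewrite ler_wpM2r ?invr_ge0 ?(ltW mR)//; apply: ler_sum. Qed.

Lemma avg_cst (c : R) : avg (fun=> c) = c.
Proof. by rewrite /avg sumr_const card_ord -(mulr_natr c) mulfK// gt_eqF. Qed.

Lemma avg_ge0 G : (forall k, 0 <= G k) -> 0 <= avg G.
Proof. by move=> G0; rewrite -(avg_cst 0); apply: avg_le. Qed.

Lemma avgD G H : avg (fun k => G k + H k) = avg G + avg H.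
Proof. by rewrite /avg big_split mulrDl. Qed.

Lemma avgZ c G : avg (fun k => c * G k) = c * avg G.
Proof. by rewrite /avg -mulr_sumr mulrA. Qed.

Lemma avg_eq0 G : (forall k, 0 <= G k) -> avg G = 0 -> forall k : 'I_m, G k = 0.
Proof.
move=> G0 /eqP; rewrite mulf_eq0 invr_eq0 (gt_eqF mR) orbF.
by rewrite psumr_eq0// => /allP H k; apply/eqP; apply: (H k); exact: mem_index_enum.
Qed.

Lemma avg_pow_mean (q : R) n (a : nat -> R) : 0 < q -> q <= n.+1%:R -> (forall k, 0 <= a k) ->
  avg (fun k => a k `^ q) <= avg (fun k => a k ^+ n.+1) `^ (q / n.+1%:R).
Proof.
move=> q0 qN a0; set A := avg (fun k => a k ^+ _).
have A0 : 0 <= A by apply: avg_ge0 => k; rewrite exprn_ge0.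
have th0 : 0 < q / n.+1%:R by rewrite divr_gt0.
have th1 : q / n.+1%:R <= 1 by rewrite ler_pdivrMr// mul1r.
have [AE|An] := eqVneq A 0.
  rewrite AE powR0 ?gt_eqF//; have H := avg_eq0 (fun k => exprn_ge0 n.+1 (a0 k)) AE.
  rewrite /avg big1 ?mul0r// => k _; move/eqP: (H k); rewrite expf_eq0 /= => /eqP ->.
  by rewrite powR0// gt_eqF.
have Ap : 0 < A by rewrite lt_neqAle eq_sym An.
apply: (@le_trans _ _ (avg (fun k => A `^ (q / n.+1%:R) *
    ((1 - q / n.+1%:R) + q / n.+1%:R / A * a k ^+ n.+1)))).
  apply: avg_le => k.
  have -> : a k `^ q = A `^ (q / n.+1%:R) * (a k ^+ n.+1 / A) `^ (q / n.+1%:R).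
    rewrite -(powRM _ A0 (divr_ge0 (exprn_ge0 _ (a0 k)) A0)).
    rewrite (mulrC A) divfK// -powR_mulrn// -powRrM.
    by rewrite mulrCA divff// mulr1.
  rewrite ler_wpM2l ?powR_ge0//.
  apply: le_trans (powR_concave th0 th1 (divr_ge0 (exprn_ge0 _ (a0 k)) A0)) _.
  by move: (q / n.+1%:R) => th; rewrite le_eqVlt; apply/orP; left; apply/eqP; field.
rewrite avgZ avgD avg_cst avgZ -/A divfK// subrK mulr1//.
Qed.

(* [c] is the value of [V^(1-N) avg (f^(N-1) b)]; Young's inequality replaces Hoelder's. *)
Lemma avg_young n (c V : R) (f b : nat -> R) : 0 < V -> 0 <= c ->
  (forall k, 0 <= f k) -> (forall k, 0 <= b k) -> V ^+ n.+1 = avg (fun k => f k ^+ n.+1) ->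
  V ^+ n * c <= avg (fun k => f k ^+ n * b k) ->
  c ^+ n.+1 <= avg (fun k => b k ^+ n.+1).
Proof.
move=> V0 c0 f0 b0 VE H; have [->|cn] := eqVneq c 0.
  by rewrite expr0n; apply: avg_ge0 => k; rewrite exprn_ge0.
have cV : 0 <= c / V by rewrite divr_ge0// ltW.
have : avg (fun k => n.+1%:R * (c / V * f k) ^+ n * b k) <=
    avg (fun k => n%:R * (c / V * f k) ^+ n.+1 + b k ^+ n.+1).
  by apply: avg_le => k; apply: young_expr => //; rewrite mulr_ge0.
have -> : (fun k => n.+1%:R * (c / V * f k) ^+ n * b k) =
    (fun k => (n.+1%:R * (c / V) ^+ n) * (f k ^+ n * b k)).
  by apply/funext => k; rewrite exprMn; ring.
have -> : (fun k => n%:R * (c / V * f k) ^+ n.+1 + b k ^+ n.+1) =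
    (fun k => (n%:R * (c / V) ^+ n.+1) * f k ^+ n.+1 + b k ^+ n.+1).
  by apply/funext => k; rewrite exprMn; ring.
rewrite avgD !avgZ -VE => H2.
have H3 : n.+1%:R * (c / V) ^+ n * (V ^+ n * c) <=
    n.+1%:R * (c / V) ^+ n * avg (fun k => f k ^+ n * b k).
  by rewrite ler_wpM2l// mulr_ge0// exprn_ge0.
have E1 : n.+1%:R * (c / V) ^+ n * (V ^+ n * c) = n.+1%:R * c ^+ n.+1.
  rewrite -mulrA; congr (_ * _); rewrite mulrA -exprMn divfK ?gt_eqF//.
  by rewrite exprSr.
have E2 : n%:R * (c / V) ^+ n.+1 * V ^+ n.+1 = n%:R * c ^+ n.+1.
  by rewrite -mulrA -exprMn divfK ?gt_eqF.
move: H3 H2; rewrite E1 E2 -natr1; lra.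
Qed.

End averages.

End power_inequalities.

Section derivative_rules.
Context {R : realType} {N : nat}.
Implicit Types (f : 'rV[R]_N -> R) (x v : 'rV[R]_N).

Lemma is_derive_sumr (I : Type) (s : seq I) (f : I -> 'rV[R]_N -> R) (d : I -> R) x v :
  (forall k, is_derive x v (f k) (d k)) ->
  is_derive x v (fun y => \sum_(k <- s) f k y) (\sum_(k <- s) d k).
Proof.
move=> H; elim: s => [|k s IH].
  rewrite big_nil (_ : (fun y => _) = cst 0); first exact: is_derive_cst.
  by apply/funext => y; rewrite big_nil.
rewrite big_cons (_ : (fun y => _) = f k + (fun y => \sum_(k <- s) f k y)).
  exact: is_deriveD.
by apply/funext => y; rewrite big_cons.
Qed.

Lemma is_derive_mulr (c t : R) : is_derive t 1 (fun s : R => s * c) c.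
Proof.
have H := is_deriveM (is_derive_id t (1 : R)) (is_derive_cst c t (1 : R)).
apply: (is_derive_eq H).
by rewrite /cst /= scaler0 add0r /GRing.scale /= mulr1.
Qed.

Lemma is_derive_sqrD (c t : R) : is_derive t 1 (fun s : R => s ^+ 2 + c) (2 * t).
Proof.
have H := is_deriveM (is_derive_id t (1 : R)) (is_derive_id t (1 : R)).
have H2 := is_deriveD H (is_derive_cst c t (1 : R)).
apply: (is_derive_eq H2).
by rewrite addr0 /GRing.scale /= mulr1 mulr_natl mulr2n.
Qed.

Lemma gradient_unique f x (G : 'rV[R]_N) : C1 f ->
  (forall v, is_derive x v f (dot G v)) -> gradient f x = G.
Proof.
move=> cf H; apply/rowP => i; rewrite mxE /partial.
by rewrite (@derive_val _ _ _ _ _ _ _ (H (delta_mx ord0 i))) dotC dot_delta.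
Qed.

End derivative_rules.

Section symmetrization.
Context {R : realType} {n : nat}.
Implicit Types (f u : 'rV[R]_n.+2 -> R) (x y z v : 'rV[R]_n.+2).
Local Notation mu := (lebesgue_rV R n.+2).
Variables (r : R) (phi : 'rV[R]_n.+2 -> R) (w : 'rV[R]_n.+2) (d : R) (m : nat).
Hypotheses (r0 : 0 < r) (tphi : tame r phi).
Hypotheses (w0 : w ord0 ord0 = 0) (ww : dot w w = 1) (d0 : 0 < d) (m0 : (0 < m)%N).
Local Notation rotT := (rotT w).
Local Notation J := (angular w).
Local Notation N := n.+2.

Let cphi : C1 phi := tame_C1 tphi.

Definition sq x : R := phi x ^+ 2 + d ^+ 2.
Definition energy x : R := sq x `^ (N%:R / 2).
Definition modulus x : R := sq x `^ (2^-1).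

Lemma sq_gt0 x : 0 < sq x.
Proof. by rewrite /sq ltr_wpDl ?sqr_ge0// exprn_gt0. Qed.

Lemma modulus_sqr x : modulus x ^+ 2 = sq x.
Proof.
rewrite /modulus -powR_mulrn ?powR_ge0// -powRrM mulVf// powRr1//.
exact: ltW (sq_gt0 x).
Qed.

Lemma modulus_ge x : d <= modulus x.
Proof.
rewrite -(@ler_pXn2r _ 2)// ?nnegrE ?(ltW d0) ?powR_ge0// modulus_sqr.
by rewrite /sq lerDr sqr_ge0.
Qed.

Lemma modulus_gt0 x : 0 < modulus x. Proof. exact: lt_le_trans (modulus_ge x). Qed.

Lemma normr_le_modulus x : `|phi x| <= modulus x.
Proof.
rewrite -(@ler_pXn2r _ 2)// ?nnegrE ?powR_ge0// modulus_sqr real_normK ?num_real//.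
by rewrite /sq lerDl sqr_ge0.
Qed.

Lemma energyE x : energy x = modulus x ^+ N.
Proof. by rewrite /energy /modulus -powR_mulrn ?powR_ge0// -powRrM mulrC. Qed.

Lemma smooth_energy : smooth energy.
Proof.
apply: smooth_powR; first exact: sq_gt0.
by apply: smoothD; [apply: smoothM; exact: tphi.1|exact: smooth_cst].
Qed.

Lemma gradient_energy x :
  gradient energy x = (N%:R * modulus x ^+ n * phi x) *: gradient phi x.
Proof.
apply: gradient_unique; first exact: smooth_C1 smooth_energy.
move=> v; have D1 := is_derive_comp_line (is_derive_sqrD (d ^+ 2) (phi x)) (C1_is_derive x v cphi).
have D2 := is_derive_comp_line (@is_derive1_powR R (N%:R / 2) _ (sq_gt0 x)) D1.
apply: (is_derive_eq D2); rewrite dotZl.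
have -> : sq x `^ (N%:R / 2 - 1) = modulus x ^+ n.
  rewrite -powR_mulrn ?powR_ge0// /modulus -powRrM; congr (_ `^ _).
  by rewrite -addn2 natrD; field.
rewrite -!mulrA; set t := dot _ _; set k := modulus x ^+ n.
by rewrite -addn2 natrD; field.
Qed.

Lemma tame_energy : tame r (fun x => energy x - d ^+ N).
Proof.
have [sp [s sr ps]] := tphi; split; first by apply: smoothB; [exact: smooth_energy|exact: smooth_cst].
exists s => // x xs; rewrite energyE.
suff -> : modulus x = d by rewrite subrr.
rewrite /modulus /sq ps// expr0n add0r -powR_mulrn ?(ltW d0)// -powRrM.
by rewrite mulfV// powRr1// ltW.
Qed.

Definition ang k : R := k%:R * (pi *+ 2 / m%:R).

Definition avg_energy x : R := avg m (fun k => energy (rotT (ang k) x)).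

Let mR : 0 < m%:R :> R. Proof. by rewrite ltr0n. Qed.

Let rot_line th x v (t : R) : rotT th (x + t *: v) = rotT th x + t *: rotT th v.
Proof. exact: rotDZ. Qed.

Let smooth_rot f th : smooth f -> smooth (fun x => f (rotT th x)).
Proof.
move=> /smooth_Ck sf; apply/smooth_Ck => k.
apply: (@Ck_affine _ _ k f (rotT th) (rotT th)) => //.
by move=> i; exact: continuous_rot_coord.
Qed.

Lemma smooth_avg_energy : smooth avg_energy.
Proof.
apply/smooth_Ck => k; rewrite /avg_energy /avg; apply: CkM; last exact: Ck_cst.
apply: Ck_sum => i; apply/smooth_Ck : k; apply: smooth_rot; exact: smooth_energy.
Qed.

Lemma dot_gradient_avg x v : dot (gradient avg_energy x) v =
  avg m (fun k => dot (gradient energy (rotT (ang k) x)) (rotT (ang k) v)).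
Proof.
have c := smooth_C1 smooth_avg_energy; rewrite -(C1_derive x v c).2.
have D1 : is_derive x v (fun y => \sum_(k < m) energy (rotT (ang k) y))
    (\sum_(k < m) dot (gradient energy (rotT (ang k) x)) (rotT (ang k) v)).
  apply: is_derive_sumr => k.
  exact: (C1_affine (smooth_C1 smooth_energy) (rot_line (ang k)) x v).
have D2 := is_derive_comp_line (is_derive_mulr m%:R^-1 _) D1.
by rewrite (@derive_val _ _ _ _ _ _ _ D2) /avg mulrC.
Qed.

Lemma avg_energy_ge x : d ^+ N <= avg_energy x.
Proof.
rewrite -[leLHS](avg_cst m0); apply: (avg_le m0) => k; rewrite energyE.
by apply: lerXn2r; rewrite ?nnegrE ?(ltW d0) ?powR_ge0// modulus_ge.
Qed.

Lemma avg_energy_gt0 x : 0 < avg_energy x.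
Proof. by rewrite (lt_le_trans _ (avg_energy_ge x))// exprn_gt0. Qed.

Definition mean x : R := avg_energy x `^ (N%:R^-1).

Lemma mean_pow x : mean x ^+ N = avg_energy x.
Proof.
by rewrite /mean -powR_mulrn ?powR_ge0// -powRrM mulVf// powRr1// ltW// avg_energy_gt0.
Qed.

Lemma mean_ge x : d <= mean x.
Proof.
by rewrite -(@ler_pXn2r _ N)// ?nnegrE ?(ltW d0) ?powR_ge0// mean_pow avg_energy_ge.
Qed.

Lemma mean_gt0 x : 0 < mean x. Proof. exact: lt_le_trans (mean_ge x). Qed.

Lemma smooth_mean : smooth mean.
Proof. by apply: smooth_powR; [exact: avg_energy_gt0|exact: smooth_avg_energy]. Qed.

Lemma dot_gradient_mean x v :
  N%:R * mean x ^+ n.+1 * dot (gradient mean x) v = dot (gradient avg_energy x) v.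
Proof.
have D := is_derive_comp_line (@is_derive1_powR R N%:R^-1 _ (avg_energy_gt0 x))
  (C1_is_derive x v (smooth_C1 smooth_avg_energy)).
rewrite -(C1_derive x v (smooth_C1 smooth_mean)).2.
rewrite (@derive_val _ _ _ _ _ _ _ D) !mulrA.
have -> : N%:R * mean x ^+ n.+1 / N%:R * avg_energy x `^ (N%:R^-1 - 1) = 1.
  rewrite (mulrC N%:R) mulfK// -powR_mulrn ?powR_ge0// /mean -powRrM.
  rewrite -powRD; last by rewrite (gt_eqF (avg_energy_gt0 x)) implybT.
  rewrite (_ : _ + _ = 0) ?powRr0//.
  have NE : n.+1%:R = N%:R - 1 :> R by rewrite -(natr1 n.+1) addrK.
  by rewrite NE mulrBr mulVf// mulr1 addrA subrK subrr.
by rewrite mul1r.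
Qed.

Lemma tame_mean : tame r (fun x => mean x - d).
Proof.
have [_ [s sr ps]] := tame_energy.
split; first by apply: smoothB; [exact: smooth_mean|exact: smooth_cst].
exists s => // x xs.
have E : avg_energy x = d ^+ N.
  rewrite -[RHS](avg_cst m0); congr (avg m _); apply/funext => k; apply/eqP.
  by rewrite -subr_eq0 ps// enorm_rotT.
by rewrite /mean E -powR_mulrn ?(ltW d0)// -powRrM mulfV// powRr1 ?subrr// ltW.
Qed.

Lemma gradient_meanB x : gradient (fun x => mean x - d) x = gradient mean x.
Proof.
rewrite (gradientB x (smooth_C1 smooth_mean) (smooth_C1 (smooth_cst d))).
rewrite (_ : gradient (fun=> d) x = 0) ?subr0//.
by apply/rowP => i; rewrite !mxE /partial derive_cst.
Qed.

Lemma normal_gradient_mean x :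
  enorm (proj (J x) (gradient mean x)) ^+ N <=
  avg m (fun k => enorm (proj (J (rotT (ang k) x)) (gradient phi (rotT (ang k) x))) ^+ N).
Proof.
pose b k : R := enorm (proj (J (rotT (ang k) x)) (gradient phi (rotT (ang k) x))).
have [v vE] : exists v, v = proj (J x) (gradient mean x) by eexists.
rewrite -vE; have vv : dot (gradient mean x) v = enorm v ^+ 2.
  by rewrite enorm_sqr dotC vE proj_dot.
have [->|cn] := eqVneq (enorm v) 0.
  by rewrite expr0n; apply: (avg_ge0 m0) => k; rewrite exprn_ge0// enorm_ge0.
have c0 : 0 < enorm v by rewrite lt_neqAle eq_sym cn enorm_ge0.
apply: (avg_young m0 (mean_gt0 x) (enorm_ge0 v) (f := fun k => modulus (rotT (ang k) x)) (b := b)).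
- by move=> k; rewrite ltW ?modulus_gt0.
- by move=> k; exact: enorm_ge0.
- rewrite mean_pow /avg_energy; congr (avg m _); apply/funext => k; exact: energyE.
have N0 : (0 : R) < N%:R * enorm v by rewrite mulr_gt0.
rewrite -(ler_pM2l N0).
have -> : N%:R * enorm v * (mean x ^+ n.+1 * enorm v) =
    dot (gradient avg_energy x) v.
  by rewrite -dot_gradient_mean vv; ring.
rewrite dot_gradient_avg -avgZ; apply: (avg_le m0) => k.
have [y yE] : exists y, y = rotT (ang k) x by eexists.
rewrite /b -yE.
have rv : rotT (ang k) v = proj (J y) (rotT (ang k) (gradient mean x)).
  rewrite vE /rotT -(proj_rot w0 ww _ _ (cos2Dsin2 (ang k))) -angular_rot//.
  by rewrite yE.
have nv : enorm (rotT (ang k) v) = enorm v by exact: enorm_rotT.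
rewrite gradient_energy dotZl dotC {1}rv proj_dot -rv.
have H := normr_dot_le (rotT (ang k) v) (proj (J y) (gradient phi y)).
rewrite nv in H.
apply: (@le_trans _ _ (N%:R * modulus y ^+ n * (modulus y *
    (enorm v * enorm (proj (J y) (gradient phi y)))))).
  rewrite -[leLHS]mulrA ler_wpM2l//.
    by rewrite mulr_ge0// exprn_ge0// powR_ge0.
  rewrite (le_trans (ler_norm _))// normrM; apply: ler_pM => //.
  exact: normr_le_modulus.
by rewrite exprSr le_eqVlt; apply/orP; left; apply/eqP; ring.
Qed.

End symmetrization.

Section symmetrized_energy.
Context {R : realType} {n : nat}.
Implicit Types (f u : 'rV[R]_n.+2 -> R) (x y z v : 'rV[R]_n.+2).
Local Notation mu := (lebesgue_rV R n.+2).
Variables (r : R) (phi : 'rV[R]_n.+2 -> R) (w : 'rV[R]_n.+2) (d : R).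
Hypotheses (r0 : 0 < r) (tphi : tame r phi).
Hypotheses (w0 : w ord0 ord0 = 0) (ww : dot w w = 1) (d0 : 0 < d).
Local Notation rotT := (rotT w).
Local Notation J := (angular w).
Local Notation N := n.+2.

Lemma int_avg_rot m (B : 'rV[R]_n.+2 -> R) : (0 < m)%N -> measurable_fun setT B ->
  (forall x, 0 <= B x) ->
  (\int[mu]_x (avg m (fun k => B (rotT (ang m k) x)))%:E = \int[mu]_x (B x)%:E)%E.
Proof.
move=> m0 mB B0; have mR : 0 < m%:R :> R by rewrite ltr0n.
have mk a : measurable_fun setT (fun x => B (rotT a x)).
  exact: (measurableT_comp mB (measurable_rotT w a)).
have mS j : measurable_fun setT (fun x => \sum_(k < j) B (rotT (ang m k) x)).
  by apply: measurable_sum => k; exact: mk.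
have S0 j x : 0 <= \sum_(k < j) B (rotT (ang m k) x) by apply: sumr_ge0.
have H j : (\int[mu]_x (\sum_(k < j) B (rotT (ang m k) x))%:E = j%:R%:E * \int[mu]_x (B x)%:E)%E.
  elim: j => [|j IH].
    by rewrite mul0e integral0_eq// => x _; rewrite big_ord0.
  transitivity (\int[mu]_x ((\sum_(k < j) B (rotT (ang m k) x)) + B (rotT (ang m j) x))%:E)%E.
    by apply: eq_integral => x _; rewrite big_ord_recr.
  rewrite (int_add mu (mS j) (mk _) (S0 j) (fun x => B0 _)) IH (int_rotT w0 ww (ang m j) mB B0).
  have B1 : (0 <= \int[mu]_x (B x)%:E)%E by exact: ge0_int.
  by rewrite -natr1 EFinD ge0_muleDl ?lee_fin// mul1e.
have mV0 : 0 <= m%:R^-1 :> R by rewrite invr_ge0 ltW.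
transitivity (\int[mu]_x (m%:R^-1 * \sum_(k < m) B (rotT (ang m k) x))%:E)%E.
  by apply: eq_integral => x _; rewrite /avg mulrC.
by rewrite (int_scale mu (mS m) mV0 (S0 m)) H muleA -EFinM mulVf ?mul1e// gt_eqF.
Qed.

Lemma tangential_gradient_mean : exists2 K : R, 0 <= K & forall m, (0 < m)%N ->
  forall x, enorm x < r ->
  `|dot (gradient (mean phi w d m) x) (J x)| <= K / m%:R * enorm (J x).
Proof.
have te := tame_energy tphi d0.
have [M M0 HM] := tame_gradient_bounded te.
have [L L0 HL] := tame_gradient_lip te.
have gE y : gradient (fun x => energy phi d x - d ^+ N) y = gradient (energy phi d) y.
  rewrite (gradientB y (smooth_C1 (smooth_energy tphi d0)) (smooth_C1 (smooth_cst _))).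
  rewrite (_ : gradient (fun=> d ^+ N) y = 0) ?subr0//.
  by apply/rowP => i; rewrite !mxE /partial derive_cst.
pose C : R := 4 * L * r + 2 * M.
have C0 : 0 <= C by rewrite addr_ge0// mulr_ge0// ?(ltW r0)// mulr_ge0.
have Nd0 : 0 < N%:R * d ^+ n.+1 by rewrite mulr_gt0// exprn_gt0.
have pi0 := @pi_gt0 R.
exists (C * (pi *+ 2) / (N%:R * d ^+ n.+1)).
  by rewrite divr_ge0 ?(ltW Nd0)// mulr_ge0// mulrn_wge0// ltW.
move=> m m0 x xr; have mR : 0 < m%:R :> R by rewrite ltr0n.
pose del : R := pi *+ 2 / m%:R.
have del0 : 0 < del by rewrite divr_gt0// mulrn_wgt0.
pose f x := energy phi d x - d ^+ N.
pose y k := rotT (ang m k) x.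
have Jy k : J (y k) = rotT (ang m k) (J x) by exact: angular_rot.
have nJ k : enorm (J (y k)) = enorm (J x) by rewrite Jy enorm_rotT.
have Jr : enorm (J x) <= r by rewrite (le_trans (angular_le w0 ww x))// ltW.
have yS k : y k.+1 = rotT del (y k).
  by rewrite /y rotTD// /ang -natr1 mulrDl mul1r addrC.
have y0 : y 0%N = x by rewrite /y /ang mul0r rotT0.
have ym : y m = x.
  by rewrite /y /ang mulrC divfK ?gt_eqF// rotT_2pi.
pose t k := dot (gradient (energy phi d) (y k)) (J (y k)).
have step k : `|f (y k.+1) - f (y k) - del * t k| <= C * del ^+ 2 * enorm (J x).
  rewrite yS /t -gE; apply: le_trans (rot_taylor w0 ww del (y k) (tame_C1 te) HM L0 HL) _.
  rewrite nJ ler_wpM2r ?enorm_ge0// ler_wpM2r ?sqr_ge0// lerD2r ler_wpM2l// mulr_ge0//.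
have tele : \sum_(k < m) (f (y k.+1) - f (y k)) = 0.
  by rewrite -(big_mkord xpredT (fun k => f (y k.+1) - f (y k))) telescope_sumr// y0 ym subrr.
have sumt : `|del * \sum_(k < m) t k| <= m%:R * (C * del ^+ 2 * enorm (J x)).
  have -> : del * \sum_(k < m) t k = - \sum_(k < m) (f (y k.+1) - f (y k) - del * t k).
    by rewrite sumrB tele sub0r opprK mulr_sumr.
  rewrite normrN (le_trans (ler_norm_sum _ _ _))//.
  apply: (@le_trans _ _ (\sum_(k < m) C * del ^+ 2 * enorm (J x))).
    by apply: ler_sum => k _; exact: step.
  by rewrite sumr_const card_ord mulr_natl.
have davg : dot (gradient (avg_energy phi w d m) x) (J x) = (\sum_(k < m) t k) / m%:R.
  rewrite (dot_gradient_avg w m tphi d0); congr (_ / _); apply: eq_bigr => k _.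
  by rewrite /t Jy.
have Havg : `|dot (gradient (avg_energy phi w d m) x) (J x)| <= C * del * enorm (J x).
  rewrite davg normrM normfV (gtr0_norm mR) ler_pdivrMr// -(ler_pM2l del0).
  rewrite -[X in X * _ <= _](gtr0_norm del0) -normrM (le_trans sumt)// le_eqVlt.
  by apply/orP; left; apply/eqP; ring.
have V0 := mean_gt0 phi w d0 m0 x; have Vd := mean_ge phi w d0 m0 x.
have Hm : N%:R * d ^+ n.+1 * `|dot (gradient (mean phi w d m) x) (J x)| <= C * del * enorm (J x).
  apply: le_trans Havg; rewrite -(dot_gradient_mean w tphi d0 m0) [leRHS]normrM.
  rewrite ler_wpM2r// normrM ger0_norm// ler_wpM2l// (gtr0_norm (exprn_gt0 _ V0)).
  by apply: lerXn2r => //; rewrite nnegrE ltW.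
rewrite -(ler_pM2l Nd0) (le_trans Hm)// le_eqVlt; apply/orP; left; apply/eqP.
by rewrite /del; field; rewrite ?gt_eqF// exprn_gt0.
Qed.

Definition normal_energy x : R := enorm (proj (J x) (gradient phi x)) ^+ N.

Lemma measurable_proj (g h : 'rV[R]_n.+2 -> 'rV[R]_n.+2) : measurable_fun setT g ->
  measurable_fun setT h -> measurable_fun setT (fun x => proj (g x) (h x)).
Proof.
move=> mg mh; apply: measurable_fun_rVP => i.
rewrite (_ : (fun x => proj (g x) (h x) ord0 i) = fun x => h x ord0 i -
    dot (h x) (g x) / dot (g x) (g x) * g x ord0 i); last first.
  by apply/funext => x; rewrite /proj !mxE.
apply: measurable_funB; first exact: (measurableT_comp (measurable_coord i) mh).
apply: measurable_funM; last exact: (measurableT_comp (measurable_coord i) mg).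
apply: measurable_funM; first exact: measurable_dot.
by apply: measurable_funV; [move=> x; exact: dot_ge0|exact: measurable_dot].
Qed.

Lemma measurable_normal_energy : measurable_fun setT normal_energy.
Proof.
apply: measurable_funX; apply: measurable_enorm_comp; apply: measurable_proj.
  exact: measurable_angular.
by apply: measurable_gradient; exact: tame_C1 tphi.
Qed.

Lemma normal_energy_ge0 x : 0 <= normal_energy x.
Proof. by rewrite exprn_ge0// enorm_ge0. Qed.

Lemma symmetrized_dirichlet (e : R) : 0 < e -> exists2 m, (0 < m)%N &
  (dirichlet r (fun x => (mean phi w d m x - d)%R) <= \int[mu]_x (normal_energy x)%:E + e%:E)%E.
Proof.
move=> eg; have [K K0 HK] := tangential_gradient_mean.
have mP := measurable_normal_energy; have P0 := normal_energy_ge0.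
have I0 : (0 <= \int[mu]_x (normal_energy x)%:E)%E by exact: ge0_int.
have Ioo : (\int[mu]_x (normal_energy x)%:E < +oo)%E.
  apply: le_lt_trans (tame_int_gradient_lty (ltn0Sn n.+1) tphi); apply: le_int => //.
    apply: measurable_funX; apply: measurable_enorm_comp; apply: measurable_gradient.
    exact: tame_C1 tphi.
  by move=> x; apply: lerXn2r; rewrite ?nnegrE ?enorm_ge0 ?proj_le.
pose Q : R := fine (\int[mu]_x (normal_energy x)%:E)%E.
have QE : (\int[mu]_x (normal_energy x)%:E = Q%:E)%E by rewrite fineK// ge0_fin_numE.
have Q0 : 0 <= Q by exact: fine_ge0.
pose V : R := fine (mu (eball r)).
have VE : mu (eball r) = V%:E by rewrite fineK// ge0_fin_numE ?measure_ge0// lebesgue_eball_lty.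
have V0 : 0 <= V by rewrite fine_ge0// measure_ge0.
have mB : measurable (eball r : set 'rV[R]_n.+2) by exact: measurable_eball.
have mI : measurable_fun setT (\1_(eball r) : 'rV[R]_n.+2 -> R) by exact: measurable_indic.
have i0 (x : 'rV[R]_n.+2) : 0 <= \1_(eball r) x :> R by rewrite indicE.
have IV : (\int[mu]_x (\1_(eball r) x)%:E = V%:E)%E by rewrite -VE; exact: esym (measure_indic mu mB).
have eta0 : 0 < e / (2 * (Q + 1)) by rewrite divr_gt0// mulr_gt0// ltr_wpDl.
have [C C0 HC] := exprD_le N eta0.
have KN0 : 0 <= C * K ^+ N * V by rewrite mulr_ge0// mulr_ge0 ?exprn_ge0// ltW.
have [m1 Hm1] : exists m1 : nat, C * K ^+ N * V / (e / 2) <= m1.+1%:R.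
  exists (Num.Def.trunc (C * K ^+ N * V / (e / 2))).
  have c0 : 0 <= C * K ^+ N * V / (e / 2) by rewrite divr_ge0// divr_ge0// ltW.
  by have /andP[_ /ltW] := Num.Theory.trunc_itv c0.
pose m := m1.+1; exists m => //; have m0 : (0 < m)%N by [].
have mR : 0 < m%:R :> R by rewrite ltr0n.
have tm := tame_mean tphi w0 ww d0 m0.
apply: le_trans (_ : _ <= \int[mu]_x (enorm (gradient (mean phi w d m) x) ^+ N)%:E)%E _.
  rewrite le_eqVlt; apply/orP; left; apply/eqP.
  apply: etrans (dirichlet_tame (ltn0Sn n.+1) tm) _; apply: eq_integral => x _.
  by rewrite (gradient_meanB w tphi d0 m0).
have Km0 : 0 <= K / m%:R by rewrite divr_ge0// ltW.
pose A x : R := avg m (fun k => normal_energy (rotT (ang m k) x)).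
have mA : measurable_fun setT A.
  apply: measurable_funM; last exact: measurable_cst.
  by apply: measurable_sum => k; exact: (measurableT_comp mP (measurable_rotT w _)).
have A0 x : 0 <= A x by apply: (avg_ge0 m0) => k; exact: P0.
have IA : (\int[mu]_x (A x)%:E = Q%:E)%E by rewrite int_avg_rot.
have e1 : 0 <= 1 + e / (2 * (Q + 1)) by rewrite addr_ge0// ltW.
have CK0 : 0 <= C * (K / m%:R) ^+ N by rewrite mulr_ge0 ?exprn_ge0// ltW.
have m1A : measurable_fun setT (fun x => (1 + e / (2 * (Q + 1))) * A x).
  exact: (measurable_funM (measurable_cst _) mA).
have m2I : measurable_fun setT (fun x : 'rV[R]_n.+2 => C * (K / m%:R) ^+ N * \1_(eball r) x).
  exact: (measurable_funM (measurable_cst _) mI).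
apply: (@le_trans _ _ (\int[mu]_x ((1 + e / (2 * (Q + 1))) * A x +
    C * (K / m%:R) ^+ N * \1_(eball r) x)%:E)%E).
  apply: le_int.
  - apply: measurable_funX; apply: measurable_enorm_comp; apply: measurable_gradient.
    exact: smooth_C1 (smooth_mean w tphi d0 m0).
  - exact: (measurable_funD m1A m2I).
  - by move=> x; rewrite exprn_ge0// enorm_ge0.
  move=> x; have [xr|rx] := ltP (enorm x) r; last first.
    rewrite -(gradient_meanB w tphi d0 m0) (tame_gradient0 tm rx) enorm0 expr0n /=.
    by apply: addr_ge0; apply: mulr_ge0.
  rewrite indicE mem_set// mulr1.
  have Jx0 := enorm_ge0 (J x).
  have H1 : enorm (gradient (mean phi w d m) x) <=
      enorm (proj (J x) (gradient (mean phi w d m) x)) + K / m%:R.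
    apply: le_trans (le_projD (J x) _) _; rewrite lerD2l.
    have := HK m m0 x xr; have [->|Jn] := eqVneq (enorm (J x)) 0.
      by rewrite invr0 !mulr0.
    by rewrite ler_pdivrMr// lt_neqAle eq_sym Jn.
  apply: (@le_trans _ _ ((enorm (proj (J x) (gradient (mean phi w d m) x)) + K / m%:R) ^+ N)).
    by apply: lerXn2r; rewrite ?nnegrE ?addr_ge0 ?enorm_ge0.
  apply: le_trans (HC _ _ (enorm_ge0 _) Km0) _; rewrite lerD2r ler_wpM2l//.
  exact: (normal_gradient_mean tphi w0 ww d0 m0).
rewrite (int_add mu m1A m2I); [|by move=> x; exact: mulr_ge0|by move=> x; exact: mulr_ge0].
rewrite (int_scale mu mA e1 A0) (int_scale mu mI CK0 i0) IA IV QE -!EFinM -!EFinD lee_fin.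
have h1 : e / (2 * (Q + 1)) * Q <= e / 2.
  rewrite invfM mulrA -mulrA ler_piMr ?divr_ge0 ?(ltW eg)//.
  by rewrite mulrC ler_pdivrMr ?ltr_wpDl// mul1r lerDl.
have h2 : C * (K / m%:R) ^+ N * V <= e / 2.
  apply: (@le_trans _ _ (C * K ^+ N * V / m%:R)); last first.
    by rewrite ler_pdivrMr// -ler_pdivrMl ?divr_gt0// mulrC.
  have -> : C * (K / m%:R) ^+ N * V = C * K ^+ N * V * (m%:R^-1 ^+ N) by rewrite exprMn; ring.
  rewrite ler_wpM2l// exprS ler_piMr ?invr_ge0 ?(ltW mR)//.
  by rewrite exprn_ile1 ?invr_ge0 ?(ltW mR)// invf_le1// ler1n.
lra.
Qed.

End symmetrized_energy.

Section symmetrized_weight.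
Context {R : realType} {n : nat}.
Implicit Types (f u : 'rV[R]_n.+2 -> R) (x y z v : 'rV[R]_n.+2).
Local Notation mu := (lebesgue_rV R n.+2).
Local Notation N := n.+2.
Variables (r a q beta : R).
Hypotheses (r0 : 0 < r) (a1 : 1 < a) (q1 : 1 < q) (qN : q <= N%:R) (b1 : 1 < beta).

Let q0 : 0 < q. Proof. exact: lt_trans q1. Qed.

Lemma hweight_integrable :
  (\int[mu]_x (\1_(eball r) x * hweight r a beta x)%:E < +oo)%E.
Proof.
have mB : measurable (eball r : set 'rV[R]_n.+2) by exact: measurable_eball.
have mI : measurable_fun setT (\1_(eball r) : 'rV[R]_n.+2 -> R) by exact: measurable_indic.
have V0 := @shell_vol_gt0 R n.+1.
have b0 : 0 <= beta by rewrite ltW// (lt_trans _ b1).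
have H j : (shell_int r 1 1 (\1_(eball r) : 'rV[R]_n.+2 -> R) j <=
    (@shell_vol R n.+1 * j.+1%:R `^ 0)%:E)%E.
  have rho0 : 0 < r * expR (- (j.+1%:R * 1)) by rewrite mulr_gt0 ?expR_gt0.
  have := @invN_shell_le R n.+1 _ 1 rho0 ltr01 (lexx _).
  rewrite powRr0; apply: le_trans; apply: le_int.
  - exact: measurable_shell_int.
  - exact: measurable_invN_shell.
  - by move=> x; rewrite !mulr_ge0 ?powR_ge0 ?invN_ge0// indicE.
  - move=> x; apply: ler_wpM2r; first by rewrite indicE.
    apply: ler_piMl; first exact: invN_ge0.
    rewrite powRr1// indicE; case: (_ \in _); rewrite ?normr1 ?normr0//; exact: ler01.
have b1' : 0 + 1 < beta by rewrite add0r.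
have [S S0 HS] := weight_series (lexx (0 : R)) b1' (ln_gt0 a1).
have W : (weighted r a 1 beta (\1_(eball r) : 'rV[R]_n.+2 -> R) < +oo)%E.
  apply: le_lt_trans (weighted_le r0 a1 b0 ltr01 mI (ltW V0) (lexx _) H) _.
  under eq_eseriesr do rewrite mulr1.
  by rewrite lte_mul_pinfty ?lee_fin ?(ltW V0)// (le_lt_trans HS)// ltry.
apply: le_lt_trans W; rewrite weighted_csupp ?oner_neq0//; last first.
  by move=> x rx; rewrite indicE memNset// /eball /= => /lt_le_trans/(_ rx); rewrite ltxx.
rewrite le_eqVlt; apply/orP; left; apply/eqP; apply: eq_integral => x _.
by rewrite powRr1// ger0_norm ?indicE.
Qed.

Variables (phi : 'rV[R]_n.+2 -> R) (w : 'rV[R]_n.+2).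
Hypotheses (tphi : tame r phi) (w0 : w ord0 ord0 = 0) (ww : dot w w = 1).

Lemma symmetrized_weighted : exists2 C : R, 0 <= C & forall d m, 0 < d -> (0 < m)%N ->
  (weighted r a q beta phi <=
   weighted r a q beta (fun x => (mean phi w d m x - d)%R) + (C * d)%:E)%E.
Proof.
have [M M0 HM] := tame_bounded tphi.
pose I : R := fine (\int[mu]_x (\1_(eball r) x * hweight r a beta x)%:E)%E.
have F0 (x : 'rV[R]_n.+2) : 0 <= \1_(eball r) x * hweight r a beta x.
  by apply: mulr_ge0; [rewrite indicE|exact: hweight_ge0].
have mB : measurable (eball r : set 'rV[R]_n.+2) by exact: measurable_eball.
have mF : measurable_fun setT (fun x : 'rV[R]_n.+2 => \1_(eball r) x * hweight r a beta x).
  by apply: measurable_funM; [exact: measurable_indic|exact: measurable_hweight].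
have IE : (\int[mu]_x (\1_(eball r) x * hweight r a beta x)%:E = I%:E)%E.
  by rewrite fineK// ge0_fin_numE ?hweight_integrable// ge0_int.
have I0 : 0 <= I by apply: fine_ge0; exact: ge0_int.
have qM0 : 0 <= q * M `^ (q - 1) by exact: mulr_ge0 (ltW q0) (powR_ge0 _ _).
exists (q * M `^ (q - 1) * I); first exact: mulr_ge0.
move=> d m d0 m0; have tU := tame_mean tphi w0 ww d0 m0.
pose U x := mean phi w d m x - d.
have mphi : measurable_fun setT phi by apply: C1_measurable; exact: tame_C1 tphi.
have mU : measurable_fun setT U by apply: C1_measurable; exact: tame_C1 tU.
have qn : q != 0 by rewrite gt_eqF.
rewrite !weighted_csupp//; [|exact: tame_csupp tU|exact: tame_csupp tphi].
pose B x : R := `|phi x| `^ q * hweight r a beta x.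
have mBB : measurable_fun setT B by exact: measurable_weighted.
have B0 x : 0 <= B x by apply: mulr_ge0; [exact: powR_ge0|exact: hweight_ge0].
rewrite -/(U _) -(int_avg_rot w0 ww m0 mBB B0).
have qMd : 0 <= q * M `^ (q - 1) * d by rewrite mulr_ge0// ltW.
have -> : ((q * M `^ (q - 1) * I * d)%:E =
    \int[mu]_x (q * M `^ (q - 1) * d * (\1_(eball r) x * hweight r a beta x))%:E)%E.
  by rewrite (int_scale mu mF qMd F0) IE -EFinM mulrAC.
have mUU := measurable_weighted r a q beta mU.
have UU0 x : 0 <= `|U x| `^ q * hweight r a beta x.
  by apply: mulr_ge0; [exact: powR_ge0|exact: hweight_ge0].
have mF2 : measurable_fun setT (fun x : 'rV[R]_n.+2 => q * M `^ (q - 1) * d * (\1_(eball r) x * hweight r a beta x)).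
  exact: (measurable_funM (measurable_cst _) mF).
rewrite -(int_add mu mUU mF2 UU0); last by move=> x; exact: mulr_ge0.
apply: le_int.
- apply: measurable_funM; last exact: measurable_cst.
  by apply: measurable_sum => k; exact: (measurableT_comp mBB (measurable_rotT w _)).
- exact: (measurable_funD mUU mF2).
- by move=> x; apply: (avg_ge0 m0) => k; exact: B0.
move=> x; have [xr|rx] := ltP (enorm x) r; last first.
  have -> : (fun k => B (rotT w (ang m k) x)) = fun=> 0.
    apply/funext => k; rewrite /B (tame_csupp tphi) ?enorm_rotT//.
    by rewrite normr0 powR0// mul0r.
  by rewrite (avg_cst m0) addr_ge0// mulr_ge0.
rewrite indicE mem_set// mul1r.
have -> : (fun k => B (rotT w (ang m k) x)) =
    fun k => hweight r a beta x * `|phi (rotT w (ang m k) x)| `^ q.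
  by apply/funext => k; rewrite /B /hweight enorm_rotT// mulrC.
rewrite avgZ -mulrDl mulrC ler_wpM2r ?hweight_ge0//.
pose b k := `|phi (rotT w (ang m k) x)|.
have b0 k : 0 <= b k by exact: normr_ge0.
pose t := avg m (fun k => b k ^+ N) `^ (N%:R^-1).
have A0 : 0 <= avg m (fun k => b k ^+ N) by apply: (avg_ge0 m0) => k; rewrite exprn_ge0.
have t0 : 0 <= t by exact: powR_ge0.
have tN : t ^+ N = avg m (fun k => b k ^+ N).
  by rewrite /t -powR_mulrn ?powR_ge0// -powRrM mulVf// powRr1.
have tM : t <= M.
  rewrite -(@ler_pXn2r _ N)// ?nnegrE// tN -(avg_cst m0 (M ^+ N)); apply: (avg_le m0) => k.
  by apply: lerXn2r; rewrite ?nnegrE//; exact: HM.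
have tV : t <= mean phi w d m x.
  rewrite -(@ler_pXn2r _ N)// ?nnegrE// ?powR_ge0// tN (mean_pow phi w d0 m0).
  apply: (avg_le m0) => k; rewrite energyE; apply: lerXn2r; rewrite ?nnegrE// ?powR_ge0//.
  exact: normr_le_modulus.
have U0 : 0 <= U x by rewrite subr_ge0; exact: mean_ge.
apply: le_trans (avg_pow_mean m0 q0 qN b0) _.
have -> : avg m (fun k => b k ^+ N) `^ (q / N%:R) = t `^ q.
  by rewrite /t -powRrM mulrC.
rewrite (ger0_norm U0); apply: powR_shift => //; first exact: ltW.
by rewrite lerD2r.
Qed.

Lemma normal_energy_bound (G y : R) : 0 < y -> 0 <= G ->
  (y%:E < weighted r a q beta phi)%E ->
  (forall v : 'rV[R]_n.+2 -> R, admissible N r v -> (G%:E <= quotient r a q beta v)%E) ->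
  ((G * y `^ (N%:R / q))%:E <= \int[mu]_x (normal_energy phi w x)%:E)%E.
Proof.
move=> y0 G0 yW HG; have [C C0 HC] := symmetrized_weighted.
have [d d0 yd] : exists2 d, 0 < d & forall m, (0 < m)%N ->
    (y%:E <= weighted r a q beta (fun x => (mean phi w d m x - d)%R))%E.
  case: (weighted r a q beta phi) yW HC => [s||]// ys HC.
    rewrite lte_fin in ys; exists ((s - y) / (C + 1)).
      by rewrite divr_gt0 ?subr_gt0// ltr_wpDl.
    move=> m m0; have C1 : 0 < C + 1 by rewrite ltr_wpDl.
    have d0 : 0 < (s - y) / (C + 1) by rewrite divr_gt0// subr_gt0.
    have := HC _ m d0 m0; case: (weighted _ _ _ _ _) => [s'| |]; [|by move=> _; rewrite leey|by []].
    rewrite -EFinD !lee_fin.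
    have : C * ((s - y) / (C + 1)) <= s - y.
      rewrite mulrA ler_pdivrMr// mulrC ler_wpM2l ?subr_ge0 ?(ltW ys)//.
      by rewrite lerDl.
    lra.
  exists 1 => // m m0; have := HC 1 m ltr01 m0.
  by case: (weighted _ _ _ _ _) => [s'| |]; [by []|by move=> _; rewrite leey|by []].
apply/lee_addgt0Pr => e e0.
have [m m0 De] := symmetrized_dirichlet r0 tphi w0 ww d0 e0.
apply: le_trans De.
have tU := tame_mean tphi w0 ww d0 m0.
have Wy := yd m m0.
have DE := dirichlet_tame (ltn0Sn n.+1) tU.
have Dlt := tame_int_gradient_lty (ltn0Sn n.+1) tU.
have D0 : (0 <= \int[mu]_x (enorm (gradient (fun x => (mean phi w d m x - d)%R) x) ^+ N)%:E)%E.
  by apply: ge0_int => x; rewrite exprn_ge0// enorm_ge0.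
rewrite DE; set D := fine (\int[mu]_x (enorm (gradient (fun x => (mean phi w d m x - d)%R) x) ^+ N)%:E)%E.
have DD : (\int[mu]_x (enorm (gradient (fun x => (mean phi w d m x - d)%R) x) ^+ N)%:E = D%:E)%E.
  by rewrite fineK// ge0_fin_numE.
rewrite DD lee_fin.
have Dge : 0 <= D by exact: fine_ge0.
have adm : admissible N r (fun x => mean phi w d m x - d).
  apply: (tame_admissible r0 a1 q0 tU); apply: lt_le_trans Wy; rewrite lte_fin //.
have := le_trans (HG _ adm) (quotient_le q0 Dge y0 (etrans DE DD) Wy).
by rewrite lee_fin ler_pdivlMr ?powR_gt0.
Qed.

End symmetrized_weight.

Section continuity_powR.
Context {R : realType}.

Lemma cvg_norm_powR (q : R) (x : nat -> R) (l : R) : 0 < q -> x @ \oo --> l ->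
  (fun j => `|x j| `^ q) @ \oo --> `|l| `^ q.
Proof.
move=> q0 xl; have nl : `|x j| @[j --> \oo] --> `|l| by exact: cvg_norm.
have [l0|ln] := eqVneq l 0.
  rewrite l0 normr0 powR0 ?gt_eqF//; apply/cvgrPdist_lt => e e0.
  rewrite l0 normr0 in nl; have eq0 : 0 < e `^ q^-1 by exact: powR_gt0.
  have /cvgrPdist_lt/(_ _ eq0) := nl; apply: filterS => j.
  rewrite !sub0r !normrN normr_id (ger0_norm (powR_ge0 _ _)) => xj.
  have -> : e = (e `^ q^-1) `^ q by rewrite -powRrM mulVf ?gt_eqF// powRr1// ltW.
  by apply: gt0_ltr_powR => //; rewrite nnegrE// ltW.
apply: (@continuous_cvg _ _ _ _ _ _ (fun t : R => t `^ q)) => //.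
apply: differentiable_continuous; apply/derivable1_diffP; apply: derivable_powR.
by rewrite in_itv /= normr_gt0 ln.
Qed.

End continuity_powR.

Section fatou_real.
Context d (T : measurableType d) (R : realType) (mu : {measure set T -> \bar R}).

Lemma limn_einf_le (u : nat -> \bar R) (y : \bar R) : (forall j, u j <= y)%E ->
  (limn_einf u <= y)%E.
Proof.
move=> uy; rewrite limn_einf_lim; apply: lime_le; first exact: is_cvg_einfs.
apply: nearW => k; apply: le_trans (uy k); apply: ereal_inf_lbound.
by exists k => /=.
Qed.

Lemma fatou_le (f : nat -> T -> R) (g : T -> R) (y : \bar R) :
  (forall j, measurable_fun setT (f j)) -> measurable_fun setT g ->
  (forall j x, 0 <= f j x) -> (forall x, 0 <= g x) ->
  {ae mu, forall x, f j x @[j --> \oo] --> g x} ->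
  (forall j, \int[mu]_x (f j x)%:E <= y)%E -> (\int[mu]_x (g x)%:E <= y)%E.
Proof.
move=> mf mg f0 g0 [B [mB B0 sB]] Hy.
have mC : measurable (~` B) by exact: measurableC.
have mI : measurable_fun setT (\1_(~` B) : T -> R) by exact: measurable_indic.
have i0 x : 0 <= \1_(~` B) x :> R by rewrite indicE.
have i1 x : \1_(~` B) x <= 1 :> R by rewrite indicE; case: (_ \in _).
have mfI j : measurable_fun setT (fun x => f j x * \1_(~` B) x) by exact: (measurable_funM (mf j) mI).
have mgI : measurable_fun setT (fun x => g x * \1_(~` B) x) by exact: (measurable_funM mg mI).
have lim x : limn_einf (fun j => (f j x * \1_(~` B) x)%:E) = (g x * \1_(~` B) x)%:E.
  suff H : (fun j => (f j x * \1_(~` B) x)%:E) @ \oo --> (g x * \1_(~` B) x)%:E.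
    by rewrite (cvg_limn_einf_sup H).1.
  apply: cvg_EFin; first exact: nearW.
  rewrite indicE; have [/set_mem xB|xB] := boolP (x \in _).
    rewrite mulr1; under eq_fun do rewrite /= mulr1.
    by apply: contrapT => H; apply: xB; exact: sB.
  by rewrite mulr0; under eq_fun do rewrite /= mulr0; exact: cvg_cst.
have -> : (\int[mu]_x (g x)%:E = \int[mu]_x (g x * \1_(~` B) x)%:E)%E.
  apply: ge0_ae_eq_integral => //.
  - exact/measurable_EFinP.
  - exact/measurable_EFinP.
  - by move=> x _; rewrite lee_fin.
  - by move=> x _; rewrite lee_fin mulr_ge0.
  exists B; split => // x /= H; apply: contrapT => xB; apply: H => _.
  by rewrite indicE mem_set ?mulr1.
have mE j : measurable_fun setT (fun x => (f j x * \1_(~` B) x)%:E) by exact/measurable_EFinP.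
have E0 j x : setT x -> (0 <= (f j x * \1_(~` B) x)%:E)%E by move=> _; rewrite lee_fin mulr_ge0.
have := fatou mu measurableT mE E0.
under eq_integral do rewrite lim.
move=> /le_trans; apply; apply: limn_einf_le => j; apply: le_trans (Hy j).
apply: le_int => //; first by move=> x; exact: mulr_ge0.
by move=> x; rewrite ler_piMr.
Qed.

End fatou_real.

Section radial_symmetry.
Context {R : realType} {n : nat}.
Implicit Types (f : 'rV[R]_n.+2 -> R) (x y z v w : 'rV[R]_n.+2).
Local Notation mu := (lebesgue_rV R n.+2).
Local Notation N := n.+2.
Local Notation p := (n.+1%:R / n.+2%:R : R).
Variables (r a q beta : R) (u : 'rV[R]_n.+2 -> R).
Hypotheses (r0 : 0 < r) (a1 : 1 < a) (q1 : 1 < q) (qN : q <= N%:R) (hb : p * q + 1 < beta).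
Hypothesis (umin : minimizer N r a q beta u).

Let q0 : 0 < q. Proof. exact: lt_trans q1. Qed.
Let b1 : 1 < beta.
Proof. by rewrite (le_lt_trans _ hb)// lerDr mulr_ge0 ?divr_ge0// ltW. Qed.

Let U := u \_ (eball r).
Let g := wgradient (eball r) u \_ (eball r).

Section approximation.
Variable phi : nat -> 'rV[R]_n.+2 -> R.
Hypothesis A : approxW r U g phi.

Let mU : measurable_fun setT U := approxW_mu A.
Let mg : measurable_fun setT g := approxW_mg A.

Let mphi k : measurable_fun setT (phi k).
Proof. exact: C1_measurable (tame_C1 (approxW_tame A k)). Qed.

Lemma weighted_liminf (K : nat) (y : \bar R) :
  (forall k, (K <= k)%N -> weighted r a q beta (phi k) <= y)%E -> (weighted r a q beta U <= y)%E.
Proof.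
move=> H; have qn : q != 0 by rewrite gt_eqF.
have md k : measurable_fun setT (fun x => `|phi k x - U x|) by exact: measurable_normB.
have [m mj ae] := ae_subseq md (fun k x => normr_ge0 _) (approxW_L1 A).
rewrite (weighted_csupp _ _ qn (approxW_u0 A)).
pose F (f : 'rV[R]_n.+2 -> R) x : R := `|f x| `^ q * hweight r a beta x.
have F0 f x : 0 <= F f x by apply: mulr_ge0; [exact: powR_ge0|exact: hweight_ge0].
apply: (@fatou_le _ _ _ mu (fun j => F (phi (m (j + K)%N))) (F U)) => //.
- by move=> j; exact: measurable_weighted.
- exact: measurable_weighted.
- apply: filterS ae => x sx.
  have c : phi (m (j + K)%N) x @[j --> \oo] --> U x.
    apply: small_cvg => e /sx[K0 HK0]; exists K0 => k Kk; apply: HK0.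
    by rewrite (leq_trans Kk)// leq_addr.
  apply: cvgM; last exact: cvg_cst.
  exact: cvg_norm_powR.
- move=> j; rewrite -(weighted_csupp _ _ qn (tame_csupp (approxW_tame A _))); apply: H.
  by rewrite (leq_trans _ (mj _))// leq_addl.
Qed.

Variable w : 'rV[R]_n.+2.
Hypotheses (w0 : w ord0 ord0 = 0) (ww : dot w w = 1).

Let P x := enorm (proj (angular w x) (g x)).

Let mP : measurable_fun setT P.
Proof.
by apply: measurable_enorm_comp; apply: measurable_proj => //; exact: measurable_angular.
Qed.

Let mgk k : measurable_fun setT (gradient (phi k)).
Proof. by apply: measurable_gradient; exact: tame_C1 (approxW_tame A k). Qed.

Lemma normal_energy_limit (e : R) : 0 < e ->
  (\int[mu]_x (P x ^+ N)%:E < +oo)%E -> exists K, forall k, (K <= k)%N ->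
  (\int[mu]_x (normal_energy (phi k) w x)%:E <= \int[mu]_x (P x ^+ N)%:E + e%:E)%E.
Proof.
move=> e0 Poo.
have mPk k : measurable_fun setT (fun x => enorm (proj (angular w x) (gradient (phi k) x))).
  by apply: measurable_enorm_comp; apply: measurable_proj => //; exact: measurable_angular.
exact: (LN_upper mP mPk (fun k => measurable_enorm_comp (measurable_rVB (mgk k) mg))
  (fun x => enorm_ge0 _) (fun k x => enorm_ge0 _) (fun k x => enorm_ge0 _)
  (fun k x => ler_dist_proj _ _ _) (approxW_g A) Poo e0).
Qed.

Lemma angular_gradient0 : {ae mu, forall x, dot (g x) (angular w x) = 0}.
Proof.
have [[Wu un] _] := umin.
have W0 : (0 < weighted r a q beta U)%E.
  apply: weighted_gt0 => //; [exact: approxW_u0 A|exact: restrict_nonzero].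
have Woo := weighted_lty r0 a1 q0 qN hb A.
pose W : R := fine (weighted r a q beta U).
have WE : weighted r a q beta U = W%:E by rewrite fineK// ge0_fin_numE// ltW.
have Wp : 0 < W by rewrite -lte_fin -WE.
have Doo := approxW_grad_lty (ltn0Sn n.+1) A.
have D0 : (0 <= \int[mu]_x (enorm (g x) ^+ N)%:E)%E.
  by apply: ge0_int => x; rewrite exprn_ge0// enorm_ge0.
pose D : R := fine (\int[mu]_x (enorm (g x) ^+ N)%:E)%E.
have DE : (\int[mu]_x (enorm (g x) ^+ N)%:E = D%:E)%E by rewrite fineK// ge0_fin_numE.
have Dp : 0 <= D by exact: fine_ge0.
have dE : dirichlet r u = D%:E by rewrite /dirichlet dirichlet_ext// -DE.
have mG : measurable_fun setT (fun x => enorm (g x) ^+ N).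
  by apply: measurable_funX; exact: measurable_enorm_comp.
have mPN : measurable_fun setT (fun x => P x ^+ N) by exact: measurable_funX.
have PN0 x : 0 <= P x ^+ N by rewrite exprn_ge0// enorm_ge0.
have Pg x : P x ^+ N <= enorm (g x) ^+ N.
  by apply: lerXn2r; rewrite ?nnegrE ?enorm_ge0// proj_le.
have XD : (\int[mu]_x (P x ^+ N)%:E <= D%:E)%E by rewrite -DE; exact: le_int.
have X0 : (0 <= \int[mu]_x (P x ^+ N)%:E)%E by exact: ge0_int.
have Xoo : (\int[mu]_x (P x ^+ N)%:E < +oo)%E by rewrite (le_lt_trans XD)// ltry.
pose X : R := fine (\int[mu]_x (P x ^+ N)%:E)%E.
have XE : (\int[mu]_x (P x ^+ N)%:E = X%:E)%E by rewrite fineK// ge0_fin_numE.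
have Xp : 0 <= X by exact: fine_ge0.
have XDr : X <= D by rewrite -lee_fin -XE.
pose th : R := N%:R / q; have th0 : 0 < th by rewrite divr_gt0.
pose G : R := D / W `^ th.
have Wt : 0 < W `^ th by exact: powR_gt0.
have G0 : 0 <= G by rewrite divr_ge0// ltW.
have HG (v : 'rV[R]_n.+2 -> R) : admissible N r v -> (G%:E <= quotient r a q beta v)%E.
  move=> av; apply: le_trans (minimizer_le umin av).
  have W0' : (0 < weighted r a q beta u)%E by rewrite -weighted_restrict.
  by apply: (quotient_ge q0 Dp dE W0'); rewrite -weighted_restrict -/U WE.
have claim (y : R) : 0 < y -> y < W -> G * y `^ th <= X.
  move=> y0 yW; rewrite leNgt; apply/negP => H.
  have e0 : 0 < (G * y `^ th - X) / 2 by rewrite divr_gt0// subr_gt0.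
  have [K HK] := normal_energy_limit e0 Xoo.
  have : (weighted r a q beta U <= y%:E)%E.
    apply: (@weighted_liminf K) => k Kk; rewrite leNgt; apply/negP => yk.
    have := normal_energy_bound r0 a1 q1 qN b1 (approxW_tame A k) w0 ww y0 G0 yk HG.
    move=> /le_trans/(_ (HK k Kk)); rewrite XE -EFinD lee_fin; lra.
  by rewrite WE lee_fin leNgt yW.
have DX : D <= X.
  rewrite leNgt; apply/negP => XD'.
  have Dg : 0 < D by exact: le_lt_trans XD'.
  have Gg : 0 < G by rewrite divr_gt0.
  pose s : R := (X + D) / (2 * G).
  have two : (0 : R) < 2 by [].
  have s0 : 0 < s by exact: divr_gt0 (ltr_wpDl Xp Dg) (mulr_gt0 two Gg).
  have sE : (s `^ th^-1) `^ th = s by rewrite -powRrM mulVf ?gt_eqF// powRr1// ltW.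
  have sW : s < W `^ th.
    rewrite ltr_pdivrMr; last exact: mulr_gt0.
    have -> : W `^ th * (2 * G) = 2 * D by rewrite /G; field; rewrite gt_eqF.
    lra.
  have yW : s `^ th^-1 < W.
    have -> : W = (W `^ th) `^ th^-1 by rewrite -powRrM mulfV ?gt_eqF// powRr1// ltW.
    apply: gt0_ltr_powR; rewrite ?invr_gt0 ?nnegrE ?(ltW s0) ?(ltW Wt)//.
  have := claim _ (powR_gt0 _ s0) yW; rewrite sE.
  have -> : G * s = (X + D) / 2 by rewrite /s; field; rewrite gt_eqF.
  lra.
have mGP : measurable_fun setT (fun x => enorm (g x) ^+ N - P x ^+ N) by exact: measurable_funB.
have GP0 x : 0 <= enorm (g x) ^+ N - P x ^+ N by rewrite subr_ge0.
have IGP0 : (0 <= \int[mu]_x (enorm (g x) ^+ N - P x ^+ N)%:E)%E by exact: ge0_int.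
have split : (\int[mu]_x (enorm (g x) ^+ N - P x ^+ N)%:E + X%:E = D%:E)%E.
  rewrite -XE -(int_add mu mGP mPN GP0 PN0) -DE; apply: eq_integral => x _.
  by rewrite subrK.
have I0 : (\int[mu]_x (enorm (g x) ^+ N - P x ^+ N)%:E = 0)%E.
  have XeD : X = D by apply/eqP; rewrite eq_le XDr DX.
  apply/eqP; rewrite eq_le IGP0 andbT.
  move: split; rewrite XeD => sp.
  by rewrite -(@leeD2rE _ D%:E)// sp add0e.
apply: filterS (int_eq0_ae mGP GP0 I0) => x /eqP; rewrite subr_eq0 => /eqP H.
apply: proj_eq; apply/eqP; rewrite -(@eqrXn2 _ N) ?enorm_ge0//; exact/eqP.
Qed.

End approximation.

Theorem minimizer_radial : radial (eball r) u.
Proof.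
have [[Wu un] _] := umin.
have [phi A] := W01N_approx (ltn0Sn _) (W01N_wgradient Wu).
have inv : rot_invariant (u \_ (eball r)).
  move=> w w0 ww c s /cos_sin_angle[th [-> ->]].
  exact: (angular_invariant r0 A w0 ww (angular_gradient0 A w0 ww) th).
have [f Hf] := approxW_radial A inv.
exists f; apply: filterS Hf => x Hx xr; have := Hx xr.
by rewrite patchE mem_set.
Qed.

End radial_symmetry.

Theorem theorem4 (R : realType) (N : nat) (r a q : R)
    (hN : (2 <= N)%N) (hr : 0 < r) (hq : 1 < q) (ha : 1 < a) :
  (N%:R < q ->
    exists beta_star : R, forall beta : R,
      (N%:R - 1) / N%:R * q + 1 < beta -> beta_star < beta ->
      forall u : 'rV[R]_N -> R,
        minimizer N r a q beta u -> ~ radial (eball r) u)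
  /\
  (q <= N%:R ->
    forall beta : R, (N%:R - 1) / N%:R * q + 1 < beta ->
      forall u : 'rV[R]_N -> R,
        minimizer N r a q beta u -> radial (eball r) u).
Proof.
case: N hN => [|[|n]] // _; split=> [Nq|qN beta].
  have [beta_star H] := symmetry_breaking hr ha Nq.
  by exists beta_star => beta _; exact: H.
rewrite (_ : n.+2%:R - 1 = n.+1%:R :> R); last by rewrite -(natr1 n.+1) addrK.
by move=> hb u umin; exact: (minimizer_radial hr ha hq qN hb umin).
Qed.
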